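(* Let $q\in(0,1)$ and let $\mathbb{U}_q=(U_q(N),\theta_N)_{N\ge 0}$ be the inductive system of quantum unitary groups. There exists an affine homeomorphism between the simplex $\mathrm{Ch}(\mathbb{U}_q)$ of quantized characters of $\mathbb{U}_q$ and the simplex of $q^2$-central probability measures on the space $\Omega$ of infinite paths on the Gelfand--Tsetlin graph $\mathbb{GT}$. Moreover, this affine homeomorphism (with $\chi$ corresponding to $P$) is determined by $$\chi|_{C^*(U_q(N))}=\sum_{\nu\in\mathrm{Sign}_N}P(X_N=\nu)\,\chi_\nu\qquad (N=1,2,\dots),$$ where $\chi_\nu$ is the natural extension of $\mathrm{Tr}(F_\nu\,\cdot\,)/\dim_q(\nu)$ to $C^*(U_q(N))$, i.e. $\chi_\nu(x)=\mathrm{Tr}(F_\nu x_\nu)/\dim_q(\nu)$ for $x=(x_{\nu'})_{\nu'}\in C^*(U_q(N))$.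
   Context: **Compact quantum groups.** A compact quantum group (CQG) $G=(A,\delta)$ is a unital $C^*$-algebra $A$ with a unital $*$-homomorphism $\delta:A\to A\otimes A$ (minimal tensor product) such that $(\mathrm{id}\otimes\delta)\delta=(\delta\otimes\mathrm{id})\delta$ and $\delta(A)(A\otimes1)$, $\delta(A)(1\otimes A)$ are dense in $A\otimes A$. A finite-dimensional representation on $V$ is an invertible $U\in B(V)\otimes A$ with $(\mathrm{id}\otimes\delta)(U)=U_{12}U_{13}$; it is unitary if $V$ is a Hilbert space and $U$ is unitary. $\mathrm{Mor}(U,V)=\{T:(T\otimes1)U=V(T\otimes1)\}$, $\mathrm{End}(U)=\mathrm{Mor}(U,U)$; $U$ is irreducible if $\mathrm{End}(U)=\mathbb{C}1$. $\widehat G$ is the set of unitary equivalence classes of irreducible unitary representations, with fixed representatives $U_\pi\in B(\mathcal H_\pi)\otimes A$. The contragredient is $U^c=(j\otimes\mathrm{id})(U^{-1})$ with $j:B(\mathcal H)\to B(\mathcal H^* )$ the transpose map. For each finite-dimensional unitary $U$ there is a unique positive invertible $F_U\in\mathrm{Mor}(U,U^{cc})$ with $\mathrm{Tr}(F_U\,\cdot)=\mathrm{Tr}(F_U^{-1}\,\cdot)$ on $\mathrm{End}(U)$ (the density matrix). $F_\pi:=F_{U_\pi}$, $\dim_q(\pi):=\mathrm{Tr}(F_\pi)$. $\mathcal A\subset A$ is the dense Hopf $*$-algebra spanned by matrix coefficients of finite-dimensional representations, and $A$ is the universal $C^*$-algebra generated by $\mathcal A$. The dual $\mathcal U(G)=\mathcal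 A^*$ is a $*$-algebra with product $f_1*f_2=(f_1\otimes f_2)\delta$ and $f^*(a)=\overline{f(S(a^* ))}$ ($S$ the antipode); $f\mapsto(U_\pi(f))_\pi$, $U_\pi(f)=(\mathrm{id}\otimes f)(U_\pi)$, is a $*$-isomorphism onto $\prod_{\pi\in\widehat G}B(\mathcal H_\pi)$, used as an identification. $W^*(G)$ is the von Neumann algebra of norm-bounded families, $\mathbb{C}[G]$ the algebraic direct sum, $C^*(G)$ the norm closure of $\mathbb{C}[G]$ in $W^*(G)$. The scaling group $\tau^G_t$ on $\mathcal A$ is given by $(\mathrm{id}\otimes\tau^G_t)(U)=(F_U^{it}\otimes1)U(F_U^{-it}\otimes1)$; the dual scaling group is $\widehat\tau^G_t(f)=f\circ\tau^G_t$, which acts on $B(\mathcal H_\pi)$ as $\mathrm{Ad}(F_\pi^{it})$. **Inductive systems and quantized characters.** For an inductive system $\mathbb G=(G_N,\theta_N)_{N\ge0}$, $G_N=(A_N,\delta_N)$, $G_0=(\mathbb C,\mathrm{id})$, where $\theta_N:A_{N+1}\to A_N$ is a surjective $*$-homomorphism with $\delta_N\theta_N=(\theta_N\otimes\theta_N)\delta_{N+1}$ and each $\widehat G_N$ is countable, put $\Theta_N(f)=f\circ\theta_N$; this gives injective unital $*$-homomorphisms $W^*(G_N)\to W^*(G_{N+1})$. Let $\mathfrak M(\mathbb G)=\varinjlim(W^*(G_N),\Theta_N)$ ($C^*$-inductive limit) and let $\mathfrak A(\mathbb G)$ be the $C^*$-subalgebra generated by all $C^*(G_N)$, $N\ge0$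 (the Stratila--Voiculescu AF-algebra). The actions $\widehat\tau^{G_N}$ are compatible with the $\Theta_N$ and induce a pointwise norm-continuous flow $\widehat\tau^{\mathbb G}:\mathbb R\curvearrowright\mathfrak A(\mathbb G)$. A state $\chi$ is $\widehat\tau^{\mathbb G}$-KMS at inverse temperature $\beta$ if $\chi(x\,\widehat\tau^{\mathbb G}_{i\beta}(y))=\chi(yx)$ for $x,y$ in a norm-dense $\widehat\tau^{\mathbb G}$-invariant $*$-subalgebra of entire analytic elements. A quantized character of $\mathbb G$ is a $\widehat\tau^{\mathbb G}$-KMS state $\chi$ on $\mathfrak A(\mathbb G)$ at inverse temperature $-1$ with $\|\chi|_{C^*(G_N)}\|=1$ for all $N\ge1$. $\mathrm{Ch}(\mathbb G)$ is the set of these with the weak$^*$ topology. **Gelfand--Tsetlin graph.** $\mathrm{Sign}_N=\{\nu\in\mathbb Z^N:\nu_1\ge\dots\ge\nu_N\}$, $\mathrm{Sign}_0=\{*\}$. Vertices: $\bigsqcup_{N\ge0}\mathrm{Sign}_N$; $\mu\in\mathrm{Sign}_N$ and $\nu\in\mathrm{Sign}_{N+1}$ ($N\ge1$) are joined by one edge (source $\mu$, range $\nu$) iff $\nu_1\ge\mu_1\ge\nu_2\ge\dots\ge\nu_N\ge\mu_N\ge\nu_{N+1}$; $*$ is joined to each vertex of $\mathrm{Sign}_1$ by one edge. $r$ is the range map, $|\nu|=\sum_i\nu_i$, $\Omega( *,\nu)$ is the set of finite paths from $*$ to $\nu$, $\Omega$ is the space of infinite paths from $*$ with the $\sigma$-algebra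 generated by the cylinder sets $C_t=\{\omega:\omega_n=t_n,\ n\le N\}$, and $X_N(\omega)=r(\omega_N)$. A probability measure $P$ on $\Omega$ is $q^2$-central if for all $N\ge1$, $\nu\in\mathrm{Sign}_N$ and $t\in\Omega( *,\nu)$, $$P(C_t)=\frac{q^{2(|r(t_1)|+\cdots+|r(t_{N-1})|)}}{\sum_{s\in\Omega( *,\nu)}q^{2(|r(s_1)|+\cdots+|r(s_{N-1})|)}}\,P(X_N=\nu).$$ The set of $q^2$-central probability measures carries the topology of weak convergence. **Quantum unitary groups.** $U_q(N)=(A_N,\delta_N)$, where $A_N$ is the universal $C^*$-algebra of the Hopf $*$-algebra $\mathcal A_N$ generated by $u_{ij}=u_{ij}(N)$ ($1\le i,j\le N$) and $\det_q^{-1}(N)$ with relations $u_{ij}u_{kj}=q\,u_{kj}u_{ij}$ ($i<k$); $u_{ij}u_{il}=q\,u_{il}u_{ij}$ ($j<l$); $u_{ij}u_{kl}=u_{kl}u_{ij}$ ($i<k,\ j>l$); $u_{ij}u_{kl}-q\,u_{il}u_{kj}=u_{kl}u_{ij}-q^{-1}u_{kj}u_{il}$ ($i<k,\ j<l$); $\det_q^{-1}(N)$ commutes with all $u_{ij}$ and is the inverse of the quantum determinant $\det_q(N)=\sum_{\sigma\in S_N}(-q)^{\ell(\sigma)}u_{1\sigma(1)}\cdots u_{N\sigma(N)}$; $\delta_N(u_{ij})=\sum_k u_{ik}\otimes u_{kj}$; $u_{ij}^*=S(u_{ji})$. The maps are $\theta_N(u_{ij}(N+1))=u_{ij}(N)$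 if $1\le i,j\le N$ and $\delta_{i,j}1$ otherwise, $\theta_N(\det_q^{-1}(N+1))=\det_q^{-1}(N)$; $U_q(0)=(\mathbb C,\mathrm{id})$. Irreducible unitary representations of $U_q(N)$ are parametrized by $\mathrm{Sign}_N$: $U_\nu$ on $\mathcal H_\nu$ is the one with highest weight $(q^{\nu_1/2},\dots,q^{\nu_N/2})$ as a module over the quantum universal enveloping algebra of $\mathfrak{gl}(N)$. It has a Gelfand--Tsetlin basis $(v_t)_{t\in\Omega( *,\nu)}$, $v_t$ being a weight vector of weight $(q^{|r(t_1)|/2},q^{(|r(t_2)|-|r(t_1)|)/2},\dots,q^{(|r(t_N)|-|r(t_{N-1})|)/2})$, in which the density matrix is given by $[F_\nu]_{tu}=\delta_{t,u}\,q^{-(N-1)|\nu|+2\sum_{n=1}^{N-1}|r(t_n)|}$. *)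

(* Defs.v *)
From HB Require Import structures.
From mathcomp Require Import all_boot all_order all_algebra perm complex.
From mathcomp Require Import all_classical all_reals all_analysis.
From mathcomp.analysis.showcase Require Import summability.

Set Implicit Arguments.
Unset Strict Implicit.
Unset Printing Implicit Defensive.

Import Order.TTheory GRing.Theory Num.Theory.
Import numFieldNormedType.Exports.

Local Open Scope classical_set_scope.
Local Open Scope ring_scope.

(* The alias makes R[i] inherit the topology and norm that MathComp-Analysis
   attaches to every numFieldType. *)
Definition Cx (R : realType) : numClosedFieldType := R[i].

Definition toC (R : realType) (x : R) : Cx R := real_complex R x.

Definition cis (R : realType) (x : R) : Cx R := Complex (cos x) (sin x).

Definition adjmx (R : realType) m n (T : 'M[Cx R]_(m, n)) : 'M[Cx R]_(n, m) :=
  map_mx Num.conj T^T.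

Record cstar_alg (R : realType) := CStarAlg {
  ccarrier :> algType (Cx R);
  cstar : ccarrier -> ccarrier;
  cnorm : ccarrier -> Cx R;
  cstarK : involutive cstar;
  cstarP : forall (c : Cx R) (x y : ccarrier),
    cstar (c *: x + y) = Num.conj c *: cstar x + cstar y;
  cstarM : forall x y : ccarrier, cstar (x * y) = cstar y * cstar x;
  cnorm_ge0 : forall x : ccarrier, 0 <= cnorm x;
  cnorm_eq0 : forall x : ccarrier, cnorm x = 0 -> x = 0;
  cnormD : forall x y : ccarrier, cnorm (x + y) <= cnorm x + cnorm y;
  cnormZ : forall (c : Cx R) (x : ccarrier), cnorm (c *: x) = `|c| * cnorm x;
  cnormM : forall x y : ccarrier, cnorm (x * y) <= cnorm x * cnorm y;
  cstar_identity : forall x : ccarrier, cnorm (cstar x * x) = cnorm x ^+ 2;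
  cnorm_complete : forall u : nat -> ccarrier,
    (forall e : Cx R, 0 < e -> exists N : nat, forall m n : nat,
       (N <= m)%N -> (N <= n)%N -> cnorm (u m - u n) < e) ->
    exists x : ccarrier, forall e : Cx R, 0 < e -> exists N : nat,
      forall n : nat, (N <= n)%N -> cnorm (u n - x) < e
}.

Section NormTopology.
Variables (R : realType) (A : cstar_alg R).

Definition norm_closure (B : set A) : set A :=
  [set x | forall e : Cx R, 0 < e -> exists2 y, B y & cnorm (x - y) < e].

Definition norm_continuous (F : R -> A) : Prop :=
  forall (t : R) (e : Cx R), 0 < e -> exists2 d : R, 0 < d &
    forall s, `|s - t| < d -> cnorm (F s - F t) < e.

Definition entire (F : Cx R -> A) : Prop :=
  forall z : Cx R, exists D : A, forall e : Cx R, 0 < e ->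
    exists2 d : Cx R, 0 < d & forall h : Cx R, 0 < `|h| < d ->
      cnorm (h^-1 *: (F (z + h) - F z) - D) < e.

End NormTopology.

(* A finite sum of elementary tensors a (x) b is represented by the list of
   the pairs (a, b); since linear functionals separate points of the algebraic
   tensor product, equality in it is equality against all f (x) g. *)
Section Tensors.
Variables (K : fieldType) (A : algType K).

Definition tens_eval (f g : A -> K) (s : seq (A * A)) : K :=
  \sum_(p <- s) f p.1 * g p.2.

Definition tens_eq (s t : seq (A * A)) : Prop :=
  forall f g : A -> K, scalar f -> scalar g -> tens_eval f g s = tens_eval f g t.

End Tensors.

Record hopf_star_alg (R : realType) := HopfStarAlg {
  hcarrier :> algType (Cx R);
  hstar : hcarrier -> hcarrier;
  comul : hcarrier -> seq (hcarrier * hcarrier);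
  counit : hcarrier -> Cx R;
  antipode : hcarrier -> hcarrier;
  hstarK : involutive hstar;
  hstarP : forall (c : Cx R) (x y : hcarrier),
    hstar (c *: x + y) = Num.conj c *: hstar x + hstar y;
  hstarM : forall x y : hcarrier, hstar (x * y) = hstar y * hstar x;
  comulP : forall (c : Cx R) (x y : hcarrier),
    tens_eq (comul (c *: x + y))
            ([seq (c *: p.1, p.2) | p <- comul x] ++ comul y);
  comulM : forall x y : hcarrier,
    tens_eq (comul (x * y))
            [seq (p.1 * r.1, p.2 * r.2) | p <- comul x, r <- comul y];
  comul1 : tens_eq (comul 1) [:: (1, 1)];
  comul_star : forall x : hcarrier,
    tens_eq (comul (hstar x)) [seq (hstar p.1, hstar p.2) | p <- comul x];
  comulA : forall (x : hcarrier) (f g h : hcarrier -> Cx R),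
    scalar f -> scalar g -> scalar h ->
    \sum_(p <- comul x) f p.1 * tens_eval g h (comul p.2) =
    \sum_(p <- comul x) tens_eval f g (comul p.1) * h p.2;
  counit_scalar : scalar counit;
  counitM : forall x y : hcarrier, counit (x * y) = counit x * counit y;
  counit1 : counit 1 = 1;
  counitl : forall x : hcarrier, \sum_(p <- comul x) counit p.1 *: p.2 = x;
  counitr : forall x : hcarrier, \sum_(p <- comul x) counit p.2 *: p.1 = x;
  antipode_linear : linear antipode;
  antipodel : forall x : hcarrier,
    \sum_(p <- comul x) antipode p.1 * p.2 = (counit x)%:A;
  antipoder : forall x : hcarrier,
    \sum_(p <- comul x) p.1 * antipode p.2 = (counit x)%:A
}.

(* A finite-dimensional representation on C^n is a matrix U over the algebra,
   [map_mx f U] is U(f) = (id (x) f)(U), and [ampl T] is T (x) 1. *)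
Section Representations.
Variables (R : realType) (A : hopf_star_alg R).
Implicit Types m n : nat.

Definition ampl m n (T : 'M[Cx R]_(m, n)) : 'M[A]_(m, n) :=
  map_mx (fun c : Cx R => c%:A) T.

Definition is_rep n (U : 'M[A]_n) : Prop :=
  (exists V : 'M[A]_n, U *m V = 1%:M /\ V *m U = 1%:M) /\
  forall i j, tens_eq (comul (U i j)) [seq (U i k, U k j) | k <- enum 'I_n].

Definition is_unitary_rep n (U : 'M[A]_n) : Prop :=
  [/\ is_rep U,
      map_mx (@hstar R A) U^T *m U = 1%:M &
      U *m map_mx (@hstar R A) U^T = 1%:M].

Definition Mor n m (U : 'M[A]_n) (V : 'M[A]_m) : set 'M[Cx R]_(m, n) :=
  [set T | ampl T *m U = V *m ampl T].

Definition irreducible n (U : 'M[A]_n) : Prop :=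
  (0 < n)%N /\ Mor U U `<=` [set T | exists c : Cx R, T = c%:M].

Definition is_irr n (U : 'M[A]_n) : Prop := is_unitary_rep U /\ irreducible U.

Definition unitarily_equiv n m (U : 'M[A]_n) (V : 'M[A]_m) : Prop :=
  exists T : 'M[Cx R]_(m, n),
    [/\ Mor U V T, adjmx T *m T = 1%:M & T *m adjmx T = 1%:M].

(* V = U^c, i.e. the transpose of V is the inverse of U. *)
Definition is_contragredient n (U V : 'M[A]_n) : Prop :=
  U *m V^T = 1%:M /\ V^T *m U = 1%:M.

Definition posdef n (F : 'M[Cx R]_n) : Prop :=
  forall v : 'cV[Cx R]_n, v != 0 -> 0 < (adjmx v *m F *m v) 0 0.

Definition is_density n (U : 'M[A]_n) (F : 'M[Cx R]_n) : Prop :=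
  [/\ posdef F,
      exists V W : 'M[A]_n,
        [/\ is_contragredient U V, is_contragredient V W & Mor U W F] &
      forall T, Mor U U T -> \tr (F *m T) = \tr (invmx F *m T)].

Definition density n (U : 'M[A]_n) : 'M[Cx R]_n := get (is_density U).

(* X = F ^ (i t), by diagonalization of the positive definite matrix F. *)
Definition is_imag_power n (F : 'M[Cx R]_n) (t : R) (X : 'M[Cx R]_n) : Prop :=
  exists (P : 'M[Cx R]_n) (d : 'rV[R]_n),
    [/\ adjmx P *m P = 1%:M,
        forall i, 0 < d 0 i,
        F = adjmx P *m diag_mx (map_mx (@toC R) d) *m P &
        X = adjmx P *m diag_mx (map_mx (fun x => cis (t * ln x)) d) *m P].

Definition is_scaling_group (tau : R -> A -> A) : Prop :=
  (forall t, linear (tau t)) /\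
  forall n (U : 'M[A]_n) t (X Y : 'M[Cx R]_n), is_unitary_rep U ->
    is_imag_power (density U) t X -> is_imag_power (density U) (- t) Y ->
    map_mx (tau t) U = ampl X *m U *m ampl Y.

End Representations.

(* A compact quantum group (A, delta), with A the universal C*-algebra of its
   dense Hopf *-algebra of matrix coefficients, is given by that Hopf
   *-algebra; the representations, the dual and the scaling group only involve
   the latter. *)
Record cqg (R : realType) := CQG {
  cqg_alg :> hopf_star_alg R;
  cqg_span : forall x : cqg_alg, exists (n : nat) (U : 'M[cqg_alg]_n)
      (c : 'M[Cx R]_n),
    is_unitary_rep U /\ x = \sum_i \sum_j c i j *: U i j
}.

Section Dual.
Variables (R : realType) (G : cqg R).

Definition conv (f g : G -> Cx R) : G -> Cx R :=
  fun a => tens_eval f g (comul a).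

(* With this formula U(f^* ) is the adjoint of U(f) for every unitary
   representation U, because S(U_ij)^* = U_ji. *)
Definition dual_star (f : G -> Cx R) : G -> Cx R :=
  fun a => Num.conj (f (hstar (antipode a))).

Definition opnorm_le n (T : 'M[Cx R]_n) (c : Cx R) : Prop :=
  forall v : 'cV[Cx R]_n,
    \sum_i `|(T *m v) i 0| ^+ 2 <= c ^+ 2 * \sum_i `|v i 0| ^+ 2.

(* The norm of the family (U_pi(f))_pi is at most c. *)
Definition dual_norm_le (f : G -> Cx R) (c : Cx R) : Prop :=
  0 <= c /\ forall n (U : 'M[G]_n), is_irr U -> opnorm_le (map_mx f U) c.

Definition Wstar : set (G -> Cx R) :=
  [set f | scalar f /\ exists c, dual_norm_le f c].

(* f is supported on the classes of finitely many irreducible V_0, .., V_(k-1). *)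
Definition group_alg : set (G -> Cx R) :=
  [set f | scalar f /\ exists (k : nat) (d : 'I_k -> nat)
       (V : forall i, 'M[G]_(d i)),
     (forall i, is_irr (V i)) /\
     forall n (U : 'M[G]_n), is_irr U ->
       (forall i, ~ unitarily_equiv (V i) U) -> map_mx f U = 0].

Definition Cstar : set (G -> Cx R) :=
  [set f | Wstar f /\ forall e : Cx R, 0 < e ->
     exists2 g, group_alg g & dual_norm_le (fun a => f a - g a) e].

End Dual.

Record inductive_system (R : realType) := InductiveSystem {
  sys :> nat -> cqg R;
  theta : forall N, {lrmorphism sys N.+1 -> sys N};
  theta_star : forall N (a : sys N.+1),
    theta N (hstar a) = hstar (theta N a);
  theta_surj : forall N (b : sys N), exists a : sys N.+1, theta N a = b;
  theta_comul : forall N (a : sys N.+1),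
    tens_eq (comul (theta N a))
            [seq (theta N p.1, theta N p.2) | p <- comul a];
  sys0_trivial : forall a : sys 0%N, exists c : Cx R, a = c%:A;
  sys_countable : forall N, exists (d : nat -> nat)
      (V : forall k, 'M[sys N]_(d k)),
    forall n (U : 'M[sys N]_n), is_irr U -> exists k, unitarily_equiv (V k) U
}.

Definition Theta (R : realType) (S : inductive_system R) N
  (f : S N -> Cx R) : S N.+1 -> Cx R := f \o theta S N.

(* A C*-inductive limit of (W*(G_N), Theta_N); it is unique up to a unique
   isomorphism compatible with the canonical maps lim_map. *)
Record cstar_limit (R : realType) (S : inductive_system R) := CstarLimit {
  lim_alg :> cstar_alg R;
  lim_map : forall N, (S N -> Cx R) -> lim_alg;
  lim_map_linear : forall N (c : Cx R) (f g : S N -> Cx R),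
    Wstar f -> Wstar g ->
    lim_map (fun a => c * f a + g a) = c *: lim_map f + lim_map g;
  lim_mapM : forall N (f g : S N -> Cx R), Wstar f -> Wstar g ->
    lim_map (conv f g) = lim_map f * lim_map g;
  lim_map1 : forall N, lim_map (@counit R (S N)) = 1;
  lim_map_star : forall N (f : S N -> Cx R), Wstar f ->
    lim_map (dual_star f) = cstar (lim_map f);
  lim_map_isometric : forall N (f : S N -> Cx R) (c : Cx R), Wstar f ->
    cnorm (lim_map f) <= c <-> dual_norm_le f c;
  lim_map_Theta : forall N (f : S N -> Cx R), Wstar f ->
    lim_map (Theta f) = lim_map f;
  lim_map_dense : forall (x : lim_alg) (e : Cx R), 0 < e ->
    exists (N : nat) (f : S N -> Cx R), Wstar f /\ cnorm (x - lim_map f) < e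
}.

Section StratilaVoiculescu.
Variables (R : realType) (S : inductive_system R) (L : cstar_limit S).

Definition cstar_subalg (B : set L) : Prop :=
  [/\ B 1,
      forall (c : Cx R) x y, B x -> B y -> B (c *: x + y),
      forall x y, B x -> B y -> B (x * y),
      forall x, B x -> B (cstar x) &
      norm_closure B `<=` B].

(* The closed *-subalgebras containing the C*(G_N) are automatically unital,
   as C*(G_0) = C 1. *)
Definition SV_set : set L :=
  [set x | forall B, cstar_subalg B ->
     (forall N (f : S N -> Cx R), Cstar f -> B (lim_map L f)) -> B x].

Definition SV_pred : {pred L} := mem SV_set.

Lemma SV_set_subalg : cstar_subalg SV_set.
Proof.
split=> [B [] //|c x y xS yS B hB BC|x y xS yS B hB BC|x xS B hB BC|x xS B hB BC];
  case: (hB) => B1 B2 B3 B4 B5.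
- by apply: B2; [exact: xS | exact: yS].
- by apply: B3; [exact: xS | exact: yS].
- by apply: B4; exact: xS.
- by apply: B5 => e /xS[y yS ?]; exists y => //; exact: yS.
Qed.

Lemma SV_pred_closed : GRing.subalg_closed SV_pred.
Proof.
have [S1 S2 S3 _ _] := SV_set_subalg.
split; first exact/mem_set.
- by move=> c x y /set_mem xS /set_mem yS; apply/mem_set; apply: S2.
- by move=> x y /set_mem xS /set_mem yS; apply/mem_set; apply: S3.
Qed.

HB.instance Definition _ :=
  GRing.isSubalgClosed.Build (Cx R) L SV_pred
    (GRing.subalg_closed_semi SV_pred_closed).

Definition SV_alg : Type := {x : L | x \in SV_pred}.

HB.instance Definition _ := SubType.on SV_alg.
HB.instance Definition _ := Choice.on SV_alg.
HB.instance Definition _ := [SubChoice_isSubAlgebra of SV_alg by <:].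

Definition SV_val (x : SV_alg) : L := val x.

Lemma SV_starP (x : SV_alg) : cstar (SV_val x) \in SV_pred.
Proof.
by have [_ _ _ S4 _] := SV_set_subalg; apply/mem_set; apply: S4; exact: set_mem (valP x).
Qed.

Definition SV_star (x : SV_alg) : SV_alg := Sub (cstar (SV_val x)) (SV_starP x).

Definition is_image N (f : S N -> Cx R) (x : SV_alg) : Prop :=
  SV_val x = lim_map L f.

Record dual_flow := DualFlow {
  flow :> R -> SV_alg -> SV_alg;
  flow_linear : forall t, linear (flow t);
  flowM : forall t (x y : SV_alg), flow t (x * y) = flow t x * flow t y;
  flow_star : forall t (x : SV_alg), flow t (SV_star x) = SV_star (flow t x);
  flow0 : forall x, flow 0 x = x;
  flowD : forall s t x, flow (s + t) x = flow s (flow t x);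
  flow_continuous : forall x, norm_continuous (fun t => SV_val (flow t x));
  flow_scaling : forall N, exists2 tau, @is_scaling_group R (S N) tau &
    forall t (f : S N -> Cx R) (x : SV_alg), Cstar f -> is_image f x ->
      is_image (f \o tau t) (flow t x)
}.

Variable tau : dual_flow.

(* F is the entire extension z |-> tau_z(y). *)
Definition is_entire_orbit (y : SV_alg) (F : Cx R -> SV_alg) : Prop :=
  entire (fun z => SV_val (F z)) /\ forall t : R, F (toC t) = tau t y.

Definition is_state (chi : SV_alg -> Cx R) : Prop :=
  [/\ scalar chi,
      forall x, 0 <= chi (SV_star x * x),
      forall x, `|chi x| <= cnorm (SV_val x) &
      forall e : Cx R, 0 < e -> exists2 x, cnorm (SV_val x) <= 1 &
        1 - e < `|chi x| ].

Definition is_KMS (beta : R) (chi : SV_alg -> Cx R) : Prop :=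
  exists D : set SV_alg,
    [/\ [/\ forall (c : Cx R) x y, D x -> D y -> D (c *: x + y),
            forall x y, D x -> D y -> D (x * y),
            forall x, D x -> D (SV_star x) &
            forall t x, D x -> D (tau t x)],
        forall (x : SV_alg) (e : Cx R), 0 < e ->
          exists2 y, D y & cnorm (SV_val (x - y)) < e,
        forall y, D y -> exists F, is_entire_orbit y F &
        forall x y F, D x -> D y -> is_entire_orbit y F ->
          chi (x * F (Complex 0 beta)) = chi (y * x)].

Definition norm_one_on (N : nat) (chi : SV_alg -> Cx R) : Prop :=
  (forall (f : S N -> Cx R) (x : SV_alg), Cstar f -> is_image f x ->
     `|chi x| <= cnorm (SV_val x)) /\
  forall e : Cx R, 0 < e -> exists (f : S N -> Cx R) (x : SV_alg),
    [/\ Cstar f, is_image f x, cnorm (SV_val x) <= 1 & 1 - e < `|chi x| ].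

(* The topology of pointwise convergence induces the weak* topology on Ch. *)
Definition Ch : set {ptws SV_alg -> Cx R} :=
  [set chi | [/\ is_state chi, is_KMS (-1) chi &
                 forall N, (0 < N)%N -> norm_one_on N chi] ].

End StratilaVoiculescu.

(* A vertex of level N is a signature, seen as a list of N integers; the edges
   being simple, a path is given by the list (t_1, t_2, ..) of its vertices
   other than the root, so that r(t_n) is the n-th element of the list. *)
Definition vertex := seq int.

Definition Sign (N : nat) :=
  {nu : N.-tuple int | sorted (fun x y : int => y <= x) nu}.

Definition sign_vertex N (nu : Sign N) : vertex := val (val nu).
Coercion sign_vertex : Sign >-> vertex.

(* The interlacing condition forces the entries of nu to be decreasing, so the
   vertices of a path from the empty list are signatures. *)
Definition edge (mu nu : vertex) : bool :=
  (size nu == (size mu).+1) &&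
  all (fun i => (mu`_i <= nu`_i) && (nu`_i.+1 <= mu`_i)) (iota 0 (size mu)).

Definition vweight (nu : vertex) : int := \sum_(x <- nu) x.

Definition paths_to (nu : vertex) : set (seq vertex) :=
  [set t | path edge [::] t && (last [::] t == nu)].

Definition level (t : seq vertex) (n : nat) : vertex := nth [::] ([::] :: t) n.

Definition inf_paths : set (nat -> vertex) :=
  [set w | w 0%N = [::] /\ forall n, edge (w n) (w n.+1)].

Definition Omega : Type := inf_paths.

HB.instance Definition _ := Choice.on Omega.

Lemma zero_path_subproof :
  (fun n => nseq n (0 : int)) \in inf_paths.
Proof.
apply/mem_set; split=> // n; rewrite /edge !size_nseq; apply/andP; split; first exact: eqtype.eqxx.
by apply/allP => i _; rewrite !nth_nseq !if_same.
Qed.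

HB.instance Definition _ :=
  isPointed.Build Omega
    (@exist _ (fun w => w \in inf_paths) _ zero_path_subproof).

Definition X (N : nat) (w : Omega) : vertex := val w N.

Definition cylinder (t : seq vertex) : set Omega :=
  [set w | forall n, (n <= size t)%N -> X n w = level t n].

Definition cylinders : set (set Omega) :=
  [set cylinder t | t in [set t | path edge [::] t]].

Definition OmegaM := g_sigma_algebraType cylinders.

Definition OmegaT :=
  initial_topology
    (val : Omega -> prod_topology (fun _ : nat => discrete_topology vertex)).

Section Central.
Variable (R : realType).

Definition Cb : set (OmegaT -> R) :=
  [set f | continuous f /\ exists M : R, forall w, `|f w| <= M].

Definition Prob := probability OmegaM R.

HB.instance Definition _ := gen_eqMixin Prob.
HB.instance Definition _ := gen_choiceMixin Prob.

Definition ProbW :=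
  initial_topology (fun P : Prob =>
    (fun f => \int[P]_w (val f w))%R : {ptws Cb -> R}).

Definition path_weight (q : R) (t : seq vertex) : R :=
  q ^ (2 * \sum_(1 <= n < size t) vweight (level t n)).

Definition at_level (N : nat) (nu : vertex) : set OmegaM :=
  [set w | X N w = nu].

(* A [probability] also assigns unconstrained values to the non-measurable sets;
   they are set to 0, so that each measure is represented exactly once. *)
Definition Central (q : R) : set ProbW :=
  [set P : Prob |
     (forall B : set OmegaM, ~ measurable B -> P B = 0%E) /\
     forall N (nu : Sign N) (t : seq vertex),
       (0 < N)%N -> paths_to nu t ->
       (P (cylinder t) =
         (path_weight q t / \sum_(s \in paths_to nu) path_weight q s)%:E
           * P (at_level N nu))%E].

End Central.

Section QuantumUnitary.
Variables (R : realType) (q : R).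

Definition inversions N (s : 'S_N) : nat :=
  #|[pred p : 'I_N * 'I_N | (p.1 < p.2)%N && (s p.2 < s p.1)%N]|.

Definition qdet (A : algType (Cx R)) N (u : 'M[A]_N) : A :=
  \sum_(s : 'S_N) (- toC q) ^+ inversions s *: \prod_i u i (s i).

Definition Uq_relations (A : algType (Cx R)) N (u : 'M[A]_N) (d : A) : Prop :=
  [/\ forall i j k : 'I_N, (i < k)%N ->
        u i j * u k j = toC q *: (u k j * u i j),
      forall i j l : 'I_N, (j < l)%N ->
        u i j * u i l = toC q *: (u i l * u i j),
      forall i j k l : 'I_N, (i < k)%N -> (l < j)%N ->
        u i j * u k l = u k l * u i j,
      forall i j k l : 'I_N, (i < k)%N -> (j < l)%N ->
        u i j * u k l - toC q *: (u i l * u k j) =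
        u k l * u i j - (toC q)^-1 *: (u k j * u i l) &
      [/\ forall i j : 'I_N, d * u i j = u i j * d,
          d * qdet u = 1 & qdet u * d = 1] ].

(* The algebra presented by these generators and relations is characterized by
   its universal property. *)
Record is_Uq N (G : cqg R) (u : 'M[G]_N) (d : G) : Prop := IsUq {
  Uq_rel : Uq_relations u d;
  Uq_universal : forall (B : algType (Cx R)) (v : 'M[B]_N) (e : B),
    Uq_relations v e ->
    exists phi : {lrmorphism G -> B},
      [/\ map_mx phi u = v, phi d = e &
          forall psi : {lrmorphism G -> B},
            map_mx psi u = v -> psi d = e -> psi =1 phi];
  Uq_comul : forall i j : 'I_N,
    tens_eq (comul (u i j)) [seq (u i k, u k j) | k <- enum 'I_N];
  Uq_star : forall i j : 'I_N, hstar (u i j) = antipode (u j i)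
}.

(* For N = 0 the presentation gives the trivial algebra C. *)
Record quantum_unitary_system := QuantumUnitarySystem {
  Uq_sys :> inductive_system R;
  gen_u : forall N, 'M[Uq_sys N]_N;
  gen_d : forall N, Uq_sys N;
  sys_Uq : forall N, is_Uq (gen_u N) (gen_d N);
  theta_uu : forall N (i j : 'I_N),
    theta Uq_sys N (gen_u N.+1 (widen_ord (leqnSn N) i)
                               (widen_ord (leqnSn N) j)) = gen_u N i j;
  theta_ul : forall N (i : 'I_N.+1),
    theta Uq_sys N (gen_u N.+1 i ord_max) = (i == ord_max)%:R;
  theta_lu : forall N (j : 'I_N.+1),
    theta Uq_sys N (gen_u N.+1 ord_max j) = (j == ord_max)%:R;
  theta_d : forall N, theta Uq_sys N (gen_d N.+1) = gen_d N
}.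

Variable UU : quantum_unitary_system.

Definition sqrt_q : Cx R := toC (Num.sqrt q).

Definition is_torus_char N (c : 'I_N -> Cx R) (K : UU N -> Cx R) : Prop :=
  [/\ scalar K, K 1 = 1, {morph K : x y / x * y} &
      forall i j, K (gen_u UU N i j) = if i == j then c i else 0].

(* The generators K_k and E_k of the quantized enveloping algebra of gl(N), as
   functionals on the Hopf algebra; U(K_k) acts as q^(eps_k / 2).  The pairing
   is the one with K_k(u_ii) = q^(- delta_ik / 2), E_k(u_(k+1,k)) = 1 and
   coproduct E_k (x) K + K^-1 (x) E_k for K = K_k K_(k+1)^-1.  With the opposite
   sign, K_k(u_ii) = q^(delta_ik / 2), the relations above would make the
   matrix in gt_density the inverse of the density matrix: already for the
   fundamental representation, S^2(u_ij) = q^(2(i-j)) u_ij forces the density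
   matrix to be diag(q^(2i-N-1))_i. *)
Definition is_K N (k : 'I_N) (K : UU N -> Cx R) : Prop :=
  is_torus_char (fun i => if i == k then sqrt_q^-1 else 1) K.

Definition is_E N (k k' : 'I_N) (E : UU N -> Cx R) : Prop :=
  let c (i : 'I_N) : Cx R :=
    if i == k then sqrt_q^-1 else if i == k' then sqrt_q else 1 in
  exists Kp Km : UU N -> Cx R,
    [/\ is_torus_char c Kp, is_torus_char (fun i => (c i)^-1) Km, scalar E,
        forall x y, E (x * y) = E x * Kp y + Km x * E y &
        forall i j, E (gen_u UU N i j) = ((i == k') && (j == k))%:R].

Definition is_weight_vector N n (U : 'M[UU N]_n) (v : 'cV[Cx R]_n)
    (w : 'I_N -> int) : Prop :=
  forall k : 'I_N, exists2 K, is_K k K &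
    map_mx K U *m v = sqrt_q ^ w k *: v.

Definition has_highest_weight N n (U : 'M[UU N]_n) (nu : Sign N) : Prop :=
  exists v : 'cV[Cx R]_n,
    [/\ v != 0, is_weight_vector U v (fun k => (sign_vertex nu)`_k) &
        forall k k' : 'I_N, k' = k.+1 :> nat -> exists2 E, is_E k k' E &
          map_mx E U *m v = 0].

(* The parametrization of the irreducible unitary representations by highest
   weights, each U_nu being written in an (orthonormal) Gelfand-Tsetlin basis:
   the i-th basis vector of U_nu is v_t for t = gt_path nu i. *)
Record GT_bases := GTBases {
  gt_dim : forall N, Sign N -> nat;
  gt_path : forall N (nu : Sign N), 'I_(gt_dim nu) -> seq vertex;
  gt_rep : forall N (nu : Sign N), 'M[UU N]_(gt_dim nu);
  gt_path_inj : forall N (nu : Sign N), injective (@gt_path N nu);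
  gt_path_range : forall N (nu : Sign N),
    range (@gt_path N nu) = paths_to nu;
  gt_irr : forall N (nu : Sign N), is_irr (gt_rep nu);
  gt_highest_weight : forall N (nu : Sign N), has_highest_weight (gt_rep nu) nu;
  gt_complete : forall N n (U : 'M[UU N]_n), is_irr U ->
    exists! nu : Sign N, unitarily_equiv (gt_rep nu) U;
  (* restricted to U_q(N), the vectors v_t with t_N = mu span a copy of U_mu,
     in which v_t corresponds to v_(t_1, .., t_N) *)
  gt_restrict : forall N (nu : Sign N.+1) (mu : Sign N)
      (i j : 'I_(gt_dim nu)) (i' j' : 'I_(gt_dim mu)),
    gt_path i = rcons (gt_path i') (nu : vertex) ->
    gt_path j = rcons (gt_path j') (nu : vertex) ->
    theta UU N (gt_rep nu i j) = gt_rep mu i' j';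
  gt_restrict0 : forall N (nu : Sign N.+1) (i j : 'I_(gt_dim nu)),
    level (gt_path i) N != level (gt_path j) N ->
    theta UU N (gt_rep nu i j) = 0;
  gt_weight : forall N (nu : Sign N) (i : 'I_(gt_dim nu)),
    is_weight_vector (gt_rep nu) (delta_mx i 0)
      (fun k => vweight (level (gt_path i) k.+1) -
                vweight (level (gt_path i) k));
  gt_density : forall N (nu : Sign N),
    is_density (gt_rep nu)
      (diag_mx (\row_i
         toC q ^ (- ((N.-1)%:Z * vweight nu) +
                  2 * \sum_(1 <= n < N) vweight (level (gt_path i) n))))
}.

Variable GT : GT_bases.

Definition quantum_char N (nu : Sign N) (f : UU N -> Cx R) : Cx R :=
  \tr (density (gt_rep GT nu) *m map_mx f (gt_rep GT nu)) /
  \tr (density (gt_rep GT nu)).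

End QuantumUnitary.

Definition homeomorphism (S T : topologicalType) (Phi : S -> T) : Prop :=
  continuous Phi /\
  exists Psi : T -> S, [/\ cancel Phi Psi, cancel Psi Phi & continuous Psi].

Definition affine_map (R : realType) (q : R) (S : inductive_system R)
    (L : cstar_limit S) (tau : dual_flow L) (Phi : Ch tau -> Central q) : Prop :=
  forall (s : R) (chi1 chi2 : Ch tau), 0 <= s <= 1 ->
    exists chi : Ch tau,
      (forall x, val chi x =
                 toC s * val chi1 x + toC (1 - s) * val chi2 x) /\
      forall B : set OmegaM, measurable B ->
        ((val (Phi chi) : Prob R) B =
         s%:E * (val (Phi chi1) : Prob R) B +
         (1 - s)%:E * (val (Phi chi2) : Prob R) B)%E.

(* Main.v *)
Require Import Defs.
From HB Require Import structures.
From mathcomp Require Import all_boot all_order all_algebra perm complex.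
From mathcomp Require Import all_classical all_reals all_analysis.
From mathcomp.analysis.showcase Require Import summability.
From mathcomp Require Import finmap ring lra.

(* C*(U_q(N)) is spanned by matrix units e_tu, indexed by the pairs of paths t, u
   of length N with the same end, and the flow multiplies e_tu by the phase
   q^(2is(|t| - |u|)), where |t| = |t_1| + ... + |t_(N-1)|.  The KMS condition at
   inverse temperature -1 amounts to
     q^(2(|t| - |u|)) chi(x e_tu) = chi(e_tu x)    for all x:
   for the nontrivial implication, the dense subalgebra in the definition of a
   KMS state need not contain e_tu, so one takes y in it close to e_tu and
   compares the integrals over one period of the entire function
   chi(x tau_z(y)) exp(-ikz), with k the frequency of e_tu, on the lines Im z = 0
   and Im z = -1.

   Hence a quantized character chi vanishes on e_tu for t <> u, and the numbers
   p(t) = chi(e_tt) have the ratios required by centrality.  They are the masses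
   of the cylinders of a probability measure: sum_v p(tv) <= p(t) since e_tt minus
   any finite sum of the e_(tv)(tv) is a projection, and no mass is lost because
   chi has norm one on every C*(U_q(N)).  Conversely, a central measure P defines
   chi(f) as the integral over the paths w of the diagonal coefficient of f at
   the initial segment of w.  Both maps are continuous because both topologies
   are pointwise convergence on the e_tt, respectively on the cylinders. *)

Set Implicit Arguments.
Unset Strict Implicit.
Unset Printing Implicit Defensive.

Import Order.TTheory GRing.Theory Num.Theory.
Import numFieldNormedType.Exports.

Local Open Scope classical_set_scope.
Local Open Scope ring_scope.

(** * Complex analysis in one variable *)

(** The flow is given abstractly: no bound on [tau s] comes with it, and [is_KMS] leaves open both
    the dense subalgebra and the entire extensions of its orbits. Hence an identity theorem is
    needed to compare two extensions at -i, and chi(x tau_s(y)) must be estimated uniformly in s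
    although only chi comes with a bound. The matrix units have a common period because the
    exponents 2(|t| - |u|) are even integers; the factor q^(-(N-1)|nu|) of the density matrix
    cancels between two paths with the same end. A vertex has infinitely many children, so [Theta]
    does not map C*(U_q(N)) into C*(U_q(N+1)): at level N+1 the unit e_tu is an infinite sum of
    units e_(tv)(uv), an element of W* only. Products are therefore computed by multiplying a unit
    of the higher level with a lifted element of W*, and mass could escape to infinity at each
    level; the condition of norm one excludes this. The matrix units are functionals on the Hopf
    algebra, obtained from the double commutant theorem for finitely many irreducibles and from
    Zorn's lemma for all of them. *)

Section RealCalculus.
Variable R : realType.
Implicit Types (f g F G : R -> R) (a b x y : R).

(** Free of quotients, this form restricts directly from [cderiv] to horizontal and vertical
    lines. *)
Lemma is_derive_epsP f x df : is_derive x 1 f df <->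
  forall e : R, 0 < e -> exists2 d : R, 0 < d & forall h : R, `|h| < d ->
    `|f (x + h) - f x - df * h| <= e * `|h|.
Proof.
split.
- move=> [fx fE] e e0.
  have : (fun h => h^-1 *: (f (h *: 1 + x) - f x)) @ 0^' --> df by rewrite -fE; exact: fx.
  move=> /cvgrPdist_le /(_ e e0); rewrite near_withinE.
  move=> /nbhs_ballP[d /= d0 H]; exists d => // h hd.
  have [->|h0] := eqVneq h 0; first by rewrite addr0 subrr mulr0 subr0 normr0 mulr0.
  have := H h; rewrite -ball_normE /= sub0r normrN => /(_ hd h0).
  rewrite /GRing.scale /= mulr1 => H1.
  have -> : f (x + h) - f x - df * h = - (h * (df - h^-1 * (f (h + x) - f x))).
    by rewrite (addrC h x); field.
  by rewrite normrN normrM mulrC ler_wpM2r.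
- move=> H.
  suff C : (fun h => h^-1 *: (f (h *: 1 + x) - f x)) @ 0^' --> df.
    by split; [apply/cvg_ex; exists df | exact/cvg_lim].
  apply/cvgrPdist_le => e e0; rewrite near_withinE.
  have [d d0 Hd] := H e e0.
  apply/nbhs_ballP; exists d => //= h; rewrite -ball_normE /= sub0r normrN => hd h0.
  rewrite /GRing.scale /= mulr1.
  have -> : df - h^-1 * (f (h + x) - f x) = - (h^-1 * (f (x + h) - f x - df * h)).
    by rewrite (addrC h x); field.
  rewrite normrN normrM normfV mulrC ler_pdivrMr ?normr_gt0 //.
  exact: Hd.
Qed.

Lemma derive_bound f df a b M : a <= b ->
  (forall x, is_derive x 1 f (df x)) ->
  (forall x, a <= x <= b -> `|df x| <= M) -> `|f b - f a| <= M * (b - a).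
Proof.
move=> ab fd dM; have [->|aNb] := eqVneq a b; first by rewrite !subrr normr0 mulr0.
have {aNb}ab : a < b by rewrite lt_neqAle aNb.
have [|c cab ->] := @MVT R f df a b ab (fun x _ => fd x).
  apply: derivable_within_continuous => x _; exact: (@ex_derive _ _ _ _ _ _ _ (fd x)).
move: cab; rewrite in_itv /= => /andP[ac cb].
rewrite normrM (@ger0_norm _ (b - a)) ?subr_ge0 ?(ltW ab) // ler_wpM2r ?subr_ge0 ?(ltW ab) //.
by apply: dM; rewrite !ltW.
Qed.

Lemma derive_incr f df a b : a < b ->
  (forall x, is_derive x 1 f (df x)) ->
  (forall x, a <= x <= b -> 0 < df x) -> 0 < f b - f a.
Proof.
move=> ab fd dM.
have [|c cab ->] := @MVT R f df a b ab (fun x _ => fd x).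
  apply: derivable_within_continuous => x _; exact: (@ex_derive _ _ _ _ _ _ _ (fd x)).
move: cab; rewrite in_itv /= => /andP[ac cb].
by rewrite mulr_gt0 ?subr_gt0 // dM // !ltW.
Qed.

(** The base point -1 makes the domain overlap with its mirror image around 0, so that the two
    primitives can be glued. *)
Lemma primitive_right f : continuous f ->
  exists F, forall x, -1 < x -> is_derive x 1 F (f x).
Proof.
move=> fc.
exists (fun x => (\int[lebesgue_measure]_(t in `[-1, x]) f t)%R) => x x1.
have I : lebesgue_measure.-integrable `[-1, x + 1] (EFin \o f).
  apply: continuous_compact_integrable; first exact: segment_compact.
  exact: continuous_subspaceT.
have xx1 : x < x + 1 by rewrite ltrDl.
have [d1 d2] := continuous_FTC1_closed xx1 I x1 (fc x).
by apply: (@DeriveDef _ _ _ _ _ _ _ d1); rewrite -derive1E; exact: d2.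
Qed.

Lemma primitive_exists f : continuous f ->
  exists F, F 0 = 0 /\ forall x, is_derive x 1 F (f x).
Proof.
move=> fc; have [P Pd] := primitive_right fc.
have [|Q Qd] := @primitive_right (fun x => - f (- x)).
  move=> x; apply: continuousN; apply: continuous_comp; [exact: oppr_continuous|exact: fc].
have Q'd x : x < 1 -> is_derive x 1 (fun t => Q (- t)) (f x).
  move=> x1; apply/is_derive_epsP => e e0.
  have /Qd/is_derive_epsP/(_ e e0)[d d0 H] : -1 < - x by lra.
  exists d => // h hd; have := H (- h); rewrite normrN => /(_ hd).
  rewrite opprK.
  by have -> : Q (- x + - h) - Q (- x) - - f x * - h = Q (- (x + h)) - Q (- x) - f x * h
    by rewrite opprD; ring.
(* On the overlap (-1, 1) both candidates are primitives of f, so their difference is constant. *)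
have E x : -1 < x -> x < 1 -> P x - P 0 = Q (- x) - Q 0.
  move=> x1 x2.
  suff H (u v : R) : -1 < u -> u < v -> v < 1 -> P u - Q (- u) = P v - Q (- v).
    have [x0|x0|->] := ltgtP x 0; last by rewrite oppr0 !subrr.
    - have := H x 0; rewrite oppr0 => /(_ x1 x0 ltr01) ?; lra.
    - have := H 0 x; rewrite oppr0 => /(_ _ x0 x2) -/(_ ltac:(lra)) ?; lra.
  move=> u1 uv v1.
  have D (t : R) : -1 < t -> t < 1 -> is_derive t 1 (P - (fun t => Q (- t))) 0.
    move=> t1 t2; have := is_deriveB (Pd t t1) (Q'd t t2); by rewrite subrr.
  have [||c _] := @MVT R (P - (fun t => Q (- t))) (fun=> 0) u v uv.
  - by move=> t; rewrite in_itv /= => /andP[ut tv]; apply: D; lra.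
  - apply: derivable_within_continuous => t; rewrite in_itv /= => /andP[ut tv].
    by apply: (@ex_derive _ _ _ _ _ _ _ (D t _ _)); lra.
  rewrite mul0r /= => /eqP; rewrite subr_eq0 => /eqP; by rewrite !fctE => ->.
exists (fun x => if 0 <= x then P x - P 0 else Q (- x) - Q 0).
split; first by rewrite lexx subrr.
move=> x; apply/is_derive_epsP => e e0.
have [x0|x0] := ltP (- 1) x.
- have /is_derive_epsP/(_ e e0)[d d0 H] := Pd x x0.
  have F t : -1 < t -> (if 0 <= t then P t - P 0 else Q (- t) - Q 0) = P t - P 0.
    by move=> t1; case: (leP 0 t) => // t0; rewrite E //; lra.
  exists (Num.min d (x + 1)); first by rewrite lt_min d0 /=; lra.
  move=> h; rewrite lt_min => /andP[hd hx]; rewrite !F //; last first.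
    by move: hx; rewrite ltr_norml => /andP[? ?]; lra.
  have -> : P (x + h) - P 0 - (P x - P 0) - f x * h = P (x + h) - P x - f x * h by ring.
  exact: H.
- have x1 : x < 1 by lra.
  have /is_derive_epsP/(_ e e0)[d d0 H] := Q'd x x1.
  exists (Num.min d 1); first by rewrite lt_min d0 /=.
  move=> h; rewrite lt_min => /andP[hd]; rewrite ltr_norml => /andP[? ?].
  have -> : (0 <= x) = false by apply/negbTE; rewrite -ltNge; lra.
  have -> : (0 <= x + h) = false by apply/negbTE; rewrite -ltNge; lra.
  have -> : Q (- (x + h)) - Q 0 - (Q (- x) - Q 0) - f x * h = Q (- (x + h)) - Q (- x) - f x * h by ring.
  exact: H.
Qed.

Definition prim f : R -> R :=
  xget (fun=> 0) [set F | F 0 = 0 /\ forall x, is_derive x 1 F (f x)].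

Lemma primP f : continuous f -> forall x, is_derive x 1 (prim f) (f x).
Proof.
move=> /primitive_exists[F [F0 Fd]]; rewrite /prim.
by case: xgetP => [G _ []|/(_ F) []].
Qed.

(** Integrals as differences of a primitive: additivity in the interval becomes an algebraic
    identity, and integrals of derivatives are evaluated by [rintE]. *)
Definition rint f a b := prim f b - prim f a.

Lemma rintE f F a b : (forall x, is_derive x 1 F (f x)) -> rint f a b = F b - F a.
Proof.
move=> Fd; rewrite /rint.
have P x : is_derive x 1 (prim f) (f x).
  rewrite /prim; case: xgetP => [G _ [] //|/(_ (fun x => F x - F 0)) []].
  split; first by rewrite subrr.
  move=> y; apply/is_derive_epsP => e /((is_derive_epsP _ _ _).1 (Fd y))[d d0 H].
  exists d => // h /H; congr (_ <= _); congr (`|_|); ring.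
have D x : is_derive x 1 (prim f - F) 0.
  by have := is_deriveB (P x) (Fd x); rewrite subrr.
have := is_derive_0_is_cst a b D; rewrite !fctE => ?; lra.
Qed.

Lemma rint_bound f a b M : a <= b -> continuous f ->
  (forall x, a <= x <= b -> `|f x| <= M) -> `|rint f a b| <= M * (b - a).
Proof. by move=> ab /primP fP; exact: derive_bound. Qed.

Lemma rint_gt0 f a b : a < b -> continuous f ->
  (forall x, a <= x <= b -> 0 < f x) -> 0 < rint f a b.
Proof. by move=> ab /primP fP; exact: derive_incr. Qed.

Lemma rint_lin f g s t a b : continuous f -> continuous g ->
  rint (fun x => s * f x + t * g x) a b = s * rint f a b + t * rint g a b.
Proof.
move=> /primP fP /primP gP.
rewrite (@rintE _ (fun x => s * prim f x + t * prim g x)) /rint; ring.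
Qed.

End RealCalculus.

(** * Derivatives, integrals over rectangles and Cauchy's theorem *)

Section ComplexCalculus.
Variable R : realType.
Local Notation C := (Cx R).
Local Notation re := (@complex.Re R).
Local Notation im := (@complex.Im R).
Local Notation pt x y := (Complex x y : C).
Implicit Types (z w h D : C) (f g : C -> C).

Lemma eq_ler (a b : R) : a = b -> a <= b. Proof. by move->. Qed.

(** The l1 norm of the plane: equivalent to the modulus, but with values in R and split along the
    coordinates, so that [lra] can treat the estimates. *)
Definition n1 z : R := `|re z| + `|im z|.

Lemma n1_ge0 z : 0 <= n1 z. Proof. by rewrite addr_ge0. Qed.
Lemma n10 : n1 0 = 0. Proof. by rewrite /n1 /= normr0 addr0. Qed.
Lemma n1N z : n1 (- z) = n1 z.
Proof. by case: z => x y; rewrite /n1 /= !normrN. Qed.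
Lemma n1D z w : n1 (z + w) <= n1 z + n1 w.
Proof.
case: z w => [a b] [c d]; rewrite /n1 /=.
by have := ler_normD a c; have := ler_normD b d; lra.
Qed.
Lemma n1M z w : n1 (z * w) <= n1 z * n1 w.
Proof.
case: z w => [a b] [c d]; rewrite /n1 /=.
have := ler_normB (a * c) (b * d); have := ler_normD (a * d) (b * c).
by rewrite !normrM; lra.
Qed.
Lemma n1_eq0 z : n1 z = 0 -> z = 0.
Proof.
case: z => x y; rewrite /n1 /= => H.
have x0 : `|x| = 0 by apply/eqP; rewrite eq_le normr_ge0 andbT; have := normr_ge0 y; lra.
have y0 : `|y| = 0 by lra.
by move/eqP: x0; move/eqP: y0; rewrite !normr_eq0 => /eqP -> /eqP ->.
Qed.
Lemma n1_gt0 z : z != 0 -> 0 < n1 z.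
Proof.
move=> z0; rewrite lt_neqAle n1_ge0 andbT eq_sym; apply: contra z0 => /eqP/n1_eq0 ->; exact: eqtype.eqxx.
Qed.
Lemma n1_i z : n1 ('i%C * z) = n1 z.
Proof. by case: z => x y; rewrite /n1 /= !(mul0r, mul1r, sub0r, add0r) normrN addrC. Qed.
Lemma abs_re_n1 z : `|re z| <= n1 z. Proof. by rewrite lerDl. Qed.
Lemma abs_im_n1 z : `|im z| <= n1 z. Proof. by rewrite lerDr. Qed.
Lemma norm_le_n1 z : `|z| <= toC (n1 z).
Proof.
case: z => x y; rewrite normc_def /toC lecR /n1 /=.
rewrite -[leRHS]ger0_norm ?addr_ge0 // -sqrtr_sqr ler_wsqrtr //.
rewrite sqrrD !real_normK ?num_real //.
by have := mulr_ge0 (normr_ge0 x) (normr_ge0 y); rewrite mulr2n; lra.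
Qed.
Lemma n1_le_norm z : toC (n1 z) <= 2 * `|z|.
Proof.
have -> : toC (n1 z) = toC `|re z| + toC `|im z| by rewrite /toC rmorphD.
have H : toC `|im z| <= `|z|.
  by case: (z) => x y; rewrite normc_def /toC lecR -sqrtr_sqr ler_wsqrtr //= lerDr sqr_ge0.
by rewrite mulr2n mulrDl mul1r lerD // normc_ge_Re.
Qed.

Definition cderiv f z D := forall e : R, 0 < e -> exists2 d : R, 0 < d &
  forall h, n1 h < d -> n1 (f (z + h) - f z - D * h) <= e * n1 h.

Definition ccont f z := forall e : R, 0 < e -> exists2 d : R, 0 < d &
  forall h, n1 h < d -> n1 (f (z + h) - f z) <= e.

Lemma cderiv_lip f z D : cderiv f z D -> exists2 d : R, 0 < d &
  forall h, n1 h < d -> n1 (f (z + h) - f z) <= (1 + n1 D) * n1 h.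
Proof.
move=> /(_ 1 ltr01)[d d0 H]; exists d => // h /H {}H.
have -> : f (z + h) - f z = (f (z + h) - f z - D * h) + D * h by ring.
by apply: (le_trans (n1D _ _)); rewrite mulrDl lerD // n1M.
Qed.

Lemma cderiv_cont f z D : cderiv f z D -> ccont f z.
Proof.
move=> /cderiv_lip[d d0 H] e e0; have n0 := n1_ge0 D.
exists (Num.min d (e / (1 + n1 D))).
  by rewrite lt_min d0 divr_gt0 // ltr_pwDl.
move=> h; rewrite lt_min => /andP[/H {}H he]; apply: (le_trans H).
by rewrite mulrC -ler_pdivlMr ?ltW // ltr_pwDl.
Qed.

Lemma cderiv_cst c z : cderiv (fun=> c) z 0.
Proof. by move=> e e0; exists 1 => // h _; rewrite subrr mul0r subr0 n10 mulr_ge0 ?n1_ge0 ?ltW. Qed.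

Lemma cderiv_id z : cderiv id z 1.
Proof.
move=> e e0; exists 1 => // h _; have -> : z + h - z - 1 * h = 0 by ring.
by rewrite n10 mulr_ge0 ?n1_ge0 ?ltW.
Qed.

Lemma cderivD f g z D E : cderiv f z D -> cderiv g z E ->
  cderiv (fun z => f z + g z) z (D + E).
Proof.
move=> Hf Hg e e0; have e2 : 0 < e / 2 by rewrite divr_gt0.
have [d d0 H1] := Hf _ e2; have [d' d'0 H2] := Hg _ e2.
exists (Num.min d d'); first by rewrite lt_min d0.
move=> h; rewrite lt_min => /andP[/H1 {}H1 /H2 {}H2].
have -> : f (z + h) + g (z + h) - (f z + g z) - (D + E) * h =
  (f (z + h) - f z - D * h) + (g (z + h) - g z - E * h) by ring.
apply: (le_trans (n1D _ _)); lra.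
Qed.

Lemma cderivM f g z D E : cderiv f z D -> cderiv g z E ->
  cderiv (fun z => f z * g z) z (D * g z + f z * E).
Proof.
move=> Hf Hg e e0.
pose B := 1 + n1 D + n1 (f z) + n1 (g z).
have f0 := n1_ge0 (f z); have g0 := n1_ge0 (g z).
have D0' := n1_ge0 D.
have B0 : 0 < B by rewrite /B; lra.
have e2 : 0 < e / (3 * B) by rewrite divr_gt0 // mulr_gt0.
have [d d0 H1] := Hf _ e2; have [d' d'0 H2] := Hg _ e2.
have [d2 d20 H3] := cderiv_lip Hf; have [d3 d30 H4] := cderiv_cont Hg e2.
exists (Num.min (Num.min d d') (Num.min d2 d3)); first by rewrite !lt_min d0 d'0 d20.
move=> h; rewrite !lt_min => /andP[/andP[/H1 {}H1 /H2 {}H2] /andP[/H3 {}H3 /H4 {}H4]].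
have -> : f (z + h) * g (z + h) - f z * g z - (D * g z + f z * E) * h =
  (f (z + h) - f z - D * h) * g z + f z * (g (z + h) - g z - E * h) +
  (f (z + h) - f z) * (g (z + h) - g z) by ring.
apply: (le_trans (n1D _ _)).
have X1 : n1 ((f (z + h) - f z - D * h) * g z) <= e / 3 * n1 h.
  apply: (le_trans (n1M _ _)); apply: (@le_trans _ _ (e / (3 * B) * n1 h * B)).
    by apply: ler_pM; rewrite ?n1_ge0 //; rewrite /B; lra.
  by apply: eq_ler; field; rewrite gt_eqF.
have X2 : n1 (f z * (g (z + h) - g z - E * h)) <= e / 3 * n1 h.
  apply: (le_trans (n1M _ _)); apply: (@le_trans _ _ (B * (e / (3 * B) * n1 h))).
    by apply: ler_pM; rewrite ?n1_ge0 //; rewrite /B; lra.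
  by apply: eq_ler; field; rewrite gt_eqF.
have X3 : n1 ((f (z + h) - f z) * (g (z + h) - g z)) <= e / 3 * n1 h.
  apply: (le_trans (n1M _ _)); apply: (@le_trans _ _ (B * n1 h * (e / (3 * B)))).
    apply: ler_pM; rewrite ?n1_ge0 //; apply: (le_trans H3); rewrite ler_wpM2r ?n1_ge0 //.
    by rewrite /B; lra.
  by apply: eq_ler; field; rewrite gt_eqF.
by have := n1D ((f (z + h) - f z - D * h) * g z) (f z * (g (z + h) - g z - E * h)); lra.
Qed.

Lemma cderiv_comp f g z D E : cderiv f z D -> cderiv g (f z) E ->
  cderiv (g \o f) z (E * D).
Proof.
move=> Hf Hg e e0; have D0 := n1_ge0 D; have E0 := n1_ge0 E.
have e1 : 0 < e / 2 / (1 + n1 D) by rewrite !divr_gt0 //; lra.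
have e2 : 0 < e / 2 / (1 + n1 E) by rewrite !divr_gt0 //; lra.
have [d d0 H1] := Hg _ e1; have [d' d'0 H2] := Hf _ e2.
have [d2 d20 H3] := cderiv_lip Hf.
exists (Num.min (d / (1 + n1 D)) (Num.min d' d2)).
  by rewrite !lt_min d'0 d20 divr_gt0 //; lra.
move=> h; rewrite !lt_min => /andP[hd /andP[/H2 {}H2 /H3 {}H3]].
have := H1 (f (z + h) - f z); rewrite (addrC (f z)) subrK => {}H1.
have {}H1 : n1 (g (f (z + h)) - g (f z) - E * (f (z + h) - f z)) <=
            e / 2 / (1 + n1 D) * n1 (f (z + h) - f z).
  apply: H1; apply: (le_lt_trans H3); rewrite mulrC -ltr_pdivlMr //; lra.
have -> : (g \o f) (z + h) - (g \o f) z - E * D * h =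
  (g (f (z + h)) - g (f z) - E * (f (z + h) - f z)) + E * (f (z + h) - f z - D * h).
  by rewrite /=; ring.
apply: (le_trans (n1D _ _)).
have X1 : e / 2 / (1 + n1 D) * n1 (f (z + h) - f z) <= e / 2 * n1 h.
  apply: (@le_trans _ _ (e / 2 / (1 + n1 D) * ((1 + n1 D) * n1 h))).
    by rewrite ler_wpM2l // ltW.
  by apply: eq_ler; field; rewrite gt_eqF //; lra.
have X2 : n1 (E * (f (z + h) - f z - D * h)) <= e / 2 * n1 h.
  apply: (le_trans (n1M _ _)); apply: (@le_trans _ _ ((1 + n1 E) * (e / 2 / (1 + n1 E) * n1 h))).
    by apply: ler_pM; rewrite ?n1_ge0 //; lra.
  by apply: eq_ler; field; rewrite gt_eqF //; lra.
lra.
Qed.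

Lemma cderiv_inv z : z != 0 -> cderiv (fun z => z^-1) z (- z^-2).
Proof.
move=> z0 e e0.
pose K := n1 (z^-1); have K0 : 0 < K by rewrite n1_gt0 // invr_eq0.
have Zz := n1_gt0 z0.
exists (Num.min (1 / (2 * K)) (Num.min (e / (2 * K ^+ 3)) (n1 z))).
  by rewrite !lt_min Zz !divr_gt0 // mulr_gt0 // exprn_gt0.
move=> h; rewrite !lt_min => /and3P[h1 h2 h3].
have zh : z + h != 0.
  apply: contraL h3 => /eqP zh; have -> : h = - z by apply/eqP; rewrite -addr_eq0 addrC zh.
  by rewrite n1N ltxx.
have -> : (z + h)^-1 - z^-1 - - z^-2 * h = z^-2 * ((z + h)^-1 * (h * h)).
  by field; rewrite z0 zh.
have B : n1 (z + h)^-1 <= 2 * K.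
  (* For h of norm at most 1 / (2 K), the second term of this resolvent identity is at most half of
     the left side. *)
  have E : (z + h)^-1 = z^-1 - z^-1 * h * (z + h)^-1 by field; rewrite z0 zh.
  have := n1D z^-1 (- (z^-1 * h * (z + h)^-1)); rewrite -E n1N -/K.
  have X : n1 (z^-1 * h * (z + h)^-1) <= 1 / 2 * n1 (z + h)^-1.
    apply: (le_trans (n1M _ _)); rewrite ler_wpM2r ?n1_ge0 //.
    apply: (le_trans (n1M _ _)); rewrite -/K mulrC -ler_pdivlMr //.
    by apply: (le_trans (ltW h1)); apply: eq_ler; field; rewrite gt_eqF.
  lra.
have -> : z^-2 = z^-1 * z^-1 by rewrite expr2 invfM.
apply: (@le_trans _ _ (K * K * (2 * K * (n1 h * n1 h)))).
  apply: (le_trans (n1M _ _)); apply: ler_pM; rewrite ?n1_ge0 ?n1M //.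
  by apply: (le_trans (n1M _ _)); apply: ler_pM; rewrite ?n1_ge0 ?n1M.
have -> : K * K * (2 * K * (n1 h * n1 h)) = 2 * K ^+ 3 * n1 h * n1 h by ring.
rewrite ler_wpM2r ?n1_ge0 // mulrC -ler_pdivlMr ?ltW // mulr_gt0 // exprn_gt0 //.
Qed.

Definition cexp z : C := Complex (expR (re z) * cos (im z)) (expR (re z) * sin (im z)).

Lemma cexpD z w : cexp (z + w) = cexp z * cexp w.
Proof.
case: z w => [a b] [c d]; rewrite /cexp /= expRD cosD sinD.
by apply/eqP; rewrite eq_complex /=; apply/andP; split; apply/eqP; ring.
Qed.

Lemma cexp0 : cexp 0 = 1.
Proof. by rewrite /cexp /= expR0 cos0 sin0 mulr1 mulr0. Qed.

Lemma cderiv_cexp0 : cderiv cexp 0 1.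
Proof.
move=> e e0.
have [e1 [e10 e11 e1e]] : exists e1 : R, [/\ 0 < e1, e1 <= 1 & 8 * e1 <= e].
  exists (Num.min (e / 8) 1); split; first by rewrite lt_min divr_gt0 //=.
    by rewrite ge_min lexx orbT.
  by rewrite mulrC -ler_pdivlMr // ge_min lexx.
have dE : is_derive (0 : R) 1 (@expR R) 1 by apply: is_derive_eq; rewrite expR0.
have dS : is_derive (0 : R) 1 (@sin R) 1 by apply: is_derive_eq; rewrite cos0.
have dC : is_derive (0 : R) 1 (@cos R) 0 by apply: is_derive_eq; rewrite sin0 oppr0.
have [d d0 HE] := (is_derive_epsP _ _ _).1 dE _ e10.
have [d' d'0 HS] := (is_derive_epsP _ _ _).1 dS _ e10.
have [d2 d20 HC] := (is_derive_epsP _ _ _).1 dC _ e10.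
exists (Num.min (Num.min d d') (Num.min d2 e1)); first by rewrite !lt_min d0 d'0 d20.
case=> a b; rewrite {1}/n1 /= !lt_min => /andP[/andP[h1 h2] /andP[h3 h4]].
have A0 := normr_ge0 a; have B0 := normr_ge0 b.
have := HE a; have := HS b; have := HC b.
rewrite !add0r expR0 cos0 sin0 mul0r !mul1r !subr0.
move=> /(_ ltac:(lra)) {}HC /(_ ltac:(lra)) {}HS /(_ ltac:(lra)) {}HE.
rewrite cexp0 /n1 /cexp /=.
have cb : `|cos b| <= 1 by rewrite ler_norml cos_geN1 cos_le1.
have -> : expR a * cos b - 1 - a =
  (expR a - 1 - a) * cos b + (cos b - 1) * (1 + a) by ring.
have -> : expR a * sin b - 0 - b =
  (expR a - 1) * sin b + (sin b - b) by ring.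
have X1 : `|(expR a - 1 - a) * cos b| <= e1 * `|a|.
  by rewrite normrM -[leRHS]mulr1 ler_pM.
have X2 : `|(cos b - 1) * (1 + a)| <= e1 * `|b| * 2.
  by rewrite normrM ler_pM //; have := ler_normD 1 a; rewrite normr1; lra.
have Y1 : `|expR a - 1| <= 2 * `|a|.
  have := ler_normD (expR a - 1 - a) a; rewrite subrK => H; apply: (le_trans H).
  have : e1 * `|a| <= 1 * `|a| by rewrite ler_wpM2r.
  lra.
have Y2 : `|sin b| <= 2 * `|b|.
  have := ler_normD (sin b - b) b; rewrite subrK => H; apply: (le_trans H).
  have : e1 * `|b| <= 1 * `|b| by rewrite ler_wpM2r.
  lra.
have X3 : `|(expR a - 1) * sin b| <= 4 * e1 * `|b|.
  rewrite normrM; apply: (@le_trans _ _ (2 * `|a| * (2 * `|b|))); first by rewrite ler_pM.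
  have -> : 2 * `|a| * (2 * `|b|) = 4 * `|a| * `|b| by ring.
  by rewrite ler_wpM2r //; lra.
have Z1 : e1 * `|a| * 8 <= e * `|a| by rewrite mulrAC ler_wpM2r // mulrC.
have Z2 : e1 * `|b| * 8 <= e * `|b| by rewrite mulrAC ler_wpM2r // mulrC.
have W1 : 0 <= e1 * `|a| by rewrite mulr_ge0 // ltW.
have W2 : 0 <= e1 * `|b| by rewrite mulr_ge0 // ltW.
have := ler_normD ((expR a - 1 - a) * cos b) ((cos b - 1) * (1 + a)).
have := ler_normD ((expR a - 1) * sin b) (sin b - b).
lra.
Qed.

Lemma cderiv_cexp z : cderiv cexp z (cexp z).
Proof.
move=> e e0; have n0 := n1_ge0 (cexp z).
have e1 : 0 < e / (1 + n1 (cexp z)) by rewrite divr_gt0 // ltr_pwDl.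
have [d d0 H] := cderiv_cexp0 e1; exists d => // h /H; rewrite add0r cexp0 mul1r => {}H.
have -> : cexp (z + h) - cexp z - cexp z * h = cexp z * (cexp h - 1 - h) by rewrite cexpD; ring.
apply: (le_trans (n1M _ _)).
apply: (@le_trans _ _ ((1 + n1 (cexp z)) * (e / (1 + n1 (cexp z)) * n1 h))).
  by apply: ler_pM; rewrite ?n1_ge0 //; lra.
by apply: eq_ler; field; rewrite gt_eqF // ltr_pwDl.
Qed.

Lemma n1_cexp z : n1 (cexp z) <= 2 * expR (re z).
Proof.
rewrite /n1 /= !normrM !(ger0_norm (expR_ge0 _)) -mulrDr mulrC ler_wpM2r ?expR_ge0 //.
have cb : `|cos (im z)| <= 1 by rewrite ler_norml cos_geN1 cos_le1.
have sb : `|sin (im z)| <= 1 by rewrite ler_norml sin_geN1 sin_le1.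
lra.
Qed.

Definition holo f := forall z, exists D, cderiv f z D.

Definition lcont (g : R -> C) := continuous (re \o g) /\ continuous (im \o g).

Lemma epsdelta_continuous (u : R -> R) :
  (forall x e : R, 0 < e -> exists2 d : R, 0 < d & forall h : R, `|h| < d -> `|u (x + h) - u x| <= e) ->
  continuous u.
Proof.
move=> H x; apply/cvgrPdist_le => e e0; have [d d0 Hd] := H x e e0.
apply/nbhs_ballP; exists d => //= y; rewrite /ball_ /= => xy.
by have := Hd (y - x); rewrite distrC => /(_ xy); rewrite addrCA subrr addr0 distrC.
Qed.

Lemma lcont_hor f y : (forall x, ccont f (pt x y)) -> lcont (fun x => f (pt x y)).
Proof.
move=> H; split; apply: epsdelta_continuous => x e /(H x)[d d0 Hd]; exists d => // h hd;
  have := Hd (pt h 0); rewrite {1}/n1 /= normr0 addr0 => /(_ hd);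
  have -> : pt x y + pt h 0 = pt (x + h) y by rewrite [LHS]/= /GRing.add /= addr0.
- apply: le_trans; case: (f (pt (x + h) y)) (f (pt x y)) => [a b] [a' b'].
  exact: (abs_re_n1 (pt a b - pt a' b')).
- apply: le_trans; case: (f (pt (x + h) y)) (f (pt x y)) => [a b] [a' b'].
  exact: (abs_im_n1 (pt a b - pt a' b')).
Qed.

Lemma lcont_ver f x : (forall y, ccont f (pt x y)) -> lcont (fun y => f (pt x y)).
Proof.
move=> H; split; apply: epsdelta_continuous => y e /(H y)[d d0 Hd]; exists d => // h hd;
  have := Hd (pt 0 h); rewrite {1}/n1 /= normr0 add0r => /(_ hd);
  have -> : pt x y + pt 0 h = pt x (y + h) by rewrite [LHS]/= /GRing.add /= addr0.
- apply: le_trans; case: (f (pt x (y + h))) (f (pt x y)) => [a b] [a' b'].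
  exact: (abs_re_n1 (pt a b - pt a' b')).
- apply: le_trans; case: (f (pt x (y + h))) (f (pt x y)) => [a b] [a' b'].
  exact: (abs_im_n1 (pt a b - pt a' b')).
Qed.

Definition cint (g : R -> C) (a b : R) : C :=
  Complex (rint (re \o g) a b) (rint (im \o g) a b).

Lemma cint_eq (g g' : R -> C) a b : g =1 g' -> cint g a b = cint g' a b.
Proof. by move=> /funext ->. Qed.

Lemma cint_lin (g g' : R -> C) (s t : C) a b : lcont g -> lcont g' ->
  cint (fun x => s * g x + t * g' x) a b = s * cint g a b + t * cint g' a b.
Proof.
move=> [c1 c2] [c3 c4]; case: s t => [s1 s2] [t1 t2]; rewrite /cint /=.
have -> : re \o (fun x => pt s1 s2 * g x + pt t1 t2 * g' x) =
   (fun x => 1 * (s1 * (re \o g) x + (- s2) * (im \o g) x) +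
             1 * (t1 * (re \o g') x + (- t2) * (im \o g') x)).
  apply/funext => x /=; case: (g x) (g' x) => [? ?] [? ?] /=; ring.
have -> : im \o (fun x => pt s1 s2 * g x + pt t1 t2 * g' x) =
   (fun x => 1 * (s2 * (re \o g) x + s1 * (im \o g) x) +
             1 * (t2 * (re \o g') x + t1 * (im \o g') x)).
  apply/funext => x /=; case: (g x) (g' x) => [? ?] [? ?] /=; ring.
have L (u v : R -> R) s t : continuous u -> continuous v -> continuous (fun x => s * u x + t * v x).
  move=> uc vc x; apply: (@cvgD _ _ _ _ _ (fun x => s * u x) (fun x => t * v x)); apply: cvgMr; [exact: uc|exact: vc].
rewrite !rint_lin //; try exact: L.
by apply/eqP; rewrite eq_complex /=; apply/andP; split; apply/eqP; ring.
Qed.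

Lemma cint_bound (g : R -> C) a b M : a <= b -> lcont g ->
  (forall x, a <= x <= b -> n1 (g x) <= M) -> n1 (cint g a b) <= 2 * M * (b - a).
Proof.
move=> ab [g1 g2] H; rewrite {1}/n1 /cint /=.
have X1 : `|rint (re \o g) a b| <= M * (b - a).
  by apply: rint_bound => // x /H; apply: le_trans; exact: abs_re_n1.
have X2 : `|rint (im \o g) a b| <= M * (b - a).
  by apply: rint_bound => // x /H; apply: le_trans; exact: abs_im_n1.
lra.
Qed.

(** The integral of f dz along the boundary of [a, b] x [c, d], counterclockwise; on the vertical
    sides dz = i dy. *)
Definition box f (a b c d : R) : C :=
  cint (fun x => f (pt x c)) a b + 'i%C * cint (fun y => f (pt b y)) c d
  - cint (fun x => f (pt x d)) a b - 'i%C * cint (fun y => f (pt a y)) c d.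

Lemma cint_cat (g : R -> C) a b c : cint g a c = cint g a b + cint g b c.
Proof.
by apply/eqP; rewrite /cint /rint eq_complex /=; apply/andP; split; apply/eqP; ring.
Qed.

Lemma box_splitx f a b c d m : box f a b c d = box f a m c d + box f m b c d.
Proof.
rewrite /box (cint_cat _ a m b) (cint_cat (fun x => f (pt x d)) a m b); ring.
Qed.

Lemma box_splity f a b c d m : box f a b c d = box f a b c m + box f a b m d.
Proof.
rewrite /box (cint_cat (fun y => f (pt b y)) c m d) (cint_cat (fun y => f (pt a y)) c m d); ring.
Qed.

Lemma box_bound f a b c d M : a <= b -> c <= d -> (forall z, ccont f z) ->
  (forall x y, a <= x <= b -> c <= y <= d -> n1 (f (pt x y)) <= M) ->
  n1 (box f a b c d) <= 4 * M * ((b - a) + (d - c)).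
Proof.
move=> ab cd fc H; rewrite /box.
have A0 : a <= a <= b by rewrite lexx. have B0 : a <= b <= b by rewrite lexx ab.
have C0 : c <= c <= d by rewrite lexx. have D0 : c <= d <= d by rewrite lexx cd.
have X1 : n1 (cint (fun x => f (pt x c)) a b) <= 2 * M * (b - a).
  by apply: cint_bound => // [|x xab]; [exact: lcont_hor|exact: H].
have X2 : n1 (cint (fun x => f (pt x d)) a b) <= 2 * M * (b - a).
  by apply: cint_bound => // [|x xab]; [exact: lcont_hor|exact: H].
have X3 : n1 (cint (fun y => f (pt b y)) c d) <= 2 * M * (d - c).
  by apply: cint_bound => // [|x xab]; [exact: lcont_ver|exact: H].
have X4 : n1 (cint (fun y => f (pt a y)) c d) <= 2 * M * (d - c).
  by apply: cint_bound => // [|x xab]; [exact: lcont_ver|exact: H].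
apply: (le_trans (n1D _ _)); rewrite n1N n1_i.
have := n1D (cint (fun x => f (pt x c)) a b + 'i%C * cint (fun y => f (pt b y)) c d)
  (- cint (fun x => f (pt x d)) a b).
have := n1D (cint (fun x => f (pt x c)) a b) ('i%C * cint (fun y => f (pt b y)) c d).
rewrite n1N n1_i; lra.
Qed.

Lemma box_lin f g s t a b c d : (forall z, ccont f z) -> (forall z, ccont g z) ->
  box (fun z => s * f z + t * g z) a b c d = s * box f a b c d + t * box g a b c d.
Proof.
move=> fc gc; rewrite /box.
rewrite (@cint_lin (fun x => f (pt x c)) (fun x => g (pt x c))); [|exact: lcont_hor..].
rewrite (@cint_lin (fun x => f (pt x d)) (fun x => g (pt x d))); [|exact: lcont_hor..].
rewrite (@cint_lin (fun y => f (pt a y)) (fun y => g (pt a y))); [|exact: lcont_ver..].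
rewrite (@cint_lin (fun y => f (pt b y)) (fun y => g (pt b y))); [|exact: lcont_ver..].
ring.
Qed.

Lemma is_derive_re_hor G x y D : cderiv G (pt x y) D ->
  is_derive x 1 (fun t => re (G (pt t y))) (re D) /\
  is_derive x 1 (fun t => im (G (pt t y))) (im D).
Proof.
move=> H; split; apply/is_derive_epsP => e /H[d d0 Hd]; exists d => // h hd;
  have := Hd (pt h 0); rewrite /n1 /= normr0 !addr0 => /(_ hd);
  have -> : pt x y + pt h 0 = pt (x + h) y by rewrite [LHS]/= /GRing.add /= addr0.
- apply: le_trans; case: (G (pt (x + h) y)) (G (pt x y)) D {H Hd} => [a b] [a' b'] [D1 D2] /=.
  by rewrite mulr0 subr0 lerDl.
- apply: le_trans; case: (G (pt (x + h) y)) (G (pt x y)) D {H Hd} => [a b] [a' b'] [D1 D2] /=.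
  by rewrite (mulr0 D1) add0r lerDr.
Qed.

Lemma is_derive_re_ver G x y D : cderiv G (pt x y) D ->
  is_derive y 1 (fun t => re (G (pt x t))) (re ('i%C * D)) /\
  is_derive y 1 (fun t => im (G (pt x t))) (im ('i%C * D)).
Proof.
move=> H; split; apply/is_derive_epsP => e /H[d d0 Hd]; exists d => // h hd;
  have := Hd (pt 0 h); rewrite /n1 /= normr0 !add0r => /(_ hd);
  have -> : pt x y + pt 0 h = pt x (y + h) by rewrite [LHS]/= /GRing.add /= addr0.
- apply: le_trans; case: (G (pt x (y + h))) (G (pt x y)) D {H Hd} => [a b] [a' b'] [D1 D2] /=.
  by rewrite !(mulr0, mul0r, mul1r, sub0r) mulNr lerDl.
- apply: le_trans; case: (G (pt x (y + h))) (G (pt x y)) D {H Hd} => [a b] [a' b'] [D1 D2] /=.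
  by rewrite !(mulr0, mul0r, mul1r, add0r, addr0) lerDr.
Qed.

Lemma cint_hor G g a b y : (forall z, cderiv G z (g z)) ->
  cint (fun x => g (pt x y)) a b = G (pt b y) - G (pt a y).
Proof.
move=> H; rewrite /cint (rintE a b (fun x => (is_derive_re_hor (H (pt x y))).1)).
rewrite (rintE a b (fun x => (is_derive_re_hor (H (pt x y))).2)).
by case: (G (pt b y)) (G (pt a y)) => [? ?] [? ?].
Qed.

Lemma cint_ver G g c d x : (forall z, cderiv G z (g z)) ->
  'i%C * cint (fun y => g (pt x y)) c d = G (pt x d) - G (pt x c).
Proof.
move=> H; rewrite /cint.
have D1 (y : R) : is_derive y 1 (fun t => - re (G (pt x t))) ((im \o (fun y => g (pt x y))) y).
  have -> : (im \o (fun y => g (pt x y))) y = - re ('i%C * g (pt x y)).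
    by rewrite /=; case: (g (pt x y)) => u v /=; rewrite mul0r mul1r sub0r opprK.
  exact: (is_deriveN (is_derive_re_ver (H (pt x y))).1).
have D2 (y : R) : is_derive y 1 (fun t => im (G (pt x t))) ((re \o (fun y => g (pt x y))) y).
  have -> : (re \o (fun y => g (pt x y))) y = im ('i%C * g (pt x y)).
    by rewrite /=; case: (g (pt x y)) => u v /=; rewrite mul0r mul1r add0r.
  exact: (is_derive_re_ver (H (pt x y))).2.
rewrite (rintE c d D1) (rintE c d D2).
case: (G (pt x d)) (G (pt x c)) => [? ?] [? ?].
by apply/eqP; rewrite eq_complex /=; apply/andP; split; apply/eqP; ring.
Qed.

Lemma box_affine (u v : C) a b c d : box (fun z => u + v * z) a b c d = 0.
Proof.
have H z : cderiv (fun z => u * z + v / 2 * (z * z)) z (u + v * z).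
  have := cderivD (cderivM (cderiv_cst u z) (cderiv_id z))
    (cderivM (cderiv_cst (v / 2) z) (cderivM (cderiv_id z) (cderiv_id z))).
  congr (cderiv _ _ _); by field.
rewrite /box !(cint_hor _ _ _ H) !(cint_ver _ _ _ H); ring.
Qed.

(** The affine part of f at z integrates to 0 by [box_affine]. The remainder is at most e times the
    distance to z, so the square of the half-perimeter has one factor from this distance and one
    from the length of the path. *)
Lemma cderiv_near_box f z D e : (forall z, ccont f z) -> cderiv f z D -> 0 < e ->
  exists2 r : R, 0 < r & forall a b c d, a <= re z <= b -> c <= im z <= d ->
    (b - a) + (d - c) < r ->
    n1 (box f a b c d) <= 4 * e * ((b - a) + (d - c)) ^+ 2.
Proof.
move=> fc fD e0; have [r r0 H] := fD e e0; exists r => //.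
case: z fD H => x0 y0 /= fD H a b c d /andP[ax xb] /andP[cy yd] small.
set z0 := pt x0 y0 in fD H *.
have -> : box f a b c d = box (fun z => 1 * f z + (-1) * ((f z0 - D * z0) + D * z)) a b c d.
  rewrite box_lin // ?box_affine; first by ring.
  move=> z; apply: cderiv_cont.
  exact: (cderivD (cderiv_cst _ z) (cderivM (cderiv_cst D z) (cderiv_id z))).
rewrite expr2 mulrA -(mulrA 4); apply: box_bound; [lra|lra| |].
  move=> z e1 e10; have [t t0 Ht] := fc z _ (divr_gt0 e10 (ltr0n R 2)).
  have [t' t'0 Ht'] := cderiv_cont (cderivM (cderiv_cst D z) (cderiv_id z)) (divr_gt0 e10 (ltr0n R 2)).
  exists (Num.min t t'); first by rewrite lt_min t0.
  move=> h; rewrite lt_min => /andP[/Ht {}Ht /Ht' {}Ht'].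
  have -> : 1 * f (z + h) + -1 * (f z0 - D * z0 + D * (z + h)) -
   (1 * f z + -1 * (f z0 - D * z0 + D * z)) =
   (f (z + h) - f z) - (D * (z + h) - D * z) by ring.
  by apply: (le_trans (n1D _ _)); rewrite n1N; lra.
move=> x y /andP[ax' xb'] /andP[cy' yd'].
have hs : n1 (pt x y - z0) <= b - a + (d - c).
  by rewrite /n1 /=; apply: lerD; rewrite ler_norml; apply/andP; split; lra.
have := H (pt x y - z0) (le_lt_trans hs small).
have -> : z0 + (pt x y - z0) = pt x y by ring.
have -> : f (pt x y) - f z0 - D * (pt x y - z0) =
  1 * f (pt x y) + -1 * (f z0 - D * z0 + D * pt x y) by ring.
by move=> X; apply: (le_trans X); rewrite ler_wpM2l // ltW.
Qed.

(** Goursat's bisection: a boundary integral of size K keeps size at least K / 4^n on one of the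
    boxes after n halvings, whereas differentiability at the common point of the nested boxes makes
    it o(4^-n). *)
Lemma goursat f (a w c h : R) : 0 < w -> 0 < h -> (forall z, ccont f z) ->
  (forall x y, a <= x <= a + w -> c <= y <= c + h -> exists D, cderiv f (pt x y) D) ->
  box f a (a + w) c (c + h) = 0.
Proof.
move=> w0 h0 fc fd; apply/n1_eq0/eqP; rewrite eq_le n1_ge0 andbT leNgt; apply/negP.
set K := n1 _ => K0.
pose sq n (p : R * R) := n1 (box f p.1 (p.1 + w / 2 ^+ n) p.2 (p.2 + h / 2 ^+ n)).
pose next n (p p' : R * R) := [/\ p.1 <= p'.1, p'.1 + w / 2 ^+ n.+1 <= p.1 + w / 2 ^+ n,
  p.2 <= p'.2, p'.2 + h / 2 ^+ n.+1 <= p.2 + h / 2 ^+ n & sq n p <= 4 * sq n.+1 p'].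
have nextP n p : exists p', next n p p'.
  case: p => p1 p2; set wn := w / 2 ^+ n.+1; set hn := h / 2 ^+ n.+1.
  have E1 : w / 2 ^+ n = wn + wn by rewrite /wn exprS; field; rewrite expf_neq0.
  have E2 : h / 2 ^+ n = hn + hn by rewrite /hn exprS; field; rewrite expf_neq0.
  have wn0 : 0 < wn by rewrite divr_gt0 // exprn_gt0.
  have hn0 : 0 < hn by rewrite divr_gt0 // exprn_gt0.
  apply: contrapT => /forallNP N.
  have N1 p' : p1 <= p'.1 <= p1 + wn -> p2 <= p'.2 <= p2 + hn -> 4 * sq n.+1 p' < sq n (p1, p2).
    move=> /andP[? ?] /andP[? ?]; rewrite ltNge; apply/negP => ?; apply: (N p').
    by split => //=; rewrite -/wn -/hn ?E1 ?E2; lra.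
  have A1 : p1 <= p1 <= p1 + wn by lra. have A2 : p1 <= p1 + wn <= p1 + wn by lra.
  have B1 : p2 <= p2 <= p2 + hn by lra. have B2 : p2 <= p2 + hn <= p2 + hn by lra.
  have := N1 (p1, p2) A1 B1; have := N1 (p1 + wn, p2) A2 B1.
  have := N1 (p1, p2 + hn) A1 B2; have := N1 (p1 + wn, p2 + hn) A2 B2.
  rewrite /sq /= -/wn -/hn E1 E2 !addrA.
  rewrite (box_splitx f p1 (p1 + wn + wn) p2 (p2 + hn + hn) (p1 + wn)).
  rewrite (box_splity f p1 (p1 + wn) p2 (p2 + hn + hn) (p2 + hn)).
  rewrite (box_splity f (p1 + wn) (p1 + wn + wn) p2 (p2 + hn + hn) (p2 + hn)).
  set Q1 := box f p1 (p1 + wn) p2 (p2 + hn); set Q2 := box f p1 (p1 + wn) (p2 + hn) (p2 + hn + hn).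
  set Q3 := box f (p1 + wn) _ p2 (p2 + hn); set Q4 := box f (p1 + wn) _ (p2 + hn) _.
  have := n1D (Q1 + Q2) (Q3 + Q4); have := n1D Q1 Q2; have := n1D Q3 Q4; lra.
pose st (n : nat) (p : R * R) := xget p [set p' | next n p p'].
pose P := fix P n := if n is n'.+1 then st n' (P n') else (a, c).
have PP n : next n (P n) (P n.+1).
  by rewrite /= /st; case: xgetP => // H; have [p' /H] := nextP n (P n).
have Ple m n : (m <= n)%N -> [/\ (P m).1 <= (P n).1, (P n).1 + w / 2 ^+ n <= (P m).1 + w / 2 ^+ m,
   (P m).2 <= (P n).2 & (P n).2 + h / 2 ^+ n <= (P m).2 + h / 2 ^+ m].
  elim: n => [|n IH]; first by rewrite leqn0 => /eqP ->; rewrite !lexx.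
  rewrite leq_eqVlt => /orP[/eqP -> |/IH[? ? ? ?]]; first by rewrite !lexx.
  by have [? ? ? ? _] := PP n; split; lra.
have wn0 n : 0 < w / 2 ^+ n by rewrite divr_gt0 // exprn_gt0.
have hn0 n : 0 < h / 2 ^+ n by rewrite divr_gt0 // exprn_gt0.
have PK n : K <= 4 ^+ n * sq n (P n).
  elim: n => [|n IH]; first by rewrite expr0 mul1r /K /sq /= expr0 !divr1.
  have [_ _ _ _ Hn] := PP n; apply: (le_trans IH).
  by rewrite exprSr -mulrA ler_wpM2l // exprn_ge0.
have U1 m n : (P m).1 <= (P n).1 + w / 2 ^+ n.
  case/orP: (leq_total m n) => /Ple[? ? ? ?]; have := wn0 m; have := wn0 n; lra.
have U2 m n : (P m).2 <= (P n).2 + h / 2 ^+ n.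
  case/orP: (leq_total m n) => /Ple[? ? ? ?]; have := hn0 m; have := hn0 n; lra.
(* The supremum of the left endpoints lies in all the nested intervals. *)
have S (u v : nat -> R) : (forall m n, u m <= u n + v n) ->
    exists x, forall n, u n <= x <= u n + v n.
  move=> H; exists (sup (range u)) => n.
  have hs : has_sup (range u).
    by split; [exists (u 0%N), 0%N | exists (u 0%N + v 0%N) => _ [m _ <-]].
  apply/andP; split; first by apply: (ub_le_sup hs.2); exists n.
  by apply: ge_sup; [exact: hs.1|move=> _ [m _ <-]].
have [x xP] := S _ _ U1; have [y yP] := S _ _ U2.
have [D HD] : exists D, cderiv f (pt x y) D.
  by apply: fd; [have := xP 0%N | have := yP 0%N]; rewrite /= expr0 divr1.
(* With this e the bound of [cderiv_near_box] at stage n is half of K / 4^n. *)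
pose e := K / (8 * (w + h) ^+ 2).
have wh2 : 0 < (w + h) ^+ 2 by rewrite exprn_gt0 // addr_gt0.
have e0 : 0 < e by rewrite divr_gt0 // mulr_gt0.
have [r r0 Hr] := cderiv_near_box fc HD e0.
have [n nr] : exists n, (w + h) / 2 ^+ n < r.
  have [n] := near_infty_natSinv_expn_lt (PosNum (divr_gt0 r0 (addr_gt0 w0 h0))).
  move=> _ /(_ n (leqnn n)) /= X; exists n.
  by rewrite mulrC -ltr_pdivlMr ?addr_gt0 // -div1r.
have EW : (P n).1 + w / 2 ^+ n - (P n).1 + ((P n).2 + h / 2 ^+ n - (P n).2) = (w + h) / 2 ^+ n.
  by rewrite mulrDl; ring.
have := Hr _ _ _ _ (xP n) (yP n); rewrite EW => /(_ nr).
rewrite -/(sq n (P n)) => Hs.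
have := le_trans (PK n) (ler_wpM2l (exprn_ge0 n (ler0n R 4)) Hs).
have -> : 4 ^+ n * (4 * e * ((w + h) / 2 ^+ n) ^+ 2) = K / 2.
  rewrite /e expr_div_n -exprM muln2 -addnn exprD.
  have -> : (4 : R) ^+ n = 2 ^+ n * 2 ^+ n by rewrite -exprMn; congr (_ ^+ _); ring.
  field; rewrite expf_neq0 //=; exact: lt0r_neq0 (addr_gt0 w0 h0).
lra.
Qed.

(** Away from (x0, y0) [goursat] applies. The remaining square of side 2 m contributes O(m), since
    continuity bounds f near the point; this is the situation of [kern] at its centre. *)
Lemma goursat_pt f a b c d x0 y0 : a < x0 < b -> c < y0 < d -> (forall z, ccont f z) ->
  (forall z, z != pt x0 y0 -> exists D, cderiv f z D) ->
  box f a b c d = 0.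
Proof.
move=> /andP[ax xb] /andP[cy yd] fc fd; apply/n1_eq0/eqP; rewrite eq_le n1_ge0 andbT.
have G a' b' c' d' : a' < b' -> c' < d' ->
    (forall x y : R, a' <= x <= b' -> c' <= y <= d' -> (x, y) != (x0, y0)) -> box f a' b' c' d' = 0.
  move=> ab cd H; have := @goursat f a' (b' - a') c' (d' - c').
  rewrite !(addrC a', addrC c') !subrK; apply; rewrite ?subr_gt0 // => x y xab ycd.
  apply: fd; have := H x y xab ycd; apply: contra => /eqP[-> ->]; exact: eqtype.eqxx.
have [r r0 Hr] := fc (pt x0 y0) 1 ltr01.
pose M := n1 (f (pt x0 y0)) + 1.
have M0 : 0 < M by rewrite ltr_wpDl ?n1_ge0.
apply/ler_addgt0Pr => e e0; rewrite add0r.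
pose m := Num.min (Num.min (r / 4) (e / (32 * M)))
   (Num.min (Num.min ((x0 - a) / 2) ((b - x0) / 2)) (Num.min ((y0 - c) / 2) ((d - y0) / 2))).
have m0 : 0 < m by rewrite !lt_min !divr_gt0 ?subr_gt0 ?mulr_gt0.
have : m <= m by []; rewrite {2}/m !le_min => /andP[/andP[m1 m2] /andP[/andP[m3 m4] /andP[m5 m6]]].
rewrite (box_splitx _ a b c d (x0 - m)) (box_splitx _ (x0 - m) b c d (x0 + m)).
rewrite (box_splity _ (x0 - m) (x0 + m) c d (y0 - m)).
rewrite (box_splity _ (x0 - m) (x0 + m) (y0 - m) d (y0 + m)).
rewrite (G a (x0 - m)) ?(G (x0 + m) b) ?(G (x0 - m) (x0 + m) c (y0 - m)) ?(G (x0 - m) (x0 + m) (y0 + m) d);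
  try lra; try (move=> x y /andP[? ?] /andP[? ?]; apply/negP => /eqP[? ?]; lra).
rewrite !add0r !addr0.
apply: le_trans (@box_bound f _ _ _ _ M _ _ fc _) _; [lra|lra| |].
  move=> x y /andP[? ?] /andP[? ?].
  have -> : f (pt x y) = (f (pt x0 y0 + (pt x y - pt x0 y0)) - f (pt x0 y0)) + f (pt x0 y0).
    by rewrite (addrC (pt x0 y0)) !subrK.
  apply: (le_trans (n1D _ _)); rewrite /M addrC lerD2l; apply: Hr.
  rewrite /n1 /=; have X1 : `|x - x0| <= m by rewrite ler_norml; apply/andP; split; lra.
  have X2 : `|y - y0| <= m by rewrite ler_norml; apply/andP; split; lra.
  lra.
have -> : 4 * M * (x0 + m - (x0 - m) + (y0 + m - (y0 - m))) = m * (16 * M) by ring.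
rewrite -ler_pdivlMr ?mulr_gt0 //; apply: (le_trans m2).
by rewrite ler_pM2l // lef_pV2 ?posrE ?mulr_gt0 // ler_pM2r //; lra.
Qed.

Lemma lcont_bounded (g : R -> C) (a b : R) : a <= b -> lcont g ->
  exists2 M, 0 <= M & forall x : R, a <= x <= b -> n1 (g x) <= M.
Proof.
move=> ab [g1 g2].
have [c1 _ H1] := @EVT_max R (Num.norm \o (re \o g)) a b ab ltac:(apply: continuous_subspaceT => x; apply: continuous_comp; [exact: g1|exact: norm_continuous]).
have [c2 _ H2] := @EVT_max R (Num.norm \o (im \o g)) a b ab ltac:(apply: continuous_subspaceT => x; apply: continuous_comp; [exact: g2|exact: norm_continuous]).
exists (`|re (g c1)| + `|im (g c2)|); first by rewrite addr_ge0.
by move=> x xab; apply: lerD; [apply: H1|apply: H2]; rewrite in_itv.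
Qed.

(** The difference quotient of f at z0, made continuous by the value D when D is the derivative; the
    vanishing of its box integral is Cauchy's formula. *)
Definition kern f z0 (D : C) z : C := if z == z0 then D else (f z - f z0) / (z - z0).

Lemma kern_cderiv f z0 D z : holo f -> z != z0 -> exists D', cderiv (kern f z0 D) z D'.
Proof.
move=> /(_ z)[E fE] zz0; have zz : z - z0 != 0 by rewrite subr_eq0.
have H1 := cderivD fE (cderiv_cst (- f z0) z).
have H2 := cderivD (cderiv_id z) (cderiv_cst (- z0) z).
have H3 := cderivM H1 (cderiv_comp H2 (cderiv_inv zz)).
eexists => e e0; have [d d0 H] := H3 e e0.
exists (Num.min d (n1 (z - z0))); first by rewrite lt_min d0 n1_gt0.
move=> h; rewrite lt_min => /andP[/H {}H hz].
rewrite /kern (negbTE zz0) ifF; last first.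
  apply/negbTE; apply: contraL hz => /eqP zh; rewrite -leNgt.
  have -> : z - z0 = - h by rewrite -zh; ring.
  by rewrite n1N.
exact: H.
Qed.

Lemma kern_ccont f z0 D z : holo f -> cderiv f z0 D -> ccont (kern f z0 D) z.
Proof.
move=> fh fD; have [->|zz0] := eqVneq z z0; last first.
  by have [D' /cderiv_cont] := kern_cderiv D fh zz0.
move=> e e0; have e2 : 0 < e / 2 by rewrite divr_gt0.
have [d d0 H] := fD _ e2; exists d => // h /H {}H.
rewrite /kern eqtype.eqxx; case: ifPn => [_|h0]; first by rewrite subrr n10 ltW.
have {}h0 : h != 0 by apply: contra h0 => /eqP ->; rewrite addr0.
rewrite (addrC z0 h) addrK (addrC h).
have -> : (f (z0 + h) - f z0) / h - D = h^-1 * (f (z0 + h) - f z0 - D * h) by field.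
set w := f _ - _ - _ in H *.
have Hw : toC (n1 w) <= toC (e / 2 * n1 h) by rewrite /toC lecR.
have h0' := n1_gt0 h0.
have N : n1 h ^+ 2 <= 2 * (re h ^+ 2 + im h ^+ 2).
  have := sqr_ge0 (`|re h| - `|im h|); rewrite /n1 -[re h ^+ 2]real_normK ?num_real //.
  rewrite -[im h ^+ 2]real_normK ?num_real //; lra.
have P : 0 < re h ^+ 2 + im h ^+ 2.
  have Q : 0 < n1 h ^+ 2 by rewrite exprn_gt0.
  lra.
have I : n1 h^-1 <= 2 / n1 h.
  have -> : n1 h^-1 = n1 h / (re h ^+ 2 + im h ^+ 2).
    case: (h) P => u v /= P; rewrite /n1 /= normrN !normrM normfV (gtr0_norm P); ring.
  by rewrite ler_pdivrMr // mulrAC ler_pdivlMr // -expr2.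
apply: (le_trans (n1M _ _)); apply: (@le_trans _ _ (2 / n1 h * (e / 2 * n1 h))).
  by apply: ler_pM; rewrite ?n1_ge0.
by apply: eq_ler; field; rewrite gt_eqF.
Qed.

Lemma toCD (x y : R) : toC (x + y) = toC x + toC y. Proof. exact: rmorphD. Qed.
Lemma toCM (x y : R) : toC (x * y) = toC x * toC y. Proof. exact: rmorphM. Qed.

Lemma holo_ccont f : holo f -> forall z, ccont f z.
Proof. by move=> fh z; have [D /cderiv_cont] := fh z. Qed.

Lemma holoM f g : holo f -> holo g -> holo (fun z => f z * g z).
Proof. by move=> fh gh z; have [D fD] := fh z; have [E gE] := gh z; eexists; exact: cderivM fD gE. Qed.

Lemma holoD f g : holo f -> holo g -> holo (fun z => f z + g z).
Proof. by move=> fh gh z; have [D fD] := fh z; have [E gE] := gh z; eexists; exact: cderivD fD gE. Qed.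

Lemma holo_cst (c : C) : holo (fun=> c).
Proof. by move=> z; eexists; exact: cderiv_cst. Qed.

Lemma holo_comp f g : holo f -> holo g -> holo (g \o f).
Proof. by move=> fh gh z; have [D fD] := fh z; have [E gE] := gh (f z); eexists; exact: cderiv_comp fD gE. Qed.

Lemma holo_id : holo id.
Proof. by move=> z; eexists; exact: cderiv_id. Qed.

Lemma holo_cexp : holo (cexp).
Proof. by move=> z; eexists; exact: cderiv_cexp. Qed.

Let z0 : C := pt 0 (-1).
Let invz (z : C) := (z - z0)^-1.

Let invz_ccont x y : (x != 0) || (y != -1) -> ccont invz (pt x y).
Proof.
move=> xy.
have N : pt x y - z0 != 0.
  rewrite subr_eq0; apply: contraL xy => /eqP[-> ->]; by rewrite !eqtype.eqxx.
have H2 := cderivD (cderiv_id (pt x y)) (cderiv_cst (- z0) (pt x y)).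
exact: cderiv_cont (cderiv_comp H2 (cderiv_inv N)).
Qed.

Let invz_im x y : im (invz (pt x y)) = - (y + 1) / (x ^+ 2 + (y + 1) ^+ 2).
Proof. by rewrite /invz /z0 /= subr0 opprK mulNr. Qed.

Let invz_re x y : re (invz (pt x y)) = x / (x ^+ 2 + (y + 1) ^+ 2).
Proof. by rewrite /invz /z0 /= subr0 opprK. Qed.

(** This integral is 2 pi i; its imaginary part is seen to be positive side by side, each integrand
    having a constant sign. *)
Let box_invz : im (box invz (-4) 4 (-2) 0) != 0.
Proof.
have L1 : lcont (fun x => invz (pt x (-2))).
  by apply: lcont_hor => x; apply: invz_ccont; apply/orP; right; apply/eqP; lra.
have L2 : lcont (fun x => invz (pt x 0)).
  by apply: lcont_hor => x; apply: invz_ccont; apply/orP; right; apply/eqP; lra.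
have L3 : lcont (fun y => invz (pt 4 y)).
  by apply: lcont_ver => x; apply: invz_ccont; apply/orP; left; apply/eqP; lra.
have L4 : lcont (fun y => invz (pt (-4) y)).
  by apply: lcont_ver => x; apply: invz_ccont; apply/orP; left; apply/eqP; lra.
rewrite gt_eqF // /box /cint /=.
have N (u v : R) : v != 0 -> 0 < u ^+ 2 + v ^+ 2.
  move=> v0; rewrite ltr_wpDl ?sqr_ge0 // lt_neqAle sqr_ge0 andbT eq_sym.
  by rewrite expf_neq0.
have N' (u v : R) : u != 0 -> 0 < u ^+ 2 + v ^+ 2 by move=> /(N v); rewrite addrC.
have X1 : 0 < rint (im \o (fun x => invz (pt x (-2)))) (-4) 4.
  apply: rint_gt0; [lra|exact: L1.2|move=> x _]; rewrite [(_ \o _) x](invz_im x (-2)); apply: divr_gt0; [lra|apply: N; apply/eqP; lra].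
have X2 : 0 < rint (fun x => 0 * (im \o (fun x => invz (pt x 0))) x + (-1) * (im \o (fun x => invz (pt x 0))) x) (-4) 4.
  apply: rint_gt0; [lra| |move=> x _].
    have -> : (fun x => 0 * (im \o (fun x => invz (pt x 0))) x + (-1) * (im \o (fun x => invz (pt x 0))) x)
      = (fun x => - ((im \o (fun x => invz (pt x 0))) x)) by apply/funext => x; ring.
    by move=> x; apply: continuousN; exact: L2.2.
  rewrite [(_ \o _) x](invz_im x 0) mul0r add0r mulN1r -mulNr opprK; apply: divr_gt0; [lra|apply: N; apply/eqP; lra].
have X3 : 0 < rint (re \o (fun y => invz (pt 4 y))) (-2) 0.
  apply: rint_gt0; [lra|exact: L3.1|move=> x _]; rewrite [(_ \o _) x](invz_re 4 x); apply: divr_gt0; [lra|apply: N'; apply/eqP; lra].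
have X4 : 0 < rint (fun x => 0 * (re \o (fun y => invz (pt (-4) y))) x + (-1) * (re \o (fun y => invz (pt (-4) y))) x) (-2) 0.
  apply: rint_gt0; [lra| |move=> x _].
    have -> : (fun x => 0 * (re \o (fun y => invz (pt (-4) y))) x + (-1) * (re \o (fun y => invz (pt (-4) y))) x)
      = (fun x => - ((re \o (fun y => invz (pt (-4) y))) x)) by apply/funext => x; ring.
    by move=> x; apply: continuousN; exact: L4.1.
  rewrite [(_ \o _) x](invz_re (-4) x) mul0r add0r mulN1r -mulNr; apply: divr_gt0; [lra|apply: N'; apply/eqP; lra].
rewrite rint_lin in X2; [|exact: L2.2..].
rewrite rint_lin in X4; [|exact: L4.1..].
lra.
Qed.

(** The logarithm of the weight. Its real part is -7/8 at -i, and at most -3/2 on the bottom and the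
    vertical sides of [-4, 4] x [-2, 0]. The term -iz decreases downwards, and the quadratic term is
    what keeps the vertical sides small near the real line. *)
Let phase z : C := - 'i%C * z + - toC 8^-1 * (z * z).

Let re_phase x y : re (phase (pt x y)) = y - 8^-1 * (x ^+ 2 - y ^+ 2).
Proof. by rewrite /phase /toC /= !expr2; ring. Qed.

Let holo_weight (M : R) : holo (fun z => cexp (toC M * phase z)).
Proof.
have H : holo (fun z => toC M * (- 'i%C * z + - toC 8^-1 * (z * z))).
  apply: holoM; first exact: holo_cst.
  apply: holoD; first by apply: holoM; [exact: holo_cst|exact: holo_id].
  by apply: holoM; [exact: holo_cst|apply: holoM; exact: holo_id].
exact: holo_comp H holo_cexp.
Qed.

(* Cauchy's formula at [- i], on a rectangle with one side on the real line, for
   [f z * cexp (M * phase z)]: on the three sides where [f] need not vanish the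
   weight is exponentially smaller in [M] than at [- i]. *)
Lemma holo_uniq f : holo f -> (forall x : R, f (toC x) = 0) -> f (pt 0 (-1)) = 0.
Proof.
move=> fh f0.
have L (g : C -> C) : holo g ->
   [/\ lcont (fun x => g (pt x (-2)) * invz (pt x (-2))),
       lcont (fun x => g (pt x 0) * invz (pt x 0)),
       lcont (fun y => g (pt 4 y) * invz (pt 4 y)) &
       lcont (fun y => g (pt (-4) y) * invz (pt (-4) y))].
  move=> /holo_ccont gc.
  have M z : ccont g z -> ccont invz z -> ccont (fun z => g z * invz z) z.
    move=> g1 i1 e e0.
    pose B := n1 (g z) + n1 (invz z) + 1.
    have G0 := n1_ge0 (g z); have I0 := n1_ge0 (invz z).
    have B0 : 0 < B by rewrite /B; lra.
    have e1 : 0 < Num.min 1 (e / (3 * B)) by rewrite lt_min ltr01 divr_gt0 // mulr_gt0.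
    have [d d0 Hd] := g1 _ e1; have [d' d'0 Hd'] := i1 _ e1.
    exists (Num.min d d'); first by rewrite lt_min d0.
    move=> h; rewrite lt_min => /andP[/Hd {}Hd /Hd' {}Hd'].
    move: Hd Hd'; rewrite !le_min => /andP[A1 A2] /andP[A3 A4].
    have -> : g (z + h) * invz (z + h) - g z * invz z = (g (z + h) - g z) * invz z +
       g z * (invz (z + h) - invz z) + (g (z + h) - g z) * (invz (z + h) - invz z) by ring.
    have e3 : e / (3 * B) * B = e / 3 by field; rewrite gt_eqF.
    have Y1 : n1 ((g (z + h) - g z) * invz z) <= e / 3.
      by rewrite -e3; apply: le_trans (n1M _ _) _; apply: ler_pM; rewrite ?n1_ge0 // /B; lra.
    have Y2 : n1 (g z * (invz (z + h) - invz z)) <= e / 3.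
      by rewrite -e3 mulrC; apply: le_trans (n1M _ _) _; apply: ler_pM; rewrite ?n1_ge0 // /B; lra.
    have Y3 : n1 ((g (z + h) - g z) * (invz (z + h) - invz z)) <= e / 3.
      by rewrite -e3; apply: le_trans (n1M _ _) _; apply: ler_pM; rewrite ?n1_ge0 // /B; lra.
    apply: (le_trans (n1D _ _)).
    have := n1D ((g (z + h) - g z) * invz z) (g z * (invz (z + h) - invz z)); lra.
  split.
  - by apply: (@lcont_hor (fun z => g z * invz z)) => x; apply: M => //; apply: invz_ccont; apply/orP; right; apply/eqP; lra.
  - by apply: (@lcont_hor (fun z => g z * invz z)) => x; apply: M => //; apply: invz_ccont; apply/orP; right; apply/eqP; lra.
  - by apply: (@lcont_ver (fun z => g z * invz z)) => x; apply: M => //; apply: invz_ccont; apply/orP; left; apply/eqP; lra.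
  - by apply: (@lcont_ver (fun z => g z * invz z)) => x; apply: M => //; apply: invz_ccont; apply/orP; left; apply/eqP; lra.
(* On the boundary, which avoids -i, [kern] equals g invz - g(-i) invz, and its integral vanishes by
   [goursat_pt]. *)
have cauchy (g : C -> C) : holo g -> box (fun z => g z * invz z) (-4) 4 (-2) 0 = g z0 * box invz (-4) 4 (-2) 0.
  move=> gh; have [D gD] := gh z0.
  have K0 : box (kern g z0 D) (-4) 4 (-2) 0 = 0.
    apply: (@goursat_pt _ _ _ _ _ 0 (-1)); [lra|lra| |].
    - by move=> z; apply: kern_ccont.
    - by move=> z; apply: kern_cderiv.
  have [L1 L2 L3 L4] := L _ (holo_cst 1); have [M1 M2 M3 M4] := L _ gh.
  have E z : z != z0 -> kern g z0 D z = 1 * (g z * invz z) + (- g z0) * (1 * invz z).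
    by move=> zz; rewrite /kern (negbTE zz) /invz; ring.
  have E1 x y : (x != 0) || (y != -1) -> kern g z0 D (pt x y) = 1 * (g (pt x y) * invz (pt x y)) + (- g z0) * (1 * invz (pt x y)).
    by move=> xy; apply: E; apply: contraL xy => /eqP[-> ->]; rewrite !eqtype.eqxx.
  move: K0; rewrite /box.
  rewrite (@cint_eq (fun x => kern g z0 D (pt x (-2))) (fun x => 1 * (g (pt x (-2)) * invz (pt x (-2))) + (- g z0) * (1 * invz (pt x (-2))))); last first.
    by move=> x; apply: E1; apply/orP; right; apply/eqP; lra.
  rewrite (@cint_eq (fun x => kern g z0 D (pt x 0)) (fun x => 1 * (g (pt x 0) * invz (pt x 0)) + (- g z0) * (1 * invz (pt x 0)))); last first.
    by move=> x; apply: E1; apply/orP; right; apply/eqP; lra.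
  rewrite (@cint_eq (fun y => kern g z0 D (pt 4 y)) (fun y => 1 * (g (pt 4 y) * invz (pt 4 y)) + (- g z0) * (1 * invz (pt 4 y)))); last first.
    by move=> x; apply: E1; apply/orP; left; apply/eqP; lra.
  rewrite (@cint_eq (fun y => kern g z0 D (pt (-4) y)) (fun y => 1 * (g (pt (-4) y) * invz (pt (-4) y)) + (- g z0) * (1 * invz (pt (-4) y)))); last first.
    by move=> x; apply: E1; apply/orP; left; apply/eqP; lra.
  rewrite !cint_lin //.
  have S (k : R -> C) a b : cint (fun x => 1 * k x) a b = cint k a b by apply: cint_eq => x; rewrite mul1r.
  rewrite !S => H; apply/eqP; rewrite -subr_eq0; apply/eqP; rewrite -[RHS]H; ring.
have [L1 L2 L3 L4] := L _ fh.
have [B1 B10 H1] := @lcont_bounded _ (-4) 4 ltac:(lra) L1.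
have [B3 B30 H3] := @lcont_bounded _ (-2) 0 ltac:(lra) L3.
have [B4 B40 H4] := @lcont_bounded _ (-2) 0 ltac:(lra) L4.
pose k := n1 (box invz (-4) 4 (-2) 0)^-1.
have k0 : 0 <= k by exact: n1_ge0.
have bi : box invz (-4) 4 (-2) 0 != 0.
  by apply: contra box_invz => /eqP ->.
(* The exponent 5/8 is the gap 3/2 - 7/8 between the three sides and -i. *)
have est (M : R) : 0 < M -> n1 (f z0) <= 64 * (B1 + B3 + B4) * k * expR (- (5 / 8 * M)).
  move=> M0; pose g z := f z * cexp (toC M * phase z).
  have gh : holo g := holoM fh (holo_weight M).
  have [M1 M2 M3 M4] := L _ gh.
  pose b := 2 * expR (- (3 / 2 * M)).
  have w3 x y : y - 8^-1 * (x ^+ 2 - y ^+ 2) <= - (3 / 2) -> n1 (cexp (toC M * phase (pt x y))) <= b.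
    move=> xy; apply: (le_trans (n1_cexp _)); rewrite /b ler_pM2l // ler_expR.
    have -> : re (toC M * phase (pt x y)) = M * re (phase (pt x y)) by case: (phase _) => u v /=; rewrite mul0r subr0.
    rewrite re_phase; have : M * (y - 8^-1 * (x ^+ 2 - y ^+ 2)) <= M * (- (3 / 2)) by rewrite ler_pM2l.
    lra.
  have b0 : 0 <= b by rewrite mulr_ge0 // expR_ge0.
  have F (p : C) B : n1 (f p * invz p) <= B -> n1 (cexp (toC M * phase p)) <= b -> n1 (g p * invz p) <= B * b.
    move=> P1 P2; have -> : g p * invz p = (f p * invz p) * cexp (toC M * phase p) by rewrite /g; ring.
    by apply: (le_trans (n1M _ _)); apply: ler_pM; rewrite ?n1_ge0.
  have I1 : n1 (cint (fun x => g (pt x (-2)) * invz (pt x (-2))) (-4) 4) <= 2 * (B1 * b) * 8.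
    have -> : (8 : R) = 4 - (-4) by ring.
    apply: cint_bound; [lra|by []|].
    move=> x xx; apply: F; first exact: H1.
    by apply: w3; have := sqr_ge0 x; lra.
  have I3 : n1 (cint (fun y => g (pt 4 y) * invz (pt 4 y)) (-2) 0) <= 2 * (B3 * b) * 2.
    have -> : 2 * (B3 * b) * 2 = 2 * (B3 * b) * (0 - (-2)) by ring.
    apply: cint_bound; [lra|by []|].
    move=> y /[dup] yy /andP[y1 y2]; apply: F; first exact: H3.
    have Q : 0 <= (y + 2) * - y by apply: mulr_ge0; lra.
    by apply: w3; lra.
  have I4 : n1 (cint (fun y => g (pt (-4) y) * invz (pt (-4) y)) (-2) 0) <= 2 * (B4 * b) * 2.
    have -> : 2 * (B4 * b) * 2 = 2 * (B4 * b) * (0 - (-2)) by ring.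
    apply: cint_bound; [lra|by []|].
    move=> y /[dup] yy /andP[y1 y2]; apply: F; first exact: H4.
    have Q : 0 <= (y + 2) * - y by apply: mulr_ge0; lra.
    by apply: w3; lra.
  have I2 : cint (fun x => g (pt x 0) * invz (pt x 0)) (-4) 4 = 0.
    have Z : is_derive (0 : R) 1 (fun _ : R => 0 : R) 0 by exact: is_derive_cst.
    rewrite (@cint_eq _ (fun x => 0 * (g (pt x 0) * invz (pt x 0)) + 0 * (g (pt x 0) * invz (pt x 0)))).
      by rewrite cint_lin // !mul0r addr0.
    by move=> x; rewrite /g (f0 x) !mul0r addr0.
  have BG : n1 (box (fun z => g z * invz z) (-4) 4 (-2) 0) <= 16 * (B1 + B3 + B4) * b.
    rewrite /box I2 subr0.
    apply: (le_trans (n1D _ _)); rewrite n1N n1_i.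
    set J1 := cint _ _ _ in I1 *; set J3 := cint _ _ _ in I3 *.
    have := n1D J1 ('i%C * J3); rewrite n1_i => Q.
    have Q3 : 0 <= B3 * b by rewrite mulr_ge0.
    have Q4 : 0 <= B4 * b by rewrite mulr_ge0.
    lra.
  rewrite cauchy // in BG.
  have GE : g z0 = (g z0 * box invz (-4) 4 (-2) 0) * (box invz (-4) 4 (-2) 0)^-1 by rewrite mulfK.
  have NG : n1 (g z0) <= 16 * (B1 + B3 + B4) * b * k.
    by rewrite GE; apply: (le_trans (n1M _ _)); rewrite ler_wpM2r.
  have fE : f z0 = g z0 * cexp (- (toC M * phase z0)).
    by rewrite /g -mulrA -cexpD subrr cexp0 mulr1.
  have NW : n1 (cexp (- (toC M * phase z0))) <= 2 * expR (7 / 8 * M).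
    apply: (le_trans (n1_cexp _)); rewrite ler_pM2l // ler_expR.
    have -> : re (- (toC M * phase z0)) = - (M * re (phase z0)) by case: (phase _) => u v /=; rewrite mul0r subr0.
    by rewrite re_phase; apply: eq_ler; field.
  rewrite fE; apply: (le_trans (n1M _ _)).
  apply: (@le_trans _ _ (16 * (B1 + B3 + B4) * b * k * (2 * expR (7 / 8 * M)))).
    by apply: ler_pM; rewrite ?n1_ge0.
  have -> : expR (- (5 / 8 * M)) = expR (- (3 / 2 * M)) * expR (7 / 8 * M).
    by rewrite -expRD; congr expR; field.
  by rewrite /b; apply: eq_ler; ring.
apply/n1_eq0/eqP; rewrite eq_le n1_ge0 andbT -/z0.
set A := 64 * (B1 + B3 + B4) * k in est.
have A0 : 0 <= A by rewrite /A !mulr_ge0 // !addr_ge0.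
apply/ler_addgt0Pr => e e0; rewrite add0r.
(* Chosen so that the exponent is A / e + 1, whose exponential exceeds A / e by exp(u) >= 1 + u. *)
pose M := 8 / 5 * (A / e + 1).
have Ae : 0 <= A / e by rewrite divr_ge0 // ltW.
have M0 : 0 < M by rewrite /M; lra.
apply: (le_trans (est M M0)).
have -> : 5 / 8 * M = A / e + 1 by rewrite /M; field; rewrite gt_eqF.
rewrite expRN ler_pdivrMr ?expR_gt0 // mulrC -ler_pdivrMr //.
apply: le_trans (expR_ge1Dx _); lra.
Qed.

(** Periodicity spreads from the real line to the plane, so the vertical sides of the rectangle of
    width T cancel in Goursat's theorem. *)
Lemma holo_periodic f (T : R) : 0 < T -> holo f -> (forall x : R, f (toC (x + T)) = f (toC x)) ->
  cint (fun x => f (pt x 0)) 0 T = cint (fun x => f (pt x (-1))) 0 T.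
Proof.
move=> T0 fh fT.
have P z : f (z + toC T) = f z.
  (* The map u |-> - u Im z + Re z preserves the real line and sends -i to z, so [holo_uniq] reaches
     every z. *)
  have A : holo (fun u => u * (- im z)%:C%C + toC (re z)).
    exact: holoD (holoM holo_id (@holo_cst _)) (@holo_cst _).
  have H : holo (fun u => f (u * (- im z)%:C%C + toC (re z) + toC T) + (-1) * f (u * (- im z)%:C%C + toC (re z))).
    exact: holoD (holo_comp (holoD A (@holo_cst (toC T))) fh) (holoM (@holo_cst (-1)) (holo_comp A fh)).
  have := holo_uniq H; have E : pt 0 (-1) * (- im z)%:C%C + toC (re z) = z.
    by case: (z) => u v; rewrite /toC /=; apply/eqP; rewrite eq_complex /=; apply/andP; split; apply/eqP; ring.
  rewrite E => /(_ _) H'; apply/eqP; rewrite -subr_eq0 -mulN1r; apply/eqP; apply: H' => x.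
  rewrite -[(- im z)%:C%C]/(toC (- im z)) -toCM -!toCD.
  by rewrite fT mulN1r subrr.
have := @goursat f 0 T (-1) 1 T0 ltr01 (holo_ccont fh) (fun x y _ _ => fh _).
rewrite add0r addNr /box.
have -> : cint (fun y => f (pt T y)) (-1) 0 = cint (fun y => f (pt 0 y)) (-1) 0.
  apply: cint_eq => y; rewrite -(P (pt 0 y)); congr f.
  by apply/eqP; rewrite eq_complex /= add0r addr0 !eqtype.eqxx.
move=> H; apply/eqP; rewrite eq_sym -subr_eq0; apply/eqP; rewrite -[RHS]H; ring.
Qed.

End ComplexCalculus.

(** * Functionals on a Hopf *-algebra and its representations *)

Local Notation dconv := Defs.conv.
Section Functionals.
Variables (K : fieldType) (V : lmodType K).

Definition lin_closed (W : set V) := forall (c : K) x y, W x -> W y -> W (c *: x + y).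

Lemma scalar0 (f : V -> K) : scalar f -> f 0 = 0.
Proof. by move=> fl; have := fl (-1) 0 0; rewrite scaler0 addr0 mulN1r addNr. Qed.
Lemma scalarD (f : V -> K) x y : scalar f -> f (x + y) = f x + f y.
Proof. by move=> fl; have := fl 1 x y; rewrite scale1r mul1r. Qed.
Lemma scalarZ (f : V -> K) c x : scalar f -> f (c *: x) = c * f x.
Proof. by move=> fl; have := fl c x 0; rewrite (scalar0 fl) !addr0. Qed.
Lemma scalarN (f : V -> K) x : scalar f -> f (- x) = - f x.
Proof. by move=> fl; rewrite -scaleN1r scalarZ // mulN1r. Qed.
Lemma scalarB (f : V -> K) x y : scalar f -> f (x - y) = f x - f y.
Proof. by move=> fl; rewrite scalarD // scalarN. Qed.
Lemma scalar_sum (f : V -> K) I (r : seq I) (P : pred I) (F : I -> V) : scalar f ->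
  f (\sum_(i <- r | P i) F i) = \sum_(i <- r | P i) f (F i).
Proof.
by move=> fl; apply: (big_morph f) => [x y|]; [exact: scalarD|exact: scalar0].
Qed.

(** Among the subspaces that contain W and avoid a, a maximal one A is a complement of the line of
    a: for x outside A, the span of A and x contains a. The functional is the coefficient of a. *)
Lemma separating_functional (W : set V) (a : V) : lin_closed W -> W 0 -> ~ W a ->
  exists f : V -> K, [/\ scalar f, f a = 1 & forall x, W x -> f x = 0].
Proof.
move=> WL W0 Wa.
pose P (M : set V) := [/\ lin_closed M, ~ M a & M = set0 \/ W `<=` M].
have [F FP Ftot|A [[AL Aa AW] Amax]] := @Zorn_bigcup V P.
  split.
  - move=> c x y [M FM Mx] [N FN Ny].
    have [MN|NM] := Ftot _ _ FM FN.
      by exists N => //; have [NL _ _] := FP _ FN; apply: NL => //; exact: MN.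
    by exists M => //; have [ML _ _] := FP _ FM; apply: ML => //; exact: NM.
  - by move=> [M FM Ma]; have [] := FP _ FM.
  - have [[M FM WM]|N] := pselect (exists2 M, F M & W `<=` M).
      by right; apply: (subset_trans WM); exact: bigcup_sup.
    left; apply/seteqP; split => // x [M FM Mx].
    have [_ _ [M0|WM]] := FP _ FM; first by rewrite -M0.
    by exfalso; apply: N; exists M.
have {}AW : W `<=` A.
  case: AW => // A0; exfalso; apply: (Amax W); last by split => //; right.
  by rewrite A0; split => // WA; exact: (WA 0 W0).
have A0 : A 0 by exact: AW.
have AZ c x : A x -> A (c *: x) by move=> Ax; have := AL c x 0 Ax A0; rewrite addr0.
have AD x y : A x -> A y -> A (x + y) by move=> Ax; have := AL 1 x y Ax; rewrite scale1r.
have AN x : A x -> A (- x) by move=> Ax; rewrite -scaleN1r; exact: AZ.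
have ex x : exists c : K, A (x - c *: a).
  have [Ax|nAx] := pselect (A x); first by exists 0; rewrite scale0r subr0.
  pose B := [set y | exists2 m, A m & exists c : K, y = c *: x + m].
  have BA : A `<=` B by move=> m Am; exists m => //; exists 0; rewrite scale0r add0r.
  have Bx : B x by exists 0 => //; exists 1; rewrite scale1r addr0.
  have : ~ P B.
    by apply: Amax; split => // BsA; apply: nAx; exact: BsA.
  have [[m Am [c E]] _|nBa nP] := pselect (B a); last first.
    exfalso; apply: nP; split => //; last by right; exact: subset_trans BA.
    move=> c y z [m Am [d ->]] [m' Am' [d' ->]]; exists (c *: m + m'); first exact: AL.
    exists (c * d + d'); rewrite scalerDr scalerA scalerDl -!addrA; congr (_ + _).
    by rewrite addrCA.
  have c0 : c != 0.
    by apply/eqP => c0; apply: Aa; rewrite E c0 scale0r add0r.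
  exists c^-1; rewrite E scalerDr scalerA mulVf // scale1r opprD addNKr.
  by apply: AN; exact: AZ.
have uq x c d : A (x - c *: a) -> A (x - d *: a) -> c = d.
  move=> Ac Ad; apply/eqP; rewrite -subr_eq0; apply/eqP; apply: contrapT => /eqP cd.
  apply: Aa; have := AZ (c - d)^-1 _ (AD _ _ Ad (AN _ Ac)).
  have -> : x - d *: a - (x - c *: a) = (c - d) *: a.
    by rewrite opprB addrC addrA subrK scalerBl.
  by rewrite scalerA mulVf // scale1r.
have [f fP] := choice ex.
exists f; split.
- move=> c x y; apply: (uq (c *: x + y)); first exact: fP.
  have -> : c *: x + y - (c * f x + f y) *: a = c *: (x - f x *: a) + (y - f y *: a).
    by rewrite scalerBr scalerA scalerDl opprD addrACA.
  by apply: AL.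
- by apply: (uq a) => //; rewrite scale1r subrr.
- by move=> x Wx; apply: (uq x) => //; rewrite scale0r subr0; exact: AW.
Qed.

Lemma functional_neq0 (a : V) : a != 0 -> exists2 f : V -> K, scalar f & f a = 1.
Proof.
move=> a0; have [|||f [fl fa _]] := @separating_functional [set 0] a; last by exists f.
- by move=> c x y -> ->; rewrite scaler0 addr0.
- by [].
- exact/eqP.
Qed.

Lemma functional_eq (a b : V) : (forall f : V -> K, scalar f -> f a = f b) -> a = b.
Proof.
move=> H; apply/eqP; rewrite -subr_eq0; apply: contrapT => /negP /functional_neq0[f fl].
by rewrite scalarB // H // subrr => /esym/eqP; rewrite oner_eq0.
Qed.

(** Coordinates on the span of a finite list, by functionals on all of V; with them a bilinear form
    becomes a finite sum of products of functionals. *)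
Lemma dual_system (s : seq V) : exists (n : nat) (e : nat -> V) (phi : nat -> V -> K),
  (forall i, scalar (phi i)) /\
  forall x, x \in s -> x = \sum_(i < n) phi i x *: e i.
Proof.
elim: s => [|x s [n [e [phi [phil H]]]]].
  by exists 0%N, (fun=> 0), (fun _ _ => 0); split => // i c x y; rewrite mulr0 addr0.
pose W := [set y | y = \sum_(i < n) phi i y *: e i].
have WL : lin_closed W.
  move=> c y z Wy Wz; rewrite /W /= {1}Wy {1}Wz scaler_sumr -big_split /=.
  by apply: eq_bigr => i _; rewrite phil scalerDl scalerA.
have W0 : W 0.
  by rewrite /W /= big1 // => i _; rewrite scalar0 // scale0r.
have [Wx|nWx] := pselect (W x).
  exists n, e, phi; split => // y; rewrite in_cons => /orP[/eqP -> //|]; exact: H.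
have [psi [psil psix psiW]] := separating_functional WL W0 nWx.
exists n.+1, (fun i => if i == n then x - \sum_(i < n) phi i x *: e i else e i),
  (fun i => if i == n then psi else phi i); split; first by move=> i; case: ifP.
have E y : \sum_(i < n) (if i == n :> nat then psi else phi i) y *:
   (if i == n :> nat then x - \sum_(i < n) phi i x *: e i else e i) = \sum_(i < n) phi i y *: e i.
  by apply: eq_bigr => i _; rewrite ltn_eqF.
move=> y; rewrite big_ord_recr /= eqtype.eqxx E in_cons => /orP[/eqP ->|ys].
  by rewrite psix scale1r addrC subrK.
by rewrite psiW ?scale0r ?addr0; exact: H.
Qed.

End Functionals.

Section TensorEquality.
Variables (K : fieldType) (A : algType K).
Implicit Types s t : seq (A * A).

(** [tens_eq] only tests products of two functionals; on the finite system of the first factors, b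
    is the sum of the products of phi_i and b(e_i, -). *)
Lemma tens_eq_bilin s t (b : A -> A -> K) :
  (forall y, scalar (b^~ y)) -> (forall x, scalar (b x)) -> tens_eq s t ->
  \sum_(p <- s) b p.1 p.2 = \sum_(p <- t) b p.1 p.2.
Proof.
move=> b1 b2 st.
have [n [e [phi [phil H]]]] := dual_system [seq p.1 | p <- s ++ t].
have E r : {subset r <= s ++ t} -> \sum_(p <- r) b p.1 p.2 = \sum_(i < n) tens_eval (phi i) (b (e i)) r.
  move=> rs; rewrite /tens_eval exchange_big /= big_seq [RHS]big_seq; apply: eq_bigr => p pr.
  rewrite [in LHS](H p.1); last by apply: map_f; exact: rs.
  rewrite (scalar_sum _ _ _ (b1 p.2)); apply: eq_bigr => i _.
  exact: (scalarZ _ _ (b1 p.2)).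
rewrite !E; last 2 first.
- by move=> p pt; rewrite mem_cat pt orbT.
- by move=> p ps; rewrite mem_cat ps.
by apply: eq_bigr => i _; apply: st.
Qed.

Lemma tens_eq_bilinV s t (b : A -> A -> A) :
  (forall y, linear (b^~ y)) -> (forall x, linear (b x)) -> tens_eq s t ->
  \sum_(p <- s) b p.1 p.2 = \sum_(p <- t) b p.1 p.2.
Proof.
move=> b1 b2 st; apply: functional_eq => f fl; rewrite !scalar_sum //.
apply: (tens_eq_bilin (b := fun x y => f (b x y))) => //.
- by move=> y c u v; rewrite b1 fl.
- by move=> x c u v; rewrite b2 fl.
Qed.

Lemma in_alg_inj : injective (fun c : K => c%:A : A).
Proof.
move=> c d /= /eqP; rewrite -subr_eq0 -scalerBl => /eqP E; apply/eqP; rewrite -subr_eq0.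
apply: contraTT isT => cd; have := congr1 (fun x => (c - d)^-1 *: x) E.
by rewrite scalerA mulVf // scale1r scaler0 => /eqP; rewrite oner_eq0.
Qed.

End TensorEquality.

Section HopfRepresentations.
Variables (R : realType) (A : hopf_star_alg R).
Implicit Types (f g : A -> Cx R) (n : nat).

Lemma scalar_conv (G : cqg R) (f g : G -> Cx R) : scalar f -> scalar g -> scalar (dconv f g).
Proof.
move=> fl gl c x y; rewrite /dconv (comulP c x y fl gl) /tens_eval big_cat big_map /=.
by rewrite mulr_sumr; congr (_ + _); apply: eq_bigr => p _; rewrite scalarZ // mulrA.
Qed.

Lemma scalar_dual_star (G : cqg R) (f : G -> Cx R) : scalar f -> scalar (dual_star f).
Proof.
move=> fl c x y; rewrite /dual_star antipode_linear hstarP fl rmorphD rmorphM /= conjCK; reflexivity.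
Qed.

(** The counit law reads eps(U) U = U, and U is invertible. *)
Lemma rep_counit n (U : 'M[A]_n) : is_rep U -> map_mx (@counit R A) U = 1%:M.
Proof.
move=> [[V [UV VU]] Ud].
have E : ampl A (map_mx (@counit R A) U) *m U = U.
  apply/matrixP => i j; rewrite !mxE -[RHS]counitl.
  rewrite (tens_eq_bilinV (b := fun x y => counit x *: y) _ _ (Ud i j)).
  - by rewrite big_map big_enum /=; apply: eq_bigr => k _; rewrite !mxE mulr_algl.
  - by move=> y c u v; rewrite counit_scalar scalerDl scalerA.
  - by move=> x c u v; rewrite scalerDr !scalerA mulrC.
have {}E : ampl A (map_mx (@counit R A) U) = 1%:M.
  by rewrite -[LHS]mulmx1 -UV mulmxA E.
apply/matrixP => i j; apply: (@in_alg_inj _ A).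
by move/matrixP: E => /(_ i j); rewrite !mxE => ->; case: eqP => _; rewrite ?scale1r ?scale0r.
Qed.

(** The antipode law reads S(U) U = eps(U) = 1, and the inverse of U is its adjoint. *)
Lemma rep_antipode n (U : 'M[A]_n) : is_unitary_rep U ->
  forall i j, antipode (U i j) = hstar (U j i).
Proof.
move=> [Ur U1 U2] i j.
have E : map_mx (@antipode R A) U *m U = 1%:M.
  apply/matrixP => a b; rewrite !mxE.
  transitivity ((counit (U a b))%:A : A).
    rewrite -antipodel.
    rewrite (tens_eq_bilinV (b := fun x y => antipode x * y) _ _ (Ur.2 a b)).
    - by rewrite big_map big_enum /=; apply: eq_bigr => k _; rewrite !mxE.
    - by move=> y c u v; rewrite antipode_linear mulrDl scalerAl.
    - by move=> x c u v; rewrite mulrDr scalerAr.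
  have /matrixP/(_ a b) := rep_counit Ur; rewrite !mxE => ->.
  by case: eqP => _; rewrite ?scale1r ?scale0r.
have : map_mx (@antipode R A) U = map_mx (@hstar R A) U^T.
  by rewrite -[LHS]mulmx1 -U2 mulmxA E mul1mx.
by move/matrixP => /(_ i j); rewrite !mxE.
Qed.

End HopfRepresentations.

Section DualEvaluation.
Variables (R : realType) (G : cqg R).
Implicit Types (f g : G -> Cx R) (n : nat).

Lemma map_conv n (U : 'M[G]_n) f g : is_rep U -> scalar f -> scalar g ->
  map_mx (dconv f g) U = map_mx f U *m map_mx g U.
Proof.
move=> [_ Ud] fl gl; apply/matrixP => i j; rewrite !mxE /dconv (Ud i j _ _ fl gl).
by rewrite /tens_eval big_map big_enum /=; apply: eq_bigr => k _; rewrite !mxE.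
Qed.

Lemma map_dual_star n (U : 'M[G]_n) f : is_unitary_rep U ->
  map_mx (dual_star f) U = adjmx (map_mx f U).
Proof.
move=> Uu; apply/matrixP => i j; rewrite !mxE /dual_star (rep_antipode Uu).
by rewrite hstarK.
Qed.

Lemma map_lin n m (U : 'M[G]_(m, n)) f g c :
  map_mx (fun a => c * f a + g a) U = c *: map_mx f U + map_mx g U.
Proof. by apply/matrixP => i j; rewrite !mxE. Qed.

Lemma map_ampl_mul n (U : 'M[G]_n) m (T : 'M[Cx R]_(m, n)) f : scalar f ->
  map_mx f (ampl G T *m U) = T *m map_mx f U.
Proof.
move=> fl; apply/matrixP => i j; rewrite !mxE scalar_sum //; apply: eq_bigr => k _.
by rewrite !mxE mulr_algl scalarZ.
Qed.

Lemma map_mul_ampl n (U : 'M[G]_n) m (T : 'M[Cx R]_(n, m)) f : scalar f ->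
  map_mx f (U *m ampl G T) = map_mx f U *m T.
Proof.
move=> fl; apply/matrixP => i j; rewrite !mxE scalar_sum //; apply: eq_bigr => k _.
by rewrite !mxE mulr_algr scalarZ // mulrC.
Qed.

(** Functionals separate points; this turns questions on intertwiners into questions on the
    commutant of the matrices U(f). *)
Lemma mor_map n m (U : 'M[G]_n) (V : 'M[G]_m) (T : 'M[Cx R]_(m, n)) :
  Mor U V T <-> forall f, scalar f -> T *m map_mx f U = map_mx f V *m T.
Proof.
split=> [TUV f fl|H]; first by rewrite -map_ampl_mul // TUV map_mul_ampl.
apply/matrixP => i j; apply: functional_eq => f fl.
have /matrixP/(_ i j) := H f fl; rewrite -map_ampl_mul // -map_mul_ampl //.
by rewrite [in X in X -> _]mxE [in X in _ = X -> _]mxE.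
Qed.

End DualEvaluation.

(** * The double commutant theorem for matrices *)

Section MatrixAlgebras.
Variables (R : realType) (n : nat).
Local Notation C := (Cx R).
Implicit Types (B : set 'M[C]_n) (X Y Z T : 'M[C]_n).

(** Take a row space of maximal rank inside S: a vector of S outside it would raise the rank. *)
Lemma subspace_row_matrix m (S : set 'rV[C]_m) :
  S 0 -> (forall (c : C) u v, S u -> S v -> S (c *: u + v)) ->
  exists M : 'M[C]_m, forall v, (v <= M)%MS <-> S v.
Proof.
move=> S0 SL.
pose P k := `[< exists M : 'M[C]_m, \rank M = k /\ forall v : 'rV_m, (v <= M)%MS -> S v >].
have exP : exists k, P k.
  exists 0%N; apply/asboolP; exists 0; split; first by rewrite mxrank0.
  by move=> v; rewrite submx0 => /eqP ->.
have ubP k : P k -> (k <= m)%N by move=> /asboolP[M [<- _]]; exact: rank_leq_col.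
case: (ex_maxnP exP ubP) => k /asboolP[M [Mk MS]] kmax.
exists M => v; split; first exact: MS.
move=> Sv; apply: contrapT => /negP nvM.
have : P (\rank (M + v)%MS).
  apply/asboolP; exists (M + v)%MS; split => // w /sub_addsmxP[[a b] /= ->].
  have -> : b *m v = b 0 0 *: v.
    by rewrite -mul_scalar_mx; congr (_ *m _); rewrite [LHS]mx11_scalar.
  rewrite addrC; apply: SL => //; apply: MS; exact: submxMl.
move=> /kmax; rewrite leqNgt -Mk => /negP; apply; apply: rank_ltmx.
by rewrite /ltmx addsmxSl /= addsmx_sub submx_refl.
Qed.

(** For this Hilbert-Schmidt form, left multiplications by Y and by [adjmx Y] are adjoint, which
    makes the projection in [double_commutant] a module map. *)
Lemma mxvec_dot (X Y : 'M[C]_n) :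
  (mxvec X *m map_mx Num.conj (mxvec Y)^T) 0 0 = \tr (X *m adjmx Y).
Proof.
rewrite mxE (reindex _ (curry_mxvec_bij n n)) /= /mxtrace.
rewrite (eq_bigr (fun p => (fun i j => X i j * Num.conj (Y i j)) p.1 p.2)); last first.
  by move=> [i j] _; rewrite /= !mxE !mxvecE.
rewrite -(pair_bigA _ (fun i j => X i j * Num.conj (Y i j))) /=.
by apply: eq_bigr => i _; rewrite mxE; apply: eq_bigr => j _; rewrite !mxE.
Qed.

Lemma adjmxM m p q (X : 'M[C]_(m, p)) (Y : 'M[C]_(p, q)) : adjmx (X *m Y) = adjmx Y *m adjmx X.
Proof. by rewrite /adjmx trmx_mul map_mxM. Qed.

Lemma adjmxK m p (X : 'M[C]_(m, p)) : adjmx (adjmx X) = X.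
Proof. by apply/matrixP => i j; rewrite !mxE conjCK. Qed.

Lemma adjmx1 m : adjmx (1%:M : 'M[C]_m) = 1%:M.
Proof.
by apply/matrixP => i j; rewrite !mxE eq_sym; case: eqP => _; rewrite ?rmorph1 ?rmorph0.
Qed.

(* The orthogonal projection P of the n x n matrices onto B is a left B-module
   map, so its blocks lie in the commutant of B and X commutes with P; hence
   X = X P(1) = P(X). *)
Lemma double_commutant B X :
  (forall (c : C) Y Z, B Y -> B Z -> B (c *: Y + Z)) -> B 1%:M ->
  (forall Y Z, B Y -> B Z -> B (Y *m Z)) -> (forall Y, B Y -> B (adjmx Y)) ->
  (forall T, (forall Y, B Y -> T *m Y = Y *m T) -> T *m X = X *m T) ->
  B X.
Proof.
move=> BL B1 BM Badj XB.
have B0 : B 0 by have := BL (-1) _ _ B1 B1; rewrite scaleN1r addNr.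
have [M MP] : exists M : 'M[C]_(n * n), forall v, (v <= M)%MS <-> B (vec_mx v).
  apply: subspace_row_matrix; first by rewrite /= linear0.
  by move=> c u v Bu Bv; rewrite /= linearP; exact: BL.
pose phi Z := vec_mx (mxvec Z *m proj_ortho M).
have phiL c Y Z : phi (c *: Y + Z) = c *: phi Y + phi Z.
  by rewrite /phi linearP /= mulmxDl -scalemxAl linearP.
have phiB Z : B (phi Z) by apply/MP; exact: proj_ortho_sub.
have phi_id Z : B Z -> phi Z = Z.
  by move=> BZ; rewrite /phi proj_ortho_id ?mxvecK //; apply/MP; rewrite mxvecK.
have orthP Z : (forall Y, B Y -> \tr (Z *m adjmx Y) = 0) -> phi Z = 0.
  move=> ZB; rewrite /phi proj_ortho_0 ?linear0 // orthomx1E; apply/eqP/matrixP => i j.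
  rewrite (ord1 i) !mxE.
  have := ZB (vec_mx (row j M)); rewrite -mxvec_dot vec_mxK mxE => E.
  apply: etrans (E _); first by apply: eq_bigr => k _; rewrite !mxE.
  by apply/MP; exact: row_sub.
have orth_phi Z Y : B Y -> \tr ((Z - phi Z) *m adjmx Y) = 0.
  move=> BY; rewrite -mxvec_dot.
  have : (mxvec (Z - phi Z) <= orthomx Num.Def.conjC (hermitian1mx (n * n)) M)%MS.
    by rewrite linearB /= vec_mxK; exact: proj_ortho_compl_sub.
  rewrite orthomx1E => /eqP ZM.
  have /submxP[D ->] : (mxvec Y <= M)%MS by apply/MP; rewrite mxvecK.
  by rewrite trmx_mul map_mxM mulmxA ZM mul0mx mxE.
have phiM Y Z : B Y -> phi (Y *m Z) = Y *m phi Z.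
  move=> BY; have -> : Y *m Z = 1 *: (Y *m phi Z) + Y *m (Z - phi Z).
    by rewrite scale1r -mulmxDr addrC subrK.
  rewrite phiL scale1r phi_id; last by apply: BM.
  rewrite (orthP (Y *m (Z - phi Z))) ?addr0 // => W BW.
  have -> : Y *m (Z - phi Z) *m adjmx W = Y *m ((Z - phi Z) *m adjmx W) by rewrite mulmxA.
  rewrite mxtrace_mulC -mulmxA.
  have -> : adjmx W *m Y = adjmx (adjmx Y *m W) by rewrite adjmxM adjmxK.
  by apply: orth_phi; apply: BM => //; exact: Badj.
(* The block of [phi] that maps the k-th column of a matrix to the j-th column of its image. *)
pose T (k j : 'I_n) : 'M[C]_n := \matrix_(i, l) phi (delta_mx l k) i j.
have phi0 : phi 0 = 0 by apply: phi_id.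
have phi_sum (I : finType) (F : I -> 'M[C]_n) : phi (\sum_i F i) = \sum_i phi (F i).
  by apply: (big_morph phi) => [Y Z|//]; have := phiL 1 Y Z; rewrite !scale1r.
have phiZ c Z : phi (c *: Z) = c *: phi Z by have := phiL c Z 0; rewrite phi0 !addr0.
have TE k j (Z : 'M[C]_n) i : (T k j *m Z) i k = phi (Z *m delta_mx k k) i j.
  have -> : Z *m delta_mx k k = \sum_l Z l k *: delta_mx l k.
    apply/matrixP => a b; rewrite summxE !mxE (bigD1 k) //= big1 => [|l lk]; last first.
      by rewrite mxE (negbTE lk) mulr0.
    rewrite addr0 (bigD1 a) //= big1 => [|l la]; last by rewrite !mxE eq_sym (negbTE la) mulr0.
    by rewrite !mxE !eqtype.eqxx addr0.
  rewrite phi_sum summxE mxE; apply: eq_bigr => l _.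
  by rewrite phiZ !mxE mulrC.
have TB k j Y : B Y -> T k j *m Y = Y *m T k j.
  move=> BY; apply/matrixP => i l.
  have -> : (T k j *m Y) i l = phi (Y *m delta_mx l k) i j.
    have -> : (T k j *m Y) i l = (T k j *m (Y *m delta_mx l k)) i k.
      rewrite mulmxA [RHS]mxE (bigD1 l) //= big1 => [|m ml]; last by rewrite [delta_mx _ _ _ _]mxE (negbTE ml) mulr0.
      by rewrite addr0 [X in _ = _ * X]mxE !eqtype.eqxx mulr1.
    rewrite TE -mulmxA mul_delta_mx //.
  rewrite phiM // !mxE; by apply: eq_bigr => m _; rewrite !mxE.
have XT k j := XB (T k j) (TB k j).
suff -> : X = phi X by [].
apply/matrixP => i j.
have E k : phi (X *m delta_mx k k) i j = (X *m phi (delta_mx k k)) i j.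
  rewrite -TE XT mxE mxE; apply: eq_bigr => l _; by rewrite mxE.
have D : \sum_k delta_mx k k = 1%:M :> 'M[C]_n.
  apply/matrixP => a b; rewrite summxE mxE (bigD1 a) //= big1 => [|l la].
    by rewrite mxE eqtype.eqxx addr0 /= eq_sym.
  by rewrite mxE eq_sym (negbTE la).
have -> : phi X = \sum_k phi (X *m delta_mx k k) by rewrite -phi_sum -mulmx_sumr D mulmx1.
rewrite summxE (eq_bigr _ (fun k _ => E k)) -summxE -mulmx_sumr -phi_sum D.
by rewrite phi_id // mulmx1.
Qed.

End MatrixAlgebras.

(** * Schur's lemma, separation of irreducibles and uniqueness of the density matrix *)

Section Irreducibles.
Variables (R : realType) (G : cqg R).
Local Notation C := (Cx R).
Implicit Types (f g : G -> C) (n m : nat).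

Lemma adjmx_lin n m (c : C) (X Y : 'M[C]_(n, m)) :
  adjmx (c *: X + Y) = Num.conj c *: adjmx X + adjmx Y.
Proof. by apply/matrixP => i j; rewrite !mxE rmorphD rmorphM. Qed.

Lemma adjmx0 n m : adjmx (0 : 'M[C]_(n, m)) = 0.
Proof. by apply/matrixP => i j; rewrite !mxE rmorph0. Qed.

Lemma scalar_comb (c : C) f g : scalar f -> scalar g -> scalar (fun a => c * f a + g a).
Proof.
move=> fl gl d x y; rewrite fl gl mulrDr mulrDr addrACA; congr (_ + _).
by rewrite mulrCA.
Qed.

Lemma mor_adj n m (U : 'M[G]_n) (V : 'M[G]_m) (T : 'M[C]_(m, n)) :
  is_unitary_rep U -> is_unitary_rep V -> Mor U V T -> Mor V U (adjmx T).
Proof.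
move=> Uu Vu /mor_map H; apply/mor_map => f fl.
have := congr1 (@adjmx R _ _) (H _ (scalar_dual_star fl)).
by rewrite !adjmxM !map_dual_star // !adjmxK => ->.
Qed.

Lemma mor_comp n m p (U : 'M[G]_n) (V : 'M[G]_m) (W : 'M[G]_p) S T :
  Mor U V T -> Mor V W S -> Mor U W (S *m T).
Proof.
move=> /mor_map H /mor_map H'; apply/mor_map => f fl.
by rewrite -mulmxA H // !mulmxA H'.
Qed.

(** The matrices U(f) form a unital star algebra whose commutant is [Mor U U], the scalars; so the
    double commutant is everything. *)
Lemma irr_full n (U : 'M[G]_n) (X : 'M[C]_n) : is_irr U ->
  exists2 f, scalar f & map_mx f U = X.
Proof.
move=> [Uu [_ Us]]; have [Ur _ _] := Uu.
pose B := [set Y : 'M[C]_n | exists2 f, scalar f & map_mx f U = Y].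
suff : B X by [].
apply: double_commutant.
- move=> c _ _ [f fl <-] [g gl <-]; exists (fun a => c * f a + g a); first exact: scalar_comb.
  exact: map_lin.
- exists (@counit R G); [exact: counit_scalar|exact: rep_counit].
- move=> _ _ [f fl <-] [g gl <-]; exists (Defs.conv f g); first exact: scalar_conv.
  exact: map_conv.
- move=> _ [f fl <-]; exists (dual_star f); first exact: scalar_dual_star.
  exact: map_dual_star.
move=> T HT; have [|c ->] := Us T; last by rewrite scalar_mxC.
by apply/mor_map => f fl; apply: HT; exists f.
Qed.

(** By irreducibility T^* T and T T^* are scalars, equal and positive; dividing T by their square
    root makes it unitary. *)
Lemma mor_equiv n m (U : 'M[G]_n) (V : 'M[G]_m) (T : 'M[C]_(m, n)) :
  is_irr U -> is_irr V -> Mor U V T -> T != 0 -> unitarily_equiv U V.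
Proof.
move=> [Uu [_ Us]] [Vu [_ Vs]] TM T0.
have [c Ec] := Us _ (mor_comp TM (mor_adj Uu Vu TM)).
have [c' Ec'] := Vs _ (mor_comp (mor_adj Uu Vu TM) TM).
have [[i j] /= Tij] : exists p : 'I_m * 'I_n, T p.1 p.2 != 0.
  apply: contrapT => /forallNP H; move/eqP: T0; apply; apply/matrixP => i j; rewrite mxE.
  by apply/eqP; apply: contrapT => /negP; exact: (H (i, j)).
have cE : c = \sum_k `|T k j| ^+ 2.
  have /matrixP/(_ j j) := Ec; rewrite !mxE eqtype.eqxx mulr1n => <-.
  by apply: eq_bigr => k _; rewrite !mxE normCK mulrC.
have c0 : 0 < c.
  rewrite cE (bigD1 i) //= ltr_pwDl ?exprn_gt0 ?normr_gt0 //.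
  by rewrite sumr_ge0 // => k _; rewrite exprn_ge0.
have cc' : c' = c.
  have : c' *: T = c *: T.
    by rewrite -mul_scalar_mx -Ec' -mulmxA Ec mul_mx_scalar.
  move/matrixP/(_ i j); rewrite !mxE; exact: mulIf.
have sc : Num.conj (sqrtC c)^-1 = (sqrtC c)^-1.
  by rewrite fmorphV; congr (_^-1); apply/CrealP; rewrite ger0_real // sqrtC_ge0 ltW.
have adjS : adjmx ((sqrtC c)^-1 *: T) = (sqrtC c)^-1 *: adjmx T.
  by have := adjmx_lin (sqrtC c)^-1 T 0; rewrite adjmx0 !addr0 sc.
have ss : (sqrtC c)^-1 * (sqrtC c)^-1 * c = 1.
  by rewrite -invfM -expr2 sqrtCK mulVf // gt_eqF.
exists ((sqrtC c)^-1 *: T); split.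
- move/mor_map: TM => TM; apply/mor_map => f fl.
  by rewrite -scalemxAl TM // scalemxAr.
- by rewrite adjS -scalemxAl -scalemxAr scalerA Ec scale_scalar_mx ss.
- by rewrite adjS -scalemxAl -scalemxAr scalerA Ec' cc' scale_scalar_mx ss.
Qed.

Lemma unitarily_equiv_sym n m (U : 'M[G]_n) (V : 'M[G]_m) : is_unitary_rep U -> is_unitary_rep V ->
  unitarily_equiv U V -> unitarily_equiv V U.
Proof.
move=> Uu Vu [T [TM T1 T2]]; exists (adjmx T); rewrite adjmxK; split => //; exact: mor_adj.
Qed.

Lemma unitarily_equiv_refl n (U : 'M[G]_n) : unitarily_equiv U U.
Proof.
exists 1%:M; rewrite adjmx1 mulmx1; split => //; apply/mor_map => f fl.
by rewrite mul1mx mulmx1.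
Qed.

(** Without intertwiners between U and V, the commutant of the block sums of U(f) and V(f) is block
    diagonal; hence the projection onto the first block lies in the double commutant. *)
Lemma irr_separate n m (U : 'M[G]_n) (V : 'M[G]_m) : is_irr U -> is_irr V ->
  ~ unitarily_equiv U V ->
  exists f, [/\ scalar f, map_mx f U = 1%:M & map_mx f V = 0].
Proof.
move=> Ui Vi UV; have [Uu _] := Ui; have [Vu _] := Vi.
have [Ur _ _] := Uu; have [Vr _ _] := Vu.
have VU : ~ unitarily_equiv V U by move=> /(unitarily_equiv_sym Vu Uu).
pose D f : 'M[C]_(n + m) := block_mx (map_mx f U) 0 0 (map_mx f V).
pose B := [set Y | exists2 f, scalar f & D f = Y].
suff [f fl /eq_block_mx[f1 _ _ f2]] : B (block_mx 1%:M 0 0 0) by exists f.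
apply: double_commutant.
- move=> c _ _ [f fl <-] [g gl <-]; exists (fun a => c * f a + g a); first exact: scalar_comb.
  by rewrite /D !map_lin scale_block_mx add_block_mx !scaler0 !addr0.
- exists (@counit R G); first exact: counit_scalar.
  by rewrite /D !rep_counit // -scalar_mx_block.
- move=> _ _ [f fl <-] [g gl <-]; exists (Defs.conv f g); first exact: scalar_conv.
  by rewrite /D !map_conv // mulmx_block !mulmx0 !mul0mx !addr0 !add0r.
- move=> _ [f fl <-]; exists (dual_star f); first exact: scalar_dual_star.
  rewrite /D !map_dual_star // /adjmx tr_block_mx map_block_mx.
  by rewrite !trmx0 !map_mx0.
move=> T HT; rewrite -[T]submxK mulmx_block mulmx_block !mulmx0 !mul0mx !mulmx1 !mul1mx !addr0.
have H f : scalar f -> _ := fun fl => HT (D f) (ex_intro2 _ _ f fl erefl).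
have H12 : ursubmx T = 0.
  apply/eqP; apply: contrapT => /negP T0; apply: VU; apply: (mor_equiv Vi Ui _ T0).
  apply/mor_map => f fl; have := H f fl; rewrite -[T]submxK /D !mulmx_block.
  by rewrite !mulmx0 !mul0mx !addr0 !add0r block_mxKur => /eq_block_mx[_ ->].
have H21 : dlsubmx T = 0.
  apply/eqP; apply: contrapT => /negP T0; apply: UV; apply: (mor_equiv Ui Vi _ T0).
  apply/mor_map => f fl; have := H f fl; rewrite -[T]submxK /D !mulmx_block.
  by rewrite !mulmx0 !mul0mx !addr0 !add0r block_mxKdl => /eq_block_mx[_ _ ->].
by rewrite H12 H21.
Qed.

Section Family.
Variables (I : eqType) (d : I -> nat) (U : forall i, 'M[G]_(d i)).
Hypotheses (Ui : forall i, is_irr (U i))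
  (Uneq : forall i j, i != j -> ~ unitarily_equiv (U i) (U j)).

(** Convolution multiplies the images, so functionals separating i0 from single members of s can be
    multiplied one at a time. *)
Lemma family_finite_functional i0 (X : 'M[C]_(d i0)) (s : seq I) : i0 \notin s ->
  exists f, [/\ scalar f, map_mx f (U i0) = X & forall i, i \in s -> map_mx f (U i) = 0].
Proof.
elim: s => [_|i s IH]; first by have [f fl fX] := irr_full X (Ui i0); exists f.
rewrite in_cons negb_or => /andP[i0i /IH[f [fl fX fs]]].
have [g [gl g1 g0]] := irr_separate (Ui i0) (Ui i) (Uneq i0i).
have Ur j : is_rep (U j) by have [[]] := Ui j.
exists (Defs.conv f g); split; first exact: scalar_conv.
- by rewrite map_conv // fX g1 mulmx1.
- move=> j; rewrite in_cons map_conv // => /orP[/eqP -> | /fs ->]; last by rewrite mul0mx.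
  by rewrite g0 mulmx0.
Qed.

(** Finite products do not reach an infinite family. They do show that the coefficient (a, b) of
    U_i0 lies outside the subspace W, which contains all the other coefficients and whose elements
    are each controlled by finitely many indices; [separating_functional] then applies. *)
Lemma family_matrix_unit i0 (a b : 'I_(d i0)) :
  exists f, [/\ scalar f, map_mx f (U i0) = delta_mx a b &
    forall i, i != i0 -> map_mx f (U i) = 0].
Proof.
pose kills (g : G -> C) (s : seq I) := [/\ scalar g,
  forall i, i \in s -> i != i0 -> map_mx g (U i) = 0 &
  forall p, p != (a, b) -> g (U i0 p.1 p.2) = 0].
pose W := [set x | exists s, forall g, kills g s -> g x = 0].
have [|||f [fl f1 fW]] := @separating_functional _ _ W (U i0 a b).
- move=> c x y [s xs] [s' ys]; exists (s ++ s') => g [gl gs gp].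
  rewrite gl xs ?ys ?mulr0 ?addr0 //; split => // i is'; apply: gs; by rewrite mem_cat is' ?orbT.
- by exists [::] => g [gl _ _]; rewrite scalar0.
- move=> [s H].
  have [|g [gl gX gs]] := @family_finite_functional i0 (delta_mx a b) (seq.filter (predC1 i0) s).
    by rewrite mem_filter /= eqtype.eqxx.
  have : g (U i0 a b) = 0.
    apply: H; split => //; first by move=> i is' ii0; apply: gs; rewrite mem_filter /= ii0.
    move=> [p1 p2] pab; have /matrixP/(_ p1 p2) := gX; rewrite !mxE /= => ->.
    by move: pab; rewrite xpair_eqE; case: andP.
  have /matrixP/(_ a b) := gX; rewrite !mxE !eqtype.eqxx /= => ->; apply/eqP; exact: oner_neq0.
exists f; split => //.
- apply/matrixP => p1 p2; rewrite !mxE.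
  have [[-> ->]|pab] := eqVneq (p1, p2) (a, b); first by rewrite !eqtype.eqxx.
  rewrite fW; first by move: pab; rewrite xpair_eqE; case: andP.
  by exists [::] => g [_ _ /(_ _ pab)].
- move=> i ii0; apply/matrixP => p1 p2; rewrite !mxE; apply: fW; exists [:: i] => g [_ gs _].
  by have /matrixP/(_ p1 p2) := gs i (mem_head _ _) ii0; rewrite !mxE.
Qed.

End Family.

Lemma posdef_unit n (F : 'M[C]_n) : posdef F -> F \in unitmx.
Proof.
move=> Fp; rewrite -row_free_unit -kermx_eq0; apply/eqP/row_matrixP => i; rewrite row0.
apply/eqP; apply: contrapT => /negP v0.
pose v := adjmx (row i (kermx F)).
have v0' : v != 0 by apply: contra v0 => /eqP E; rewrite -[row _ _]adjmxK -/v E adjmx0.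
have := Fp _ v0'; rewrite adjmxK.
have -> : row i (kermx F) *m F = 0 by apply/sub_kermxP; exact: row_sub.
by rewrite mul0mx mxE ltxx.
Qed.

Lemma posdef_trace n (F : 'M[C]_n) : (0 < n)%N -> posdef F -> 0 < \tr F.
Proof.
move=> n0 Fp; have Fi i : 0 < F i i.
  have v0 : (delta_mx i 0 : 'cV[C]_n) != 0.
    by apply/eqP => /matrixP/(_ i 0); rewrite !mxE !eqtype.eqxx => /eqP; rewrite oner_eq0.
  have := Fp _ v0; have -> : adjmx (delta_mx i 0 : 'cV[C]_n) = delta_mx 0 i.
    by rewrite /adjmx trmx_delta map_delta_mx.
  by rewrite -rowE -colE !mxE.
rewrite /mxtrace (bigD1 (Ordinal n0)) //= ltr_pwDl // sumr_ge0 // => i _; exact: ltW.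
Qed.

(** By Schur's lemma F = c F'. The trace condition at the identity gives c = 1 / c, and positivity
    selects c = 1. *)
Lemma density_unique n (U : 'M[G]_n) (F F' : 'M[C]_n) : is_irr U ->
  is_density U F -> is_density U F' -> F = F'.
Proof.
move=> [Uu [n0 Us]] [Fp [V [W [UV VW /mor_map FM]]] Ft] [Fp' [V' [W' [UV' VW' /mor_map FM']]] Ft'].
have VV' : V = V'.
  have E : V^T = V'^T by rewrite -[LHS]mulmx1 -UV'.1 mulmxA UV.2 mul1mx.
  by rewrite -[V]trmxK E trmxK.
have WW' : W = W'.
  rewrite -VV' in VW'.
  have E : W^T = W'^T by rewrite -[LHS]mulmx1 -VW'.1 mulmxA VW.2 mul1mx.
  by rewrite -[W]trmxK E trmxK.
rewrite -WW' in FM'.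
have Fu := posdef_unit Fp'.
have [|c Tc] := Us (invmx F' *m F).
  apply/mor_map => f fl; rewrite -mulmxA FM // mulmxA.
  have -> : invmx F' *m map_mx f W = map_mx f U *m invmx F'.
    by rewrite -[LHS]mulmx1 -(mulmxV Fu) !mulmxA -(mulmxA (invmx F')) -FM' // !mulmxA mulVmx // mul1mx.
  by rewrite mulmxA.
have Fc : F = c *: F'.
  by rewrite -[LHS](mulKVmx Fu) Tc mul_mx_scalar.
have t0 := posdef_trace n0 Fp; have t0' := posdef_trace n0 Fp'.
have tc : \tr F = c * \tr F' by rewrite Fc mxtraceZ.
have c0 : 0 < c by move: t0; rewrite tc pmulr_lgt0.
have M1 : Mor U U (1%:M) by apply/mor_map => f fl; rewrite mul1mx mulmx1.
have := Ft _ M1; have := Ft' _ M1; rewrite !mulmx1 => e' e.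
have iF : invmx F = c^-1 *: invmx F'.
  rewrite Fc invmxZ //; by rewrite -Fc; apply: posdef_unit.
have : c * \tr F' = c^-1 * \tr F' by rewrite -tc e iF mxtraceZ -e'.
move=> /(mulIf (lt0r_neq0 t0')) cc.
have : c ^+ 2 == 1 by rewrite expr2 {1}cc mulVf // lt0r_neq0.
rewrite sqrf_eq1 => /orP[/eqP c1|/eqP c1]; first by rewrite Fc c1 scale1r.
by move: c0; rewrite c1 oppr_gt0 ltr10.
Qed.

End Irreducibles.

(** * Matrix units indexed by Gelfand-Tsetlin paths *)

Section GelfandTsetlin.
Variables (R : realType) (q : R) (UU : quantum_unitary_system q) (GT : GT_bases UU).
Local Notation C := (Cx R).
Implicit Types (t u s : seq vertex) (N M : nat).

Definition is_path N t := path edge [::] t && (size t == N).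

Lemma edge_size v w : edge v w -> size w = (size v).+1.
Proof. by case/andP => /eqP. Qed.

Lemma path_size v t : path edge v t -> size (last v t) = (size v + size t)%N.
Proof.
elim: t v => [|w t IH] v /=; first by rewrite addn0.
by move=> /andP[/edge_size vw /IH ->]; rewrite vw addSnnS.
Qed.

Lemma edge_sorted v w : edge v w -> sorted (fun x y : int => y <= x) w.
Proof.
move=> /andP[/eqP sw /allP H]; apply/(sortedP 0) => i; rewrite sw ltnS => iv.
have /andP[h1 h2] : (v`_i <= w`_i) && (w`_i.+1 <= v`_i).
  by apply: (H i); rewrite mem_iota add0n.
exact: le_trans h2 h1.
Qed.

Lemma is_path_rcons N t v : is_path N.+1 (rcons t v) = is_path N t && edge (last [::] t) v.
Proof. by rewrite /is_path rcons_path size_rcons eqSS andbAC. Qed.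

Lemma is_path_rconsP N t : is_path N.+1 t -> exists t' v,
  [/\ t = rcons t' v, is_path N t' & edge (last [::] t') v].
Proof.
case/lastP: t => [|t' v]; first by rewrite /is_path.
by rewrite is_path_rcons => /andP[? ?]; exists t', v.
Qed.

Lemma path_end N t : is_path N t -> exists nu : Sign N, paths_to nu t.
Proof.
move=> /andP[tp /eqP tN].
have ls : size (last [::] t) == N by rewrite path_size // tN.
have lo : sorted (fun x y : int => y <= x) (last [::] t).
  case/lastP: (t) tp => [//|t' v]; rewrite rcons_path last_rcons => /andP[_]; exact: edge_sorted.
exists (Sub (Tuple ls) lo); apply/andP; split => //; exact: eqtype.eqxx.
Qed.

Lemma sign_inj N : injective (fun nu : Sign N => sign_vertex nu).
Proof. by move=> nu mu /= E; apply/val_inj/val_inj. Qed.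

Lemma size_sign N (nu : Sign N) : size (sign_vertex nu) = N.
Proof. exact: size_tuple. Qed.

Lemma paths_to_is_path N (nu : Sign N) t : paths_to nu t -> is_path N t.
Proof.
move=> /andP[tp /eqP tl]; rewrite /is_path tp /=; apply/eqP.
by have := path_size tp; rewrite tl size_sign.
Qed.

Lemma paths_to_last N (nu : Sign N) t : paths_to nu t -> last [::] t = sign_vertex nu.
Proof. by case/andP => _ /eqP. Qed.

Lemma gt_path_to N (nu : Sign N) (i : 'I_(gt_dim GT nu)) : paths_to nu (gt_path i).
Proof. by rewrite -(gt_path_range GT nu); exists i. Qed.

Lemma gt_path_is_path N (nu : Sign N) (i : 'I_(gt_dim GT nu)) : is_path N (gt_path i).
Proof. exact: paths_to_is_path (gt_path_to i). Qed.

Lemma gt_path_last N (nu : Sign N) (i : 'I_(gt_dim GT nu)) : last [::] (gt_path i) = sign_vertex nu.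
Proof. exact: paths_to_last (gt_path_to i). Qed.

Lemma gt_index N (nu : Sign N) t : paths_to nu t -> exists i : 'I_(gt_dim GT nu), gt_path i = t.
Proof. by rewrite -(gt_path_range GT nu) => -[i _ <-]; exists i. Qed.

Lemma gt_indexE N t : is_path N t -> exists (nu : Sign N) (i : 'I_(gt_dim GT nu)), gt_path i = t.
Proof. by move=> /path_end[nu /gt_index[i <-]]; exists nu, i. Qed.

Lemma gt_path_ends N (nu mu : Sign N) (i : 'I_(gt_dim GT nu)) (j : 'I_(gt_dim GT mu)) :
  gt_path i = gt_path j -> nu = mu.
Proof. by move=> ij; apply: sign_inj; rewrite -(gt_path_last i) ij gt_path_last. Qed.

(* The matrix coefficient of v_t, v_u; it is 0 unless t and u are paths of
   length N with the same end. *)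
Definition coef N t u : UU N :=
  xget 0 [set a | exists (nu : Sign N) (i j : 'I_(gt_dim GT nu)),
     [/\ gt_path i = t, gt_path j = u & a = gt_rep GT nu i j]].

Lemma coefE N (nu : Sign N) (i j : 'I_(gt_dim GT nu)) :
  coef N (gt_path i) (gt_path j) = gt_rep GT nu i j.
Proof.
rewrite /coef; case: xgetP => [_ _ [mu [i' [j' [ei ej ->]]]]|H]; last first.
  by exfalso; apply: (H (gt_rep GT nu i j)); exists nu, i, j.
have E := gt_path_ends ei; case: nu / E i j ei ej => i j /gt_path_inj -> /gt_path_inj -> //.
Qed.

Lemma coef0 N t u : last [::] t != last [::] u -> coef N t u = 0.
Proof.
move=> tu; rewrite /coef; case: xgetP => [a _ [nu [i [j [ei ej _]]]]|//].
by move: tu; rewrite -ei -ej !gt_path_last eqtype.eqxx.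
Qed.

Lemma coef_none N t u : (forall (nu : Sign N) (i j : 'I_(gt_dim GT nu)),
  gt_path i = t -> gt_path j = u -> False) -> coef N t u = 0.
Proof.
by move=> H; rewrite /coef xgetPN // => a [nu [i [j [ei ej _]]]]; exact: H ei ej.
Qed.

(** With [coef] equal to 0 for different ends, the two branching rules of [GT_bases] merge into one
    formula. *)
Lemma theta_coef N t u v : is_path N.+1 (rcons t v) -> is_path N.+1 (rcons u v) ->
  theta UU N (coef N.+1 (rcons t v) (rcons u v)) = coef N t u.
Proof.
move=> pt pu.
have [nu [i ei]] := gt_indexE pt; have [nu' [j ej]] := gt_indexE pu.
have nv : (sign_vertex nu) = v by rewrite -(gt_path_last i) ei last_rcons.
have nv' : (sign_vertex nu') = v by rewrite -(gt_path_last j) ej last_rcons.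
have E : nu' = nu by apply: sign_inj; rewrite nv nv'.
case: nu / E i ei nv => i ei nv.
rewrite -ei -ej coefE.
move: pt pu; rewrite !is_path_rcons => /andP[pt _] /andP[pu _].
have [tu|tu] := eqVneq (last [::] t) (last [::] u); last first.
  rewrite coef0 //; apply: gt_restrict0.
  have lt (w : seq vertex) : is_path N w -> level (rcons w v) N = last [::] w.
    move=> /andP[_ /eqP wN]; rewrite /level -rcons_cons nth_rcons /= wN ltnS leqnn.
    by rewrite -wN -last_nth.
  by rewrite ei ej !lt.
have [mu [i' ei']] := gt_indexE pt; have [mu' [j' ej']] := gt_indexE pu.
have E : mu' = mu by apply: sign_inj; rewrite -(gt_path_last i') -(gt_path_last j') ei' ej' tu.
case: mu / E i' ei' => i' ei'.
rewrite -ei' -ej' coefE; apply: gt_restrict; first by rewrite ei ei' nv'.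
by rewrite ej ej' nv'.
Qed.

Lemma gt_inequiv N (nu mu : Sign N) : nu != mu ->
  ~ unitarily_equiv (gt_rep GT nu) (gt_rep GT mu).
Proof.
move=> nm H; have [la [_ lu]] := gt_complete GT (gt_irr GT mu).
by move/eqP: nm; apply; rewrite -(lu _ H); apply: lu; exact: unitarily_equiv_refl.
Qed.

Lemma gt_unitary N (nu : Sign N) : is_unitary_rep (gt_rep GT nu).
Proof. by have [] := gt_irr GT nu. Qed.

Lemma gt_is_rep N (nu : Sign N) : is_rep (gt_rep GT nu).
Proof. by have [] := gt_unitary nu. Qed.

Section Coefficients.
Variable N : nat.
Implicit Types f g : UU N -> C.

Lemma conv_coef (nu : Sign N) f g t u : scalar f -> scalar g ->
  paths_to nu t -> paths_to nu u ->
  Defs.conv f g (coef N t u) =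
  \sum_(k < gt_dim GT nu) f (coef N t (gt_path k)) * g (coef N (gt_path k) u).
Proof.
move=> fl gl /gt_index[i <-] /gt_index[j <-].
have /matrixP/(_ i j) := map_conv (gt_is_rep nu) fl gl; rewrite coefE !mxE => ->.
by apply: eq_bigr => k _; rewrite !mxE !coefE.
Qed.

Lemma dual_star_coef f t u : scalar f -> dual_star f (coef N t u) = Num.conj (f (coef N u t)).
Proof.
move=> fl.
have [[nu [i [j [<- <-]]]]|H] := pselect (exists (nu : Sign N) (i j : 'I_(gt_dim GT nu)),
  gt_path i = t /\ gt_path j = u).
  rewrite !coefE; have /matrixP/(_ i j) := map_dual_star f (gt_unitary nu); by rewrite !mxE.
have -> : coef N t u = 0.
  by rewrite /coef xgetPN // => a [nu [i [j [ei ej _]]]]; apply: H; exists nu, i, j.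
have -> : coef N u t = 0.
  by rewrite /coef xgetPN // => a [nu [i [j [ei ej _]]]]; apply: H; exists nu, j, i.
by rewrite (scalar0 (scalar_dual_star fl)) scalar0 // rmorph0.
Qed.

Lemma counit_coef t u : is_path N t -> is_path N u -> counit (coef N t u) = (t == u)%:R.
Proof.
move=> /gt_indexE[nu [i ei]] /gt_indexE[mu [j ej]].
have [tu|tu] := eqVneq (sign_vertex nu) (sign_vertex mu).
  have E := sign_inj tu; case: mu / E j ej tu => j ej _.
  have /matrixP/(_ i j) := rep_counit (gt_is_rep nu); rewrite -ei -ej coefE !mxE => ->.
  by rewrite (inj_eq (@gt_path_inj _ _ _ GT N nu)).
rewrite coef0; last by rewrite -ei -ej !gt_path_last.
have -> : (t == u) = false.
  by apply/negbTE; apply: contra tu => /eqP tu; rewrite -(gt_path_last i) ei tu -ej gt_path_last.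
by rewrite (scalar0 (@counit_scalar _ _)).
Qed.

(** Pairs of paths with the same end enumerate the coefficients of all [gt_rep], where
    [family_matrix_unit] applies; if t, u is not such a pair, 0 is the required functional. *)
Lemma matrix_unit_exists t u : exists f, scalar f /\
  forall t' u', is_path N t' -> is_path N u' -> last [::] t' = last [::] u' ->
    f (coef N t' u') = ((t' == t) && (u' == u))%:R.
Proof.
have Z : (forall t' u', is_path N t' -> is_path N u' -> last [::] t' = last [::] u' -> ~~ ((t' == t) && (u' == u))) ->
  exists f, scalar f /\ forall t' u', is_path N t' -> is_path N u' -> last [::] t' = last [::] u' ->
    f (coef N t' u') = ((t' == t) && (u' == u))%:R.
  move=> H; exists (fun=> 0); split; first by move=> c x y; rewrite mulr0 addr0.
  by move=> t' u' pt pu tu; rewrite (negbTE (H _ _ pt pu tu)).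
have [pt|npt] := boolP (is_path N t); last first.
  by apply: Z => t' u' pt' _ _; apply: contra npt => /andP[/eqP <-].
have [pu|npu] := boolP (is_path N u); last first.
  by apply: Z => t' u' _ pu' _; apply: contra npu => /andP[_ /eqP <-].
have [tu|ntu] := eqVneq (last [::] t) (last [::] u); last first.
  by apply: Z => t' u' _ _ tu'; apply: contra ntu => /andP[/eqP <- /eqP <-]; apply/eqP.
have [nu [i ei]] := gt_indexE pt; have [mu [j ej]] := gt_indexE pu.
have E : mu = nu by apply: sign_inj; rewrite -(gt_path_last i) -(gt_path_last j) ei ej tu.
case: nu / E i ei => i ei.
have [f [fl f1 f2]] := family_matrix_unit (@gt_irr _ _ _ GT N) (@gt_inequiv N) i j.
exists f; split => // t' u' /gt_indexE[la [k ek]] /gt_indexE[la' [l el]] tu'.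
have E : la' = la by apply: sign_inj; rewrite -(gt_path_last k) -(gt_path_last l) ek el tu'.
case: la / E k ek => k ek.
rewrite -ek -el -ei -ej coefE.
have [E|lm] := eqVneq la' mu.
  case: mu / E i j f f1 f2 fl {ei ej} => i j f f1 f2 fl.
  have /matrixP/(_ k l) := f1; rewrite !mxE => ->.
  by rewrite !(inj_eq (@gt_path_inj _ _ _ GT N la')).
have /matrixP/(_ k l) := f2 _ lm; rewrite !mxE => ->.
case: andP => // -[/eqP kl _]; by move/eqP: lm; rewrite (gt_path_ends kl).
Qed.

Definition unit_fun t u : UU N -> C := xget (fun=> 0) [set f | scalar f /\
  forall t' u', is_path N t' -> is_path N u' -> last [::] t' = last [::] u' ->
    f (coef N t' u') = ((t' == t) && (u' == u))%:R].

Lemma unit_fun_scalar t u : scalar (unit_fun t u).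
Proof.
rewrite /unit_fun; case: xgetP => [f _ [] //|H].
by have [f /H] := matrix_unit_exists t u.
Qed.

Lemma unit_funE t u t' u' : is_path N t' -> is_path N u' -> last [::] t' = last [::] u' ->
  unit_fun t u (coef N t' u') = ((t' == t) && (u' == u))%:R.
Proof.
rewrite /unit_fun; case: xgetP => [f _ [_]|H]; first exact.
by have [f /H] := matrix_unit_exists t u.
Qed.

End Coefficients.

End GelfandTsetlin.

Arguments coef {R q UU} GT N t u.
Arguments unit_fun {R q UU} GT N t u.
Arguments unit_fun_scalar {R q UU} GT N t u.

Section ComplexModulus.
Variable R : realType.
Local Notation C := (Cx R).
Implicit Types z w : C.

(** The modulus with values in R, where [lra] and [nra] apply; unlike [n1] it is multiplicative. *)
Definition nm z : R := complex.Re `|z|.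

Lemma nmE z : `|z| = toC (nm z).
Proof. by rewrite /nm normc_def. Qed.
Lemma toC_le (x y : R) : (toC x <= toC y) = (x <= y). Proof. exact: lecR. Qed.
Lemma toC_lt (x y : R) : (toC x < toC y) = (x < y). Proof. exact: ltcR. Qed.
Lemma toC_inj : injective (@toC R). Proof. exact: complexI. Qed.
Lemma toC0 : toC 0 = 0 :> C. Proof. exact: rmorph0. Qed.
Lemma toC1 : toC 1 = 1 :> C. Proof. exact: rmorph1. Qed.
Lemma ge0_toC z : 0 <= z -> z = toC (complex.Re z).
Proof. by move=> z0; rewrite /toC RRe_real // ger0_real. Qed.
Lemma nm_ge0 z : 0 <= nm z. Proof. by rewrite -toC_le toC0 -nmE. Qed.
Lemma nmM z w : nm (z * w) = nm z * nm w.
Proof. by apply: toC_inj; rewrite [RHS]rmorphM -nmE normrM !nmE. Qed.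
Lemma nmD z w : nm (z + w) <= nm z + nm w.
Proof. by rewrite -toC_le [toC (_ + _)]rmorphD -!nmE ler_normD. Qed.
Lemma nmN z : nm (- z) = nm z. Proof. by rewrite /nm normrN. Qed.
Lemma nm0 : nm 0 = 0. Proof. by rewrite /nm normr0. Qed.
Lemma nm1 : nm 1 = 1. Proof. by rewrite /nm normr1. Qed.
Lemma nm_eq0 z : nm z = 0 -> z = 0.
Proof. by move=> z0; apply/eqP; rewrite -normr_eq0 nmE z0 toC0. Qed.
Lemma nm_toC (x : R) : nm (toC x) = `|x|.
Proof. by apply: toC_inj; rewrite -nmE normc_def /= expr0n /= addr0 sqrtr_sqr. Qed.
Lemma nm_conj z : nm (Num.conj z) = nm z. Proof. by rewrite /nm norm_conjC. Qed.
Lemma normr_le z (x : R) : (`|z| <= toC x) = (nm z <= x). Proof. by rewrite nmE toC_le. Qed.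
Lemma nm_sum I (r : seq I) (P : pred I) (F : I -> C) :
  nm (\sum_(i <- r | P i) F i) <= \sum_(i <- r | P i) nm (F i).
Proof.
by elim/big_rec2: _ => [|i y x _ H]; rewrite ?nm0 // (le_trans (nmD _ _)) // lerD2l.
Qed.
Lemma conj_toC (x : R) : Num.conj (toC x) = toC x.
Proof. by apply/CrealP; rewrite complex_real. Qed.
Lemma nm_le_n1 z : nm z <= n1 z.
Proof. by rewrite -toC_le -nmE norm_le_n1. Qed.
Lemma n1_le_nm z : n1 z <= 2 * nm z.
Proof. have E : toC 2 = 2 :> C by exact: (rmorph_nat (real_complex R) 2).
by rewrite -toC_le toCM E -nmE n1_le_norm. Qed.
Lemma abs_re_nm z : `|complex.Re z| <= nm z.
Proof. by rewrite -toC_le -nmE; exact: normc_ge_Re. Qed.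
Lemma abs_im_nm z : `|complex.Im z| <= nm z.
Proof.
rewrite -toC_le -nmE; case: z => x y; rewrite normc_def /toC lecR -sqrtr_sqr ler_wsqrtr //=.
by rewrite lerDr sqr_ge0.
Qed.
End ComplexModulus.

(** * Operator norms and the bounded elements of the dual *)

Section OperatorNorm.
Variable R : realType.
Local Notation C := (Cx R).

Definition vn n (v : 'cV[C]_n) : C := \sum_i `|v i 0| ^+ 2.

Lemma vnE n (v : 'cV[C]_n) : vn v = (adjmx v *m v) 0 0.
Proof. by rewrite mxE; apply: eq_bigr => i _; rewrite !mxE normCK mulrC. Qed.

Lemma vn_ge0 n (v : 'cV[C]_n) : 0 <= vn v.
Proof. by rewrite sumr_ge0 // => i _; rewrite exprn_ge0. Qed.

Lemma vn_isometry n m (T : 'M[C]_(m, n)) v : adjmx T *m T = 1%:M -> vn (T *m v) = vn v.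
Proof. by move=> TT; rewrite !vnE adjmxM mulmxA -(mulmxA (adjmx v)) TT mulmx1. Qed.

Lemma vn_coord n (v : 'cV[C]_n) i : `|v i 0| ^+ 2 <= vn v.
Proof. by rewrite /vn (bigD1 i) //= lerDl sumr_ge0 // => j _; rewrite exprn_ge0. Qed.

Lemma vn_delta n (j : 'I_n) : vn (delta_mx j 0) = 1.
Proof.
rewrite /vn (bigD1 j) //= big1 => [|i ij]; first by rewrite mxE !eqtype.eqxx normr1 expr1n addr0.
by rewrite mxE (negbTE ij) normr0 expr0n.
Qed.

Lemma opnorm_entry n (T : 'M[C]_n) c i j : 0 <= c -> opnorm_le T c -> `|T i j| <= c.
Proof.
move=> c0 /(_ (delta_mx j 0)); rewrite -/(vn _) -/(vn _) vn_delta mulr1 => H.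
rewrite -(@ler_pXn2r _ 2) // ?nnegrE //; apply: le_trans H.
by have := vn_coord (T *m delta_mx j 0) i; rewrite -colE mxE.
Qed.

Lemma normD_sqr (x y : C) : `|x + y| ^+ 2 <= 2 * `|x| ^+ 2 + 2 * `|y| ^+ 2.
Proof.
have H : `|x + y| ^+ 2 + `|x - y| ^+ 2 = 2 * `|x| ^+ 2 + 2 * `|y| ^+ 2.
  by rewrite !normCK !rmorphB !rmorphD /=; ring.
by rewrite -H lerDl exprn_ge0.
Qed.

(** The factor 2 is the price of [normD_sqr]; the bound serves to show that combinations are
    bounded. *)
Lemma opnorm_comb n (T S : 'M[C]_n) (k a b : C) : 0 <= a -> 0 <= b -> opnorm_le T a -> opnorm_le S b ->
  opnorm_le (k *: T + S) (2 * (`|k| * a + b)).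
Proof.
move=> a0 b0 Ta Sb v; rewrite -/(vn _) -/(vn _).
apply: (@le_trans _ _ (2 * `|k| ^+ 2 * vn (T *m v) + 2 * vn (S *m v))).
  rewrite /vn !mulr_sumr -big_split /=; apply: ler_sum => i _.
  rewrite mulmxDl mxE -scalemxAl mxE.
  by apply: (le_trans (normD_sqr _ _)); rewrite normrM exprMn mulrA.
have k0 : 0 <= `|k| by []. have v0 := vn_ge0 v.
apply: (@le_trans _ _ (2 * `|k| ^+ 2 * (a ^+ 2 * vn v) + 2 * (b ^+ 2 * vn v))).
  apply: lerD; first by apply: ler_wpM2l; rewrite ?mulr_ge0 ?exprn_ge0 //; exact: Ta.
  by apply: ler_wpM2l => //; exact: Sb.
rewrite -subr_ge0.
have -> : (2 * (`|k| * a + b)) ^+ 2 * vn v -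
  (2 * `|k| ^+ 2 * (a ^+ 2 * vn v) + 2 * (b ^+ 2 * vn v)) =
  (2 * (`|k| * a) ^+ 2 + 2 * b ^+ 2 + 8 * (`|k| * a * b)) * vn v by ring.
by rewrite !(mulr_ge0, addr_ge0, exprn_ge0) // mulr_ge0.
Qed.

Lemma opnorm_mul n (T S : 'M[C]_n) (a b : C) : 0 <= a -> opnorm_le T a -> opnorm_le S b ->
  opnorm_le (T *m S) (a * b).
Proof.
move=> a0 Ta Sb v; rewrite -mulmxA; apply: (le_trans (Ta _)).
have E : (a * b) ^+ 2 * vn v = a ^+ 2 * (b ^+ 2 * vn v) by ring.
rewrite -!/(vn _) E; apply: ler_wpM2l; first by rewrite exprn_ge0.
exact: Sb.
Qed.

(** With w = T^* v, expand the nonnegative squared norm of T w - a^2 v; bounding that of T w by a^2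
    |w|^2 leaves |w|^2 <= a^2 |v|^2. *)
Lemma opnorm_adj n (T : 'M[C]_n) (a : C) : 0 < a -> opnorm_le T a -> opnorm_le (adjmx T) a.
Proof.
move=> a0 Ta v; rewrite -/(vn _) -/(vn _); set w := adjmx T *m v.
have wE : (adjmx (T *m w) *m v) 0 0 = vn w by rewrite adjmxM -mulmxA -/w vnE.
have wE' : (adjmx v *m (T *m w)) 0 0 = vn w.
  by rewrite mulmxA -[T]adjmxK -adjmxM -/w vnE.
have Tw : vn (T *m w) <= a ^+ 2 * vn w by exact: Ta.
set x := T *m w in wE wE' Tw; pose k := a ^+ 2.
have rk : Num.conj k = k by apply/CrealP; rewrite ger0_real // exprn_ge0 ?ltW.
have : 0 <= vn (x - k *: v) by exact: vn_ge0.
have -> : vn (x - k *: v) = vn x - 2 * (k * vn w) + k * (k * vn v).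
  have E1 : vn w = \sum_i x i 0 * Num.conj (v i 0).
    by rewrite -wE' mxE; apply: eq_bigr => i _; rewrite !mxE mulrC.
  have E2 : vn w = \sum_i v i 0 * Num.conj (x i 0).
    by rewrite -wE mxE; apply: eq_bigr => i _; rewrite !mxE mulrC.
  have -> : 2 * (k * vn w) = k * vn w + k * vn w by ring.
  rewrite {1}E1 E2 /vn !mulr_sumr -big_split /= -sumrB -big_split /=.
  apply: eq_bigr => i _; rewrite !mxE !normCK rmorphB rmorphM /= rk; ring.
move=> H; have k0 : 0 < k by rewrite exprn_gt0.
have {}H : 0 <= k * (k * vn v - vn w).
  apply: (le_trans H); rewrite -subr_ge0.
  have -> : k * (k * vn v - vn w) - (vn x - 2 * (k * vn w) + k * (k * vn v)) = k * vn w - vn x by ring.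
  by rewrite subr_ge0.
by rewrite pmulr_rge0 // subr_ge0 in H.
Qed.

Lemma map_equiv (G : cqg R) n m (U : 'M[G]_n) (V : 'M[G]_m) (f : G -> C) : scalar f ->
  unitarily_equiv U V -> exists T : 'M[C]_(m, n), [/\ adjmx T *m T = 1%:M, T *m adjmx T = 1%:M &
    map_mx f V = T *m map_mx f U *m adjmx T].
Proof.
move=> fl [T [/mor_map TM T1 T2]]; exists T; split => //.
by rewrite TM // -mulmxA T2 mulmx1.
Qed.

Lemma opnorm_equiv (G : cqg R) n m (U : 'M[G]_n) (V : 'M[G]_m) (f : G -> C) c : scalar f ->
  unitarily_equiv U V -> opnorm_le (map_mx f U) c -> opnorm_le (map_mx f V) c.
Proof.
move=> fl /(map_equiv fl)[T [T1 T2 ->]] Uc v; rewrite -/(vn _) -/(vn _).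
rewrite -!mulmxA vn_isometry //; apply: (le_trans (Uc _)).
by rewrite -!/(vn _) vn_isometry // adjmxK.
Qed.

Lemma opnorm_adj0 n (T : 'M[C]_n) (a : C) : 0 <= a -> opnorm_le T a -> opnorm_le (adjmx T) (a + 1).
Proof.
move=> a0 Ta; apply: opnorm_adj; first by rewrite ltr_wpDl.
move=> v; apply: (le_trans (Ta v)); rewrite -!/(vn _) ler_wpM2r ?vn_ge0 //.
by rewrite ler_pXn2r // ?nnegrE ?addr_ge0 // lerDl.
Qed.

End OperatorNorm.

Section GTNorm.
Variables (R : realType) (q : R) (UU : quantum_unitary_system q) (GT : GT_bases UU).
Local Notation C := (Cx R).
Local Notation coef := (coef GT).

Lemma dual_norm_leP N (f : UU N -> C) c : scalar f -> dual_norm_le f c <->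
  0 <= c /\ forall nu : Sign N, opnorm_le (map_mx f (gt_rep GT nu)) c.
Proof.
move=> fl; split=> [[c0 H]|[c0 H]]; split => //.
  by move=> nu; apply: H; exact: gt_irr.
move=> n U /(gt_complete GT)[nu [E _]]; exact: opnorm_equiv fl E (H nu).
Qed.

Lemma dual_norm_coef N (f : UU N -> C) c t u : dual_norm_le f c -> scalar f -> `|f (coef N t u)| <= c.
Proof.
move=> /[swap] fl /(dual_norm_leP _ fl)[c0 H].
have [[nu [i [j [<- <-]]]]|X] := pselect (exists (nu : Sign N) (i j : 'I_(gt_dim GT nu)),
  gt_path i = t /\ gt_path j = u).
  by rewrite coefE; have := opnorm_entry i j c0 (H nu); rewrite mxE.
have -> : coef N t u = 0.
  by rewrite /coef xgetPN // => a [nu [i [j [ei ej _]]]]; apply: X; exists nu, i, j.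
by rewrite scalar0 // normr0.
Qed.

Lemma dual_norm_ext N (f g : UU N -> C) c : scalar f -> scalar g ->
  (forall t u, is_path N t -> is_path N u -> last [::] t = last [::] u -> f (coef N t u) = g (coef N t u)) ->
  dual_norm_le f c -> dual_norm_le g c.
Proof.
move=> fl gl fg /(dual_norm_leP _ fl)[c0 H]; apply/(dual_norm_leP _ gl); split; first exact: c0.
move=> nu.
have -> : map_mx g (gt_rep GT nu) = map_mx f (gt_rep GT nu).
  apply/matrixP => i j; rewrite !mxE -coefE fg ?gt_path_is_path //.
  by rewrite !gt_path_last.
exact: H.
Qed.

Lemma Wstar_comb N (k : C) (f g : UU N -> C) : Wstar f -> Wstar g -> Wstar (fun a => k * f a + g a).
Proof.
move=> [fl [a /(dual_norm_leP _ fl)[a0 fa]]] [gl [b /(dual_norm_leP _ gl)[b0 gb]]].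
split; first exact: scalar_comb.
exists (2 * (`|k| * a + b)); apply/dual_norm_leP; first exact: scalar_comb.
split; first by rewrite mulr_ge0 // addr_ge0 // mulr_ge0.
by move=> nu; rewrite map_lin; exact: opnorm_comb.
Qed.

Lemma Wstar_conv N (f g : UU N -> C) : Wstar f -> Wstar g -> Wstar (Defs.conv f g).
Proof.
move=> [fl [a /(dual_norm_leP _ fl)[a0 fa]]] [gl [b /(dual_norm_leP _ gl)[b0 gb]]].
split; first exact: scalar_conv.
exists (a * b); apply/dual_norm_leP; first exact: scalar_conv.
split; first by rewrite mulr_ge0.
by move=> nu; rewrite map_conv //; [exact: opnorm_mul|exact: gt_is_rep].
Qed.

Lemma Wstar_dual_star N (f : UU N -> C) : Wstar f -> Wstar (dual_star f).
Proof.
move=> [fl [a /(dual_norm_leP _ fl)[a0 fa]]]; split; first exact: scalar_dual_star.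
exists (a + 1); apply/dual_norm_leP; first exact: scalar_dual_star.
split; first by rewrite addr_ge0.
by move=> nu; rewrite map_dual_star; [exact: opnorm_adj0|exact: gt_unitary].
Qed.

Lemma Wstar_ext N (f g : UU N -> C) : scalar g ->
  (forall t u, is_path N t -> is_path N u -> last [::] t = last [::] u -> f (coef N t u) = g (coef N t u)) ->
  Wstar f -> Wstar g.
Proof. by move=> gl fg [fl [c fc]]; split => //; exists c; exact: dual_norm_ext fc. Qed.

Lemma Wstar0 N : Wstar (fun _ : UU N => 0 : C).
Proof.
have Z : scalar (fun _ : UU N => 0 : C) by move=> c x y; rewrite mulr0 addr0.
split => //; exists 0; split => // n U _ v.
rewrite big1 ?mulr_ge0 ?sumr_ge0 ?expr0n //= ?mul0r // => i _.
by rewrite mxE big1 ?normr0 ?expr0n // => j _; rewrite mxE mul0r.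
Qed.

Lemma unit_fun_norm N t u : dual_norm_le (unit_fun GT N t u) 1.
Proof.
apply/dual_norm_leP; first exact: unit_fun_scalar.
split => // nu v; rewrite expr1n mul1r -!/(vn _).
set M := map_mx _ _.
have ME i j : M i j = ((gt_path i == t) && (gt_path j == u))%:R.
  by rewrite mxE -coefE unit_funE ?gt_path_is_path // !gt_path_last.
have [[i0 i0t]|nt] := pselect (exists i : 'I_(gt_dim GT nu), gt_path i = t); last first.
  rewrite {1}/vn big1 ?vn_ge0 // => i _.
  rewrite mxE big1 ?normr0 ?expr0n // => j _; rewrite ME.
  by case: eqP => [E|]; rewrite ?mul0r //; case: nt; exists i.
have [[j0 j0u]|nu'] := pselect (exists j : 'I_(gt_dim GT nu), gt_path j = u); last first.
  rewrite {1}/vn big1 ?vn_ge0 // => i _.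
  rewrite mxE big1 ?normr0 ?expr0n // => j _; rewrite ME.
  by case: (gt_path j =P u) => [E|]; rewrite ?andbF ?mul0r //; case: nu'; exists j.
have -> : M = delta_mx i0 j0.
  by apply/matrixP => i j; rewrite ME mxE -i0t -j0u !(inj_eq (@gt_path_inj _ _ _ GT N nu)).
have -> : vn (delta_mx i0 j0 *m v) = `|v j0 0| ^+ 2; last exact: vn_coord.
rewrite /vn (bigD1 i0) //= big1 => [|i ii]; last first.
  by rewrite mxE big1 ?normr0 ?expr0n // => j _; rewrite mxE (negbTE ii) mul0r.
rewrite addr0 mxE (bigD1 j0) //= big1 => [|j jj]; last by rewrite mxE (negbTE jj) andbF mul0r.
by rewrite mxE !eqtype.eqxx mul1r addr0.
Qed.

Lemma unit_fun_Wstar N t u : Wstar (unit_fun GT N t u).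
Proof. by split; [exact: unit_fun_scalar|exists 1; exact: unit_fun_norm]. Qed.

Lemma finite_support_Cstar N (f : UU N -> C) (s : seq (Sign N)) : Wstar f ->
  (forall nu : Sign N, nu \notin s -> map_mx f (gt_rep GT nu) = 0) -> Cstar f.
Proof.
move=> fW fs; split => // e e0; exists f; last first.
  apply: (@dual_norm_ext N (fun=> 0)).
  - by move=> c x y; rewrite mulr0 addr0.
  - by move=> c x y; rewrite !subrr mulr0 addr0.
  - by move=> t' u' _ _ _; rewrite subrr.
  - split; first exact: ltW.
    move=> n U _ v; rewrite -!/(vn _) {1}/vn big1; first by rewrite mulr_ge0 ?vn_ge0 // exprn_ge0 // ltW.
    by move=> i _; rewrite mxE big1 ?normr0 ?expr0n // => j _; rewrite mxE mul0r.
split; first exact: fW.1.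
exists (size s), (fun i => gt_dim GT (tnth (in_tuple s) i)), (fun i => gt_rep GT (tnth (in_tuple s) i)).
split=> [i|n U /(gt_complete GT)[mu [E _]] H]; first exact: gt_irr.
have [T [_ _ ->]] := map_equiv fW.1 E.
rewrite fs ?mulmx0 ?mul0mx //; apply/negP => /seq_tnthP [i mi].
by apply: (H i); rewrite -mi.
Qed.

Lemma unit_fun_Cstar N t u : Cstar (unit_fun GT N t u).
Proof.
have [r rP] : exists r : seq (Sign N), forall nu : Sign N, paths_to nu t -> nu \in r.
  have [[nu nut]|no] := pselect (exists nu : Sign N, paths_to nu t); last first.
    by exists [::] => nu nut; case: no; exists nu.
  exists [:: nu] => mu mut; rewrite inE; apply/eqP/sign_inj.
  by rewrite -(paths_to_last mut) (paths_to_last nut).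
apply: (finite_support_Cstar (s := r) (unit_fun_Wstar _ _ _)) => nu nur.
apply/matrixP => i j; rewrite !mxE -coefE unit_funE ?gt_path_is_path //; last by rewrite !gt_path_last.
case: eqP => //= it; move/negP: nur; case; apply: rP; rewrite -it; exact: gt_path_to.
Qed.

(** Restricted to U_q(N), U_nu is block diagonal along the vertices at level N, with blocks U_mu;
    the squared norms of a vector and of its image split accordingly. *)
Lemma Wstar_Theta N (f : UU N -> C) : Wstar f -> Wstar (Theta (S := UU) f).
Proof.
move=> [fl [c fc]].
have Tl : scalar (Theta (S := UU) f).
  by move=> k x y; rewrite /Theta /= linearP fl.
split => //; exists c; have [c0 H] := (dual_norm_leP _ fl).1 fc.
apply/dual_norm_leP => //; split => // nu v; rewrite -!/(vn _).
set M := map_mx _ _.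
pose lv (i : 'I_(gt_dim GT nu)) := level (gt_path i) N.
(* A representative of the class of i: [partition_big] then runs over the finite index type instead
   of the infinite type of vertices. *)
pose k i := odflt i [pick j | lv j == lv i].
have lvk i : lv (k i) = lv i.
  by rewrite /k; case: pickP => [j /eqP //|/(_ i)]; rewrite eqtype.eqxx.
have kE i j : lv i = lv j -> k i = k j.
  move=> ij; rewrite /k (eq_pick (Q := fun l => lv l == lv j)); last by move=> l /=; rewrite ij.
  by case: pickP => [//|/(_ j)]; rewrite eqtype.eqxx.
rewrite /vn (partition_big k predT) //= [X in _ <= _ * X](partition_big k predT) //= mulr_sumr.
apply: ler_sum => i0 _.
have [ki0|ki0] := eqVneq (k i0) i0; last first.
  rewrite !big_pred0 ?mulr0 // => i; apply/negbTE; apply: contra ki0 => /eqP <-;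
    by apply/eqP; apply: kE; exact: lvk.
have kP i : (k i == i0) = (lv i == lv i0).
  by apply/eqP/eqP => [E|/kE ->//]; rewrite -E lvk.
have [t0 [w [e0 p0 ed]]] := is_path_rconsP (gt_path_is_path i0).
have wn : w = sign_vertex nu by rewrite -(gt_path_last i0) e0 last_rcons.
have lr (s : seq vertex) : is_path N s -> level (rcons s w) N = last [::] s.
  move=> /andP[_ /eqP wN]; rewrite /level -rcons_cons nth_rcons /= wN ltnS leqnn.
  by rewrite -wN -last_nth.
have [mu [i0' ei0']] := gt_indexE GT p0.
have lmu : lv i0 = sign_vertex mu by rewrite /lv e0 lr // -ei0' gt_path_last.
have gex (j : 'I_(gt_dim GT mu)) : exists i : 'I_(gt_dim GT nu), gt_path i = rcons (gt_path j) w.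
  apply: gt_index; apply/andP; split; last by rewrite last_rcons wn.
  have := gt_path_is_path j; move=> /andP[pj _]; rewrite rcons_path pj /=.
  by rewrite gt_path_last -lmu /lv e0 lr.
have [g gP] := choice gex.
have lvg j : lv (g j) = lv i0 by rewrite lmu /lv gP lr ?gt_path_is_path // gt_path_last.
have g_inj : injective g.
  by move=> a b gab; apply: (@gt_path_inj _ _ _ GT N mu); have := gP a; rewrite gab gP => /rcons_inj[].
have hex (i : 'I_(gt_dim GT nu)) : exists j : 'I_(gt_dim GT mu), lv i == lv i0 -> g j = i.
  have [/eqP ii|] := boolP (lv i == lv i0); last by move=> _; exists i0'.
  have [t [w' [et pt _]]] := is_path_rconsP (gt_path_is_path i).
  have ww : w' = w by rewrite wn -(gt_path_last i) et last_rcons.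
  have [|j ej] := @gt_index _ _ _ GT _ mu t.
    apply/andP; split; first by case/andP: pt.
    by rewrite -lmu -ii /lv et ww lr.
  by exists j => _; apply: (@gt_path_inj _ _ _ GT _ nu); rewrite gP ej et ww.
have [h hP] := choice hex.
have reidx (F : 'I_(gt_dim GT nu) -> C) : \sum_(i | lv i == lv i0) F i = \sum_j F (g j).
  rewrite (reindex_onto g h) //=; apply: eq_bigl => j; rewrite lvg eqtype.eqxx /=.
  by apply/eqP; apply: g_inj; apply: hP; rewrite lvg.
rewrite (eq_bigl _ _ kP) [X in _ <= _ * X](eq_bigl _ _ kP) !reidx.
have := H mu (\col_j v (g j) 0); rewrite /opnorm_le.
have -> : \sum_i `|(\col_j v (g j) 0) i 0| ^+ 2 = \sum_j `|v (g j) 0| ^+ 2.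
  by apply: eq_bigr => j _; rewrite mxE.
apply: le_trans; rewrite le_eqVlt; apply/orP; left; apply/eqP; apply: eq_bigr => j _.
congr (`|_| ^+ 2); rewrite mxE (bigID (fun l => lv l == lv i0)) /= [X in _ + X]big1; last first.
  move=> l ll; rewrite mxE /Theta /= gt_restrict0 ?scalar0 ?mul0r //.
  by rewrite -/(lv _) -/(lv _) lvg eq_sym.
rewrite addr0 reidx [RHS]mxE; apply: eq_bigr => l _.
by rewrite !mxE /Theta /= (@gt_restrict _ _ _ GT _ nu mu _ _ j l) // gP wn.
Qed.

End GTNorm.

Section RealNorm.
Variables (R : realType) (A : cstar_alg R).
Implicit Types (x y : A) (c : Cx R).

Definition rn x : R := complex.Re (cnorm x).

Lemma rnE x : cnorm x = toC (rn x). Proof. exact: ge0_toC (cnorm_ge0 x). Qed.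
Lemma rn_ge0 x : 0 <= rn x. Proof. by rewrite -toC_le -rnE toC0 cnorm_ge0. Qed.
Lemma rn_eq0 x : rn x = 0 -> x = 0.
Proof. by move=> x0; apply: cnorm_eq0; rewrite rnE x0 toC0. Qed.
Lemma rnD x y : rn (x + y) <= rn x + rn y.
Proof. by rewrite -toC_le toCD -!rnE cnormD. Qed.
Lemma rnM x y : rn (x * y) <= rn x * rn y.
Proof. by rewrite -toC_le toCM -!rnE cnormM. Qed.
Lemma rnZ c x : rn (c *: x) = nm c * rn x.
Proof. by apply: toC_inj; rewrite toCM -nmE -!rnE cnormZ. Qed.
Lemma rn0 : rn (0 : A) = 0. Proof. by rewrite -(scale0r 0) rnZ nm0 mul0r. Qed.
Lemma rnN x : rn (- x) = rn x. Proof. by rewrite -scaleN1r rnZ nmN nm1 mul1r. Qed.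
Lemma rnB x y : rn (x - y) = rn (y - x). Proof. by rewrite -rnN opprB. Qed.
Lemma rn_triangle x y z : rn (x - z) <= rn (x - y) + rn (y - z).
Proof. by have -> : x - z = (x - y) + (y - z) by [rewrite addrA subrK]; exact: rnD. Qed.
Lemma rn_starM x : rn (cstar x * x) = rn x ^+ 2.
Proof. by apply: toC_inj; rewrite -rnE cstar_identity rnE /toC rmorphXn. Qed.
Lemma cstarD x y : cstar (x + y) = cstar x + cstar y.
Proof. by have := cstarP 1 x y; rewrite scale1r rmorph1 scale1r. Qed.
Lemma cstar0 : cstar (0 : A) = 0.
Proof. by have := cstarP (-1) (0 : A) 0; rewrite scaler0 addr0 rmorphN rmorph1 scaleN1r addNr. Qed.
Lemma cstarZ c x : cstar (c *: x) = Num.conj c *: cstar x.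
Proof. by have := cstarP c x 0; rewrite !addr0 cstar0 addr0. Qed.
Lemma cstarN x : cstar (- x) = - cstar x.
Proof. by rewrite -scaleN1r cstarZ rmorphN rmorph1 scaleN1r. Qed.
Lemma cstar1 : cstar (1 : A) = 1.
Proof. by have := cstarM (1 : A) (cstar 1); rewrite mul1r !cstarK mul1r => <-. Qed.
Lemma rn_star x : rn (cstar x) = rn x.
Proof.
have H y : rn y <= rn (cstar y).
  have [y0|y0] := eqVneq (rn y) 0; first by rewrite y0 rn_ge0.
  have yp : 0 < rn y by rewrite lt_neqAle eq_sym y0 rn_ge0.
  by rewrite -(ler_pM2r yp) -expr2 -rn_starM rnM.
by apply/eqP; rewrite eq_le H andbT; have := H (cstar x); rewrite cstarK.
Qed.
End RealNorm.

Section CisPower.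
Variable R : realType.
Lemma cisD (x y : R) : cis (x + y) = cis x * cis y.
Proof.
rewrite /cis cosD sinD; apply/eqP; rewrite eq_complex /=; apply/andP; split; apply/eqP => //.
by rewrite addrC.
Qed.
Lemma cis0 : cis (0 : R) = 1. Proof. by rewrite /cis cos0 sin0. Qed.
Lemma nm_cis (x : R) : nm (cis x) = 1.
Proof. by apply: toC_inj; rewrite -nmE normc_def /= cos2Dsin2 sqrtr1. Qed.
Lemma toC_exprz (x : R) (z : int) : toC x ^ z = toC (x ^ z).
Proof. by rewrite /toC fmorphXz. Qed.
Lemma ln_exprz (x : R) (z : int) : 0 < x -> ln (x ^ z) = z%:~R * ln x.
Proof.
move=> x0; case: z => n.
  by rewrite -exprnP lnXn // mulr_natl.
by rewrite NegzE -exprnN lnV ?posrE ?exprn_gt0 // lnXn // rmorphN /= mulNr mulr_natl.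
Qed.
End CisPower.

(** * Matrix units in the limit algebra *)

Section LimitElements.
Variables (R : realType) (q : R) (UU : quantum_unitary_system q) (GT : GT_bases UU).
Variable L : cstar_limit UU.
Local Notation C := (Cx R).
Local Notation coef := (coef GT).
Local Notation ufun := (unit_fun GT).
Implicit Types (N M : nat) (t u s : seq vertex).

Lemma lim0 N : lim_map L (fun _ : UU N => 0 : C) = 0.
Proof.
have := lim_map_linear L (-1) (Wstar0 UU N) (Wstar0 UU N).
have -> : (fun a : UU N => -1 * 0 + 0 : C) = (fun=> 0) by apply/funext => a; rewrite mulr0 addr0.
by move=> ->; rewrite scaleN1r addNr.
Qed.

(** The coefficients determine all norms, so the difference has norm 0 in the limit; this replaces
    an equality of the functions f and g. *)
Lemma lim_ext N (f g : UU N -> C) : Wstar f -> scalar g ->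
  (forall t u, is_path N t -> is_path N u -> last [::] t = last [::] u -> f (coef N t u) = g (coef N t u)) ->
  lim_map L f = lim_map L g.
Proof.
move=> fW gl fg; have gW : Wstar g := Wstar_ext gl fg fW.
apply/eqP; rewrite -subr_eq0 -scaleN1r addrC; apply/eqP.
rewrite -(lim_map_linear L (-1) gW fW).
have hW := Wstar_comb GT (-1) gW fW.
apply: cnorm_eq0; apply/eqP; rewrite eq_le cnorm_ge0 andbT.
apply/(lim_map_isometric L 0 hW); apply: (@dual_norm_ext _ _ _ GT _ (fun=> 0)).
- exact: (Wstar0 UU N).1.
- exact: hW.1.
- by move=> t u pt pu tu; rewrite fg // mulN1r addNr.
- apply/(lim_map_isometric L 0 (Wstar0 UU N)); by rewrite lim0 -(scale0r 0) cnormZ normr0 mul0r.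
Qed.

Lemma rn_coef N (f : UU N -> C) t u : Wstar f -> nm (f (coef N t u)) <= rn (lim_map L f).
Proof.
move=> fW; rewrite -normr_le -rnE.
apply: dual_norm_coef; last exact: fW.1.
by apply/(lim_map_isometric L _ fW).
Qed.

Lemma Wstar_sum N (I : Type) (r : seq I) (c : I -> C) (f : I -> UU N -> C) :
  (forall i, Wstar (f i)) -> Wstar (fun a => \sum_(i <- r) c i * f i a).
Proof.
move=> fW; elim: r => [|i r IH].
  by rewrite (_ : (fun _ => _) = fun=> 0); [exact: Wstar0|apply/funext => a; rewrite big_nil].
rewrite (_ : (fun _ => _) = fun a => c i * f i a + \sum_(i <- r) c i * f i a).
  exact: (Wstar_comb GT (c i) (fW i) IH).
by apply/funext => a; rewrite big_cons.
Qed.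

Lemma lim_sum N (I : Type) (r : seq I) (c : I -> C) (f : I -> UU N -> C) :
  (forall i, Wstar (f i)) ->
  lim_map L (fun a => \sum_(i <- r) c i * f i a) = \sum_(i <- r) c i *: lim_map L (f i).
Proof.
move=> fW; elim: r => [|i r IH].
  by rewrite (_ : (fun _ => _) = fun=> 0) ?lim0 ?big_nil //; apply/funext => a; rewrite big_nil.
rewrite (_ : (fun _ => _) = fun a => c i * f i a + \sum_(i <- r) c i * f i a).
  by rewrite lim_map_linear ?IH ?big_cons //; exact: Wstar_sum.
by apply/funext => a; rewrite big_cons.
Qed.

Definition eL N t u : L := lim_map L (ufun N t u).

Definition valid N t u := [&& is_path N t, is_path N u & last [::] t == last [::] u].

Lemma valid_index N t u : valid N t u -> exists (nu : Sign N) (i j : 'I_(gt_dim GT nu)),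
  gt_path i = t /\ gt_path j = u.
Proof.
move=> /and3P[pt pu /eqP tu].
have [nu [i ei]] := gt_indexE GT pt; have [mu [j ej]] := gt_indexE GT pu.
have E : mu = nu by apply: sign_inj; rewrite -(gt_path_last i) -(gt_path_last j) ei ej tu.
by case: nu / E i ei => i ei; exists mu, i, j.
Qed.

Lemma valid_gt N (nu : Sign N) (i j : 'I_(gt_dim GT nu)) : valid N (gt_path i) (gt_path j).
Proof. by rewrite /valid !gt_path_is_path !gt_path_last eqtype.eqxx. Qed.

Lemma sum_path_eq N (nu : Sign N) (i : 'I_(gt_dim GT nu)) (F : 'I_(gt_dim GT nu) -> C) :
  \sum_(k < gt_dim GT nu) (gt_path k == gt_path i)%:R * F k = F i.
Proof.
rewrite (bigD1 i) //= eqtype.eqxx mul1r big1 ?addr0 // => k ki.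
by rewrite (inj_eq (@gt_path_inj _ _ _ GT N nu)) (negbTE ki) mul0r.
Qed.

(** The unit confines the product to the finite-dimensional block nu, where it is a product of
    matrices; so g may be any element of W*. *)
Lemma lim_mul_unit N (nu : Sign N) (i j : 'I_(gt_dim GT nu)) (g : UU N -> C) : Wstar g ->
  lim_map L g * eL N (gt_path i) (gt_path j) =
  \sum_(k < gt_dim GT nu) g (coef N (gt_path k) (gt_path i)) *: eL N (gt_path k) (gt_path j).
Proof.
move=> gW; have uW t u := unit_fun_Wstar GT N t u; rewrite /eL -(lim_mapM L gW (uW _ _)).
rewrite -(lim_sum (index_enum _) (fun k => g (coef N (gt_path k) (gt_path i))) (fun k : 'I_(gt_dim GT nu) => uW (gt_path k) (gt_path j))).
apply: lim_ext; first exact: (Wstar_conv GT gW (uW _ _)).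
  exact: (Wstar_sum _ _ (fun k : 'I_(gt_dim GT nu) => uW (gt_path k) (gt_path j))).1.
move=> t u pt pu tu.
have [mu [a [b [et eu]]]] : exists (nu : Sign N) (a b : 'I_(gt_dim GT nu)), gt_path a = t /\ gt_path b = u.
  by apply: valid_index; rewrite /valid pt pu tu eqtype.eqxx.
rewrite (@conv_coef _ _ _ GT N mu); [|exact: gW.1|exact: unit_fun_scalar|by rewrite -et; exact: gt_path_to|by rewrite -eu; exact: gt_path_to].
have E1 (k : 'I_(gt_dim GT mu)) : ufun N (gt_path i) (gt_path j) (coef N (gt_path k) u) =
    ((gt_path k == gt_path i) && (u == gt_path j))%:R.
  by rewrite unit_funE ?gt_path_is_path // gt_path_last -eu gt_path_last.
have E2 (k : 'I_(gt_dim GT nu)) : ufun N (gt_path k) (gt_path j) (coef N t u) =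
    ((t == gt_path k) && (u == gt_path j))%:R by rewrite unit_funE.
under eq_bigr do rewrite E1.
under [RHS]eq_bigr do rewrite E2.
have [uj|] := eqVneq u (gt_path j); last first.
  by move=> _; rewrite !big1 // => k _; rewrite andbF mulr0.
have E : mu = nu by apply: sign_inj; rewrite -(gt_path_last b) eu uj gt_path_last.
case: nu / E i j uj E1 E2 => i j uj _ _.
rewrite -et; under eq_bigr do rewrite andbT mulrC.
under [RHS]eq_bigr do rewrite andbT mulrC eq_sym.
by rewrite (sum_path_eq i (fun k => g (coef N (gt_path a) (gt_path k)))) sum_path_eq.
Qed.

Lemma cstar_unit N t u : cstar (eL N t u) = eL N u t.
Proof.
rewrite /eL -lim_map_star; last exact: unit_fun_Wstar.
apply: lim_ext; [exact: (Wstar_dual_star GT (unit_fun_Wstar _ _ _ _))|exact: unit_fun_scalar|].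
move=> a b pa pb ab; rewrite dual_star_coef; last exact: unit_fun_scalar.
by rewrite !unit_funE // rmorph_nat andbC.
Qed.

Lemma unit_mul_lim N (nu : Sign N) (i j : 'I_(gt_dim GT nu)) (g : UU N -> C) : Wstar g ->
  eL N (gt_path i) (gt_path j) * lim_map L g =
  \sum_(k < gt_dim GT nu) g (coef N (gt_path j) (gt_path k)) *: eL N (gt_path i) (gt_path k).
Proof.
move=> gW; apply: (can_inj (@cstarK _ L)).
rewrite cstarM cstar_unit -lim_map_star // lim_mul_unit; last exact: (Wstar_dual_star GT).
rewrite (big_morph _ (@cstarD _ L) (@cstar0 _ L)); apply: eq_bigr => k _.
by rewrite cstarZ cstar_unit dual_star_coef //; exact: gW.1.
Qed.

(** Iterated, [Theta] lets f act on the initial segments of length N and as the identity on the rest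
    of the paths. *)
Lemma lift_lim k N (f : UU N -> C) : Wstar f -> exists g : UU (k + N)%N -> C,
  [/\ Wstar g, lim_map L g = lim_map L f &
   forall t u, is_path (k + N) t -> is_path (k + N) u ->
     g (coef (k + N) t u) = if drop N t == drop N u then f (coef N (take N t) (take N u)) else 0].
Proof.
move=> fW; elim: k => [|k [g [gW gf H]]].
  exists f; split => // t u /andP[_ /eqP tN] /andP[_ /eqP uN].
  by rewrite !drop_oversize ?tN ?uN // eqtype.eqxx !take_oversize ?tN ?uN.
exists (Theta (S := UU) g); split; first exact: (Wstar_Theta GT).
  by rewrite lim_map_Theta.
move=> t u pt pu.
have [t' [v [et pt' _]]] := is_path_rconsP pt; have [u' [w [eu pu' _]]] := is_path_rconsP pu.
have Nt : (N <= size t')%N by case/andP: pt' => _ /eqP ->; rewrite leq_addl.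
have Nu : (N <= size u')%N by case/andP: pu' => _ /eqP ->; rewrite leq_addl.
rewrite et eu !drop_rcons // -!cats1 !takel_cat // !cats1 eqseq_rcons.
have [vw|vw] := eqVneq v w; last first.
  rewrite andbF coef0 ?last_rcons // scalar0 //; exact: (Wstar_Theta GT gW).1.
rewrite andbT -vw /Theta /= theta_coef; [exact: H|by rewrite -et|by rewrite vw -eu].
Qed.

Lemma lift_to N K (f : UU N -> C) : (N <= K)%N -> Wstar f -> exists g : UU K -> C,
  [/\ Wstar g, lim_map L g = lim_map L f &
   forall t u, is_path K t -> is_path K u ->
     g (coef K t u) = if drop N t == drop N u then f (coef N (take N t) (take N u)) else 0].
Proof.
move=> NK fW; have [g] := lift_lim (K - N) fW.
by move: g; rewrite subnK // => g gP; exists g.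
Qed.

Lemma SV_lim N (f : UU N -> C) : Cstar f -> lim_map L f \in @SV_pred R UU L.
Proof. by move=> fC; apply/mem_set => B _; exact. Qed.

Definition svC N (f : UU N -> C) (fC : Cstar f) : SV_alg L := Sub (lim_map L f) (SV_lim fC).

Lemma svC_image N (f : UU N -> C) (fC : Cstar f) : is_image f (svC fC).
Proof. by []. Qed.

Definition eS N t u : SV_alg L := svC (unit_fun_Cstar GT N t u).

Lemma SV_val_unit N t u : SV_val (eS N t u) = eL N t u. Proof. by []. Qed.

Lemma SV_val_inj : injective (@SV_val R UU L).
Proof. exact: val_inj. Qed.

Lemma SV_valD (x y : SV_alg L) : SV_val (x + y) = SV_val x + SV_val y. Proof. by []. Qed.
Lemma SV_valZ c (x : SV_alg L) : SV_val (c *: x) = c *: SV_val x. Proof. by []. Qed.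
Lemma SV_valM (x y : SV_alg L) : SV_val (x * y) = SV_val x * SV_val y. Proof. by []. Qed.
Lemma SV_valB (x y : SV_alg L) : SV_val (x - y) = SV_val x - SV_val y. Proof. by []. Qed.
Lemma SV_val0 : SV_val (0 : SV_alg L) = 0. Proof. by []. Qed.
Lemma SV_val1 : SV_val (1 : SV_alg L) = 1. Proof. by []. Qed.
Lemma SV_val_star (x : SV_alg L) : SV_val (SV_star x) = cstar (SV_val x). Proof. by []. Qed.
Lemma SV_val_sum I (r : seq I) (P : pred I) (F : I -> SV_alg L) :
  SV_val (\sum_(i <- r | P i) F i) = \sum_(i <- r | P i) SV_val (F i).
Proof. by apply: (big_morph (@SV_val R UU L)). Qed.

Definition uspan : set (SV_alg L) := [set x | exists s : seq (C * (nat * (seq vertex * seq vertex))),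
  all (fun p => valid p.2.1 p.2.2.1 p.2.2.2) s /\
  x = \sum_(p <- s) p.1 *: eS p.2.1 p.2.2.1 p.2.2.2].

Lemma uspan0 : uspan 0. Proof. by exists [::]; rewrite big_nil. Qed.

Lemma uspan_unit N t u : valid N t u -> uspan (eS N t u).
Proof. by move=> v; exists [:: (1, (N, (t, u)))]; rewrite /= v big_seq1 scale1r. Qed.

Lemma uspan_comb c x y : uspan x -> uspan y -> uspan (c *: x + y).
Proof.
move=> [s [sv ->]] [s' [sv' ->]]; exists ([seq (c * p.1, p.2) | p <- s] ++ s').
rewrite all_cat sv' andbT all_map big_cat big_map /=; split; first exact: sv.
by rewrite scaler_sumr; congr (_ + _); apply: eq_bigr => p _; rewrite scalerA.
Qed.

Lemma uspanZ c x : uspan x -> uspan (c *: x).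
Proof. by move=> xs; have := uspan_comb c xs uspan0; rewrite addr0. Qed.
Lemma uspanD x y : uspan x -> uspan y -> uspan (x + y).
Proof. by move=> xs ys; have := uspan_comb 1 xs ys; rewrite scale1r. Qed.
Lemma uspan_sum I (r : seq I) (P : pred I) (F : I -> SV_alg L) :
  (forall i, P i -> uspan (F i)) -> uspan (\sum_(i <- r | P i) F i).
Proof. by move=> H; apply: big_ind => //; [exact: uspan0|exact: uspanD]. Qed.

Lemma uspan_ind (Q : SV_alg L -> Prop) : Q 0 ->
  (forall c x y, Q x -> Q y -> Q (c *: x + y)) ->
  (forall N t u, valid N t u -> Q (eS N t u)) -> forall x, uspan x -> Q x.
Proof.
move=> Q0 QL QU _ [s [sv ->]]; elim: s sv => [|p s IH] /=; first by rewrite big_nil.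
by move=> /andP[pv /IH H]; rewrite big_cons; apply: QL => //; exact: QU.
Qed.

(** The unit of lower level, lifted to the higher one, is only an element of W*, but its product
    with a unit of that level is a finite combination of units. *)
Lemma unit_mulS N M t u t' u' : valid N t u -> valid M t' u' -> uspan (eS N t u * eS M t' u').
Proof.
move=> v v'; have [nu [i [j [<- <-]]]] := valid_index v; have [mu [a [b [<- <-]]]] := valid_index v'.
have [NM|MN] := leqP N M.
  have [g [gW gf _]] := lift_to NM (unit_fun_Wstar GT N (gt_path i) (gt_path j)).
  have -> : eS N (gt_path i) (gt_path j) * eS M (gt_path a) (gt_path b) =
     \sum_(k < gt_dim GT mu) g (coef M (gt_path k) (gt_path a)) *: eS M (gt_path k) (gt_path b).
    apply: SV_val_inj; rewrite SV_valM SV_val_sum SV_val_unit /eL -gf lim_mul_unit //.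
  by apply: uspan_sum => k _; apply: uspanZ; apply: uspan_unit; exact: valid_gt.
have [g [gW gf _]] := lift_to (ltnW MN) (unit_fun_Wstar GT M (gt_path a) (gt_path b)).
have -> : eS N (gt_path i) (gt_path j) * eS M (gt_path a) (gt_path b) =
   \sum_(k < gt_dim GT nu) g (coef N (gt_path j) (gt_path k)) *: eS N (gt_path i) (gt_path k).
  apply: SV_val_inj; rewrite SV_valM SV_val_sum SV_val_unit (SV_val_unit M) /(eL M) -gf unit_mul_lim //.
by apply: uspan_sum => k _; apply: uspanZ; apply: uspan_unit; exact: valid_gt.
Qed.

Lemma uspanM x y : uspan x -> uspan y -> uspan (x * y).
Proof.
move=> xs ys; apply: (@uspan_ind (fun x => uspan (x * y)) _ _ _ x xs); first by rewrite mul0r; exact: uspan0.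
  by move=> c x' y' H1 H2; rewrite mulrDl -scalerAl; exact: uspan_comb.
move=> N t u v; apply: (@uspan_ind (fun y => uspan (eS N t u * y)) _ _ _ y ys); first by rewrite mulr0; exact: uspan0.
  by move=> c x' y' H1 H2; rewrite mulrDr -scalerAr; exact: uspan_comb.
by move=> M t' u' v'; exact: unit_mulS.
Qed.

Lemma SV_starD (x y : SV_alg L) : SV_star (x + y) = SV_star x + SV_star y.
Proof. by apply: SV_val_inj; rewrite /= SV_val_star SV_valD cstarD. Qed.
Lemma SV_starZ c (x : SV_alg L) : SV_star (c *: x) = Num.conj c *: SV_star x.
Proof. by apply: SV_val_inj; rewrite SV_val_star SV_valZ cstarZ. Qed.
Lemma SV_starM (x y : SV_alg L) : SV_star (x * y) = SV_star y * SV_star x.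
Proof. by apply: SV_val_inj; rewrite SV_val_star SV_valM cstarM. Qed.
Lemma SV_starK (x : SV_alg L) : SV_star (SV_star x) = x.
Proof. by apply: SV_val_inj; rewrite !SV_val_star cstarK. Qed.
Lemma SV_star0 : SV_star (0 : SV_alg L) = 0.
Proof. by apply: SV_val_inj; rewrite SV_val_star SV_val0 cstar0. Qed.

Lemma SV_star_unit N t u : SV_star (eS N t u) = eS N u t.
Proof. by apply: SV_val_inj; rewrite SV_val_star; exact: cstar_unit. Qed.

Lemma valid_sym N t u : valid N t u -> valid N u t.
Proof. by move=> /and3P[pt pu tu]; rewrite /valid pt pu eq_sym. Qed.

Lemma uspan_star x : uspan x -> uspan (SV_star x).
Proof.
move=> xs; apply: (@uspan_ind (fun x => uspan (SV_star x)) _ _ _ x xs); first by rewrite SV_star0; exact: uspan0.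
  by move=> c y z H1 H2; rewrite SV_starD SV_starZ; exact: uspan_comb.
by move=> N t u v; rewrite SV_star_unit; apply: uspan_unit; exact: valid_sym.
Qed.

(** [group_alg] speaks of arbitrary irreducible representations; [gt_complete] trades them for
    signatures. *)
Lemma group_alg_support N (g : UU N -> C) : group_alg g -> exists s : seq (Sign N),
  uniq s /\ forall t u nu, paths_to (sign_vertex nu) t -> nu \notin s -> g (coef N t u) = 0.
Proof.
move=> [gl [k [d [V [Vi gV]]]]].
have ex (i : 'I_k) : exists nu : Sign N, unitarily_equiv (gt_rep GT nu) (V i).
  by have [nu [E _]] := gt_complete GT (Vi i); exists nu.
have [nu_ nuP] := choice ex.
exists (undup [seq nu_ i | i : 'I_k]); split; first exact: undup_uniq.
move=> t u nu /(gt_index GT)[i <-]; rewrite mem_undup => nus.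
have [[mu [a [b [ea eb]]]]|X] := pselect (exists (mu : Sign N) (a b : 'I_(gt_dim GT mu)),
  gt_path a = gt_path i /\ gt_path b = u); last first.
  have -> : coef N (gt_path i) u = 0.
    by apply: coef_none => mu a b ea eb; apply: X; exists mu, a, b.
  by rewrite scalar0.
have E := gt_path_ends ea; case: nu / E i ea nus => i ea nus.
rewrite -ea -eb coefE.
have : map_mx g (gt_rep GT mu) = 0.
  apply: gV; first exact: gt_irr.
  move=> j Vj; move/negP: nus; apply; apply/mapP; exists j; first by rewrite mem_enum.
  have Vju : is_unitary_rep (V j) by have [] := Vi j.
  have [la [_ lu]] := gt_complete GT (Vi j).
  by rewrite -(lu _ (nuP j)) (lu _ (unitarily_equiv_sym Vju (gt_unitary GT mu) Vj)).
by move/matrixP/(_ a b); rewrite !mxE.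
Qed.

Lemma group_alg_lim N (g : UU N -> C) : group_alg g -> Wstar g ->
  exists s : seq (Sign N), [/\ uniq s,
    forall t u nu, paths_to (sign_vertex nu) t -> nu \notin s -> g (coef N t u) = 0 & lim_map L g =
  \sum_(nu <- s) \sum_(i < gt_dim GT nu) \sum_(j < gt_dim GT nu) g (coef N (gt_path i) (gt_path j)) *: eL N (gt_path i) (gt_path j)].
Proof.
move=> gg gW; have [s [us gs]] := group_alg_support gg; exists s; split => //.
pose F (nu : Sign N) (i : 'I_(gt_dim GT nu)) (a : UU N) : C :=
  \sum_(j < gt_dim GT nu) g (coef N (gt_path i) (gt_path j)) * ufun N (gt_path i) (gt_path j) a.
have uW t u := unit_fun_Wstar GT N t u.
have FW (nu : Sign N) i : Wstar (F nu i) by apply: Wstar_sum => j; exact: uW.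
pose H (nu : Sign N) (a : UU N) : C := \sum_i 1 * F nu i a.
have HW nu : Wstar (H nu) by apply: Wstar_sum; exact: FW.
transitivity (lim_map L (fun a => \sum_(nu <- s) 1 * H nu a)); last first.
  rewrite (lim_sum _ _ HW); apply: eq_bigr => nu _; rewrite scale1r (lim_sum _ _ (FW nu)).
  apply: eq_bigr => i _; rewrite scale1r.
  exact: (lim_sum _ _ (fun j : 'I_(gt_dim GT nu) => uW (gt_path i) (gt_path j))).
apply: (lim_ext gW); first exact: (Wstar_sum _ _ HW).1.
move=> t u pt pu tu.
have [mu [a [b [et eu]]]] : exists (nu : Sign N) (a b : 'I_(gt_dim GT nu)), gt_path a = t /\ gt_path b = u.
  by apply: valid_index; rewrite /valid pt pu tu eqtype.eqxx.
have HE nu : H nu (coef N t u) = if nu == mu then g (coef N t u) else 0.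
  rewrite /H; under eq_bigr do rewrite mul1r /F.
  have [E|nm] := eqVneq nu mu; last first.
    rewrite big1 // => i _; rewrite big1 // => j _; rewrite unit_funE //.
    case: eqP => [ti|]; rewrite ?mulr0 //.
    by move/eqP: nm; case; apply: (gt_path_ends (GT := GT) (i := i) (j := a)); rewrite et ti.
  case: mu / E a b et eu => a b et eu.
  rewrite -et -eu -[RHS](sum_path_eq a (fun i => g (coef N (gt_path i) (gt_path b)))).
  apply: eq_bigr => i _.
  rewrite -[in RHS](sum_path_eq b (fun j => g (coef N (gt_path i) (gt_path j)))) mulr_sumr.
  apply: eq_bigr => j _; rewrite unit_funE ?gt_path_is_path ?gt_path_last //.
  rewrite (eq_sym (gt_path a)) (eq_sym (gt_path b)) mulrC.
  by case: eqP => _; case: eqP => _; rewrite ?(mul0r, mul1r).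
under eq_bigr do rewrite mul1r HE.
rewrite -big_mkcond /=.
have [ms|ms] := boolP (mu \in s).
  by rewrite -big_filter filter_pred1_uniq // big_seq1.
rewrite big_seq_cond big_pred0; last first.
  by move=> nu; apply/negP => /andP[ns /eqP nm]; move: ms; rewrite -nm ns.
by apply: (gs _ _ mu) => //; rewrite -et; exact: gt_path_to.
Qed.

Definition coef_sum N (g : UU N -> C) (r : seq (Sign N)) : SV_alg L :=
  \sum_(nu <- r) \sum_(i < gt_dim GT nu) \sum_(j < gt_dim GT nu)
    g (coef N (gt_path i) (gt_path j)) *: eS N (gt_path i) (gt_path j).

(** One approximation carrying all that is used later: a finite combination of units, its norm
    distance to f and the distances of the single coefficients. *)
Lemma Cstar_approx N (f : UU N -> C) (e : R) : Cstar f -> 0 < e -> exists (g : UU N -> C) (r : seq (Sign N)),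
  [/\ uniq r, forall t u nu, paths_to (sign_vertex nu) t -> nu \notin r -> g (coef N t u) = 0,
   SV_val (coef_sum g r) = lim_map L g, rn (lim_map L f - lim_map L g) <= e &
   Wstar g /\ forall t u, nm (f (coef N t u) - g (coef N t u)) <= e].
Proof.
move=> [fW fC] e0; have [|g gg fg] := fC (toC e); first by rewrite -toC0 toC_lt.
have dW : Wstar (fun a => f a - g a).
  split; last by exists (toC e).
  by move=> c x y; rewrite fW.1 gg.1; ring.
have gW : Wstar g.
  have := Wstar_comb GT (-1) dW fW.
  by have -> : (fun a => -1 * (f a - g a) + f a) = g by apply/funext => a; ring.
have [r [ur gr gE]] := group_alg_lim gg gW; exists g, r; split => //.
  rewrite gE SV_val_sum; apply: eq_bigr => nu _; rewrite SV_val_sum; apply: eq_bigr => i _.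
  by rewrite SV_val_sum.
  have -> : lim_map L f - lim_map L g = lim_map L (fun a => f a - g a).
    have -> : (fun a => f a - g a) = (fun a => -1 * g a + f a) by apply/funext => a; ring.
    by rewrite lim_map_linear // scaleN1r addrC.
  by have /(lim_map_isometric L _ dW) := fg; rewrite rnE toC_le.
split => // t u; rewrite -normr_le; exact: (dual_norm_coef GT t u fg dW.1).
Qed.

Lemma Cstar_uspan N (f : UU N -> C) (e : R) : Cstar f -> 0 < e ->
  exists2 y, uspan y & rn (lim_map L f - SV_val y) < e.
Proof.
move=> fC e0; have [g [r [_ _ yE fg _]]] := Cstar_approx fC (divr_gt0 e0 (ltr0n R 2)).
exists (coef_sum g r); last by rewrite yE; lra.
apply: uspan_sum => nu _; apply: uspan_sum => i _; apply: uspan_sum => j _.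
by apply: uspanZ; apply: uspan_unit; exact: valid_gt.
Qed.

(** [SV_set] is an intersection, so it suffices that the limits of [uspan] form a closed star
    subalgebra containing every C*(U_q(N)). *)
Lemma uspan_dense (x : SV_alg L) (e : R) : 0 < e -> exists2 y, uspan y & rn (SV_val x - SV_val y) < e.
Proof.
pose B : set L := [set z | forall e : R, 0 < e -> exists2 y, uspan y & rn (z - SV_val y) < e].
suff : B (SV_val x) by apply.
have /set_mem := valP x; apply; last by move=> N f fC e' e'0; exact: Cstar_uspan.
have pe (e' : Cx R) : 0 < e' -> exists2 r : R, 0 < r & e' = toC r.
  by move=> e'0; have E := ge0_toC (ltW e'0); exists (complex.Re e') => //; rewrite -toC_lt -E toC0.
split.
(* The unit of level 0, indexed by the empty path, is the identity. *)
- move=> e' e'0; exists (eS 0 [::] [::]).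
    by apply: uspan_unit; rewrite /valid.
  rewrite SV_val_unit -(lim_map1 L 0) /eL -(@lim_ext _ (ufun 0 [::] [::])).
  + by rewrite subrr rn0.
  + exact: unit_fun_Wstar.
  + exact: counit_scalar.
  + move=> t u pt pu tu; rewrite unit_funE // counit_coef //.
    have /nilP -> : nilp t by case/andP: pt.
    by have /nilP -> : nilp u by case/andP: pu.
- move=> c z w Bz Bw e' e'0.
  have e1 : 0 < e' / 2 / (nm c + 1) by rewrite !divr_gt0 // ltr_wpDl ?nm_ge0.
  have e2 : 0 < e' / 2 by rewrite divr_gt0.
  have [y ys H1] := Bz _ e1; have [y' ys' H2] := Bw _ e2.
  exists (c *: y + y'); first exact: uspan_comb.
  have -> : c *: z + w - SV_val (c *: y + y') = c *: (z - SV_val y) + (w - SV_val y').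
    by rewrite SV_valD SV_valZ scalerBr opprD addrACA.
  apply: (le_lt_trans (rnD _ _)); rewrite rnZ.
  have : nm c * rn (z - SV_val y) <= e' / 2; last lra.
  rewrite ltr_pdivlMr ?ltr_wpDl ?nm_ge0 // in H1.
  by have := rn_ge0 (z - SV_val y); have := nm_ge0 c; lra.
- move=> z w Bz Bw e' e'0.
  have w1 : 0 < rn w + 1 by rewrite ltr_wpDl ?rn_ge0.
  have [y ys H1] := Bz (e' / 2 / (rn w + 1)) ltac:(by rewrite !divr_gt0).
  have y1 : 0 < rn (SV_val y) + 1 by rewrite ltr_wpDl ?rn_ge0.
  have [y' ys' H2] := Bw (e' / 2 / (rn (SV_val y) + 1)) ltac:(by rewrite !divr_gt0).
  exists (y * y'); first exact: uspanM.
  have -> : z * w - SV_val (y * y') = (z - SV_val y) * w + SV_val y * (w - SV_val y').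
    by rewrite SV_valM mulrBl mulrBr addrA subrK.
  apply: (le_lt_trans (rnD _ _)).
  rewrite ltr_pdivlMr // in H1; rewrite ltr_pdivlMr // in H2.
  have := rnM (z - SV_val y) w; have := rnM (SV_val y) (w - SV_val y').
  have := rn_ge0 (z - SV_val y); have := rn_ge0 (w - SV_val y').
  lra.
- move=> z Bz e' e'0; have [y ys H] := Bz _ e'0; exists (SV_star y); first exact: uspan_star.
  by rewrite SV_val_star -cstarN -cstarD rn_star.
- move=> z zB e' e'0.
  have [|w Bw zw] := zB (toC (e' / 2)); first by rewrite -toC0 toC_lt divr_gt0.
  have [y ys wy] := Bw (e' / 2) ltac:(by rewrite divr_gt0).
  exists y => //; apply: (le_lt_trans (rn_triangle _ w _)).
  rewrite rnE toC_lt in zw; lra.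
Qed.

End LimitElements.

(** * KMS states are twisted traces *)

Section ComplexDerivative.
Variable R : realType.
Local Notation C := (Cx R).
Implicit Types z h D : C.

Lemma cderiv_quotient (f : C -> C) z D : cderiv f z D -> forall e : R, 0 < e ->
  exists2 d : R, 0 < d & forall h, 0 < nm h < d -> nm (h^-1 * (f (z + h) - f z) - D) < e.
Proof.
move=> H e e0; have [d d0 Hd] := H (e / 4) (divr_gt0 e0 (ltr0n R 4)).
exists (d / 2); first by rewrite divr_gt0.
move=> h /andP[h0 hd]; have hn : h != 0 by apply: contraTneq h0 => ->; rewrite nm0 ltxx.
have -> : h^-1 * (f (z + h) - f z) - D = h^-1 * (f (z + h) - f z - D * h) by field.
have {}Hd : n1 (f (z + h) - f z - D * h) <= e / 4 * n1 h.
  by apply: Hd; have := n1_le_nm h; lra.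
rewrite nmM; have -> : nm h^-1 = (nm h)^-1 by apply: toC_inj; rewrite -nmE normfV nmE /toC fmorphV.
rewrite mulrC ltr_pdivrMr //; apply: le_lt_trans (nm_le_n1 _) _; apply: (le_lt_trans Hd).
have := n1_le_nm h; have : 0 < e * nm h by rewrite mulr_gt0.
have : e / 4 * n1 h <= e / 4 * (2 * nm h) by rewrite ler_wpM2l ?n1_le_nm // divr_ge0 // ltW.
lra.
Qed.

Lemma cderiv_of_quotient (f : C -> C) z D : (forall e : R, 0 < e ->
  exists2 d : R, 0 < d & forall h, 0 < nm h < d -> nm (h^-1 * (f (z + h) - f z) - D) < e) -> cderiv f z D.
Proof.
move=> H e e0; have [d d0 Hd] := H (e / 2) (divr_gt0 e0 (ltr0n R 2)); exists d => // h hd.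
have [->|hn] := eqVneq h 0; first by rewrite addr0 subrr mulr0 subr0 n10 mulr0.
have h0 : 0 < nm h.
  by rewrite lt_neqAle nm_ge0 andbT eq_sym; apply: contra hn => /eqP/nm_eq0 ->.
have {}Hd := Hd h ltac:(rewrite h0 (le_lt_trans (nm_le_n1 h) hd) //).
have -> : f (z + h) - f z - D * h = h * (h^-1 * (f (z + h) - f z) - D) by field.
apply: (le_trans (n1_le_nm _)); rewrite nmM mulrA.
have := nm_le_n1 h; set a := nm (_ - _) in Hd *.
have a0 : 0 <= a by exact: nm_ge0.
move=> hh; apply: (@le_trans _ _ (2 * n1 h * (e / 2))).
  by apply: ler_pM => //; [rewrite mulr_ge0 ?nm_ge0|rewrite ler_pM2l|exact: ltW].
by apply: eq_ler; field.
Qed.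

Lemma cexp_toC (x : R) : cexp (toC x) = toC (expR x).
Proof. by rewrite /cexp /toC /= cos0 sin0 mulr1 mulr0. Qed.

Lemma cexp_iR (x : R) : cexp ('i%C * toC x) = cis x.
Proof. by rewrite /cexp /cis /toC /= !(mul0r, mul1r, mulr0, subr0, add0r, oppr0, addr0) expR0 !mul1r. Qed.

Lemma gt0_toC (e : C) : 0 < e -> exists2 r : R, 0 < r & e = toC r.
Proof.
by move=> e0; have E := ge0_toC (ltW e0); exists (complex.Re e) => //; rewrite -toC_lt -E toC0.
Qed.

End ComplexDerivative.

Section EntireFunctions.
Variables (R : realType) (A : cstar_alg R).
Local Notation C := (Cx R).

Lemma entire_comb (F G : C -> A) (c : C) : entire F -> entire G -> entire (fun z => c *: F z + G z).
Proof.
move=> FE GE z; have [D HD] := FE z; have [E HE] := GE z; exists (c *: D + E) => e e0.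
have [r r0 ->] := gt0_toC e0.
have n0 := nm_ge0 c.
have [|d d0 Hd] := HD (toC (r / 2 / (nm c + 1))).
  by rewrite -toC0 toC_lt !divr_gt0 // ltr_wpDl.
have [|d' d'0 Hd'] := HE (toC (r / 2)); first by rewrite -toC0 toC_lt divr_gt0.
have [s s0 sd] := gt0_toC d0; have [s' s'0 sd'] := gt0_toC d'0.
exists (toC (Num.min s s')); first by rewrite -toC0 toC_lt lt_min s0.
move=> h; rewrite nmE -toC0 !toC_lt lt_min => /andP[h0 /andP[hs hs']].
have {}Hd : rn (h^-1 *: (F (z + h) - F z) - D) < r / 2 / (nm c + 1).
  by rewrite -toC_lt -rnE; apply: Hd; rewrite nmE sd -toC0 !toC_lt h0.
have {}Hd' : rn (h^-1 *: (G (z + h) - G z) - E) < r / 2.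
  by rewrite -toC_lt -rnE; apply: Hd'; rewrite nmE sd' -toC0 !toC_lt h0.
rewrite rnE toC_lt.
have -> : h^-1 *: (c *: F (z + h) + G (z + h) - (c *: F z + G z)) - (c *: D + E) =
  c *: (h^-1 *: (F (z + h) - F z) - D) + (h^-1 *: (G (z + h) - G z) - E).
  by rewrite opprD addrACA -scalerBr scalerDr !scalerA (mulrC h^-1 c) -scalerA opprD addrACA -scalerBr.
apply: (le_lt_trans (rnD _ _)); rewrite rnZ.
rewrite ltr_pdivlMr ?ltr_wpDl // in Hd.
have := rn_ge0 (h^-1 *: (F (z + h) - F z) - D); nra.
Qed.

Lemma entire_scale (f : C -> C) (y : A) : holo f -> entire (fun z => f z *: y).
Proof.
move=> fh z; have [D HD] := fh z; exists (D *: y) => e e0; have [r r0 ->] := gt0_toC e0.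
have y0 := rn_ge0 y.
have [d d0 Hd] := cderiv_quotient HD (divr_gt0 r0 (ltr_wpDl y0 ltr01)).
exists (toC d); first by rewrite -toC0 toC_lt.
move=> h; rewrite nmE -toC0 !toC_lt => /Hd {}Hd; rewrite rnE toC_lt.
rewrite -scalerBl scalerA -scalerBl rnZ; rewrite ltr_pdivlMr ?ltr_wpDl // in Hd.
have := nm_ge0 (h^-1 * (f (z + h) - f z) - D); nra.
Qed.

Lemma entire_cst (y : A) : entire (fun=> y).
Proof.
move=> z; exists 0 => e e0; exists 1 => // h _; rewrite subrr scaler0 subr0.
by rewrite rnE rn0 toC0.
Qed.

Lemma entire_translate (F : C -> A) (w : C) : entire F -> entire (fun z => F (z + w)).
Proof.
move=> FE z; have [D HD] := FE (z + w); exists D => e /HD[d d0 Hd]; exists d => // h /Hd.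
by rewrite (addrAC z w h).
Qed.

End EntireFunctions.

Section SVEntire.
Variables (R : realType) (S : inductive_system R) (L : cstar_limit S).
Local Notation C := (Cx R).

Lemma SV_limit (u : L) : (forall e : R, 0 < e -> exists2 y : SV_alg L, True & rn (u - SV_val y) < e) ->
  exists y : SV_alg L, SV_val y = u.
Proof.
move=> H; suff uS : u \in @SV_pred R S L by exists (Sub u uS).
apply/mem_set; have [_ _ _ _] := SV_set_subalg L; apply => e e0; have [r r0 ->] := gt0_toC e0.
have [y _ Hy] := H r r0; exists (SV_val y); first exact: set_mem (valP y).
by rewrite rnE toC_lt.
Qed.

Lemma SV_entire_holo (phi : SV_alg L -> C) (K : R) (F : C -> SV_alg L) : scalar phi ->
  (forall x, nm (phi x) <= K * rn (SV_val x)) -> entire (fun z => SV_val (F z)) ->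
  holo (fun z => phi (F z)).
Proof.
move=> phil phiK FE z; have [D HD] := FE z.
(* phi is defined on [SV_alg] only: the derivative D in L is first recognised as a limit of
   difference quotients in [SV_alg]. *)
have [|D' D'E] := @SV_limit D.
  move=> e e0; have [|d d0 Hd] := HD (toC e); first by rewrite -toC0 toC_lt.
  have [r r0 rd] := gt0_toC d0; pose h := toC (r / 2).
  exists (h^-1 *: (F (z + h) - F z)) => //.
  rewrite rnB -toC_lt -rnE; apply: Hd; rewrite nmE rd nm_toC -toC0 !toC_lt.
  by rewrite ger0_norm ?divr_ge0 ?ltW // divr_gt0 //=; lra.
exists (phi D'); apply: cderiv_of_quotient => e e0.
have K0 : 0 <= `|K| by [].
have e1 : 0 < e / (`|K| + 1) by rewrite divr_gt0 // ltr_wpDl.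
have [|d d0 Hd] := HD (toC (e / (`|K| + 1))); first by rewrite -toC0 toC_lt.
have [r r0 rd] := gt0_toC d0; exists r => // h /andP[h0 hr].
have := Hd h; rewrite nmE rd -toC0 !toC_lt h0 hr rnE toC_lt => /(_ isT).
rewrite -D'E; pose w := h^-1 *: (F (z + h) - F z) - D'.
rewrite -[X in rn X]/(SV_val w) => Hw.
have -> : h^-1 * (phi (F (z + h)) - phi (F z)) - phi D' = phi w.
  by rewrite /w (scalarB _ _ phil) (scalarZ _ _ phil) (scalarB _ _ phil).
apply: (le_lt_trans (phiK _)); rewrite ltr_pdivlMr ?ltr_wpDl // in Hw.
have := rn_ge0 (SV_val w); have : K * rn (SV_val w) <= `|K| * rn (SV_val w) by rewrite ler_wpM2r ?rn_ge0 // ler_norm.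
nra.
Qed.

End SVEntire.

(** * The flow on matrix units and the twisted trace property *)

Section Flow.
Variables (R : realType) (q : R) (UU : quantum_unitary_system q) (GT : GT_bases UU).
Variables (L : cstar_limit UU) (tau : dual_flow L).
Hypothesis q01 : 0 < q < 1.
Local Notation C := (Cx R).
Local Notation coef := (coef GT).
Local Notation eS := (eS GT L).
Implicit Types (N M : nat) (t u : seq vertex).

Let q0 : 0 < q. Proof. by case/andP: q01. Qed.
Let lnq : ln q < 0. Proof. by rewrite ln_lt0. Qed.

Definition wt N t : int := \sum_(1 <= n < N) vweight (level t n).

Definition dval N (nu : Sign N) t : R := q ^ (- ((N.-1)%:Z * vweight nu) + 2 * wt N t).

Lemma dval_gt0 N (nu : Sign N) t : 0 < dval nu t.
Proof. by rewrite exprz_gt0. Qed.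

(** [density] is a choice; [density_unique] identifies it with the matrix of [gt_density]. *)
Lemma density_gt N (nu : Sign N) :
  density (gt_rep GT nu) = diag_mx (\row_i toC (dval nu (gt_path i))).
Proof.
have H := gt_density GT nu.
have E : (\row_i toC q ^ (- ((N.-1)%:Z * vweight nu) +
   2 * \sum_(1 <= n < N) vweight (level (gt_path i) n))) =
   \row_i toC (dval nu (gt_path i)) :> 'rV_(gt_dim GT nu).
  by apply/matrixP => i j; rewrite !mxE toC_exprz.
rewrite E in H.
apply: (density_unique (gt_irr GT nu) _ H).
by rewrite /density; case: xgetP => [F _ //|]; case/(_ _ H).
Qed.

(** The exponent of q in [dval nu t / dval nu u]: the factor depending on nu alone cancels. It is
    even, whence the common period of the units. *)
Definition freq N t u : int := 2 * (wt N t - wt N u).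

Lemma ln_dval N (nu : Sign N) t u :
  ln (dval nu t) - ln (dval nu u) = (freq N t u)%:~R * ln q.
Proof.
rewrite /dval !ln_exprz // -mulrBl -rmorphB /=; congr (_%:~R * _).
by rewrite /freq; ring.
Qed.

(** [tau s] comes from conjugation by F^(is) in each representation, and F is diagonal in the basis
    of paths; so e_tu is multiplied by (d_t / d_u)^(is). *)
Lemma flow_unit N t u (s : R) : valid N t u ->
  tau s (eS N t u) = cis ((freq N t u)%:~R * (s * ln q)) *: eS N t u.
Proof.
move=> v; have [sg [sl sgP] sgE] := flow_scaling tau N.
apply: SV_val_inj; have -> := sgE s _ _ (unit_fun_Cstar GT N t u) (svC_image L _).
rewrite SV_valZ SV_val_unit.
set c := cis _; pose g : UU N -> C := fun a => c * unit_fun GT N t u a + 0.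
have Z := Wstar0 UU N; have uW := unit_fun_Wstar GT N t u.
have gW : Wstar g := Wstar_comb GT c uW Z.
have <- : lim_map L g = c *: eL GT L N t u by rewrite (lim_map_linear L c uW Z) lim0 addr0.
have fl : scalar (unit_fun GT N t u \o sg s).
  by move=> k x y; rewrite /= sl (unit_fun_scalar GT N t u).
apply/esym/(lim_ext L (GT := GT) gW fl) => a b pa pb ab.
have [nu [i [j [ei ej]]]] : exists (nu : Sign N) (i j : 'I_(gt_dim GT nu)), gt_path i = a /\ gt_path j = b.
  by apply: valid_index; rewrite /valid pa pb ab eqtype.eqxx.
pose d : 'rV[R]_(gt_dim GT nu) := \row_i dval nu (gt_path i).
have dp (r : R) : is_imag_power (density (gt_rep GT nu)) r (diag_mx (map_mx (fun x => cis (r * ln x)) d)).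
  exists 1%:M, d; rewrite adjmx1 !mulmx1 !mul1mx; split => //.
    by move=> k; rewrite mxE dval_gt0.
  by rewrite density_gt; congr diag_mx; apply/matrixP => k l; rewrite !mxE.
have := sgP _ _ s _ _ (gt_unitary GT nu) (dp s) (dp (- s)).
move=> /(congr1 (map_mx (unit_fun GT N t u))); rewrite map_mul_ampl; last exact: unit_fun_scalar.
rewrite map_ampl_mul; last exact: unit_fun_scalar.
move=> /matrixP/(_ i j); rewrite !mul_diag_mx !mul_mx_diag !mxE -coefE ei ej => E; rewrite [RHS]E.
rewrite /g addr0 unit_funE //; case: eqP => [at'|_]; last by rewrite !(mulr0, mul0r).
case: eqP => [bu|_]; last by rewrite !(mulr0, mul0r).
rewrite /= !mulr1 -cisD /c; congr cis.
by rewrite mulNr -mulrBr ln_dval -at' -bu; ring.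
Qed.

Lemma flowZ s c (x : SV_alg L) : tau s (c *: x) = c *: tau s x.
Proof.
have l := flow_linear tau s.
have F0 : tau s 0 = 0 by have := l (-1) 0 0; rewrite scaler0 addr0 scaleN1r addNr.
by have := l c x 0; rewrite F0 !addr0.
Qed.
Lemma flow_add s (x y : SV_alg L) : tau s (x + y) = tau s x + tau s y.
Proof. by have := flow_linear tau s 1 x y; rewrite !scale1r. Qed.
Lemma flow_sub s (x y : SV_alg L) : tau s (x - y) = tau s x - tau s y.
Proof. by rewrite flow_add -scaleN1r flowZ scaleN1r. Qed.
Lemma flow_zero s : tau s (0 : SV_alg L) = 0.
Proof. by rewrite -{1}(scale0r (0 : SV_alg L)) flowZ scale0r. Qed.
(** [tau s] is multiplicative and onto, so the image of 1 is again a unit. *)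
Lemma flow_one s : tau s (1 : SV_alg L) = 1.
Proof.
have H x : tau s 1 * x = x.
  have E : x = tau s (tau (- s) x) by rewrite -flowD subrr flow0.
  by rewrite {1}E -flowM mul1r -E.
by rewrite -[LHS]mulr1 H.
Qed.

Definition twisted_trace (chi : SV_alg L -> C) := forall N t u x, valid N t u ->
  toC (q ^ freq N t u) * chi (x * eS N t u) = chi (eS N t u * x).

Lemma expR_lnq (k : int) : expR (k%:~R * ln q) = q ^ k.
Proof. by rewrite -ln_exprz // lnK // posrE exprz_gt0. Qed.

Lemma twisted_trace_KMS (chi : SV_alg L -> C) : scalar chi ->
  (forall x, nm (chi x) <= rn (SV_val x)) -> twisted_trace chi -> is_KMS tau (-1) chi.
Proof.
move=> cl cb ct.
have orb y : uspan GT y -> exists F, is_entire_orbit tau y F /\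
   forall x, chi (x * F (Complex 0 (-1))) = chi (y * x).
  move=> ys; apply: (@uspan_ind _ _ _ GT L (fun y => exists F, is_entire_orbit tau y F /\
   forall x, chi (x * F (Complex 0 (-1))) = chi (y * x)) _ _ _ y ys).
  - exists (fun=> 0); split; last by move=> x; rewrite mulr0 mul0r.
    split; first exact: entire_cst.
    by move=> s; rewrite flow_zero.
  - move=> c x1 x2 [F [[FE Ft] FK]] [G [[GE Gt] GK]].
    exists (fun z => c *: F z + G z); split; last first.
      by move=> x; rewrite mulrDr -scalerAr cl FK GK mulrDl -scalerAl cl.
    split; first exact: (entire_comb c FE GE).
    by move=> s; rewrite Ft Gt flow_linear.
  - move=> N t u v; pose k : R := (freq N t u)%:~R * ln q.
    exists (fun z => cexp ('i%C * toC k * z) *: eS N t u); split; last first.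
      move=> x; rewrite -scalerAr scalarZ // -ct //; congr (_ * _).
      have -> : 'i%C * toC k * Complex 0 (-1) = toC k.
        by rewrite /toC; apply/eqP; rewrite eq_complex /=; apply/andP; split; apply/eqP; ring.
      by rewrite cexp_toC expR_lnq.
    split.
      have H : holo (fun z => cexp ('i%C * toC k * z)).
        exact: holo_comp (holoM (@holo_cst _ ('i%C * toC k)) (@holo_id _)) (@holo_cexp R).
      have := entire_scale (SV_val (eS N t u)) H; exact.
    move=> s; rewrite flow_unit // -mulrA -toCM cexp_iR; congr (cis _ *: _).
    by rewrite /k; ring.
exists (uspan GT (L := L)); split.
- split; [exact: uspan_comb|exact: uspanM|exact: uspan_star|].
  move=> s x xs; apply: (@uspan_ind _ _ _ GT L (fun x => uspan GT (tau s x)) _ _ _ x xs).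
  + by rewrite flow_zero; exact: uspan0.
  + by move=> c x1 x2 H1 H2; rewrite flow_linear; exact: uspan_comb.
  + by move=> N t u v; rewrite flow_unit //; apply: uspanZ; exact: uspan_unit.
- move=> x e e0; have [r r0 ->] := gt0_toC e0; have [y ys xy] := uspan_dense GT x r0.
  by exists y => //; rewrite rnE toC_lt SV_valB.
- by move=> y /orb[F [FO _]]; exists F.
(* [is_KMS] speaks of every entire extension F of the orbit of y; by [holo_uniq], chi(x F) and chi(x
   F0) agree at -i for the explicit extension F0. *)
- move=> x y F xs ys FO; have [F0 [F0O F0K]] := orb y ys; rewrite -F0K.
  have B w : nm (chi (x * w)) <= rn (SV_val x) * rn (SV_val w).
    by apply: (le_trans (cb _)); rewrite SV_valM rnM.
  have xl : scalar (fun w => chi (x * w)) by move=> c w w'; rewrite mulrDr -scalerAr cl.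
  have H1 := SV_entire_holo xl B FO.1; have H2 := SV_entire_holo xl B F0O.1.
  suff /eqP : chi (x * F (Complex 0 (-1))) + (-1) * chi (x * F0 (Complex 0 (-1))) = 0.
    by rewrite mulN1r subr_eq0 => /eqP.
  apply: (holo_uniq (holoD H1 (holoM (@holo_cst _ (-1)) H2))) => s.
  by rewrite FO.2 F0O.2 mulN1r subrr.
Qed.

Section PositiveFunctional.
Variable chi : SV_alg L -> C.
Hypotheses (chil : scalar chi) (chipos : forall x, 0 <= chi (SV_star x * x))
  (chib : forall x, nm (chi x) <= rn (SV_val x)).

Lemma rn_one_le : rn (1 : L) <= 1.
Proof.
have := rn_starM (1 : L); rewrite cstar1 mulr1 expr2 => E.
have r0 := rn_ge0 (1 : L); rewrite leNgt; apply/negP => r1; nra.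
Qed.

(** A weak Cauchy-Schwarz inequality: positivity at x + k w for k = 1, -1, i, -i bounds both A + B
    and A - B by the right-hand side, and their sum is 2 A. *)
Lemma chi_positive_mul (x w : SV_alg L) :
  nm (chi (SV_star x * w)) <= complex.Re (chi (SV_star x * x)) + complex.Re (chi (SV_star w * w)).
Proof.
pose A := chi (SV_star x * w); pose B := chi (SV_star w * x).
pose S := chi (SV_star x * x) + chi (SV_star w * w).
have exp (k : C) : chi (SV_star (x + k *: w) * (x + k *: w)) =
   chi (SV_star x * x) + k * A + Num.conj k * B + Num.conj k * k * chi (SV_star w * w).
  have -> : SV_star (x + k *: w) * (x + k *: w) = (SV_star x * x + k *: (SV_star x * w)) +
      (Num.conj k *: (SV_star w * x) + (Num.conj k * k) *: (SV_star w * w)).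
    by rewrite SV_starD SV_starZ mulrDl !mulrDr -!scalerAl -!scalerAr scalerA.
  by rewrite !(scalarD _ _ chil) !(scalarZ _ _ chil) /A /B addrA.
have S0 : 0 <= S by rewrite addr_ge0.
have SE : S = toC (complex.Re (chi (SV_star x * x)) + complex.Re (chi (SV_star w * w))).
  by rewrite toCD -!ge0_toC.
have cr (z : C) : 0 <= S + z -> 0 <= S - z -> `|z| <= S.
  move=> h1 h2; have Sr : S \is Num.real by exact: ger0_real.
  have zr : z \is Num.real by rewrite -[z](addKr S) addrC rpredB // ger0_real.
  rewrite real_ler_norml //; apply/andP; split; last by rewrite -subr_ge0.
  by rewrite -subr_ge0 opprK addrC.
have H1 : `|A + B| <= S.
  apply: cr.
    have := chipos (x + 1 *: w); rewrite exp rmorph1 !mul1r /S => h.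
    by apply: (le_trans h); rewrite le_eqVlt; apply/orP; left; apply/eqP; ring.
  have := chipos (x + (-1) *: w); rewrite exp rmorphN rmorph1 /S => h.
  by apply: (le_trans h); rewrite le_eqVlt; apply/orP; left; apply/eqP; ring.
have ci : Num.conj ('i%C : C) = - 'i%C by apply/eqP; rewrite eq_complex /= oppr0 !eqtype.eqxx.
have ii : 'i%C * 'i%C = -1 :> C by rewrite -expr2 sqr_i.
have ni : `|'i%C : C| = 1 by rewrite normc_def /= expr0n expr1n add0r sqrtr1.
have H2 : `|A - B| <= S.
  rewrite -[leLHS]mul1r -ni -normrM; apply: cr.
    have := chipos (x + 'i%C *: w); rewrite exp ci mulNr (mulNr 'i%C) ii opprK mul1r => h.
    by apply: (le_trans h); rewrite le_eqVlt /S; apply/orP; left; apply/eqP; ring.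
  have := chipos (x + (- 'i%C) *: w); rewrite exp rmorphN /= ci opprK mulNr mulrN ii opprK mul1r => h.
  by apply: (le_trans h); rewrite le_eqVlt /S; apply/orP; left; apply/eqP; ring.
rewrite -toC_le -SE -nmE -/A.
have : `|A + B + (A - B)| <= S + S by apply: (le_trans (ler_normD _ _)); exact: lerD.
have -> : A + B + (A - B) = 2 * A by ring.
have -> : S + S = 2 * S by ring.
by rewrite normrM ger0_norm // ler_pM2l.
Qed.

(* c = (a + c c) / 2 is solved by iteration, and then b = 1 - c. *)
Lemma SV_sqrt (z : SV_alg L) : rn (SV_val z) <= 2^-1 ->
  exists b, SV_star b * b = 1 - SV_star z * z.
Proof.
move=> z2; pose a := SV_star z * z.
have a4 : rn (SV_val a) <= 4^-1.
  rewrite /a SV_valM SV_val_star rn_starM expr2.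
  have := rn_ge0 (SV_val z); have -> : (4 : R)^-1 = 2^-1 * 2^-1 by rewrite -invfM; congr (_^-1); ring.
  by move=> ?; apply: ler_pM.
have h2 : nm (toC (2^-1 : R)) = 2^-1 by rewrite nm_toC ger0_norm.
pose c := fix c n : SV_alg L := if n is n'.+1 then toC (2^-1) *: (a + c n' * c n') else 0.
have cstar n : SV_star (c n) = c n.
  elim: n => [|n IH] /=; first exact: SV_star0.
  by rewrite SV_starZ conj_toC SV_starD !SV_starM IH SV_starK.
have cn n : rn (SV_val (c n)) <= 2^-1.
  elim: n => [|n IH]; first by rewrite /= SV_val0 rn0.
  rewrite [c n.+1]/= SV_valZ rnZ h2 ler_piMr // SV_valD SV_valM.
  apply: (le_trans (rnD _ _)); apply: (le_trans (lerD a4 (rnM _ _))).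
  have : rn (SV_val (c n)) * rn (SV_val (c n)) <= 2^-1 * 2^-1 by apply: ler_pM => //; exact: rn_ge0.
  by move=> ?; lra.
have diff n : rn (SV_val (c n.+1) - SV_val (c n)) <= 2^-1 ^+ n.
  elim: n => [|n IH].
    rewrite expr0 [c 0%N]/= SV_val0 subr0; apply: (le_trans (cn 1%N)); lra.
  have -> : SV_val (c n.+2) - SV_val (c n.+1) = toC (2^-1) *: ((SV_val (c n.+1)) * (SV_val (c n.+1) - SV_val (c n)) + (SV_val (c n.+1) - SV_val (c n)) * SV_val (c n)).
    rewrite -[LHS]/(SV_val (c n.+2 - c n.+1)) [c n.+2]/= [X in _ - X]/= -scalerBr.
    rewrite SV_valZ; congr (_ *: _); rewrite opprD addrACA subrr add0r SV_valB !SV_valM.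
    by rewrite mulrBr mulrBl addrA subrK.
  rewrite rnZ h2 exprS ler_pM2l ?invr_gt0 //.
  apply: (le_trans (rnD _ _)).
  have d0 := rn_ge0 (SV_val (c n.+1) - SV_val (c n)).
  have X1 : rn (SV_val (c n.+1) * (SV_val (c n.+1) - SV_val (c n))) <= 2^-1 * rn (SV_val (c n.+1) - SV_val (c n)).
    by apply: (le_trans (rnM _ _)); rewrite ler_wpM2r.
  have X2 : rn ((SV_val (c n.+1) - SV_val (c n)) * SV_val (c n)) <= 2^-1 * rn (SV_val (c n.+1) - SV_val (c n)).
    by apply: (le_trans (rnM _ _)); rewrite mulrC ler_wpM2r.
  lra.
have cauchy n k : rn (SV_val (c (k + n)%N) - SV_val (c n)) <= 2 * 2^-1 ^+ n.
  suff : rn (SV_val (c (k + n)%N) - SV_val (c n)) <= 2 * 2^-1 ^+ n - 2 * 2^-1 ^+ (k + n).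
    by move=> h; apply: (le_trans h); rewrite gerBl mulr_ge0 // exprn_ge0.
  elim: k => [|k IH]; first by rewrite add0n !subrr rn0.
  apply: (le_trans (rn_triangle _ (SV_val (c (k + n)%N)) _)).
  apply: (le_trans (lerD (diff _) IH)); rewrite addSn exprS; lra.
have small (e : R) : 0 < e -> exists n, 2 * 2^-1 ^+ n < e.
  move=> e0; have [n _ /(_ n (leqnn n)) /= H] := near_infty_natSinv_expn_lt (PosNum (divr_gt0 e0 (ltr0n R 2))).
  by exists n; rewrite exprVn mulrC -ltr_pdivlMr // -div1r.
have [|l lP] := @cnorm_complete _ L (fun n => SV_val (c n)).
  move=> e' e'0; have [e e0 ->] := gt0_toC e'0.
  have [N HN] := small _ (divr_gt0 e0 (ltr0n R 2)); exists N => m n Nm Nn.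
  rewrite rnE toC_lt; apply: (le_lt_trans (rn_triangle _ (SV_val (c N)) _)); rewrite (rnB _ (SV_val (c n))).
  have := cauchy N (m - N)%N; have := cauchy N (n - N)%N; rewrite !subnK // => ? ?; lra.
have {}lP (e : R) : 0 < e -> exists N, forall n, (N <= n)%N -> rn (SV_val (c n) - l) < e.
  by move=> e0; have [|N HN] := lP (toC e); [rewrite -toC0 toC_lt|exists N => n /HN; rewrite rnE toC_lt].
have [y yl] : exists y : SV_alg L, SV_val y = l.
  apply: SV_limit => e /lP[N HN]; exists (c N) => //; rewrite rnB; exact: HN.
have lim_uniq (u v : L) : (forall e : R, 0 < e -> rn (u - v) <= e) -> u = v.
  move=> H; apply/eqP; rewrite -subr_eq0; apply/eqP/rn_eq0/eqP; rewrite eq_le rn_ge0 andbT.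
  by apply/ler_addgt0Pr => e e0; rewrite add0r; exact: H.
have ystar : SV_star y = y.
  apply: SV_val_inj; rewrite SV_val_star yl; apply: lim_uniq => e e0.
  have [N /(_ N (leqnn N)) HN] := lP (e / 2) (divr_gt0 e0 (ltr0n R 2)).
  apply: (le_trans (rn_triangle _ (SV_val (c N)) _)).
  have -> : rn (Defs.cstar l - SV_val (c N)) = rn (SV_val (c N) - l).
    by rewrite -{1}(cstar N) SV_val_star -cstarN -cstarD rn_star rnB.
  lra.
have yfix : y = toC (2^-1) *: (a + y * y).
  apply: SV_val_inj; rewrite SV_valZ SV_valD SV_valM yl; apply: lim_uniq => e e0.
  have e2 : 0 < e / 4 by rewrite divr_gt0.
  have [N HN] := lP _ e2; have := HN N (leqnn N); have := HN N.+1 (leqnSn N).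
  set u := SV_val (c N) => H1 H2.
  apply: (le_trans (rn_triangle _ (SV_val (c N.+1)) _)); rewrite rnB.
  rewrite [in X in _ + X]/= SV_valZ SV_valD SV_valM -/u -scalerBr rnZ h2.
  have -> : SV_val a + u * u - (SV_val a + l * l) = u * (u - l) + (u - l) * l.
    by rewrite opprD addrACA subrr add0r mulrBr mulrBl addrA subrK.
  have l1 : rn l <= 2^-1.
    apply/ler_addgt0Pr => e' e'0; have [N' /(_ N' (leqnn N')) HN'] := lP _ e'0.
    have := rn_triangle l (SV_val (c N')) 0; rewrite !subr0 (rnB l); have := cn N'; lra.
  have u1 : rn u <= 2^-1 by exact: cn.
  have := rnD (u * (u - l)) ((u - l) * l).
  have d0 := rn_ge0 (u - l).
  have X1 : rn (u * (u - l)) <= 2^-1 * rn (u - l).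
    by apply: (le_trans (rnM _ _)); rewrite ler_wpM2r.
  have X2 : rn ((u - l) * l) <= 2^-1 * rn (u - l).
    by apply: (le_trans (rnM _ _)); rewrite mulrC ler_wpM2r.
  lra.
exists (1 - y).
have -> : SV_star (1 - y) = 1 - y.
  by rewrite -scaleN1r SV_starD SV_starZ rmorphN rmorph1 ystar; congr (_ + _); apply: SV_val_inj; rewrite SV_val_star cstar1.
have -> : (1 - y) * (1 - y) = 1 - (y + y) + y * y.
  by rewrite mulrBl !mulrBr !mulr1 !mul1r opprB opprD !addrA (addrAC _ _ (- y)) addrAC.
have -> : y + y = a + y * y.
  rewrite {1 2}yfix -scalerDl -toCD.
  have -> : 2^-1 + 2^-1 = 1 :> R by field.
  by rewrite toC1 scale1r.
by rewrite opprD addrA subrK.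
Qed.

Lemma chi_flow_pos s (z : SV_alg L) : 0 <= chi (tau s (SV_star z * z)).
Proof. by rewrite flowM flow_star; exact: chipos. Qed.

(* The flow is not assumed isometric; a bound on [chi (tau s _)] uniform in [s]
   comes from its positivity, [1 - z^* z] being of the form [b^* b] for small z. *)
Lemma chi_flow_small s (z : SV_alg L) : rn (SV_val z) <= 2^-1 ->
  complex.Re (chi (tau s (SV_star z * z))) <= 1.
Proof.
move=> /SV_sqrt[b bE]; have := chi_flow_pos s b; rewrite bE flow_sub flow_one (scalarB _ _ chil).
have c1 : complex.Re (chi 1) <= 1.
  have := chib 1; have := rn_one_le; have := abs_re_nm (chi 1); have := ler_norm (complex.Re (chi 1)).
  rewrite SV_val1; lra.
rewrite (ge0_toC (chi_flow_pos s z)); case: (chi 1) c1 => u v /= u1.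
by rewrite lecE /= => /andP[_]; lra.
Qed.

Lemma chi_flow_bound s (x z : SV_alg L) (X r : R) : 0 < X -> 0 < r ->
  rn (SV_val x) <= X -> rn (SV_val z) <= r ->
  nm (chi (x * tau s z)) <= 4 * X * r /\ nm (chi (tau s z * x)) <= 4 * X * r.
Proof.
move=> X0 r0 xX zr.
(* The factor 1 / (2 r) brings z to norm 1/2, as [chi_flow_small] requires; the two terms of
   [chi_positive_mul] are then at most 1 each, and 4 X r is 2 times X times 2 r. *)
pose x' := toC (X^-1) *: x; pose z' := toC ((2 * r)^-1) *: z.
have x'1 : rn (SV_val x') <= 1.
  rewrite SV_valZ rnZ; have -> : nm (toC X^-1) = X^-1 by rewrite nm_toC ger0_norm // invr_ge0 ltW.
  by rewrite ler_pdivrMl // mulr1.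
have z'1 : rn (SV_val z') <= 2^-1.
  rewrite SV_valZ rnZ.
  have -> : nm (toC (2 * r)^-1) = (2 * r)^-1 by rewrite nm_toC ger0_norm // invr_ge0 mulr_ge0 // ltW.
  rewrite ler_pdivrMl ?mulr_gt0 //.
  by have -> : 2 * r * 2^-1 = r by field.
have xE : x = toC X *: x' by rewrite scalerA -toCM mulfV ?gt_eqF // toC1 scale1r.
have zE : z = toC (2 * r) *: z' by rewrite scalerA -toCM mulfV ?gt_eqF ?mulr_gt0 // toC1 scale1r.
have pr (y : SV_alg L) : rn (SV_val y) <= 1 -> complex.Re (chi (SV_star y * y)) <= 1.
  move=> y1; apply: (le_trans (ler_norm _)); apply: (le_trans (abs_re_nm _)).
  apply: (le_trans (chib _)); rewrite SV_valM SV_val_star rn_starM.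
  by rewrite expr_le1 // rn_ge0.
have two (k : C) : nm k <= 2 -> X * (2 * r) * nm k <= 4 * X * r.
  by move=> k2; have := mulr_gt0 X0 r0; nra.
clearbody x' z'.
have -> : chi (x * tau s z) = toC X * toC (2 * r) * chi (x' * tau s z').
  by rewrite xE zE flowZ -scalerAl -scalerAr scalerA (scalarZ _ _ chil).
have -> : chi (tau s z * x) = toC X * toC (2 * r) * chi (tau s z' * x').
  by rewrite xE zE flowZ -scalerAl -scalerAr scalerA (scalarZ _ _ chil) (mulrC (toC X)).
rewrite !nmM.
have nn (u : R) : 0 < u -> nm (toC u) = u by move=> u0; rewrite nm_toC gtr0_norm.
rewrite !nn ?mulr_gt0 //; split.
- apply: two; have := chi_positive_mul (SV_star x') (tau s z').
  rewrite SV_starK -flow_star -flowM => h; apply: (le_trans h).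
  have := chi_flow_small s z'1.
  have := pr (SV_star x'); rewrite SV_starK SV_val_star rn_star => /(_ x'1); lra.
- apply: two.
  have := chi_positive_mul (tau s (SV_star z')) x'.
  rewrite flow_star SV_starK => h; apply: (le_trans h).
  have := @chi_flow_small s (SV_star z'); rewrite SV_starK SV_val_star rn_star flowM flow_star => /(_ z'1).
  have := pr x' x'1; lra.
Qed.

End PositiveFunctional.

Section KMSTrace.
Variable chi : SV_alg L -> C.
Hypotheses (chil : scalar chi) (chipos : forall x, 0 <= chi (SV_star x * x))
  (chib : forall x, nm (chi x) <= rn (SV_val x)) (chiKMS : is_KMS tau (-1) chi).

(** Every frequency is 2 m ln q with m an integer, so each unit returns after this time. *)
Let T : R := pi / - ln q.

Let T0 : 0 < T. Proof. by rewrite divr_gt0 ?pi_gt0 // oppr_gt0. Qed.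

Let cis_period (m : int) : cis ((2 * m)%:~R * (T * ln q)) = 1 :> C.
Proof.
have -> : (2 * m)%:~R * (T * ln q) = - (m%:~R * pi *+ 2).
  rewrite /T invrN mulrN mulNr divfK ?lt_eqF // rmorphM /= mulrN; congr (- _).
  by rewrite -mulr_natl; ring.
have N (y : R) : cis y = 1 -> cis (- y) = 1 :> C.
  by move=> y1; rewrite -[LHS]mul1r -[X in X * _]y1 -cisD subrr cis0.
have H (n : nat) : cis (n%:R * pi *+ 2) = 1 :> C.
  elim: n => [|n IH]; first by rewrite mul0r mul0rn cis0.
  by rewrite -natr1 mulrDl mul1r mulrnDl cisD IH mul1r /cis cos2pi sin2pi.
apply: (N); case: m => n; first exact: H.
by rewrite NegzE rmorphN /= mulNr mulNrn; apply: (N); exact: H.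
Qed.

Let flow_period (y : SV_alg L) : uspan GT y -> tau T y = y.
Proof.
move=> ys; apply: (@uspan_ind _ _ _ GT L (fun y => tau T y = y) _ _ _ y ys).
- exact: flow_zero.
- by move=> c x1 x2 H1 H2; rewrite flow_linear H1 H2.
- by move=> N t u v; rewrite flow_unit // /freq cis_period scale1r.
Qed.

(** Exact on [uspan] by [flow_period]; the bound of [chi_flow_bound], uniform in s, carries it to
    every y by density. *)
Let chi_period (x y : SV_alg L) (s : R) : chi (x * tau (s + T) y) = chi (x * tau s y).
Proof.
apply/eqP; rewrite -subr_eq0; apply/eqP/nm_eq0/eqP; rewrite eq_le nm_ge0 andbT.
apply/ler_addgt0Pr => e e0; rewrite add0r.
pose X := rn (SV_val x) + 1; have X0 : 0 < X by rewrite ltr_wpDl ?rn_ge0.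
have xX : rn (SV_val x) <= X by rewrite lerDl.
pose r := e / (8 * X); have r0 : 0 < r by rewrite divr_gt0 // mulr_gt0.
have [y' ys yr] := uspan_dense GT y r0.
have {}yr : rn (SV_val (y - y')) <= r by rewrite SV_valB ltW.
have -> : chi (x * tau (s + T) y) - chi (x * tau s y) =
   chi (x * tau (s + T) (y - y')) - chi (x * tau s (y - y')).
  rewrite !flow_sub !mulrBr !(scalarB _ _ chil) (flowD tau s T y') flow_period //.
  by rewrite opprB addrA subrK.
have [B1 _] := chi_flow_bound chil chipos chib (s + T) X0 r0 xX yr.
have [B2 _] := chi_flow_bound chil chipos chib s X0 r0 xX yr.
apply: (le_trans (nmD _ _)); rewrite nmN; apply: (le_trans (lerD B1 B2)).
by apply: eq_ler; rewrite /r; field; rewrite gt_eqF.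
Qed.

(** The common integral differs from T a by at most 2 T M0 and from T b by at most 2 T M1. *)
Lemma cint_compare (g0 g1 : R -> C) (a b : C) (M0 M1 : R) : lcont g0 -> lcont g1 ->
  cint g0 0 T = cint g1 0 T -> (forall s, n1 (g0 s - a) <= M0) -> (forall s, n1 (g1 s - b) <= M1) ->
  n1 (a - b) <= 2 * (M0 + M1).
Proof.
move=> c0 c1 E H0 H1.
have cc (c : C) : lcont (fun _ : R => c) by split => x; exact: cst_continuous.
have ci (g : R -> C) (c : C) : lcont g -> cint (fun s => g s - c) 0 T = cint g 0 T - toC T * c.
  move=> gc; rewrite (@cint_eq _ _ (fun s => 1 * g s + (-1) * c)); last by move=> s; ring.
  rewrite cint_lin // mul1r mulN1r; congr (_ - _).
  rewrite (@cint_hor _ (fun z => c * z) (fun=> c) 0 T 0); last first.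
    move=> z; have := cderivM (cderiv_cst c z) (cderiv_id z).
    by congr (cderiv _ _ _); rewrite mul0r add0r mulr1.
  rewrite (_ : Complex 0 0 = 0) // mulr0 subr0 mulrC //.
have lc (g : R -> C) (c : C) : lcont g -> lcont (fun s => g s - c).
  move=> [k1 k2]; split.
    have -> : complex.Re (R:=R) \o (fun s => g s - c) = (fun s => (complex.Re (R:=R) \o g) s - complex.Re c).
      by apply/funext => s /=; case: (g s) (c) => ? ? [? ?].
    by move=> x; apply: continuousB; [exact: k1|exact: cst_continuous].
  have -> : complex.Im (R:=R) \o (fun s => g s - c) = (fun s => (complex.Im (R:=R) \o g) s - complex.Im c).
    by apply/funext => s /=; case: (g s) (c) => ? ? [? ?].
  by move=> x; apply: continuousB; [exact: k2|exact: cst_continuous].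
have B0 := cint_bound (ltW T0) (lc _ a c0) (fun s _ => H0 s).
have B1 := cint_bound (ltW T0) (lc _ b c1) (fun s _ => H1 s).
rewrite !subr0 ci // in B0; rewrite !subr0 ci // in B1.
have TE : n1 (toC T * (a - b)) = T * n1 (a - b).
  have Tg (t : R) (z : C) : 0 < t -> n1 (toC t * z) = t * n1 z.
    move=> t0; case: z => u v; rewrite /n1 /= !mul0r subr0 addr0 !normrM (gtr0_norm t0); ring.
  exact: Tg.
have : n1 (toC T * (a - b)) <= 2 * M0 * T + 2 * M1 * T.
  have -> : toC T * (a - b) = (cint g1 0 T - toC T * b) - (cint g0 0 T - toC T * a) by rewrite E; ring.
  by apply: (le_trans (n1D _ _)); rewrite n1N; lra.
rewrite TE -(ler_pM2l T0 (n1 _)) => h; apply: (le_trans h); apply: eq_ler; ring.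
Qed.

Lemma KMS_twisted_trace : twisted_trace chi.
Proof.
have [D [[DL DM Dst Dtau] Ddense Dorb DK]] := chiKMS.
have dense x (r : R) : 0 < r -> exists2 y, D y & rn (SV_val (x - y)) < r.
  move=> r0; have [|y Dy xy] := Ddense x (toC r); first by rewrite -toC0 toC_lt.
  by exists y => //; rewrite -toC_lt -rnE.
move=> N t u x v; set k := freq N t u; pose kl : R := k%:~R * ln q; set e := eS N t u.
have flow_e s : tau s e = cis (kl * s) *: e.
  by rewrite /e flow_unit // -/k; congr (cis _ *: _); rewrite /kl; ring.
(* By density and boundedness of chi, x may be taken in D, where the KMS condition can be used. *)
suff main x' : D x' -> chi (x' * e) = toC (expR (- kl)) * chi (e * x').
  have qk : toC (q ^ k) * toC (expR (- kl)) = 1.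
    by rewrite -expR_lnq -toCM -expRD subrr expR0 toC1.
  apply/eqP; rewrite -subr_eq0; apply/eqP/nm_eq0/eqP; rewrite eq_le nm_ge0 andbT.
  apply/ler_addgt0Pr => d d0; rewrite add0r.
  pose K := nm (toC (q ^ k)) * rn (SV_val e) + rn (SV_val e) + 1.
  have K0 : 0 < K by rewrite ltr_wpDl // addr_ge0 ?mulr_ge0 ?nm_ge0 ?rn_ge0.
  have [x' Dx' xx'] := dense x (d / K) (divr_gt0 d0 K0).
  have E : toC (q ^ k) * chi (x' * e) = chi (e * x') by rewrite main // mulrA qk mul1r.
  have -> : toC (q ^ k) * chi (x * e) - chi (e * x) = toC (q ^ k) * chi ((x - x') * e) - chi (e * (x - x')).
    rewrite mulrBl mulrBr !(scalarB _ _ chil) mulrBr E opprB addrA subrK //.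
  apply: (le_trans (nmD _ _)); rewrite nmN nmM.
  have Y1 : nm (chi ((x - x') * e)) <= rn (SV_val (x - x')) * rn (SV_val e).
    by apply: (le_trans (chib _)); rewrite SV_valM rnM.
  have Y2 : nm (chi (e * (x - x'))) <= rn (SV_val e) * rn (SV_val (x - x')).
    by apply: (le_trans (chib _)); rewrite SV_valM rnM.
  have Y3 : nm (toC (q ^ k)) * nm (chi ((x - x') * e)) <= nm (toC (q ^ k)) * (rn (SV_val (x - x')) * rn (SV_val e)).
    by rewrite ler_wpM2l ?nm_ge0.
  rewrite ltr_pdivlMr // in xx'.
  have := rn_ge0 (SV_val (x - x')); rewrite /K in xx' *; lra.
move=> Dx; apply/eqP; rewrite -subr_eq0; apply/eqP/n1_eq0/eqP; rewrite eq_le n1_ge0 andbT.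
apply/ler_addgt0Pr => d d0; rewrite add0r.
pose X := rn (SV_val x') + 1; have X0 : 0 < X by rewrite ltr_wpDl ?rn_ge0.
have xX : rn (SV_val x') <= X by rewrite lerDl.
pose W := expR (- kl); have W0 : 0 < W by exact: expR_gt0.
(* With this r the final bound 2 (8 X r + 8 X r W) is d; each 8 is the 4 of [chi_flow_bound] doubled
   in passing from [nm] to [n1]. *)
pose r := d / (16 * X * (1 + W)); have r0 : 0 < r.
  by rewrite divr_gt0 // !mulr_gt0 // addr_gt0.
have [y Dy ey] := dense e r r0.
have {}ey : rn (SV_val (y - e)) <= r by rewrite SV_valB rnB -SV_valB ltW.
have [F FO] := Dorb y Dy.
have B w : nm (chi (x' * w)) <= rn (SV_val x') * rn (SV_val w).
  by apply: (le_trans (chib _)); rewrite SV_valM rnM.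
have xl : scalar (fun w => chi (x' * w)) by move=> c w w'; rewrite mulrDr -scalerAr chil.
have fh := SV_entire_holo xl B FO.1.
have eh : holo (fun z => cexp (- ('i%C * toC kl) * z)).
  exact: holo_comp (holoM (@holo_cst _ (- ('i%C * toC kl))) (@holo_id _)) (@holo_cexp R).
(* If y were e itself, h would be the constant chi(x' e) on the real line and W chi(e x') on the
   line Im z = -1. *)
pose h z := cexp (- ('i%C * toC kl) * z) * chi (x' * F z).
have hh : holo h := holoM eh fh.
have e0 s : cexp (- ('i%C * toC kl) * toC s) = cis (- (kl * s)).
  by rewrite -cexp_iR; congr cexp; rewrite mulNr -mulrA -toCM -mulrN /toC rmorphN.
have h0 s : h (toC s) = cis (- (kl * s)) * chi (x' * tau s y) by rewrite /h e0 FO.2.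
have zs s : Complex s (-1) = Complex 0 (-1) + toC s :> C.
  by apply/eqP; rewrite eq_complex /= add0r addr0 !eqtype.eqxx.
have h1 s : h (Complex s (-1)) = cis (- (kl * s)) * (toC W * chi (tau s y * x')).
  have <- : chi (x' * F (Complex s (-1))) = chi (tau s y * x').
    (* The KMS condition is applied to tau_s(y), which lies in D and has the entire extension z |->
       F(z + s). *)
    rewrite zs; apply: (DK x' (tau s y) (fun z => F (z + toC s))) => //; first exact: Dtau.
    split; first exact: (entire_translate (toC s) FO.1).
    by move=> p; rewrite -toCD FO.2 flowD.
  rewrite /h zs mulrDr cexpD e0 mulrA [X in X * _]mulrC; congr (_ * _ * _).
  rewrite -cexp_toC; congr cexp; rewrite /toC; apply/eqP; rewrite eq_complex /=.
  by apply/andP; split; apply/eqP; ring.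
have hT s : h (toC (s + T)) = h (toC s).
  rewrite !h0 chi_period; congr (_ * _).
  have -> : - (kl * (s + T)) = - (kl * s) + - (kl * T) by ring.
  rewrite cisD; have -> : - (kl * T) = (2 * - (wt N t - wt N u))%:~R * (T * ln q).
    by rewrite /kl /k /freq mulrN rmorphN /=; ring.
  by rewrite cis_period mulr1.
have HP := holo_periodic T0 hh hT.
have c0 : lcont (fun s => h (Complex s 0)) by apply: lcont_hor => s; exact: (holo_ccont hh).
have c1 : lcont (fun s => h (Complex s (-1))) by apply: lcont_hor => s; exact: (holo_ccont hh).
have cc s : cis (- (kl * s)) * cis (kl * s) = 1 :> C by rewrite -cisD addNr cis0.
have := @cint_compare _ _ (chi (x' * e)) (toC W * chi (e * x')) (8 * X * r) (8 * X * r * W) c0 c1 HP _ _.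
move=> /(_ _ _)/le_trans; apply.
- move=> s; rewrite -[Complex s 0]/(toC s) h0.
  have -> : cis (- (kl * s)) * chi (x' * tau s y) - chi (x' * e) = cis (- (kl * s)) * chi (x' * tau s (y - e)).
    rewrite flow_sub flow_e mulrBr (scalarB _ _ chil) -scalerAr (scalarZ _ _ chil) mulrBr.
    by rewrite mulrA cc mul1r.
  apply: (le_trans (n1_le_nm _)); rewrite nmM nm_cis mul1r.
  have [B1 _] := chi_flow_bound chil chipos chib s X0 r0 xX ey; lra.
- move=> s; rewrite h1.
  have -> : cis (- (kl * s)) * (toC W * chi (tau s y * x')) - toC W * chi (e * x') =
     cis (- (kl * s)) * (toC W * chi (tau s (y - e) * x')).
    have -> : chi (tau s (y - e) * x') = chi (tau s y * x') - cis (kl * s) * chi (e * x').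
      by rewrite flow_sub flow_e mulrBl (scalarB _ _ chil) -scalerAl (scalarZ _ _ chil).
    by rewrite -[X in _ - X]mul1r -(cc s); ring.
  apply: (le_trans (n1_le_nm _)); rewrite !nmM nm_cis mul1r nm_toC gtr0_norm //.
  have [_ B1] := chi_flow_bound chil chipos chib s X0 r0 xX ey.
  have : W * nm (chi (tau s (y - e) * x')) <= W * (4 * X * r) by rewrite ler_pM2l.
  lra.
apply: eq_ler; rewrite /r; field; rewrite !gt_eqF // addr_gt0 //.
Qed.

End KMSTrace.

End Flow.

(** * Measures on the path space *)

Section PathSpace.
Implicit Types (w : Omega) (t u : seq vertex) (n N : nat).

Definition pre w n : seq vertex := mkseq (fun k => X k.+1 w) n.

Lemma X0 w : X 0 w = [::].
Proof. by have [] := set_mem (valP w). Qed.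

Lemma edge_X w n : edge (X n w) (X n.+1 w).
Proof. by have [_] := set_mem (valP w); apply. Qed.

Lemma size_pre w n : size (pre w n) = n. Proof. exact: size_mkseq. Qed.

Lemma preS w n : pre w n.+1 = rcons (pre w n) (X n.+1 w).
Proof. exact: mkseqS. Qed.

Lemma level_pre w n k : (k <= n)%N -> level (pre w n) k = X k w.
Proof. by case: k => [|k] kn; rewrite /level /= ?X0 // nth_mkseq. Qed.

Lemma last_pre w n : last [::] (pre w n) = X n w.
Proof. by case: n => [|n]; rewrite ?preS ?last_rcons //= X0. Qed.

Lemma pre_is_path w n : is_path n (pre w n).
Proof.
elim: n => [//|n IH].
by rewrite preS is_path_rcons IH last_pre edge_X.
Qed.

Lemma take_pre w n k : (k <= n)%N -> take k (pre w n) = pre w k.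
Proof.
move=> kn; apply: (@eq_from_nth _ [::]).
  by rewrite size_takel !size_pre.
by rewrite size_takel ?size_pre // => i ik; rewrite nth_take // !nth_mkseq // (leq_trans ik).
Qed.

Lemma cylinderP t w : cylinder t w <-> pre w (size t) = t.
Proof.
split=> [H|E n nt]; last by rewrite -[in RHS]E level_pre.
apply: (@eq_from_nth _ [::]); first by rewrite size_pre.
by rewrite size_pre => i it; rewrite nth_mkseq // H.
Qed.

Lemma cylinder_path N t w : is_path N t -> cylinder t w <-> pre w N = t.
Proof. by move=> /andP[_ /eqP <-]; exact: cylinderP. Qed.

Lemma Omega_of (g : nat -> seq vertex) : g 0%N = [::] ->
  (forall n, exists2 v, edge (last [::] (g n)) v & g n.+1 = rcons (g n) v) ->
  exists w, forall n, pre w n = g n.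
Proof.
move=> g0 gS; pose f n := last [::] (g n).
have fP : f \in inf_paths.
  apply/mem_set; split; first by rewrite /f g0.
  by move=> n; rewrite /f; have [v e ->] := gS n; rewrite last_rcons.
exists (Sub f fP : Omega) => n; elim: n => [|n IH]; first by rewrite g0.
rewrite preS IH; have [v e E] := gS n; rewrite E; congr rcons.
by rewrite /X /= /f E last_rcons.
Qed.

End PathSpace.

Section PathTopology.
Implicit Types (w : OmegaT) (t u : seq vertex) (n N : nat).

(** Vertices are discrete: a coordinate is read off an initial segment, and agreeing with w up to
    level n is a finite intersection of coordinate conditions. *)
Lemma nbhs_cylinder w (U : set OmegaT) :
  nbhs w U <-> exists n, forall w' : OmegaT, pre w' n = pre w n -> U w'.
Proof.
pose F : set_system OmegaT := [set V | exists n, forall w', pre w' n = pre w n -> V w'].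
have FF : Filter F.
  split.
  - by exists 0%N.
  - move=> P Q [n Pn] [m Qm]; exists (maxn n m) => w' E; split.
      by apply: Pn; rewrite -(take_pre w' (leq_maxl n m)) E take_pre // leq_maxl.
    by apply: Qm; rewrite -(take_pre w' (leq_maxr n m)) E take_pre // leq_maxr.
  - by move=> P Q PQ [n Pn]; exists n => w' /Pn /PQ.
pose PT := prod_topology (fun _ : nat => discrete_topology vertex).
split.
  have cvF : (val : Omega -> PT) @ F --> (val w : PT).
    apply/cvg_sup => i A; rewrite nbhsE => -[B [[C oC <-] Cw] BA].
    apply: filterS BA _; exists i => w' E.
    change (C (X i w')).
    by rewrite -last_pre E last_pre.
  rewrite nbhsE => -[B [[C oC <-] Cw] BU]; change (F U); apply: (filterS BU).
  by have := cvF C; apply; exact: open_nbhs_nbhs.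
move=> [n H].
have c i : nbhs w [set w' : OmegaT | X i w' = X i w].
  have pc : continuous (fun f : PT => (f i : discrete_topology vertex)).
    exact: (@proj_continuous nat (fun _ => discrete_topology vertex) i).
  have vc : continuous (val : OmegaT -> PT) by exact: initial_continuous.
  have cc : continuous ((fun f : PT => f i) \o (val : OmegaT -> PT)).
    by move=> z; apply: continuous_comp; [exact: vc|exact: pc].
  by have := cc w [set X i w]; apply; exact: discrete_set1.
have : nbhs w (\bigcap_(i < n.+1) [set w' : OmegaT | X i w' = X i w]).
  rewrite bigcap_mkord; elim/big_ind: _ => [|A B|i _]; first exact: filterT.
    exact: filterI.
  exact: c.
apply: filterS => w' Hw; apply: H; apply: (@eq_from_nth _ [::]); first by rewrite !size_pre.
by rewrite size_pre => i ni; rewrite !nth_mkseq //; exact: (Hw i.+1).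
Qed.

End PathTopology.

Lemma continuous_cylinder (R : realType) (f : OmegaT -> R) :
  (forall w (e : R), 0 < e -> exists n, forall w', pre w' n = pre w n -> `|f w - f w'| < e) ->
  continuous f.
Proof.
move=> H w U /nbhs_ballP[e e0 eU]; have [n Hn] := H w e e0.
by apply/nbhs_cylinder; exists n => w' /Hn; exact: eU.
Qed.

Lemma cylinder_continuous (R : realType) (f : OmegaT -> R) w (e : R) : continuous f -> 0 < e ->
  exists n, forall w', pre w' n = pre w n -> `|f w - f w'| < e.
Proof.
move=> fc e0; have : nbhs (w : OmegaT) (f @^-1` ball (f w) e) by apply: fc; exact: nbhsx_ballx.
by move/nbhs_cylinder.
Qed.

Section PathMeasurable.
Variable R : realType.
Implicit Types (w : OmegaM) (t u : seq vertex) (n N : nat).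

Lemma measurable_cylinder t : is_path (size t) t -> measurable (cylinder t : set OmegaM).
Proof. by move=> /andP[tp _]; apply: sub_sigma_algebra; exists t. Qed.

(** Finite paths are countable, so any condition A on the initial segment gives a countable union of
    cylinders. *)
Lemma measurable_pre_set n (A : set (seq vertex)) : measurable [set w : OmegaM | A (pre w n)].
Proof.
have -> : [set w : OmegaM | A (pre w n)] =
   \bigcup_(t in [set: seq vertex]) [set w : OmegaM | A t /\ pre w n = t].
  apply/seteqP; split=> [w Aw|w [t _ [At Et]]]; last by rewrite /= Et.
  by exists (pre w n).
apply: countable_bigcupT_measurable; first exact: countableP.
move=> t; have [At|nA] := pselect (A t /\ is_path n t); last first.
  rewrite (_ : [set _ | _] = set0) //; apply/seteqP; split => // w [At E].
  by apply: nA; split => //; rewrite -E pre_is_path.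
have tn : size t = n by case: At => _ /andP[_ /eqP].
rewrite (_ : [set _ | _] = cylinder t).
  by apply: measurable_cylinder; rewrite tn; case: At.
apply/seteqP; split=> w.
  by case=> _ E; apply/cylinderP; rewrite tn.
by move=> /cylinderP; rewrite tn => E; split => //; case: At.
Qed.

(** The preimage of an open interval is the union over n of the cylinders of length n contained in
    it. *)
Lemma continuous_measurable_path (f : OmegaM -> R) :
  continuous (f : OmegaT -> R) -> measurable_fun setT f.
Proof.
move=> fc.
apply: (measurability _ (measurable_realfun.RGenOpens.measurableE R)).
move=> _ [_ [a [b ->]] <-]; rewrite setTI.
have -> : f @^-1` `]a, b[%classic = \bigcup_(n in [set: nat])
    [set w : OmegaM | [set t | forall w', pre w' n = t -> f w' \in `]a, b[] (pre w n)].
  apply/seteqP; split=> w; last by move=> [n _ /(_ w erefl)].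
  move=> /= fw; have : nbhs (w : OmegaT) (f @^-1` `]a, b[%classic).
    apply: fc; apply: open_nbhs_nbhs; split => //; exact: interval_open.
  by move=> /nbhs_cylinder[n H]; exists n => // w' /H.
by apply: bigcupT_measurable => n; exact: measurable_pre_set.
Qed.

Lemma bounded_path_integrable (P : Prob R) (f : OmegaM -> R) (M : R) :
  measurable_fun setT f -> (forall w, `|f w| <= M) -> P.-integrable setT (EFin \o f).
Proof.
move=> mf fM; apply: measurable_bounded_integrable => //.
  by apply: (le_lt_trans (probability_le1 P measurableT)); exact: ltry.
exists M; split; first exact: num_real.
by move=> K MK w _; apply: (le_trans (fM w)); exact: ltW.
Qed.

Lemma measurable_level n (h : seq vertex -> R) : measurable_fun setT (fun w : OmegaM => h (pre w n)).
Proof. by move=> _ B _; rewrite setTI; exact: (@measurable_pre_set n (h @^-1` B)). Qed.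

Lemma Rintegral_bound (P : Prob R) (f : OmegaM -> R) (M : R) :
  measurable_fun setT f -> (forall w, `|f w| <= M) -> `|\int[P]_w f w| <= M.
Proof.
move=> mf fM; have fi := bounded_path_integrable P mf fM.
apply: (le_trans (le_normr_Rintegral measurableT fi)).
have -> : M = \int[P]_(w in setT) M.
  transitivity (M * fine (P setT)); first by rewrite probability_setT mulr1.
  by rewrite Rintegral_cst.
apply: le_Rintegral => //.
- by apply: (@bounded_path_integrable _ _ M); [exact: measurableT_comp|move=> w; rewrite normr_id].
- by apply: (@bounded_path_integrable _ _ `|M|) => //.
Qed.

Lemma Rintegral_indic (P : Prob R) (A : set OmegaM) : measurable A ->
  \int[P]_w (\1_A w) = fine (P A).
Proof. by move=> mA; rewrite /Rintegral integral_indic // setIT. Qed.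

Lemma probE (P : Prob R) (A : set OmegaM) : measurable A -> P A = (fine (P A))%:E.
Proof. by move=> mA; rewrite fineK // fin_num_measure. Qed.

(** Apart from the set function, a [probability] packs propositions only. *)
Lemma probability_eq (P Q : Prob R) : (P : set OmegaM -> \bar R) = Q -> P = Q.
Proof.
case: P Q => m c [m' c'] /= E; case: m' / E c' => c'.
congr Probability.Pack.
case: c => -[a1 a2] [a3] [a4] [a5] [a6] [a7] [a8].
case: c' => -[b1 b2] [b3] [b4] [b5] [b6] [b7] [b8].
move: b3 b4 b5 b6 b7 b8; rewrite (Prop_irrelevance b1 a1) (Prop_irrelevance b2 a2) => b3 b4 b5 b6 b7 b8.
by rewrite (Prop_irrelevance b3 a3) (Prop_irrelevance b4 a4) (Prop_irrelevance b5 a5) (Prop_irrelevance b6 a6) (Prop_irrelevance b7 a7) (Prop_irrelevance b8 a8).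
Qed.

(** Two cylinders are nested or disjoint, so together with the empty set they are stable under
    intersection. *)
Lemma probability_unique (P Q : Prob R) :
  (forall t, is_path (size t) t -> P (cylinder t) = Q (cylinder t)) ->
  forall B, measurable B -> P B = Q B.
Proof.
move=> H; pose G : set (set OmegaM) := [set A | A = set0 \/ cylinders A].
apply: (@measure_unique _ _ OmegaM G (fun=> cylinder [::])).
- apply/seteqP; split; apply: smallest_sub; try exact: smallest_sigma_algebra.
    by move=> A cA; apply: sub_sigma_algebra; right.
  move=> A [->|cA]; first exact: measurable0.
  exact: sub_sigma_algebra.
- have main t u : path edge [::] t -> path edge [::] u -> (size t <= size u)%N -> G (cylinder t `&` cylinder u).
    move=> pt pu tu; have [E|NE] := eqVneq (take (size t) u) t.
      right; exists u => //; apply/seteqP; split => w; last by case.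
      move=> cu; split => //; apply/cylinderP; rewrite -[RHS]E.
      by move/cylinderP: cu => <-; rewrite take_pre // size_pre.
    left; apply/seteqP; split => // w [/cylinderP ct /cylinderP cu].
    by move/eqP: NE; apply; rewrite -cu take_pre.
  move=> A B [->|[t pt <-]]; first by left; rewrite set0I.
  move=> [->|[u pu <-]]; first by left; rewrite setI0.
  have [tu|ut] := leqP (size t) (size u); first exact: main.
  by rewrite setIC; apply: main => //; exact: ltnW.
- by move=> _; right; exists [::].
- by rewrite bigcup_const //; apply/seteqP; split => // w _; apply/cylinderP.
- move=> A [->|[t pt <-]]; first by rewrite !measure0.
  by apply: H; rewrite /is_path pt eqtype.eqxx.
- by move=> _; apply: (le_lt_trans (probability_le1 P _)); [exact: measurable_cylinder|exact: ltry].
Qed.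

End PathMeasurable.

Lemma ler_sum_subset (R : numDomainType) (I : eqType) (s s' : seq I) (F : I -> R) : uniq s -> uniq s' ->
  {subset s <= s'} -> (forall i, 0 <= F i) -> \sum_(i <- s) F i <= \sum_(i <- s') F i.
Proof.
move=> us us' ss' F0; rewrite [leRHS](bigID (mem s)) /=.
rewrite -[X in _ <= X + _]big_filter.
suff pe : perm_eq [seq i <- s' | i \in s] s by rewrite (perm_big _ pe) lerDl sumr_ge0.
apply: uniq_perm => //; first exact: filter_uniq.
by move=> i; rewrite mem_filter; apply/andP/idP => [[]//|is_]; split => //; exact: ss'.
Qed.

(* Order the children of each vertex by their codes; the paths from the root
   then subdivide [0, 1) into nested half-open intervals of lengths p t, and the
   measure is the image of the Lebesgue measure. *)
Section TreeMeasure.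
Variables (R : realType) (p : seq vertex -> R).
Implicit Types (t u : seq vertex) (x : R).
Hypotheses (p0 : forall t, 0 <= p t) (p1 : p [::] = 1).
Hypothesis p_le : forall N t s, is_path N t -> uniq s -> all (edge (last [::] t)) s ->
  \sum_(v <- s) p (rcons t v) <= p t.
Hypothesis p_ge : forall N t (e : R), is_path N t -> 0 < e ->
  exists s, [/\ uniq s, all (edge (last [::] t)) s & p t - e < \sum_(v <- s) p (rcons t v)].

Let children t n := [seq v <- pmap (@pickle_inv vertex) (iota 0 n) | edge (last [::] t) v].

(** The offset of the child with code n inside the interval of t: the lengths of all children with
    smaller codes. *)
Let S t n : R := \sum_(v <- children t n) p (rcons t v).

Let S_step t m : S t m.+1 = S t m +
  (if @pickle_inv vertex m is Some v then if edge (last [::] t) v then p (rcons t v) else 0 else 0).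
Proof.
rewrite /S /children -addn1 iotaD pmap_cat filter_cat big_cat /= add0n.
case: pickle_inv => [v|] /=; last by rewrite big_nil.
by case: ifP => _; rewrite ?big_nil // big_seq1.
Qed.

Let S_mono t m n : (m <= n)%N -> S t m <= S t n.
Proof.
move=> mn; rewrite -(subnK mn); elim: (n - m)%N => [//|k IH].
rewrite addSn S_step; apply: (le_trans IH); rewrite lerDl.
by case: pickle_inv => // v; case: ifP.
Qed.

Let children_uniq t n : uniq (children t n).
Proof. by apply: filter_uniq; apply: (pmap_uniq (@pickle_invK vertex)); exact: iota_uniq. Qed.

Let S_le N t n : is_path N t -> S t n <= p t.
Proof. by move=> tN; apply: (p_le tN) => //; apply/allP => v; rewrite mem_filter => /andP[]. Qed.

Let S_ge N t (e : R) : is_path N t -> 0 < e -> exists n, p t - e < S t n.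
Proof.
move=> tN /(p_ge tN)[s [us /allP se H]]; exists (\max_(v <- s) choice.pickle v).+1.
apply: (lt_le_trans H); apply: ler_sum_subset => // v vs.
rewrite /children mem_filter se //=.
have -> := @mem_pmap nat vertex (@pickle_inv vertex) (iota 0 (\max_(v0 <- s) choice.pickle v0).+1) v.
rewrite -(@pickleK_inv vertex v); apply: map_f.
by rewrite mem_iota add0n ltnS leq0n /=; exact: leq_bigmax_seq.
Qed.

Let left t : R := \sum_(i < size t) S (take i t) (choice.pickle (nth [::] t i)).

Let left_rcons t v : left (rcons t v) = left t + S t (choice.pickle v).
Proof.
rewrite /left size_rcons big_ord_recr /= nth_rcons ltnn eqtype.eqxx -cats1 take_size_cat //.
congr (_ + _); apply: eq_bigr => i _.
by rewrite takel_cat ?(ltnW (ltn_ord i)) // nth_cat ltn_ord.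
Qed.

(** Half-open intervals make the children of t partition the interval of t. *)
Let J t : set R := `[left t, left t + p t[%classic.

Let IE t x : J t x <-> left t <= x /\ x < left t + p t.
Proof. by rewrite /J /= in_itv /=; split => [/andP[]|[-> ->]]. Qed.

Let S_child t v : edge (last [::] t) v -> S t (choice.pickle v).+1 = S t (choice.pickle v) + p (rcons t v).
Proof. by move=> e; rewrite S_step pickleK_inv e. Qed.

Let I_child t v x : edge (last [::] t) v ->
  J (rcons t v) x <-> S t (choice.pickle v) <= x - left t < S t (choice.pickle v).+1.
Proof.
move=> e; rewrite IE left_rcons S_child //; split=> [[h1 h2]|/andP[h1 h2]].
  by apply/andP; split; lra.
by split; lra.
Qed.

Let I_sub N t v x : is_path N.+1 (rcons t v) -> J (rcons t v) x -> J t x.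
Proof.
rewrite is_path_rcons => /andP[tN e] /(I_child x e)/andP[h1 h2].
have s0 : 0 <= S t (choice.pickle v) by apply: sumr_ge0.
by apply/IE; split; have := S_le (choice.pickle v).+1 tN; lra.
Qed.

(** The least n with x < left t + S t n is a successor m + 1, and m is the code of the child whose
    interval contains x; [p_ge] makes such an n exist. *)
Let I_exists N t x : is_path N t -> J t x -> exists2 v, edge (last [::] t) v & J (rcons t v) x.
Proof.
move=> tN /IE[h1 h2]; have [|n nP] := S_ge tN (_ : 0 < p t - (x - left t)); first by lra.
have ex : exists n, x - left t < S t n by exists n; lra.
case: (ex_minnP ex) => -[|m] mP mmin; first by move: mP; rewrite /S /children big_nil; lra.
have Sm : S t m <= x - left t by rewrite leNgt; apply/negP => /mmin; rewrite ltnn.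
have := S_step t m; case E : (@pickle_inv vertex m) => [v|]; last by lra.
case: ifP => [e _|_]; last by lra.
have vm : choice.pickle v = m by have := @pickle_invK vertex m; rewrite E.
by exists v => //; apply/(I_child x e); rewrite vm mP Sm.
Qed.

Let I_inj N t u x : is_path N t -> is_path N u -> J t x -> J u x -> t = u.
Proof.
elim: N t u => [|N IH] t u; first by move=> /andP[_ /nilP ->] /andP[_ /nilP ->].
move=> tN uN; have [t' [v [Et t'N e]]] := is_path_rconsP tN; have [u' [w [Eu u'N e']]] := is_path_rconsP uN.
rewrite Et Eu in tN uN * => It Iu.
have E := IH _ _ t'N u'N (I_sub tN It) (I_sub uN Iu); move: e' Iu; rewrite -E => e'.
move=> /(I_child x e')/andP[h1 h2]; move: It => /(I_child x e)/andP[h3 h4].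
have [lt|lt|/(pcan_inj (@pickleK_inv vertex)) -> //] := ltngtP (choice.pickle v) (choice.pickle w).
- by exfalso; have := S_mono t' lt; lra.
- by exfalso; have := S_mono t' lt; lra.
Qed.

Let path_of x : J [::] x -> exists w, forall n, J (pre w n) x.
Proof.
move=> x01.
have ex t : exists u, forall N, is_path N t -> J t x ->
   exists v, [/\ u = rcons t v, edge (last [::] t) v & J u x].
  have [[N [tN tx]]|H] := pselect (exists N, is_path N t /\ J t x).
    by have [v e vx] := I_exists tN tx; exists (rcons t v) => _ _ _; exists v.
  by exists [::] => N tN tx; exfalso; apply: H; exists N.
have [f fP] := choice ex; pose g n := iter n f [::].
have gP n : is_path n (g n) /\ J (g n) x.
  elim: n => [|n [IH1 IH2]]; first by [].
  have [v [E e vx]] := fP _ _ IH1 IH2; split; last exact: vx.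
  by rewrite /g iterS E is_path_rcons IH1.
have [//||w wP] := @Omega_of g.
  by move=> n; have [v [E e _]] := fP _ _ (gP n).1 (gP n).2; exists v.
by exists w => n; rewrite wP; exact: (gP n).2.
Qed.

Let F (x : measurableTypeR R) : OmegaM := xget point [set w | forall n, J (pre w n) x].

Let FP x : J [::] x -> forall n, J (pre (F x) n) x.
Proof. by rewrite /F => /path_of[w wP]; case: xgetP => [w' _ //|/(_ w)]. Qed.

Let I_root N t : is_path N t -> J t `<=` J [::].
Proof.
elim: N t => [|N IH] t tN x; first by case/andP: tN => _ /nilP ->.
have [t' [v [Et t'N e]]] := is_path_rconsP tN.
by rewrite Et in tN * => /(I_sub tN); exact: IH.
Qed.

Let F_cylinder N t : is_path N t -> J [::] `&` F @^-1` cylinder t = J t.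
Proof.
move=> tN; apply/seteqP; split=> x.
  by move=> [x0 /(cylinder_path _ tN) E]; have := FP x0 N; rewrite E.
move=> xt; have x0 := I_root tN xt; split => //; apply/(cylinder_path _ tN).
exact: I_inj (pre_is_path _ _) tN (FP x0 N) xt.
Qed.

Let mF : measurable_fun (J [::] : set (measurableTypeR R)) F.
Proof.
apply: (@measurability _ _ (measurableTypeR R) OmegaM (J [::]) F cylinders) => // _ [_ [t tp <-] <-].
rewrite (@F_cylinder (size t)); first exact: measurable_itv.
by apply/andP.
Qed.

Let mI B : measurable B -> measurable (J [::] `&` F @^-1` B).
Proof. by move=> mB; apply: mF => //; exact: measurable_itv. Qed.

(** The value 0 outside the sigma-algebra is the normalisation required by [Central]. *)
Definition tree_measure (B : set OmegaM) : \bar R :=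
  if asbool (measurable B) then lebesgue_measure (J [::] `&` F @^-1` B) else 0%E.

Let tree_measure0 : tree_measure set0 = 0%E.
Proof. by rewrite /tree_measure preimage_set0 setI0 measure0; case: ifP. Qed.

Let tree_measure_ge0 B : (0 <= tree_measure B)%E.
Proof. by rewrite /tree_measure; case: ifP. Qed.

Let tree_measure_sigma : semi_sigma_additive tree_measure.
Proof.
move=> B mB tB mUB; rewrite /tree_measure asboolT // preimage_bigcup setI_bigcupr.
under eq_fun do under eq_bigr do rewrite asboolT //.
apply: measure_semi_sigma_additive.
- by move=> n; exact: mI.
- apply/trivIsetP => i j _ _ ij; rewrite setIACA -[X in _ `&` X]preimage_setI.
  by move/trivIsetP : tB => /(_ _ _ I I ij) ->; rewrite ?preimage_set0 ?setI0.
- by rewrite -setI_bigcupr -preimage_bigcup; exact: mI.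
Qed.

HB.instance Definition _ := isMeasure.Build _ _ _ tree_measure
  tree_measure0 tree_measure_ge0 tree_measure_sigma.

Let tree_measure_cylinder N t : is_path N t -> tree_measure (cylinder t) = (p t)%:E.
Proof.
move=> tN; rewrite /tree_measure asboolT; last first.
  by apply: measurable_cylinder; case/andP: tN => tp _; rewrite /is_path tp eqtype.eqxx.
rewrite (F_cylinder tN) /J lebesgue_measure_itv /= lte_fin ltrDl.
have := p0 t; rewrite le_eqVlt => /predU1P[<-|->]; first by rewrite ltxx.
by rewrite -EFinB addrAC subrr add0r.
Qed.

Let tree_measureT : tree_measure setT = 1%E.
Proof.
have -> : setT = cylinder [::] by apply/seteqP; split => // w _; apply/cylinderP.
by rewrite (@tree_measure_cylinder 0) // p1.
Qed.

HB.instance Definition _ := Measure_isProbability.Build _ _ _ tree_measure tree_measureT.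

Lemma tree_measure_exists : exists P : Prob R, (forall B : set OmegaM, ~ measurable B -> P B = 0%E) /\
  forall t, is_path (size t) t -> P (cylinder t) = (p t)%:E.
Proof.
exists (tree_measure : Prob R); split => [B mB|t]; last exact: tree_measure_cylinder.
by rewrite /= /tree_measure asboolF.
Qed.

End TreeMeasure.

(** * From central measures to quantized characters *)

(* A functional bounded on a dense family extends to the whole algebra: the real
   part is extended by the formula [E x = sup_i (Re (phi i) - |x - D i|)]. *)
Section Extension.
Variables (R : realType) (A : cstar_alg R) (I : Type) (D : I -> A) (phi : I -> Cx R).
Local Notation C := (Cx R).
Hypotheses (i0 : I) (dense : forall x (e : R), 0 < e -> exists i, rn (x - D i) < e).
Hypothesis comb : forall (c : C) i j, exists m, D m = c *: D i + D j /\ phi m = c * phi i + phi j.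
Hypothesis bound : forall i, complex.Re (phi i) <= rn (D i).

Let rho i : R := complex.Re (phi i).

(** In particular the real part of phi i depends only on D i, although several indices may give the
    same vector. *)
Let lip i j : rho i - rho j <= rn (D i - D j).
Proof.
have [m [Dm pm]] := comb (-1) j i; have := bound m.
rewrite Dm pm scaleN1r mulN1r addrC [X in _ -> _ <= rn X]addrC.
by rewrite /rho; case: (phi i) (phi j) => ? ? [? ?].
Qed.

Let vals x : set R := [set rho i - rn (x - D i) | i in setT].

Let vals_sup x : has_sup (vals x).
Proof.
split; first by exists (rho i0 - rn (x - D i0)), i0.
exists (rho i0 + rn (x - D i0)) => _ [i _ <-].
have := lip i i0; have := rn_triangle (D i) x (D i0); rewrite (rnB (D i) x); lra.
Qed.

Let E x : R := sup (vals x).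

Let E_ge x i : rho i - rn (x - D i) <= E x.
Proof. by apply: sup_upper_bound; [exact: vals_sup|exists i]. Qed.

Let E_le x y : E x <= E y + rn (x - y).
Proof.
apply: ge_sup; first by case: (vals_sup x).
move=> _ [i _ <-]; have := E_ge y i; have := rn_triangle y x (D i); rewrite (rnB y x); lra.
Qed.

Let E_D i : E (D i) = rho i.
Proof.
apply/eqP; rewrite eq_le; apply/andP; split.
  apply: ge_sup; first by case: (vals_sup (D i)).
  by move=> _ [j _ <-]; have := lip j i; rewrite (rnB (D i)); lra.
by have := E_ge (D i) i; rewrite subrr rn0 subr0.
Qed.

(** [E] is 1-Lipschitz and agrees with the linear [rho] on the dense family, so linearity holds up
    to every e. *)
Let E_linear (k : R) x y : E (toC k *: x + y) = k * E x + E y.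
Proof.
apply/eqP; rewrite -subr_eq0 -normr_eq0 eq_le normr_ge0 andbT; apply/ler_addgt0Pr => e e0; rewrite add0r.
have k0 : 0 < 4 * (`|k| + 1) by rewrite mulr_gt0 // ltr_wpDl.
have [i xi] := dense x (divr_gt0 e0 k0); have [j yj] := dense y (divr_gt0 e0 (ltr0n R 4)).
have [m [Dm pm]] := comb (toC k) i j.
have rm : rho m = k * rho i + rho j.
  by rewrite /rho pm; case: (phi i) (phi j) => a b [c d] /=; ring.
have := E_le x (D i); have := E_le (D i) x; have := E_le y (D j); have := E_le (D j) y.
have := E_le (toC k *: x + y) (D m); have := E_le (D m) (toC k *: x + y).
rewrite !E_D (rnB (D i)) (rnB (D j)) (rnB (D m)) rm.
have -> : toC k *: x + y - D m = toC k *: (x - D i) + (y - D j).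
  by rewrite Dm scalerBr opprD addrACA.
have := rnD (toC k *: (x - D i)) (y - D j); rewrite rnZ nm_toC.
rewrite ltr_pdivlMr // in xi.
set a := rn _; set b := rn (x - D i) in xi *; set d := rn (y - D j) in yj *.
set Z := E (_ + y); move=> H1 H2 H3 H4 H5 H6 H7.
have b0 : 0 <= b := rn_ge0 _; have kk : 0 <= `|k| := normr_ge0 _.
have K1 : `|k * (E x - rho i)| <= `|k| * b.
  by rewrite normrM ler_wpM2l // ler_norml; apply/andP; split; lra.
have -> : Z - (k * E x + E y) = (Z - (k * rho i + rho j)) - k * (E x - rho i) + (rho j - E y) by ring.
apply: (le_trans (ler_normD _ _)); apply: (le_trans (lerD (ler_normB _ _) (lexx _))).
have K2 : `|Z - (k * rho i + rho j)| <= `|k| * b + d by rewrite ler_norml; apply/andP; split; lra.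
have K3 : `|rho j - E y| <= d by rewrite ler_norml; apply/andP; split; lra.
nra.
Qed.

(** A complex functional is recovered from its real part by Im chi(x) = - Re chi(ix). *)
Let chi x : C := Complex (E x) (- E ('i%C *: x)).

Let E_add x y : E (x + y) = E x + E y.
Proof. by have := E_linear 1 x y; rewrite toC1 scale1r mul1r. Qed.

Let E0 : E 0 = 0.
Proof. by have := E_add 0 0; rewrite addr0; lra. Qed.

Let E_scale (k : R) x : E (toC k *: x) = k * E x.
Proof. by have := E_linear k x 0; rewrite !addr0 E0 addr0. Qed.

Let chiZ c x : chi (c *: x) = c * chi x.
Proof.
case: c => a b.
have cE : Complex a b *: x = toC a *: x + toC b *: ('i%C *: x).
  rewrite scalerA -scalerDl; congr (_ *: _); apply/eqP; rewrite eq_complex /=.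
  by apply/andP; split; apply/eqP; ring.
have iE : 'i%C *: (Complex a b *: x) = toC (- b) *: x + toC a *: ('i%C *: x).
  rewrite !scalerA -scalerDl; congr (_ *: _); apply/eqP; rewrite eq_complex /=.
  by apply/andP; split; apply/eqP; ring.
rewrite /chi iE cE !E_add !E_scale; apply/eqP; rewrite eq_complex /=.
by apply/andP; split; apply/eqP; ring.
Qed.

Lemma extend_functional : exists f : A -> C,
  [/\ scalar f, forall x, nm (f x) <= rn x & forall i, f (D i) = phi i].
Proof.
exists chi; split.
- move=> c x y; rewrite -chiZ /chi scalerDr !E_add.
  by apply/eqP; rewrite eq_complex /= !eqtype.eqxx /=; apply/eqP; ring.
- move=> x; have [-> |z0] := eqVneq (chi x) 0; first by rewrite nm0 rn_ge0.
  (* The phase u turns chi(x) to the positive axis, so that the bound on the real part bounds the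
     modulus. *)
  pose u : C := Num.conj (chi x) / toC (nm (chi x)).
  have n0 : nm (chi x) != 0 by apply: contra z0 => /eqP/nm_eq0 ->.
  have np : 0 < nm (chi x) by rewrite lt_neqAle eq_sym n0 nm_ge0.
  have nT : toC (nm (chi x)) != 0 by apply: contra n0 => /eqP; rewrite -toC0 => /toC_inj ->.
  have E1 : chi (u *: x) = toC (nm (chi x)).
    rewrite chiZ /u mulrAC (mulrC (Num.conj _)) -normCK nmE.
    by apply: (mulIf nT); rewrite divfK // expr2.
  have nu : nm u = 1.
    rewrite /u nmM nm_conj.
    have -> : nm (toC (nm (chi x)))^-1 = (nm (chi x))^-1.
      by apply: toC_inj; rewrite -nmE normfV nmE nm_toC gtr0_norm // /toC fmorphV.
    by rewrite mulfV.
  have -> : nm (chi x) = E (u *: x) by have := congr1 (@complex.Re R) E1.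
  by have := E_le (u *: x) 0; rewrite E0 add0r subr0 rnZ nu mul1r.
- move=> i; have [m [Dm pm]] := comb 'i%C i i.
  have rD : rho m = - complex.Im (phi i) + rho i by rewrite /rho pm; case: (phi i) => a b /=; ring.
  have := E_D m; rewrite Dm E_add rD E_D => H.
  rewrite /chi E_D /rho; apply/eqP; rewrite eq_complex /= eqtype.eqxx /=; apply/eqP; lra.
Qed.

End Extension.

Section Mass.
Variable R : realType.
Implicit Types (P : Prob R) (t u : seq vertex) (n N : nat).

Definition mass P t : R := fine (P (cylinder t)).

Lemma mass_ge0 P t : 0 <= mass P t. Proof. by apply: fine_ge0; exact: measure_ge0. Qed.

Lemma is_path_size N t : is_path N t -> is_path (size t) t.
Proof. by move=> /[dup] /andP[_ /eqP ->]. Qed.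

Lemma massE P N t : is_path N t -> P (cylinder t) = (mass P t)%:E.
Proof. by move=> /is_path_size/measurable_cylinder/probE. Qed.

Lemma mass_root P : mass P [::] = 1.
Proof.
rewrite /mass (_ : cylinder [::] = setT) ?probability_setT //.
by apply/seteqP; split => // w _; apply/cylinderP.
Qed.

Lemma prob_paths P N (s : seq (seq vertex)) : uniq s -> all (is_path N) s ->
  P [set w : OmegaM | pre w N \in s] = (\sum_(t <- s) mass P t)%:E.
Proof.
elim: s => [|t s IH] /=.
  by move=> _ _; rewrite big_nil (_ : [set _ | _] = set0) ?measure0 //; apply/seteqP; split.
move=> /andP[ts us] /andP[tN sN]; rewrite big_cons EFinD -IH // -(massE P tN) -measureU.
- congr (P _); apply/seteqP; split=> w /=; rewrite inE.
    by move=> /orP[/eqP E|H]; [left; apply/(cylinder_path _ tN)|right].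
  by case=> [/(cylinder_path _ tN) ->|->]; rewrite ?eqtype.eqxx ?orbT.
- by apply: measurable_cylinder; exact: is_path_size tN.
- exact: (@measurable_pre_set N [set t | t \in s]).
- apply/seteqP; split => // w [/(cylinder_path _ tN) E] /=; rewrite E => ts'.
  by rewrite ts' in ts.
Qed.

Lemma mass_sum_le1 P N (s : seq (seq vertex)) : uniq s -> all (is_path N) s ->
  \sum_(t <- s) mass P t <= 1.
Proof.
move=> us sN; rewrite -lee_fin -(prob_paths P us sN); apply: probability_le1.
exact: (@measurable_pre_set N [set t | t \in s]).
Qed.

Lemma exhaust P (A : nat -> set OmegaM) (e : R) : (forall n, measurable (A n)) ->
  (forall n m, (n <= m)%N -> A n `<=` A m) -> (forall w, exists n, A n w) -> 0 < e ->
  exists n, 1 - e < fine (P (A n)).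
Proof.
move=> mA Am Aw e0.
have cup : \bigcup_n A n = setT by apply/seteqP; split => // w _; have [n ?] := Aw w; exists n.
have : P \o A @ \oo --> P (\bigcup_n A n).
  apply: nondecreasing_cvg_mu => //; first exact: bigcupT_measurable.
  by move=> n m nm; apply/subsetPset; exact: Am.
rewrite cup probability_setT => /fine_cvgP[_ /cvgrPdist_lt/(_ e e0)[n _ Hn]].
exists n; have := Hn n (leqnn n) => /=; rewrite ltr_norml => /andP[_]; lra.
Qed.

Lemma mass_exhaust P N (e : R) : 0 < e ->
  exists s, [/\ uniq s, all (is_path N) s & 1 - e < \sum_(t <- s) mass P t].
Proof.
move=> e0; pose s n := [seq t <- pmap (@pickle_inv (seq vertex)) (iota 0 n) | is_path N t].
have us n : uniq (s n).
  by apply: filter_uniq; apply: (pmap_uniq (@pickle_invK (seq vertex))); exact: iota_uniq.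
have sN n : all (is_path N) (s n) by apply/allP => t; rewrite mem_filter => /andP[].
have sE n t : (t \in s n) = is_path N t && (choice.pickle t < n)%N.
  rewrite mem_filter; congr (_ && _).
  have -> := @mem_pmap nat (seq vertex) (@pickle_inv (seq vertex)) (iota 0 n) t.
  apply/mapP/idP => [[k + E]|tn].
    have := @pickle_invK (seq vertex) k; rewrite -E /= => ->.
    by rewrite mem_iota add0n.
  by exists (choice.pickle t); rewrite ?pickleK_inv // mem_iota add0n.
have [|||n] := @exhaust P (fun n => [set w : OmegaM | pre w N \in s n]) e _ _ _ e0.
- by move=> n; exact: (@measurable_pre_set N [set t | t \in s n]).
- move=> n m nm w /=; rewrite !sE => /andP[-> h]; exact: leq_trans nm.
- by move=> w; exists (choice.pickle (pre w N)).+1; rewrite /= sE pre_is_path ltnSn.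
- by rewrite (prob_paths P (us n) (sN n)) /= => H; exists (s n).
Qed.

End Mass.

Section LevelIntegral.
Variables (R : realType) (P : Prob R) (N : nat).
Local Notation C := (Cx R).

Definition bdd (h : seq vertex -> R) := exists M : R, forall t, is_path N t -> `|h t| <= M.

Definition lint (h : seq vertex -> R) : R := \int[P]_w h (pre w N).

Lemma lint_integrable h : bdd h -> P.-integrable setT (EFin \o (fun w : OmegaM => h (pre w N))).
Proof.
move=> [M hM]; apply: (bounded_path_integrable P (measurable_level N h) (M := M)) => w.
exact: hM (pre_is_path w N).
Qed.

Lemma bdd_lin (a b : R) h g : bdd h -> bdd g -> bdd (fun t => a * h t + b * g t).
Proof.
move=> [M hM] [K gK]; exists (`|a| * M + `|b| * K) => t tN.
by apply: (le_trans (ler_normD _ _)); rewrite !normrM lerD // ler_wpM2l // ?hM ?gK.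
Qed.

Lemma lint_lin (a b : R) h g : bdd h -> bdd g ->
  lint (fun t => a * h t + b * g t) = a * lint h + b * lint g.
Proof.
move=> hb gb; have z : bdd (fun=> 0) by exists 0 => t _; rewrite normr0.
have sc (c : R) k : bdd k -> P.-integrable setT (EFin \o (fun w : OmegaM => c * k (pre w N))).
  move=> kb; have := lint_integrable (bdd_lin c 0 kb z).
  by congr (P.-integrable _ _); apply/funext => w /=; rewrite mulr0 addr0.
rewrite /lint RintegralD //; [|exact: sc|exact: sc].
by rewrite !RintegralZl //; exact: lint_integrable.
Qed.

Lemma lint_bound h (M : R) : (forall t, is_path N t -> `|h t| <= M) -> `|lint h| <= M.
Proof.
move=> hM; apply: Rintegral_bound; first exact: measurable_level.
by move=> w; apply: hM; exact: pre_is_path.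
Qed.

Lemma lint_ge0 h : (forall t, is_path N t -> 0 <= h t) -> 0 <= lint h.
Proof. by move=> h0; apply: Rintegral_ge0 => w _; apply: h0; exact: pre_is_path. Qed.

Definition cbdd (h : seq vertex -> C) := exists M : R, forall t, is_path N t -> nm (h t) <= M.

Definition clint (h : seq vertex -> C) : C :=
  Complex (lint (fun t => complex.Re (h t))) (lint (fun t => complex.Im (h t))).

Lemma cbdd_re h : cbdd h -> bdd (fun t => complex.Re (h t)).
Proof. by move=> [M hM]; exists M => t /hM; apply: le_trans; exact: abs_re_nm. Qed.
Lemma cbdd_im h : cbdd h -> bdd (fun t => complex.Im (h t)).
Proof. by move=> [M hM]; exists M => t /hM; apply: le_trans; exact: abs_im_nm. Qed.

Lemma eq_lint h g : (forall t, is_path N t -> h t = g t) -> lint h = lint g.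
Proof. by move=> hg; apply: eq_Rintegral => w _; apply: hg; exact: pre_is_path. Qed.

Lemma clint_lin (c : C) h g : cbdd h -> cbdd g -> clint (fun t => c * h t + g t) = c * clint h + clint g.
Proof.
move=> hb gb; case: c => a b; rewrite /clint.
have hr := cbdd_re hb; have hi := cbdd_im hb; have gr := cbdd_re gb; have gi := cbdd_im gb.
have -> : lint (fun t => complex.Re (Complex a b * h t + g t)) =
   1 * lint (fun t => a * complex.Re (h t) + (- b) * complex.Im (h t)) + 1 * lint (fun t => complex.Re (g t)).
  rewrite -lint_lin //; last exact: bdd_lin.
  by apply: eq_lint => t _; case: (h t) (g t) => ? ? [? ?] /=; ring.
have -> : lint (fun t => complex.Im (Complex a b * h t + g t)) =
   1 * lint (fun t => a * complex.Im (h t) + b * complex.Re (h t)) + 1 * lint (fun t => complex.Im (g t)).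
  rewrite -lint_lin //; last exact: bdd_lin.
  by apply: eq_lint => t _; case: (h t) (g t) => ? ? [? ?] /=; ring.
rewrite !lint_lin //; apply/eqP; rewrite eq_complex /=; apply/andP; split; apply/eqP; ring.
Qed.

Lemma lint_indic (k : bool) (t : seq vertex) : is_path N t ->
  lint (fun u => ((u == t) && k)%:R) = k%:R * mass P t.
Proof.
move=> tN; rewrite /mass -Rintegral_indic; last by apply: measurable_cylinder; exact: is_path_size tN.
rewrite -RintegralZl //; last first.
  apply: (@bounded_path_integrable _ _ _ 1).
    by apply: measurable_realfun.measurable_indic; apply: measurable_cylinder; exact: is_path_size tN.
  by move=> w; rewrite indicE; case: (_ \in _); rewrite ?normr1 ?normr0.
apply: eq_Rintegral => w _; rewrite indicE -natrM mulnb andbC; congr ((_ && _)%:R).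
by apply/eqP/idP => [E|]; [apply/mem_set/(cylinder_path _ tN)|move/set_mem/(cylinder_path _ tN)].
Qed.

End LevelIntegral.

Section StateOfMeasure.
Variables (R : realType) (q : R) (UU : quantum_unitary_system q) (GT : GT_bases UU).
Variables (L : cstar_limit UU) (P : Prob R).
Local Notation C := (Cx R).
Local Notation coef := (coef GT).
Local Notation eS := (eS GT L).
Implicit Types (N M : nat) (t u : seq vertex).

Let diag N (f : UU N -> C) t : C := f (coef N t t).

Let diag_bdd N (f : UU N -> C) : Wstar f -> cbdd N (diag f).
Proof. by move=> fW; exists (rn (lim_map L f)) => t _; exact: rn_coef. Qed.

Let phi N (f : UU N -> C) : C := clint P N (diag f).

(** Makes the integral independent of the level at which an element of the limit is represented. *)
Let phi_lift N K (f : UU N -> C) (g : UU K -> C) : (N <= K)%N ->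
  (forall t, is_path K t -> g (coef K t t) = f (coef N (take N t) (take N t))) -> phi g = phi f.
Proof.
move=> NK gf; rewrite /phi /clint /lint; apply/eqP; rewrite eq_complex /=; apply/andP; split; apply/eqP.
  by apply: eq_Rintegral => w _; rewrite /diag gf ?pre_is_path // take_pre.
by apply: eq_Rintegral => w _; rewrite /diag gf ?pre_is_path // take_pre.
Qed.

(** The index type for [extend_functional]: elements of all W*(U_q(N)), one vector of L being given
    by many indices. *)
Let I := {N : nat & {f : UU N -> C | Wstar f}}.

Let chi_exists : exists chi : L -> C, [/\ scalar chi, forall x, nm (chi x) <= rn x &
  forall N (f : UU N -> C), Wstar f -> chi (lim_map L f) = phi f].
Proof.
pose D (i : I) : L := lim_map L (sval (projT2 i)).
pose F (i : I) : C := phi (sval (projT2 i)).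
have [| | | |chi [chil chib chiD]] := @extend_functional R L I D F.
- exact: (existT _ 0%N (exist _ _ (Wstar0 UU 0))).
- move=> x e e0; have [|N [f [fW xf]]] := lim_map_dense x (_ : 0 < toC e); first by rewrite -toC0 toC_lt.
  by exists (existT _ N (exist _ f fW)); rewrite -toC_lt -rnE.
- move=> c [N [f fW]] [M [g gW]].
  (* Both elements are lifted to a common level before being combined. *)
  have [f' [f'W f'f f'E]] := lift_to GT L (leq_maxl N M) fW.
  have [g' [g'W g'g g'E]] := lift_to GT L (leq_maxr N M) gW.
  exists (existT _ (maxn N M) (exist _ _ (Wstar_comb GT c f'W g'W))); rewrite /D /F /=; split.
    by rewrite lim_map_linear // f'f g'g.
  have -> : phi f = phi f'.
    by apply/esym/(phi_lift (leq_maxl N M)) => t tK; rewrite f'E // eqtype.eqxx.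
  have -> : phi g = phi g'.
    by apply/esym/(phi_lift (leq_maxr N M)) => t tK; rewrite g'E // eqtype.eqxx.
  exact: (clint_lin P c (diag_bdd f'W) (diag_bdd g'W)).
- move=> [N [f fW]]; rewrite /D /F /=; apply: (le_trans (ler_norm _)); apply: lint_bound => t _.
  by apply: (le_trans (abs_re_nm _)); exact: rn_coef.
exists chi; split => // N f fW; exact: (chiD (existT _ N (exist _ f fW))).
Qed.

Let phi_ge0 N (f : UU N -> C) : (forall t, is_path N t -> 0 <= f (coef N t t)) -> 0 <= phi f.
Proof.
move=> f0; rewrite lecE /=; apply/andP; split.
  rewrite (_ : lint P N _ = 0) ?eqtype.eqxx // -[RHS](@normr0_eq0 _ R 0) ?normr0 //.
  apply/eqP; rewrite -normr_eq0 eq_le normr_ge0 andbT; apply: lint_bound => t /f0.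
  by rewrite lecE /diag => /andP[/eqP -> _]; rewrite normr0.
by apply: lint_ge0 => t /f0; rewrite lecE => /andP[].
Qed.

Lemma ge0_closed (c : C) : (forall e : R, 0 < e -> exists2 z : C, 0 <= z & nm (c - z) <= e) -> 0 <= c.
Proof.
move=> H; rewrite lecE /=; apply/andP; split.
  rewrite -normr_eq0 eq_le normr_ge0 andbT; apply/ler_addgt0Pr => e e0; rewrite add0r.
  have [z z0 cz] := H e e0; apply: le_trans cz; apply: le_trans (abs_im_nm _).
  by move: z0; rewrite lecE; case: z c {H} => a b [a' b'] /= /andP[/eqP ->]; rewrite subr0.
apply/ler_addgt0Pr => e e0; have [z z0 cz] := H e e0.
have := le_trans (abs_re_nm _) cz; rewrite ler_norml => /andP[h _].
by move: z0 h; rewrite lecE; case: z c {H cz} => a b [a' b'] /= /andP[_]; lra.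
Qed.

Lemma eL_root : eL GT L 0 [::] [::] = 1.
Proof.
rewrite -(lim_map1 L 0) /eL; apply: (lim_ext L (GT := GT)).
- exact: unit_fun_Wstar.
- exact: counit_scalar.
- move=> t u pt pu tu; rewrite unit_funE // counit_coef //.
  have /nilP -> : nilp t by case/andP: pt.
  by have /nilP -> : nilp u by case/andP: pu.
Qed.

Lemma state_of_measure : exists chi : L -> C,
  [/\ scalar chi, forall x, nm (chi x) <= rn x, forall x, 0 <= chi (Defs.cstar x * x) &
   forall N t u, valid N t u -> chi (eL GT L N t u) = toC ((t == u)%:R * mass P t)].
Proof.
have [chi [chil chib chiE]] := chi_exists; exists chi; split => //.
- move=> x; apply: ge0_closed => e e0.
  (* With d <= 1 the approximation y has norm at most |x| + 1, so y^* y is within d (2 |x| + 1) of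
     x^* x. *)
  pose d := Num.min 1 (e / (2 * rn x + 2)).
  have x0 := rn_ge0 x; have k0 : 0 < 2 * rn x + 2 by lra.
  have d0 : 0 < d by rewrite lt_min ltr01 divr_gt0.
  have [|N [f [fW xf]]] := lim_map_dense x (_ : 0 < toC d); first by rewrite -toC0 toC_lt.
  move: xf; rewrite rnE toC_lt; set y := lim_map L f => xy.
  exists (chi (Defs.cstar y * y)).
    have sW := Wstar_dual_star GT fW.
    rewrite /y -(lim_map_star L fW) -(lim_mapM L sW fW) (chiE _ _ (Wstar_conv GT sW fW)).
    apply: phi_ge0 => t /[dup] /path_end[nu nut] tN.
    (* The diagonal coefficients of f^* f are sums of squared moduli. *)
    rewrite (conv_coef GT (nu := nu)) //; [|exact: scalar_dual_star fW.1|exact: fW.1].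
    apply: sumr_ge0 => k _; rewrite dual_star_coef; last exact: fW.1.
    by rewrite mulrC -normCK exprn_ge0.
  rewrite -(scalarB _ _ chil); apply: (le_trans (chib _)).
  have -> : Defs.cstar x * x - Defs.cstar y * y = Defs.cstar x * (x - y) + Defs.cstar (x - y) * y.
    by rewrite cstarD cstarN mulrBr mulrBl addrA subrK.
  apply: (le_trans (rnD _ _)).
  have := rnM (Defs.cstar x) (x - y); have := rnM (Defs.cstar (x - y)) y; rewrite !rn_star.
  have := rn_triangle y x 0; rewrite !subr0 (rnB y).
  move: xy; rewrite lt_min ltr_pdivlMr // => /andP[d1 d2].
  have := rn_ge0 (x - y); have := rn_ge0 y; nra.
- move=> N t u v; rewrite /eL chiE; last exact: unit_fun_Wstar.
  have [vt vu tu] := and3P v.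
  rewrite /phi /clint /toC; apply/eqP; rewrite eq_complex /=.
  have E (s : seq vertex) : is_path N s -> diag (unit_fun GT N t u) s = toC ((s == t) && (t == u))%:R.
    move=> sN; rewrite /diag unit_funE //.
    have -> : (s == t) && (s == u) = (s == t) && (t == u) by case: (s =P t) => [->|].
    by rewrite /toC rmorph_nat.
  apply/andP; split; apply/eqP.
    rewrite -(lint_indic P (t == u) vt); apply: eq_lint => s sN.
    by rewrite E.
  rewrite (eq_lint P (g := fun=> 0)); last by move=> s sN; rewrite E.
  by rewrite /lint Rintegral_cst // mul0r.
Qed.

End StateOfMeasure.

(** * Centrality in terms of cylinder masses *)

Section CentralMeasures.
Variables (R : realType) (q : R) (UU : quantum_unitary_system q) (GT : GT_bases UU).
Hypothesis q01 : 0 < q < 1.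
Implicit Types (N M : nat) (t u : seq vertex) (P : Prob R).

Let q0 : 0 < q. Proof. by case/andP: q01. Qed.

Definition gt_paths N (nu : Sign N) := [seq @gt_path _ _ _ GT N nu i | i : 'I_(gt_dim GT nu)].

Lemma gt_paths_uniq N (nu : Sign N) : uniq (gt_paths nu).
Proof. by rewrite map_inj_uniq ?enum_uniq //; exact: gt_path_inj. Qed.

Lemma mem_gt_paths N (nu : Sign N) t : t \in gt_paths nu <-> paths_to nu t.
Proof.
split=> [/mapP[i _ ->]|/(gt_index GT)[i <-]]; first exact: gt_path_to.
by apply: map_f; rewrite mem_enum.
Qed.

Lemma sum_paths_to N (nu : Sign N) (F : seq vertex -> R) :
  \sum_(s \in paths_to nu) F s = \sum_(i < gt_dim GT nu) F (gt_path i).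
Proof.
have -> : paths_to nu = [set` gt_paths nu] by apply/seteqP; split => t /mem_gt_paths.
by rewrite -fsbig_seq ?gt_paths_uniq // big_map big_enum.
Qed.

Lemma prob_at_level P N (nu : Sign N) :
  P (at_level N nu) = (\sum_(i < gt_dim GT nu) mass P (gt_path i))%:E.
Proof.
have -> : at_level N nu = [set w : OmegaM | pre w N \in gt_paths nu].
  apply/seteqP; split=> w /=.
    move=> E; apply/mem_gt_paths; rewrite /paths_to /= last_pre E eqtype.eqxx andbT.
    by case/andP: (pre_is_path w N).
  by move=> /mem_gt_paths/paths_to_last; rewrite last_pre.
rewrite prob_paths ?gt_paths_uniq //; first by rewrite big_map big_enum.
by apply/allP => t /mem_gt_paths/paths_to_is_path.
Qed.

Lemma path_weightE N t : is_path N t -> path_weight q t = q ^ (2 * wt N t).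
Proof. by rewrite /path_weight /wt => /andP[_ /eqP ->]. Qed.

Lemma path_weight_gt0 t : 0 < path_weight q t.
Proof. exact: exprz_gt0. Qed.

Lemma path_weight_freq N t u : is_path N t -> is_path N u ->
  path_weight q t = q ^ freq N t u * path_weight q u.
Proof.
move=> tN uN; rewrite !(@path_weightE N) // -expfzDr ?gt_eqF //; congr (_ ^ _).
by rewrite /freq; ring.
Qed.

(** Centrality as ratios of masses, without normalising sums: the form that the twisted trace
    produces. *)
Definition central_mass P := forall N t u, valid N t u -> mass P t = q ^ freq N t u * mass P u.

(** Summing the ratios over all paths to nu recovers the normalising sum. *)
Lemma central_massP P : (forall N (nu : Sign N) t, (0 < N)%N -> paths_to nu t ->
    (P (cylinder t) = (path_weight q t / \sum_(s \in paths_to nu) path_weight q s)%:E * P (at_level N nu))%E) <->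
  central_mass P.
Proof.
split=> [H N t u /[dup] v /and3P[tN uN _]|H N nu t _ tn].
  have [nu [i [j [ei ej]]]] := valid_index GT v.
  (* At level 0 the empty path is the only one and the frequency is 0. *)
  have [N0|N0] := posnP N.
    rewrite /freq; move: tN uN; rewrite N0 => /andP[_ /nilP ->] /andP[_ /nilP ->].
    by rewrite subrr mulr0 expr0z mul1r.
  have K s : paths_to nu s -> mass P s = path_weight q s / (\sum_(i < gt_dim GT nu) path_weight q (gt_path i)) *
      \sum_(i < gt_dim GT nu) mass P (gt_path i).
    by move=> sn; apply: EFin_inj; rewrite -(massE P (paths_to_is_path sn)) (H N nu) // prob_at_level sum_paths_to.
  rewrite !K; [|by rewrite -ej; exact: gt_path_to|by rewrite -ei; exact: gt_path_to].
  by rewrite (path_weight_freq tN uN) !mulrA.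
have tN := paths_to_is_path tn.
rewrite (massE P tN) prob_at_level sum_paths_to -EFinM; congr (_%:E).
have fE (i : 'I_(gt_dim GT nu)) : path_weight q (gt_path i) * mass P t = path_weight q t * mass P (gt_path i).
  rewrite (H N (gt_path i) t) ?(path_weight_freq (gt_path_is_path i) tN); last first.
    by rewrite /valid gt_path_is_path tN gt_path_last (paths_to_last tn) eqtype.eqxx.
  ring.
have Z0 : \sum_(i < gt_dim GT nu) path_weight q (gt_path i) != 0.
  have [i _] := gt_index GT tn.
  rewrite gt_eqF // (bigD1 i) //= ltr_wpDr ?path_weight_gt0 // sumr_ge0 // => j _.
  exact: ltW (path_weight_gt0 _).
rewrite mulrAC mulr_sumr; apply: (mulIf Z0); rewrite divfK // mulr_sumr.
by apply: eq_bigr => i _; rewrite mulrC fE.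
Qed.

(** From level N on the two paths have the same vertices, level N included because the segments have
    the same end; these terms of [wt] cancel. *)
Lemma freq_take N M t u : (N <= M)%N -> is_path M t -> is_path M u ->
  drop N t = drop N u -> last [::] (take N t) = last [::] (take N u) ->
  freq M t u = freq N (take N t) (take N u).
Proof.
move=> NM /andP[_ /eqP tM] /andP[_ /eqP uM] D Lx.
have lt (s : seq vertex) n : size s = M -> (n <= N)%N -> level (take N s) n = level s n.
  by move=> sM; case: n => [//|n] nN; rewrite /level /= nth_take.
have ll (s : seq vertex) : size s = M -> level s N = last [::] (take N s).
  move=> sM; rewrite -(lt s N sM (leqnn N)) /level (last_nth [::]) size_takel ?sM //.
have hi n : (N <= n)%N -> level t n = level u n.
  move=> Nn; rewrite -(subnKC Nn); case: (n - N)%N => [|k]; first by rewrite addn0 !ll.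
  by rewrite addnS /level /= -!nth_drop D.
(* The bound [maxn 1 N] treats N = 0, since the sums start at level 1. *)
have split (s : seq vertex) : size s = M ->
   wt M s = wt N (take N s) + \sum_(maxn 1 N <= n < M) vweight (level s n).
  move=> sM; rewrite /wt; have [N0|N0] := posnP N.
    by rewrite [X in X + _]big_geq ?N0 // add0r.
  rewrite (big_cat_nat N0 NM) /= (maxn_idPr N0); congr (_ + _).
  by apply: eq_big_nat => n /andP[_ nN]; rewrite lt // ltnW.
by rewrite /freq !split // (eq_big_nat _ _ (F2 := fun n => vweight (level u n))); [ring|move=> n /andP[h _]; rewrite hi // (leq_trans (leq_maxr 1 N))].
Qed.

End CentralMeasures.

Section UnitFunctionals.
Variables (R : realType) (q : R) (UU : quantum_unitary_system q) (GT : GT_bases UU).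
Variables (L : cstar_limit UU).
Hypothesis q01 : 0 < q < 1.
Local Notation C := (Cx R).
Local Notation coef := (coef GT).
Local Notation eS := (eS GT L).
Implicit Types (N M : nat) (t u : seq vertex).

Lemma functional_ext (chi chi' : SV_alg L -> C) : scalar chi -> scalar chi' ->
  (forall x, nm (chi x) <= rn (SV_val x)) -> (forall x, nm (chi' x) <= rn (SV_val x)) ->
  (forall N t u, valid N t u -> chi (eS N t u) = chi' (eS N t u)) -> chi =1 chi'.
Proof.
move=> cl cl' cb cb' H x; apply/eqP; rewrite -subr_eq0; apply/eqP/nm_eq0/eqP; rewrite eq_le nm_ge0 andbT.
apply/ler_addgt0Pr => e e0; rewrite add0r.
have [y ys xy] := uspan_dense GT x (divr_gt0 e0 (ltr0n R 2)).
have E : chi y = chi' y.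
  apply: (@uspan_ind _ _ _ GT L (fun y => chi y = chi' y) _ _ _ y ys).
  - by rewrite !scalar0.
  - by move=> c a b H1 H2; rewrite cl cl' H1 H2.
  - exact: H.
have -> : chi x - chi' x = chi (x - y) - chi' (x - y).
  by rewrite (scalarB _ _ cl) (scalarB _ _ cl') E opprB addrA subrK.
apply: (le_trans (nmD _ _)); rewrite nmN.
have := cb (x - y); have := cb' (x - y); rewrite SV_valB; lra.
Qed.

Lemma unit_mul_same N t u t' u' : valid N t u -> valid N t' u' ->
  eS N t u * eS N t' u' = (u == t')%:R *: eS N t u'.
Proof.
move=> v v'; have [nu [i [j [ei ej]]]] := valid_index GT v'.
apply: SV_val_inj; rewrite SV_valM SV_valZ !SV_val_unit -ei -ej {1}/eL (lim_mul_unit L i j (unit_fun_Wstar GT N t u)).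
have [tN uN /eqP tu] := and3P v.
transitivity (\sum_(k < gt_dim GT nu) ((gt_path k == t) && (gt_path i == u))%:R *: eL GT L N (gt_path k) (gt_path j)).
  by apply: eq_bigr => k _; rewrite unit_funE ?gt_path_is_path // !gt_path_last.
have [uu|uu] := eqVneq u (gt_path i); last first.
  rewrite scale0r big1 // => k _.
  by rewrite andbF scale0r.
have [k ek] : exists k : 'I_(gt_dim GT nu), gt_path k = t.
  by apply: (gt_index GT); rewrite /paths_to /= tu uu gt_path_last eqtype.eqxx andbT; case/andP: tN.
rewrite (bigD1 k) //= big1 ?addr0 => [|l lk]; first by rewrite ek eqtype.eqxx.
by rewrite -ek (inj_eq (@gt_path_inj _ _ _ GT N nu)) (negbTE lk) scale0r.
Qed.

(** Both products involve the same entry g, at (b, a), of the lift of e_tu to level M; it is nonzero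
    only if b and a extend t and u by the same tail. *)
Lemma unit_mul_diff N M t u a b : (N <= M)%N -> valid N t u -> valid M a b ->
  exists g : C,
    [/\ g != 0 -> [/\ take N b = t, take N a = u & drop N b = drop N a],
     (forall chi : SV_alg L -> C, scalar chi -> (forall c d, valid M c d -> c != d -> chi (eS M c d) = 0) ->
       chi (eS M a b * eS N t u) = g * chi (eS M a a)) &
     (forall chi : SV_alg L -> C, scalar chi -> (forall c d, valid M c d -> c != d -> chi (eS M c d) = 0) ->
       chi (eS N t u * eS M a b) = g * chi (eS M b b))].
Proof.
move=> NM v v'; have [nu [i [j [ei ej]]]] := valid_index GT v'; rewrite -ei -ej.
have [tN uN tu] := and3P v.
have [h [hW hf hE]] := lift_to GT L NM (unit_fun_Wstar GT N t u).
exists (h (coef M (gt_path j) (gt_path i))); split.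
- have N0 : (0 : C) != 0 -> False by rewrite eqtype.eqxx.
  rewrite hE ?gt_path_is_path //; case: (drop N (gt_path j) =P drop N (gt_path i)) => [D|_ /N0 //].
  have [lt|lt] := eqVneq (last [::] (take N (gt_path j))) (last [::] (take N (gt_path i))); last first.
    by rewrite coef0 // (scalar0 (unit_fun_scalar GT N t u)) eqtype.eqxx.
  have tp (k : 'I_(gt_dim GT nu)) : is_path N (take N (gt_path k)).
    have /andP[p /eqP s] := gt_path_is_path k.
    by rewrite /is_path take_path //= size_takel ?s.
  rewrite unit_funE //; case: (take N (gt_path j) =P t) => [->|_ /N0 //].
  by case: (take N (gt_path i) =P u) => [->|_ /N0 //].
- move=> chi cl c0.
  have -> : eS M (gt_path i) (gt_path j) * eS N t u =
      \sum_(k < gt_dim GT nu) h (coef M (gt_path j) (gt_path k)) *: eS M (gt_path i) (gt_path k).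
    apply: SV_val_inj; rewrite SV_valM SV_val_sum SV_val_unit (SV_val_unit GT L N) /(eL _ _ N) -hf unit_mul_lim //.
  rewrite (scalar_sum _ _ _ cl) (bigD1 i) //= big1 ?addr0 => [|k ki]; first by rewrite (scalarZ _ _ cl).
  rewrite (scalarZ _ _ cl) c0 ?mulr0 ?valid_gt // eq_sym.
  by rewrite (inj_eq (@gt_path_inj _ _ _ GT M nu)).
- move=> chi cl c0.
  have -> : eS N t u * eS M (gt_path i) (gt_path j) =
      \sum_(k < gt_dim GT nu) h (coef M (gt_path k) (gt_path i)) *: eS M (gt_path k) (gt_path j).
    apply: SV_val_inj; rewrite SV_valM SV_val_sum SV_val_unit {1}/eL -hf lim_mul_unit //.
  rewrite (scalar_sum _ _ _ cl) (bigD1 j) //= big1 ?addr0 => [|k kj]; first by rewrite (scalarZ _ _ cl).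
  rewrite (scalarZ _ _ cl) c0 ?mulr0 ?valid_gt //.
  by rewrite (inj_eq (@gt_path_inj _ _ _ GT M nu)).
Qed.

(** By density x may be a unit. [unit_mul_diff] reduces the two sides to the values of chi at two
    diagonal units of the higher level, whose ratio is known; if e_tu has the lower level,
    [freq_take] turns this ratio into the one wanted. *)
Lemma units_twisted_trace (chi : SV_alg L -> C) (p : seq vertex -> R) : scalar chi ->
  (forall x, nm (chi x) <= rn (SV_val x)) ->
  (forall N t u, valid N t u -> chi (eS N t u) = toC ((t == u)%:R * p t)) ->
  (forall N t u, valid N t u -> p t = q ^ freq N t u * p u) -> twisted_trace GT chi.
Proof.
move=> cl cb cE pE N t u x v.
have c0 M c d : valid M c d -> c != d -> chi (eS M c d) = 0.
  by move=> vv cd; rewrite (cE _ _ _ vv) (negbTE cd) mul0r toC0.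
have diag M c d : valid M c d -> chi (eS M c c) = toC (p c) /\ chi (eS M d d) = toC (p d).
  by move=> /and3P[cM dM _]; rewrite !(cE M) ?eqtype.eqxx ?mul1r // /valid ?cM ?dM eqtype.eqxx.
pose lhs x := toC (q ^ freq N t u) * chi (x * eS N t u) - chi (eS N t u * x).
suff main y : uspan GT y -> lhs y = 0.
  apply/eqP; rewrite -subr_eq0; apply/eqP/nm_eq0/eqP; rewrite eq_le nm_ge0 andbT.
  apply/ler_addgt0Pr => e e0; rewrite add0r.
  pose K := nm (toC (q ^ freq N t u)) * rn (SV_val (eS N t u)) + rn (SV_val (eS N t u)) + 1.
  have K0 : 0 < K by rewrite ltr_wpDl // addr_ge0 ?mulr_ge0 ?nm_ge0 ?rn_ge0.
  have [y ys xy] := uspan_dense GT x (divr_gt0 e0 K0).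
  have -> : toC (q ^ freq N t u) * chi (x * eS N t u) - chi (eS N t u * x) = lhs (x - y).
    rewrite -[LHS]subr0 -(main y ys) /lhs mulrBl mulrBr !(scalarB _ _ cl) mulrBr.
    by rewrite !opprB addrACA [RHS]addrACA; congr (_ + _); rewrite addrC.
  rewrite /lhs; apply: (le_trans (nmD _ _)); rewrite nmN nmM.
  have Y1 : nm (chi ((x - y) * eS N t u)) <= rn (SV_val (x - y)) * rn (SV_val (eS N t u)).
    by apply: (le_trans (cb _)); rewrite SV_valM rnM.
  have Y2 : nm (chi (eS N t u * (x - y))) <= rn (SV_val (eS N t u)) * rn (SV_val (x - y)).
    by apply: (le_trans (cb _)); rewrite SV_valM rnM.
  have Y3 : nm (toC (q ^ freq N t u)) * nm (chi ((x - y) * eS N t u)) <=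
      nm (toC (q ^ freq N t u)) * (rn (SV_val (x - y)) * rn (SV_val (eS N t u))).
    by rewrite ler_wpM2l ?nm_ge0.
  rewrite -SV_valB ltr_pdivlMr // in xy.
  have := rn_ge0 (SV_val (x - y)); rewrite /K in xy *; lra.
move=> ys; apply: (@uspan_ind _ _ _ GT L (fun y => lhs y = 0) _ _ _ y ys).
- by rewrite /lhs mul0r mulr0 (scalar0 cl) mulr0 subr0.
- move=> c a b Ha Hb; have -> : lhs (c *: a + b) = c * lhs a + lhs b; last by rewrite Ha Hb mulr0 addr0.
  rewrite /lhs mulrDl mulrDr -scalerAl -scalerAr !cl; ring.
- move=> M a b v'; rewrite /lhs; have [NM|MN] := leqP N M.
    have [g [gP H1 H2]] := unit_mul_diff NM v v'.
    have [D1 D2] := diag _ _ _ v'.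
    rewrite (H1 chi cl (c0 M)) (H2 chi cl (c0 M)) D1 D2.
    have [->|g0] := eqVneq g 0; first by rewrite !mul0r mulr0 subr0.
    have [bt au dr] := gP g0; have [aM bM ab] := and3P v'; have [tN uN /eqP tu] := and3P v.
    have -> : p b = q ^ freq N t u * p a.
      rewrite (pE M b a); last by rewrite /valid aM bM eq_sym.
      by rewrite (freq_take NM bM aM dr) bt au.
    by rewrite toCM; ring.
  have [g [gP H1 H2]] := unit_mul_diff (ltnW MN) v' v.
  have [D1 D2] := diag _ _ _ v.
  rewrite (H1 chi cl (c0 N)) (H2 chi cl (c0 N)) D1 D2 (pE N t u v) toCM; ring.
Qed.

Definition diag_sum N (s : seq (seq vertex)) : SV_alg L := \sum_(t <- s) eS N t t.

Lemma valid_diag N t : is_path N t -> valid N t t.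
Proof. by move=> tN; rewrite /valid tN eqtype.eqxx. Qed.

Lemma diag_sum_star N s : SV_star (diag_sum N s) = diag_sum N s.
Proof.
rewrite /diag_sum (big_morph (@SV_star _ _ L) (fun x y => SV_starD x y) (@SV_star0 _ _ _ L)).
by apply: eq_bigr => t _; exact: SV_star_unit.
Qed.

Lemma diag_sum_mul N (s s' : seq (seq vertex)) : uniq s -> uniq s' -> all (is_path N) s -> all (is_path N) s' ->
  diag_sum N s * diag_sum N s' = diag_sum N [seq t <- s | t \in s'].
Proof.
move=> us us' /allP sN /allP sN'; rewrite /diag_sum mulr_suml big_filter [RHS]big_mkcond /=.
apply: eq_big_seq => t ts; rewrite mulr_sumr.
transitivity (\sum_(u <- s') (u == t)%:R *: eS N t u).
  by apply: eq_big_seq => u us0; rewrite (eq_sym u) unit_mul_same //; apply: valid_diag; [exact: sN|exact: sN'].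
case: ifPn => [ts'|ts'].
  by rewrite (bigD1_seq t) //= eqtype.eqxx scale1r big1 ?addr0 // => u ut; rewrite (negbTE ut) scale0r.
rewrite big_seq_cond big1 // => u; rewrite andbT => us0.
by case: eqP => [E|]; rewrite ?scale0r //; rewrite -E us0 in ts'.
Qed.

(** By the C*-identity the norm of a projection equals its own square. *)
Lemma projection_norm (p : SV_alg L) : SV_star p = p -> p * p = p -> rn (SV_val p) <= 1.
Proof.
move=> ps pp; have := rn_starM (SV_val p); rewrite -SV_val_star ps -SV_valM pp expr2 => E.
have r0 := rn_ge0 (SV_val p); clear ps pp; rewrite leNgt; apply/negP => r1; nra.
Qed.

Lemma diag_sum_projection N s : uniq s -> all (is_path N) s -> diag_sum N s * diag_sum N s = diag_sum N s.
Proof.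
by move=> us sN; rewrite diag_sum_mul //; congr diag_sum; apply/all_filterP; apply/allP.
Qed.

Lemma diag_sum_norm N s : uniq s -> all (is_path N) s -> rn (SV_val (diag_sum N s)) <= 1.
Proof. by move=> us sN; apply: projection_norm; [exact: diag_sum_star|exact: diag_sum_projection]. Qed.

End UnitFunctionals.

Section MeasureToCharacter.
Variables (R : realType) (q : R) (UU : quantum_unitary_system q) (GT : GT_bases UU).
Variables (L : cstar_limit UU) (tau : dual_flow L).
Hypothesis q01 : 0 < q < 1.
Local Notation C := (Cx R).
Local Notation coef := (coef GT).
Local Notation eS := (eS GT L).
Implicit Types (N M : nat) (t u : seq vertex).

Lemma diag_sum_image N (s : seq (seq vertex)) : all (is_path N) s ->
  exists2 f : UU N -> C, Cstar f & is_image f (diag_sum GT L N s).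
Proof.
move=> sN; pose f (a : UU N) : C := \sum_(t <- s) 1 * unit_fun GT N t t a.
have uW t : Wstar (unit_fun GT N t t) by exact: unit_fun_Wstar.
exists f; last first.
  rewrite /is_image /diag_sum SV_val_sum /f (lim_sum GT L s (fun=> 1) uW).
  by apply: eq_bigr => t _; rewrite scale1r.
have fW : Wstar f by exact: Wstar_sum.
have ex t : exists r : seq (Sign N), is_path N t -> exists2 nu, nu \in r & paths_to (sign_vertex nu) t.
  have [/path_end[nu tn]|_] := boolP (is_path N t); last by exists [::].
  by exists [:: nu] => _; exists nu; rewrite ?mem_head.
have [e eP] := choice ex.
apply: (finite_support_Cstar (GT := GT) (s := flatten (map e s)) fW) => nu nus.
apply/matrixP => i j; rewrite !mxE -coefE /f big_seq big1 // => t ts; rewrite mul1r.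
rewrite unit_funE ?gt_path_is_path //; last by rewrite !gt_path_last.
case: eqP => //= it; exfalso; move/negP: nus; apply.
have [mu mut mup] := eP t (allP sN _ ts); apply/flatten_mapP; exists t => //.
suff <- : mu = nu by [].
by apply: sign_inj; rewrite -(paths_to_last mup) -it gt_path_last.
Qed.

Lemma measure_Ch (P : Prob R) : central_mass q P -> exists chi : SV_alg L -> C, Ch tau chi /\
  forall N t u, valid N t u -> chi (eS N t u) = toC ((t == u)%:R * mass P t).
Proof.
move=> Pc; have [chi [chil chib chipos chiE]] := state_of_measure GT L P.
pose psi (x : SV_alg L) := chi (SV_val x).
have psil : scalar psi by move=> c x y; rewrite /psi SV_valD SV_valZ chil.
have psib x : nm (psi x) <= rn (SV_val x) by exact: chib.
have psiE N t u : valid N t u -> psi (eS N t u) = toC ((t == u)%:R * mass P t).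
  by move=> v; rewrite /psi SV_val_unit chiE.
exists psi; split => //; split.
- split => //.
  + by move=> x; exact: chipos.
  + by move=> x; rewrite nmE rnE toC_le.
  + move=> e e0; exists 1.
      by rewrite rnE -toC1 toC_le SV_val1 rn_one_le.
    rewrite /psi SV_val1 -(eL_root GT L) chiE // eqtype.eqxx mul1r mass_root toC1 normr1.
    by rewrite gtrBl.
- apply: (twisted_trace_KMS (GT := GT) tau q01 psil psib).
  apply: (units_twisted_trace psil psib psiE) => N t u v; exact: Pc.
- move=> N _; split=> [f x _ _|e e0]; first by rewrite nmE rnE toC_le.
  have [r r0 re] := gt0_toC e0.
  (* Norm one is approached on finite sums of diagonal units, where chi is the mass of finitely many
     cylinders. *)
  have [s [us sN H]] := mass_exhaust P N r0.
  have [f fC fi] := diag_sum_image sN; exists f, (diag_sum GT L N s); split => //.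
    by rewrite rnE -toC1 toC_le diag_sum_norm.
  have -> : psi (diag_sum GT L N s) = toC (\sum_(t <- s) mass P t).
    rewrite /diag_sum (scalar_sum _ _ _ psil) (big_morph (@toC R) (@toCD R) (@toC0 R)).
    apply: eq_big_seq => t ts; rewrite psiE ?eqtype.eqxx ?mul1r //.
    by apply: valid_diag; exact: (allP sN).
  rewrite nmE nm_toC ger0_norm; last by apply: sumr_ge0 => t _; exact: mass_ge0.
  by rewrite re -toC1 -[toC 1 - _](rmorphB (@real_complex R)) toC_lt.
Qed.

End MeasureToCharacter.

(** * From quantized characters to central measures *)

Section CharacterToMeasure.
Variables (R : realType) (q : R) (UU : quantum_unitary_system q) (GT : GT_bases UU).
Variables (L : cstar_limit UU) (tau : dual_flow L).
Hypothesis q01 : 0 < q < 1.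
Local Notation C := (Cx R).
Local Notation coef := (coef GT).
Local Notation eS := (eS GT L).
Local Notation diag_sum := (diag_sum GT L).
Implicit Types (N M : nat) (t u : seq vertex) (s : seq (seq vertex)).
Variable chi : SV_alg L -> C.
Hypothesis chiCh : Ch tau chi.

Lemma Ch_scalar : scalar chi. Proof. by case: chiCh => -[]. Qed.
Lemma Ch_positive x : 0 <= chi (SV_star x * x). Proof. by case: chiCh => -[]. Qed.
Lemma Ch_bound x : nm (chi x) <= rn (SV_val x).
Proof. by case: chiCh => -[_ _ /(_ x)]; rewrite nmE rnE toC_le. Qed.
Lemma Ch_twisted_trace : twisted_trace GT chi.
Proof. by case: (chiCh) => _ K _; exact: (KMS_twisted_trace GT q01 Ch_scalar Ch_positive Ch_bound K). Qed.

Local Notation chil := Ch_scalar.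

Definition diag_value t : R := complex.Re (chi (eS (size t) t t)).
Local Notation p := diag_value.

Let chi_diag0 N t : is_path N t -> chi (eS N t t) = toC (p t) /\ 0 <= p t.
Proof.
move=> tN; have v := valid_diag tN.
have E : chi (eS N t t) = chi (SV_star (eS N t t) * eS N t t).
  by rewrite SV_star_unit unit_mul_same // eqtype.eqxx scale1r.
have := Ch_positive (eS N t t); rewrite -E => c0.
have <- : size t = N by case/andP: tN => _ /eqP.
have sE : size t = N by case/andP: tN => _ /eqP.
rewrite /p sE; split; first exact: ge0_toC.
by move: c0; rewrite lecE => /andP[].
Qed.

Lemma diag_value_ge0 N t : is_path N t -> 0 <= p t.
Proof. by move=> /chi_diag0[]. Qed.

(** The twisted trace at x = e_ut, where the two products are e_uu and e_tt. *)
Lemma diag_value_freq N t u : valid N t u -> p t = q ^ freq N t u * p u.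
Proof.
move=> v; have [tN uN _] := and3P v; have v' := valid_sym v.
have := Ch_twisted_trace (eS N u t) v; rewrite !unit_mul_same // !eqtype.eqxx !scale1r.
rewrite (chi_diag0 tN).1 (chi_diag0 uN).1 -toCM => E; apply: toC_inj; exact: esym.
Qed.

(** For t <> u the twisted trace at x = e_uu has the product 0 on one side and e_tu on the other. *)
Lemma Ch_unit N t u : valid N t u -> chi (eS N t u) = toC ((t == u)%:R * p t).
Proof.
move=> v; have [tN uN _] := and3P v; have vu := valid_diag uN.
have [<-|tu] := eqVneq t u; first by rewrite mul1r (chi_diag0 tN).1.
have := Ch_twisted_trace (eS N u u) v; rewrite !unit_mul_same // eqtype.eqxx (eq_sym u t) (negbTE tu).
by rewrite scale0r scale1r (scalar0 chil) mulr0 mul0r toC0.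
Qed.

Lemma Ch_diag_sum N s : all (is_path N) s -> chi (diag_sum N s) = toC (\sum_(t <- s) p t).
Proof.
move=> /allP sN; rewrite /diag_sum (scalar_sum _ _ _ chil) (big_morph (@toC R) (@toCD R) (@toC0 R)).
by apply: eq_big_seq => t /sN tN; rewrite (chi_diag0 tN).1.
Qed.

Let proj_le1 (x : SV_alg L) : SV_star x = x -> x * x = x -> complex.Re (chi x) <= 1.
Proof.
move=> xs xx; apply: (le_trans (ler_norm _)); apply: (le_trans (abs_re_nm _)).
apply: (le_trans (Ch_bound _)); exact: projection_norm.
Qed.

(** The hypotheses make x - y a projection, hence of the form z^* z. *)
Let proj_mono (x y : SV_alg L) : SV_star x = x -> x * x = x -> SV_star y = y -> y * y = y ->
  x * y = y -> complex.Re (chi y) <= complex.Re (chi x).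
Proof.
move=> xs xx ys yy xy; have yx : y * x = y by rewrite -{1}ys -{1}xs -SV_starM xy ys.
have := Ch_positive (x - y).
have -> : SV_star (x - y) * (x - y) = x - y.
  have -> : SV_star (x - y) = x - y by rewrite -scaleN1r SV_starD SV_starZ rmorphN rmorph1 xs ys.
  by rewrite mulrBl !mulrBr xx xy yx yy subrr subr0.
by rewrite (scalarB _ _ chil) lecE => /andP[_]; case: (chi x) (chi y) => ? ? [? ?] /=; lra.
Qed.

Lemma diag_value_sum_le1 N s : uniq s -> all (is_path N) s -> \sum_(t <- s) p t <= 1.
Proof.
move=> us sN; have := proj_le1 (diag_sum_star GT L N s) (diag_sum_projection GT L us sN).
by rewrite Ch_diag_sum.
Qed.

Lemma gt_paths_flatten_uniq N (r : seq (Sign N)) : uniq r -> uniq (flatten (map (@gt_paths _ _ _ GT N) r)).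
Proof.
elim: r => [//|nu r IH] /= /andP[nr /IH ur]; rewrite cat_uniq gt_paths_uniq ur andbT /=.
apply/hasPn => t /flatten_mapP[mu mur tmu]; apply/negP => tnu.
have E : mu = nu.
  apply: sign_inj; move/(mem_gt_paths GT): tmu => /paths_to_last <-.
  by move/(mem_gt_paths GT): tnu => /paths_to_last <-.
by rewrite -E mur in nr.
Qed.

Lemma gt_paths_flatten_path N (r : seq (Sign N)) : all (is_path N) (flatten (map (@gt_paths _ _ _ GT N) r)).
Proof. by apply/allP => t /flatten_mapP[nu _ /mem_gt_paths/paths_to_is_path]. Qed.

Lemma sum_gt_paths_flatten N (r : seq (Sign N)) (F : seq vertex -> R) :
  \sum_(t <- flatten (map (@gt_paths _ _ _ GT N) r)) F t = \sum_(nu <- r) \sum_(i < gt_dim GT nu) F (gt_path i).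
Proof.
rewrite big_flatten big_map; apply: eq_bigr => nu _.
by rewrite big_map big_enum.
Qed.

Lemma Ch_coef_sum N (g : UU N -> C) (r : seq (Sign N)) : chi (coef_sum GT L g r) =
  \sum_(nu <- r) \sum_(i < gt_dim GT nu) g (coef N (gt_path i) (gt_path i)) * toC (p (gt_path i)).
Proof.
rewrite (scalar_sum _ _ _ chil); apply: eq_bigr => nu _; rewrite (scalar_sum _ _ _ chil); apply: eq_bigr => i _.
rewrite (scalar_sum _ _ _ chil) (bigD1 i) //= big1 ?addr0 => [|j ji].
  by rewrite (scalarZ _ _ chil) Ch_unit ?valid_gt // eqtype.eqxx mul1r.
rewrite (scalarZ _ _ chil) Ch_unit ?valid_gt // (inj_eq (@gt_path_inj _ _ _ GT N nu)) eq_sym (negbTE ji).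
by rewrite mul0r toC0 mulr0.
Qed.

(** Some x of norm at most 1 in C*(U_q(N)) has |chi(x)| > 1 - e/4, and a finite combination y within
    e/4 of it has coefficients of modulus at most 1 + e/4. As chi sees only the diagonal, |chi(y)|
    <= (1 + e/4) S, where S is the total of finitely many values p(t); so S > 1 - e. *)
Lemma diag_value_sum_gt N (e : R) : (0 < N)%N -> 0 < e ->
  exists s, [/\ uniq s, all (is_path N) s & 1 - e < \sum_(t <- s) p t].
Proof.
move=> N0 e0; have e4 : 0 < e / 4 by rewrite divr_gt0.
case: (chiCh) => _ _ /(_ N N0)[_ /(_ (toC (e / 4)))].
rewrite -toC0 toC_lt => /(_ e4)[f [x [fC fx]]].
rewrite rnE nmE -toC1 toC_le -[toC 1 - _](rmorphB (@real_complex R)) toC_lt => x1 cx.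
have [g [r [ur _ yE xy [gW _]]]] := Cstar_approx GT L fC e4.
pose y := coef_sum GT L g r.
have {}xy : rn (SV_val (x - y)) <= e / 4 by rewrite SV_valB yE fx.
have y1 : rn (lim_map L g) <= 1 + e / 4.
  rewrite -yE; have := rn_triangle (SV_val y) (SV_val x) 0; rewrite !subr0 rnB -SV_valB; lra.
have cy := Ch_coef_sum g r.
pose S := \sum_(nu <- r) \sum_(i < gt_dim GT nu) p (gt_path i).
have ny : nm (chi y) <= (1 + e / 4) * S.
  rewrite /y cy mulr_sumr; apply: (le_trans (nm_sum _ _ _)); apply: ler_sum => nu _.
  rewrite mulr_sumr; apply: (le_trans (nm_sum _ _ _)); apply: ler_sum => i _.
  have p0 : 0 <= p (gt_path i) by apply: diag_value_ge0; exact: gt_path_is_path.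
  rewrite nmM nm_toC ger0_norm // ler_wpM2r //; apply: le_trans y1; exact: rn_coef.
have SE := sum_gt_paths_flatten r p.
exists (flatten (map (@gt_paths _ _ _ GT N) r)); split.
- exact: gt_paths_flatten_uniq.
- exact: gt_paths_flatten_path.
have := diag_value_sum_le1 (gt_paths_flatten_uniq ur) (gt_paths_flatten_path r).
rewrite SE -/S => S1.
have := Ch_bound (x - y); have := nmD (chi (x - y)) (chi y).
rewrite {1}(scalarB _ _ chil) subrK; nra.
Qed.

(** [Ch] requires norm one from level 1 on, so the value chi(1) at the root is compared with
    diagonal sums of level 1. *)
Lemma diag_value_root : p [::] = 1.
Proof.
have E : eS 0 [::] [::] = 1 by apply: SV_val_inj; rewrite SV_val_unit eL_root.
apply/eqP; rewrite eq_le; apply/andP; split.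
  by have := diag_value_sum_le1 (N := 0) (s := [:: [::]]) isT isT; rewrite big_seq1.
apply/ler_addgt0Pr => e e0; have [s [us sN H]] := diag_value_sum_gt (ltn0Sn 0) e0.
have := @proj_mono 1 (diag_sum 1 s) _ (mul1r _) (diag_sum_star GT L _ _) (diag_sum_projection GT L us sN) (mul1r _).
rewrite Ch_diag_sum // -E -[complex.Re (chi _)]/(p [::]) SV_star_unit => /(_ erefl) /=; lra.
Qed.

(** At level M the unit e_tt acts as the projection onto the paths that extend t. *)
Lemma unit_mul_take N M t c : (N <= M)%N -> is_path N t -> is_path M c ->
  eS N t t * eS M c c = (take N c == t)%:R *: eS M c c.
Proof.
move=> NM tN cM; have [nu [i ei]] := gt_indexE GT cM; rewrite -ei.
have [h [hW hf hE]] := lift_to GT L NM (unit_fun_Wstar GT N t t).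
apply: SV_val_inj; rewrite SV_valM SV_valZ !SV_val_unit {1}/eL -hf (lim_mul_unit L i i hW).
have tp (k : 'I_(gt_dim GT nu)) : is_path N (take N (gt_path k)).
  have /andP[pk /eqP sk] := gt_path_is_path k.
  by rewrite /is_path take_path //= size_takel ?sk.
have hk (k : 'I_(gt_dim GT nu)) : h (coef M (gt_path k) (gt_path i)) = ((k == i) && (take N (gt_path i) == t))%:R.
  rewrite hE ?gt_path_is_path //.
  have [D|D] := eqVneq (drop N (gt_path k)) (drop N (gt_path i)); last first.
    by have -> : (k == i) = false by apply/negbTE; apply: contra D => /eqP ->.
  have [T|T] := eqVneq (take N (gt_path k)) (take N (gt_path i)).
    have ki : k = i by apply: (@gt_path_inj _ _ _ GT M nu); rewrite -(cat_take_drop N (gt_path k)) T D cat_take_drop.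
    by rewrite ki unit_funE // eqtype.eqxx andbb.
  have ki : (k == i) = false by apply/negbTE; apply: contra T => /eqP ->.
  rewrite ki /=; have [lt|lt] := eqVneq (last [::] (take N (gt_path k))) (last [::] (take N (gt_path i))); last first.
    by rewrite coef0 // (scalar0 (unit_fun_scalar GT N t t)).
  rewrite unit_funE //; case: (take N (gt_path i) =P t) => [it|]; rewrite ?andbF // andbT.
  by rewrite -it (negbTE T).
rewrite (bigD1 i) //= hk eqtype.eqxx /= big1 ?addr0 // => k ki.
by rewrite hk (negbTE ki) scale0r.
Qed.

Let unit_diag_sum N M t s : (N <= M)%N -> is_path N t -> all (is_path M) s ->
  eS N t t * diag_sum M s = diag_sum M [seq c <- s | take N c == t].
Proof.
move=> NM tN /allP sM; rewrite /diag_sum mulr_sumr big_filter [RHS]big_mkcond /=.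
apply: eq_big_seq => c cs; rewrite unit_mul_take ?sM //.
by case: ifP; rewrite ?scale1r ?scale0r.
Qed.

Lemma diag_value_le N t (s : seq vertex) : is_path N t -> uniq s -> all (edge (last [::] t)) s ->
  \sum_(v <- s) p (rcons t v) <= p t.
Proof.
move=> tN us /allP es; pose r := [seq rcons t v | v <- s].
have ur : uniq r by rewrite map_inj_uniq //; exact: rcons_injr.
have rN : all (is_path N.+1) r.
  by apply/allP => _ /mapP[v /es ve ->]; rewrite is_path_rcons tN.
have Et : eS N t t * eS N t t = eS N t t by rewrite unit_mul_same ?valid_diag // eqtype.eqxx scale1r.
have := proj_mono (SV_star_unit GT L N t t) Et (diag_sum_star GT L N.+1 r) (diag_sum_projection GT L ur rN).
rewrite unit_diag_sum // Ch_diag_sum // (chi_diag0 tN).1 big_map /=; apply.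
congr (diag_sum _ _); apply/all_filterP/allP => _ /mapP[v _ ->].
by rewrite -cats1 take_size_cat //; case/andP: tN => _ /eqP.
Qed.

(** The total mass at level N + 1 is nearly 1. The paths not extending t give a projection
    orthogonal to e_tt, so their mass is at most 1 - p(t), and the rest must come from the children
    of t. *)
Lemma diag_value_gt N t (e : R) : is_path N t -> 0 < e ->
  exists s : seq vertex, [/\ uniq s, all (edge (last [::] t)) s & p t - e < \sum_(v <- s) p (rcons t v)].
Proof.
move=> tN e0; have [s [us sN H]] := diag_value_sum_gt (ltn0Sn N) e0.
pose r := [seq c <- s | take N c == t]; pose r' := [seq c <- s | take N c != t].
have sE : \sum_(c <- s) p c = \sum_(c <- r) p c + \sum_(c <- r') p c.
  by rewrite !big_filter (bigID (fun c => take N c == t)).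
have ur' : uniq r' by apply: filter_uniq.
have r'N : all (is_path N.+1) r'.
  by apply/allP => c; rewrite mem_filter => /andP[_]; exact: (allP sN).
pose Q := diag_sum N.+1 r'; pose E := eS N t t.
have EE : E * E = E by rewrite unit_mul_same ?valid_diag // eqtype.eqxx scale1r.
have EQ : E * Q = 0.
  rewrite unit_diag_sum //; have -> : [seq c <- r' | take N c == t] = [::].
    apply/eqP; rewrite -(negbK (_ == _)) -has_filter; apply/hasPn => c.
    by rewrite mem_filter => /andP[].
  by rewrite /diag_sum big_nil.
have Es : SV_star E = E := SV_star_unit GT L N t t.
have Qs : SV_star Q = Q := diag_sum_star GT L N.+1 r'.
have QE : Q * E = 0 by rewrite -Es -Qs -SV_starM EQ SV_star0.
have QQ : Q * Q = Q := diag_sum_projection GT L ur' r'N.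
have := @proj_le1 (E + Q) _ _; rewrite SV_starD Es Qs mulrDl !mulrDr EE EQ QE QQ addr0 add0r => /(_ erefl erefl).
rewrite (scalarD _ _ chil) (chi_diag0 tN).1 Ch_diag_sum // -toCD /= => H'.
have rP c : c \in r -> exists2 v, edge (last [::] t) v & c = rcons t v.
  rewrite mem_filter => /andP[/eqP ct /(allP sN)/is_path_rconsP[t' [v [cE t'N ed]]]].
  have <- : t' = t by rewrite -ct cE -cats1 take_size_cat //; case/andP: t'N => _ /eqP.
  by exists v.
exists [seq last [::] c | c <- r].
have rE : r = [seq rcons t (last [::] c) | c <- r].
  rewrite -[LHS]map_id; apply/eq_in_map => c /rP[v _ ->]; by rewrite last_rcons.
split.
- rewrite map_inj_in_uniq ?filter_uniq // => c d /rP[v _ ->] /rP[w _ ->].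
  by rewrite !last_rcons => ->.
- by apply/allP => _ /mapP[c /rP[v ve ->] ->]; rewrite last_rcons.
- rewrite big_map; have -> : \sum_(c <- r) p (rcons t (last [::] c)) = \sum_(c <- r) p c.
    by rewrite [in RHS]rE big_map.
  lra.
Qed.

Lemma character_measure : exists P : Prob R, [/\ forall B : set OmegaM, ~ measurable B -> P B = 0%E,
  central_mass q P & forall N t, is_path N t -> mass P t = p t].
Proof.
(* [diag_value] is unconstrained on lists that are not paths, while [tree_measure_exists] asks for
   nonnegativity everywhere. *)
pose p' t := if is_path (size t) t then p t else 0.
have pp N t : is_path N t -> p' t = p t by move=> /is_path_size tN; rewrite /p' tN.
have ed N t v : is_path N t -> edge (last [::] t) v -> p' (rcons t v) = p (rcons t v).
  by move=> tN tv; apply: (pp N.+1); rewrite is_path_rcons tN.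
have [||||P [P0 PE]] := @tree_measure_exists R p'.
- by move=> t; rewrite /p'; case: ifP => [/diag_value_ge0|].
- by rewrite (pp 0%N) // diag_value_root.
- move=> N t s tN us es; rewrite (pp N) //; apply: le_trans (diag_value_le tN us es).
  by rewrite le_eqVlt; apply/orP; left; apply/eqP; apply: eq_big_seq => v /(allP es) /(ed N) ->.
- move=> N t e tN /(diag_value_gt tN)[s [us es H]]; exists s; split => //; rewrite (pp N) //.
  have -> : \sum_(v <- s) p' (rcons t v) = \sum_(v <- s) p (rcons t v).
    by apply: eq_big_seq => v /(allP es) /(ed N) ->.
  exact: H.
have mP N t : is_path N t -> mass P t = p t.
  by move=> tN; rewrite /mass PE; [rewrite (pp N)|exact: is_path_size tN].
exists P; split => // N t u v; have [tN uN _] := and3P v.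
by rewrite !(mP N) //; exact: diag_value_freq.
Qed.

End CharacterToMeasure.

(** * The homeomorphism *)

Section WeakConvergence.
Variable R : realType.
Implicit Types (P : Prob R) (t : seq vertex) (s : seq (seq vertex)).

Lemma Rintegral_le_dist P (f g k : OmegaM -> R) (K : R) : measurable_fun setT f -> measurable_fun setT g ->
  measurable_fun setT k -> (forall w, `|f w| <= K) -> (forall w, `|g w| <= K) -> (forall w, `|k w| <= K) ->
  (forall w, `|f w - g w| <= k w) -> `|\int[P]_w f w - \int[P]_w g w| <= \int[P]_w k w.
Proof.
move=> mf mg mk fK gK kK fgk.
have fi := bounded_path_integrable P mf fK; have gi := bounded_path_integrable P mg gK.
have ki := bounded_path_integrable P mk kK.
have mfg : measurable_fun setT (fun w => f w - g w).
  exact: measurable_realfun.measurable_funB.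
have fgK w : `|f w - g w| <= K by apply: (le_trans (fgk w)); apply: le_trans (kK w); exact: ler_norm.
have fgi := bounded_path_integrable P mfg fgK.
rewrite -RintegralB //; apply: (le_trans (le_normr_Rintegral measurableT fgi)).
apply: le_Rintegral => //.
apply: (bounded_path_integrable P (M := K)); first exact: measurableT_comp.
by move=> w; rewrite normr_id.
Qed.

Lemma Rintegral_level_sum P n s (c : seq vertex -> R) : uniq s -> all (is_path n) s ->
  \int[P]_w (if pre w n \in s then c (pre w n) else 0) = \sum_(t <- s) c t * mass P t.
Proof.
move=> us sN; rewrite -[LHS]/(lint P n (fun t => if t \in s then c t else 0)).
have [M hM] : exists M : R, forall t, t \in s -> `|c t| <= M.
  exists (\sum_(t <- s) `|c t|) => t ts; rewrite (bigD1_seq t) //= lerDl.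
  by apply: sumr_ge0 => u _.
elim: s us sN hM => [|t s IH] /=.
  by move=> _ _ _; rewrite big_nil /lint Rintegral_cst // mul0r.
move=> /andP[ts us] /andP[tn sn] hM; rewrite big_cons -IH //; last first.
  by move=> u us'; apply: hM; rewrite inE us' orbT.
have := lint_indic P true tn; rewrite mul1r => <-; rewrite -[X in _ = _ + X]mul1r -lint_lin.
- apply: eq_lint => u _; rewrite inE andbT; have [->|ut] := eqVneq u t.
    by rewrite (negbTE ts) mulr1 mulr0 addr0.
  by rewrite mulr0 add0r mul1r.
- by exists 1 => u _; case: (_ && _); rewrite ?normr1 ?normr0.
- exists `|M| => u _; case: ifP => [us'|]; last by rewrite normr0.
  by apply: le_trans (ler_norm M); apply: hM; rewrite inE us' orbT.
Qed.

(* Cylinders on which f is nearly constant exhaust the path space, and finitely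
   many of them carry almost all the mass of P0. *)
Lemma weak_mass P0 (f : OmegaM -> R) (e : R) : continuous (f : OmegaT -> R) ->
  (exists M : R, forall w, `|f w| <= M) -> 0 < e ->
  exists n s (d : R), [/\ 0 < d, all (is_path n) s &
    forall P, (forall t, t \in s -> `|mass P0 t - mass P t| < d) ->
      `|\int[P0]_w f w - \int[P]_w f w| < e].
Proof.
move=> fc [M0 fM0] e0; pose M := `|M0| + 1.
have Mp : 0 < M by rewrite ltr_wpDl.
have fM w : `|f w| <= M.
  by apply: (le_trans (fM0 w)); apply: (le_trans (ler_norm _)); rewrite lerDl.
(* The total error is 2 h + 6 M k < e: h + 2 M k for P0, h + 3 M k for P, and M k between the two
   finite sums. *)
pose h := e / 8; have h0 : 0 < h by rewrite divr_gt0.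
pose k := e / (16 * M); have k0 : 0 < k by rewrite divr_gt0 // mulr_gt0.
have kM : M * k = e / 16 by rewrite /k; field; rewrite gt_eqF.
pose G n : set (seq vertex) := [set t | forall w w', pre w n = t -> pre w' n = t -> `|f w - f w'| <= h].
have mA n : measurable [set w : OmegaM | G n (pre w n)] by exact: measurable_pre_set.
have [||n nP] := @exhaust R P0 (fun n => [set w : OmegaM | G n (pre w n)]) k mA _ _ k0.
- move=> n m nm w /= H w1 w2 E1 E2; apply: H.
    by rewrite -(take_pre w1 nm) E1 take_pre.
  by rewrite -(take_pre w2 nm) E2 take_pre.
- move=> w; have [n Hn] := cylinder_continuous w fc (divr_gt0 h0 (ltr0n R 2)).
  exists n => w1 w2 E1 E2; have := Hn w1 E1; have := Hn w2 E2.
  have -> : f w1 - f w2 = (f w - f w2) - (f w - f w1) by ring.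
  by have := ler_normB (f w - f w2) (f w - f w1); lra.
have [s0 [us0 sn0 s0P]] := mass_exhaust P0 n k0.
pose s := [seq t <- s0 | asbool (G n t)].
have us : uniq s by exact: filter_uniq.
have sn : all (is_path n) s by apply/allP => t; rewrite mem_filter => /andP[_ /(allP sn0)].
have sP : 1 - 2 * k < \sum_(t <- s) mass P0 t.
  pose s' := [seq t <- s0 | ~~ asbool (G n t)].
  have us' : uniq s' by exact: filter_uniq.
  have sn' : all (is_path n) s' by apply/allP => t; rewrite mem_filter => /andP[_ /(allP sn0)].
  have E : \sum_(t <- s0) mass P0 t = \sum_(t <- s) mass P0 t + \sum_(t <- s') mass P0 t.
    by rewrite !big_filter (bigID (fun t => asbool (G n t))).
  have ms' : measurable [set w : OmegaM | pre w n \in s'].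
    exact: (@measurable_pre_set n [set t | t \in s']).
  have B : (P0 [set w : OmegaM | pre w n \in s'] <= P0 (~` [set w : OmegaM | G n (pre w n)]))%E.
    apply: le_measure; [exact: mem_set|by apply: mem_set; exact: measurableC|].
    by move=> w /=; rewrite mem_filter => /andP[/asboolPn].
  have C : P0 (~` [set w : OmegaM | G n (pre w n)]) = (1 - fine (P0 [set w : OmegaM | G n (pre w n)]))%:E.
    by rewrite EFinB -probE // probability_setC.
  rewrite prob_paths // C lee_fin in B; lra.
have ex t : exists c : R, `|c| <= M /\ (t \in s -> forall w, pre w n = t -> `|f w - c| <= h).
  have [[w wt]|nw] := pselect (exists w, pre w n = t); last first.
    by exists 0; rewrite normr0 ltW //; split => // _ w wt; case: nw; exists w.
  exists (f w); split => //; rewrite mem_filter => /andP[/asboolP Gt _] w' wt'; exact: Gt.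
have [c cP] := choice ex.
pose d := k / ((size s)%:R + 1); have sz : 0 < (size s)%:R + 1 :> R by rewrite ltr_wpDl ?ler0n.
have d0 : 0 < d by rewrite divr_gt0.
have ds : (size s)%:R * d <= k.
  rewrite /d mulrA ler_pdivrMr //; have := ler0n R (size s); nra.
exists n, s, d; split => // P Pd.
(* f is within h of its sample value on the cylinders of s, and within M of 0 elsewhere. *)
have approx (Q : Prob R) : `|\int[Q]_w f w - \sum_(t <- s) c t * mass Q t| <= h + M * (1 - \sum_(t <- s) mass Q t).
  rewrite -(Rintegral_level_sum Q c us sn).
  have -> : h + M * (1 - \sum_(t <- s) mass Q t) = \int[Q]_w (if pre w n \in s then h else h + M).
    transitivity (lint Q n (fun t => (h + M) * 1 + (- M) * (if t \in s then 1 else 0))); last first.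
      rewrite -[RHS]/(lint Q n (fun t => if t \in s then h else h + M)).
      by apply: eq_lint => t _; case: ifP => _; ring.
    rewrite lint_lin; last first.
    - by exists 1 => t _; case: ifP => _; rewrite ?normr1 ?normr0.
    - by exists 1 => t _; rewrite normr1.
    have -> : lint Q n (fun t => if t \in s then 1 else 0) = \sum_(t <- s) mass Q t.
      by have := Rintegral_level_sum Q (fun=> 1) us sn; under eq_bigr do rewrite mul1r.
    rewrite /lint Rintegral_cst // -[X in fine X]/(Q setT) probability_setT /=; ring.
  apply: (@Rintegral_le_dist _ _ _ _ (h + M)).
  - exact: continuous_measurable_path.
  - exact: (measurable_level n (fun t => if t \in s then c t else 0)).
  - exact: (measurable_level n (fun t => if t \in s then h else h + M)).
  - by move=> w; apply: (le_trans (fM w)); rewrite lerDr ltW.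
  - move=> w; case: ifP => _; last by rewrite normr0 addr_ge0 // ltW.
    by apply: (le_trans (cP _).1); rewrite lerDr ltW.
  - by move=> w; case: ifP => _; rewrite ger0_norm ?addr_ge0 ?(ltW h0) ?(ltW Mp) // lerDl ltW.
  - move=> w; case: ifP => [ws|_]; first exact: (cP _).2.
    by rewrite subr0; apply: (le_trans (fM w)); rewrite lerDr ltW.
have sd : (size s)%:R * d = \sum_(t <- s) d by rewrite big_const_seq count_predT iter_addr_0 mulr_natl.
have S1 : `|\sum_(t <- s) mass P0 t - \sum_(t <- s) mass P t| <= k.
  rewrite -sumrB; apply: (le_trans (ler_norm_sum _ _ _)); apply: le_trans ds.
  rewrite sd big_seq [leRHS]big_seq; apply: ler_sum => t ts; exact: ltW (Pd t ts).
have S2 : `|\sum_(t <- s) c t * mass P0 t - \sum_(t <- s) c t * mass P t| <= M * k.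
  rewrite -sumrB; apply: (le_trans (ler_norm_sum _ _ _)).
  apply: (@le_trans _ _ (M * ((size s)%:R * d))); last by rewrite ler_pM2l.
  rewrite sd mulr_sumr big_seq [leRHS]big_seq; apply: ler_sum => t ts.
  by rewrite -mulrBr normrM ler_pM ?(cP t).1 // ltW // Pd.
have A0 := approx P0; have A1 := approx P.
have T1 : M * (1 - \sum_(t <- s) mass P0 t) <= M * (2 * k) by rewrite ler_pM2l //; lra.
have T2 : M * (1 - \sum_(t <- s) mass P t) <= M * (3 * k).
  by rewrite ler_pM2l //; move: S1; rewrite ler_norml => /andP[]; lra.
move: A0 A1 S2; rewrite !ler_norml ltr_norml => /andP[a1 a2] /andP[b1 b2] /andP[c1 c2].
by apply/andP; split; rewrite /h in a1 a2 b1 b2; lra.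
Qed.

Lemma mnormalize_self (m : {measure set OmegaM -> \bar R}) (P : Prob R) : m setT = 1%E ->
  forall B, mnormalize m P B = m B.
Proof. by move=> mT B; rewrite /mnormalize /= mT onee_eq0 /= invr1 mule1. Qed.

(** [mnormalize] supplies the probability structure; the total mass is already one, so it changes no
    value. *)
Lemma mixture_exists (P Q : Prob R) (a : R) : 0 <= a <= 1 ->
  exists P' : Prob R, forall B, P' B = (a%:E * P B + (1 - a)%:E * Q B)%E.
Proof.
move=> /andP[a0]; rewrite -subr_ge0 => a1.
pose m := measure_add (mscale (NngNum a0) P) (mscale (NngNum a1) Q).
have mE B : m B = (a%:E * P B + (1 - a)%:E * Q B)%E by rewrite /m measure_addE.
have mT : m setT = 1%E by rewrite mE !probability_setT !mule1 -EFinD addrC subrK.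
by exists (mnormalize m P) => B; rewrite -mE; exact: mnormalize_self mT B.
Qed.

End WeakConvergence.

Section CharacterFormula.
Variables (R : realType) (q : R) (UU : quantum_unitary_system q) (GT : GT_bases UU).
Variables (L : cstar_limit UU) (tau : dual_flow L).
Hypothesis q01 : 0 < q < 1.
Local Notation C := (Cx R).
Local Notation coef := (coef GT).
Local Notation eS := (eS GT L).
Implicit Types (N : nat) (t u : seq vertex) (P : Prob R).

Let q0 : 0 < q. Proof. by case/andP: q01. Qed.

Lemma dval_freq N (nu : Sign N) t u : dval q nu t = q ^ freq N t u * dval q nu u.
Proof. by rewrite /dval -expfzDr ?gt_eqF // /freq; congr (_ ^ _); ring. Qed.

Lemma quantum_charE N (nu : Sign N) (f : UU N -> C) : quantum_char GT nu f =
  (\sum_(i < gt_dim GT nu) toC (dval q nu (gt_path i)) * f (coef N (gt_path i) (gt_path i))) /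
  toC (\sum_(i < gt_dim GT nu) dval q nu (gt_path i)).
Proof.
rewrite /quantum_char density_gt //; congr (_ / _).
  by apply: eq_bigr => i _; rewrite mul_diag_mx !mxE coefE.
rewrite (big_morph (@toC R) (@toCD R) (@toC0 R)); apply: eq_bigr => i _.
by rewrite !mxE eqtype.eqxx mulr1n.
Qed.

(** Centrality says that the masses of the paths to nu are proportional to the eigenvalues of F_nu;
    so the weighted trace is the integral of the diagonal of f over the paths through nu. *)
Lemma level_term P N (nu : Sign N) (f : UU N -> C) : central_mass q P ->
  toC (fine (P (at_level N nu))) * quantum_char GT nu f =
  \sum_(i < gt_dim GT nu) f (coef N (gt_path i) (gt_path i)) * toC (mass P (gt_path i)).
Proof.
move=> Pc; rewrite quantum_charE (prob_at_level GT) /= mulrA mulr_sumr mulr_suml; apply: eq_bigr => i _.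
set T := \sum_(j < _) dval _ _ _.
have T0 : toC T != 0.
  rewrite -toC0 (inj_eq (@toC_inj R)) gt_eqF // /T (bigD1 i) //= ltr_wpDr ?dval_gt0 //.
  by apply: sumr_ge0 => j _; exact: ltW (dval_gt0 _ _ _).
apply: (mulIf T0); rewrite divfK // mulrA -toCM -[RHS]mulrA -toCM mulrC; congr (_ * toC _).
rewrite mulr_suml mulr_sumr; apply: eq_bigr => j _.
rewrite (dval_freq nu (gt_path i) (gt_path j)) (Pc N (gt_path i) (gt_path j)) ?valid_gt //; ring.
Qed.

Lemma partial_sumE (I : choiceType) (h : I -> C) (B : {fset I}) : partial_sum h B = \sum_(i <- B) h i.
Proof. by rewrite /partial_sum [RHS]finmap.big_seq_fsetE. Qed.

Lemma sum_fset_support (V : nmodType) (I : choiceType) (h : I -> V) (r : seq I) (B : {fset I}) : uniq r ->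
  {subset r <= B} -> (forall i, i \notin r -> h i = 0) -> \sum_(i <- r) h i = \sum_(i <- B) h i.
Proof.
move=> ur rB h0; rewrite [RHS](bigID (mem r)) /= [X in _ = _ + X]big1 ?addr0; last by move=> i /h0.
rewrite -[RHS]big_filter; apply: perm_big; apply: uniq_perm => //.
  by rewrite filter_uniq // fset_uniq.
by move=> i; rewrite mem_filter; apply/idP/andP => [ir|[]//]; split => //; exact: rB.
Qed.

(** For a finite combination g near f the sum is finite and exact. The error is uniform in the
    finite set B of signatures: the coefficients of f - g are at most e/4, and the masses of one
    level add up to at most 1. *)
Lemma character_formula (chi : SV_alg L -> C) P N (f : UU N -> C) (x : SV_alg L) :
  Ch tau chi -> central_mass q P -> (forall t, is_path N t -> mass P t = diag_value GT chi t) ->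
  Cstar f -> is_image f x ->
  partial_sum (fun nu : Sign N => toC (fine (P (at_level N nu))) * quantum_char GT nu f) @ totally --> (chi x : C).
Proof.
move=> cC Pc PE fC fx; have FF := @totally_filter (Sign N); apply/cvgrPdist_lt => _ /gt0_toC[e e0 ->].
have e4 : 0 < e / 4 by rewrite divr_gt0.
have [g [r [ur gr yE dn [_ dW]]]] := Cstar_approx GT L fC e4.
pose y := coef_sum GT L g r; have chil := Ch_scalar cC.
pose H (k : UU N -> C) (nu : Sign N) : C :=
  \sum_(i < gt_dim GT nu) k (coef N (gt_path i) (gt_path i)) * toC (mass P (gt_path i)).
have cy : chi y = \sum_(nu <- r) H g nu.
  rewrite (Ch_coef_sum GT q01 cC); apply: eq_bigr => nu _; apply: eq_bigr => i _.
  by rewrite PE //; exact: gt_path_is_path.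
exists [fset nu in r]%fset => // B /= rB.
rewrite partial_sumE; under eq_bigr do rewrite level_term // -/(H f _).
have cyB : chi y = \sum_(nu <- B) H g nu.
  rewrite cy; apply: sum_fset_support => // nu nur; first by apply: (finmap.fsubsetP rB); rewrite !inE.
  by rewrite /H big1 // => i _; rewrite (gr _ _ nu) ?mul0r //; exact: gt_path_to.
have -> : chi x - \sum_(nu <- B) H f nu = chi (x - y) - \sum_(nu <- B) H (fun a => f a - g a) nu.
  have -> : \sum_(nu <- B) H (fun a => f a - g a) nu = \sum_(nu <- B) H f nu - \sum_(nu <- B) H g nu.
    rewrite -sumrB; apply: eq_bigr => nu _; rewrite /H -sumrB; apply: eq_bigr => i _; ring.
  by rewrite (scalarB _ _ chil) -cyB; ring.
rewrite nmE toC_lt; apply: (le_lt_trans (nmD _ _)); rewrite nmN.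
have X1 : nm (chi (x - y)) <= e / 4.
  by apply: (le_trans (Ch_bound cC _)); rewrite SV_valB yE fx.
suff X2 : nm (\sum_(nu <- B) H (fun a => f a - g a) nu) <= e / 4 by lra.
apply: (@le_trans _ _ (e / 4 * \sum_(nu <- B) \sum_(i < gt_dim GT nu) mass P (gt_path i))); last first.
  rewrite ler_piMr ?divr_ge0 ?(ltW e0) // -sum_gt_paths_flatten.
  apply: (@mass_sum_le1 _ _ N); last exact: gt_paths_flatten_path.
  by apply: gt_paths_flatten_uniq; exact: finmap.fset_uniq.
apply: (le_trans (nm_sum _ _ _)); rewrite mulr_sumr; apply: ler_sum => nu _.
apply: (le_trans (nm_sum _ _ _)); rewrite mulr_sumr; apply: ler_sum => i _.
by rewrite nmM nm_toC ger0_norm ?mass_ge0 // ler_wpM2r ?mass_ge0.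
Qed.

(** Every partial sum whose index set contains the end of t equals the mass of t; so the formula
    determines P on cylinders. *)
Lemma character_formula_unit P N t (c : C) : central_mass q P -> is_path N t ->
  partial_sum (fun nu : Sign N => toC (fine (P (at_level N nu))) * quantum_char GT nu (unit_fun GT N t t)) @ totally --> c ->
  c = toC (mass P t).
Proof.
have FF := @totally_filter (Sign N).
move=> Pc tN /cvgrPdist_lt H; have [mu [i ei]] := gt_indexE GT tN.
apply/eqP; rewrite -subr_eq0; apply/eqP/nm_eq0/eqP; rewrite eq_le nm_ge0 andbT.
apply/ler_addgt0Pr => e e0; rewrite add0r.
have [|A _ HA] := H (toC e); first by rewrite -toC0 toC_lt.
have := HA (A `|` [fset mu])%fset (finmap.fsubsetUl _ _).
rewrite partial_sumE; under eq_bigr do rewrite level_term //.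
have -> : \sum_(nu <- (A `|` [fset mu])%fset) \sum_(j < gt_dim GT nu)
    unit_fun GT N t t (coef N (gt_path j) (gt_path j)) * toC (mass P (gt_path j)) = toC (mass P t).
  rewrite (bigD1_seq mu) ?finmap.fset_uniq //=; last by rewrite !inE eqtype.eqxx orbT.
  rewrite [X in _ + X]big1 ?addr0 => [|nu numu].
    rewrite (bigD1 i) //= big1 ?addr0 => [|j ji].
      by rewrite unit_funE ?gt_path_is_path // ei eqtype.eqxx mul1r.
    by rewrite unit_funE ?gt_path_is_path // -ei (inj_eq (@gt_path_inj _ _ _ GT N mu)) (negbTE ji) mul0r.
  rewrite big1 // => j _; rewrite unit_funE ?gt_path_is_path //; case: eqP => [E|]; last by rewrite mul0r.
  by move/eqP: numu; case; apply: (gt_path_ends (i := j) (j := i)); rewrite E ei.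
by rewrite nmE toC_lt; exact: ltW.
Qed.

End CharacterFormula.

Section Homeomorphism.
Variables (R : realType) (q : R) (UU : quantum_unitary_system q) (GT : GT_bases UU).
Variables (L : cstar_limit UU) (tau : dual_flow L).
Hypothesis q01 : 0 < q < 1.
Local Notation C := (Cx R).
Local Notation eS := (eS GT L).
Implicit Types (N : nat) (t u : seq vertex).

Local Notation meas Q := (val Q : Prob R).

Lemma CentralP (Q : Central q) : (forall B : set OmegaM, ~ measurable B -> meas Q B = 0%E) /\
  central_mass q (meas Q).
Proof.
have [Q0 QC] := set_mem (valP Q); split => //.
by apply/(central_massP GT q01) => N nu t N0 tn; exact: QC.
Qed.

Lemma Central_intro (P : Prob R) : (forall B : set OmegaM, ~ measurable B -> P B = 0%E) ->
  central_mass q P -> exists Q : Central q, meas Q = P.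
Proof.
move=> P0 Pc; have PC : (P : ProbW R) \in Central q.
  by apply/mem_set; split => //; move=> N nu t N0 tn; exact: (central_massP GT q01 P).2.
by exists (@exist (ProbW R) (fun Q => Q \in Central q) P PC).
Qed.

(** Cylinders determine a probability on the measurable sets, and [Central] fixes the value 0 on the
    others. *)
Lemma Central_eq (Q Q' : Central q) : (forall N t, is_path N t -> mass (meas Q) t = mass (meas Q') t) -> Q = Q'.
Proof.
move=> H; apply: val_inj; apply: (@probability_eq R (val Q) (val Q')); apply/funext => B.
have [mB|nB] := pselect (measurable (B : set OmegaM)); last first.
  by rewrite (CentralP Q).1 // (CentralP Q').1.
apply: probability_unique => // t tN.
by rewrite (massE (meas Q) tN) (massE (meas Q') tN) (H _ _ tN).
Qed.

Let Phi_ex (chi : Ch tau) : exists Q : Central q,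
  forall N t, is_path N t -> mass (meas Q) t = diag_value GT (val chi) t.
Proof.
have [P [P0 Pc PE]] := character_measure GT q01 (set_mem (valP chi)).
by have [Q QP] := Central_intro P0 Pc; exists Q; rewrite QP.
Qed.

Let Psi_ex (Q : Central q) : exists chi : Ch tau,
  forall N t u, valid N t u -> val chi (eS N t u) = toC ((t == u)%:R * mass (meas Q) t).
Proof.
have [chi [cC cE]] := measure_Ch GT tau q01 (CentralP Q).2.
by exists (@exist {ptws SV_alg L -> C} (fun f => f \in Ch tau) chi (mem_set cC)).
Qed.

Definition char_measure : Ch tau -> Central q := projT1 (choice Phi_ex).
Definition measure_char : Central q -> Ch tau := projT1 (choice Psi_ex).

Lemma char_measureE (chi : Ch tau) N t : is_path N t ->
  mass (meas (char_measure chi)) t = diag_value GT (val chi) t.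
Proof. by move=> tN; rewrite /char_measure; case: choice => f fP /=; exact: fP tN. Qed.

Lemma measure_charE (Q : Central q) N t u : valid N t u ->
  val (measure_char Q) (eS N t u) = toC ((t == u)%:R * mass (meas Q) t).
Proof. by move=> v; rewrite /measure_char; case: choice => f fP /=; exact: fP v. Qed.

Let ChP (chi : Ch tau) : Ch tau (val chi) := set_mem (valP chi).

Lemma Ch_eq (chi chi' : Ch tau) : (forall N t u, valid N t u -> val chi (eS N t u) = val chi' (eS N t u)) ->
  chi = chi'.
Proof.
move=> H; apply: val_inj; apply/funext => x.
by apply: (functional_ext (GT := GT) (Ch_scalar (ChP chi)) (Ch_scalar (ChP chi')) (Ch_bound (ChP chi)) (Ch_bound (ChP chi'))).
Qed.

Lemma char_measureK : cancel char_measure measure_char.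
Proof.
move=> chi; apply: Ch_eq => N t u v; rewrite measure_charE // (Ch_unit GT q01 (ChP chi) v).
by case/and3P: v => tN _ _; rewrite (char_measureE chi tN).
Qed.

Lemma measure_charK : cancel measure_char char_measure.
Proof.
move=> Q; apply: Central_eq => N t tN; rewrite (char_measureE _ tN) /diag_value.
have sE : size t = N by case/andP: tN => _ /eqP.
by rewrite sE (measure_charE _ (valid_diag tN)) eqtype.eqxx mul1r.
Qed.

Lemma cvg_ptws (T : Type) (F : set_system T) (U : Type) (V : topologicalType) (f : T -> {ptws U -> V}) (l : {ptws U -> V}) :
  Filter F -> (forall x, f ^~ x @ F --> l x) -> f @ F --> l.
Proof.
move=> FF H; apply/cvg_sup => x A; rewrite nbhsE => -[B [[D oD <-] Dl] BA].
by apply: filterS BA _; apply: (H x); exact: open_nbhs_nbhs.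
Qed.

(** A cylinder is open and closed, so its indicator is one of the test functions of weak
    convergence. *)
Lemma mass_continuous (Q0 : Central q) N t (e : R) : is_path N t -> 0 < e ->
  \forall Q \near Q0, `|mass (meas Q0) t - mass (meas Q) t| < e.
Proof.
move=> tN e0; pose f : OmegaT -> R := \1_(cylinder t).
have fC : Cb f.
  split; last by exists 1 => w; rewrite /f indicE; case: (_ \in _); rewrite ?normr1 ?normr0.
  apply: continuous_cylinder => w r r0; exists N => w' E.
  have -> : f w' = f w; last by rewrite subrr normr0.
  rewrite /f !indicE; congr ((nat_of_bool _)%:R).
  by apply/idP/idP => /set_mem/(cylinder_path _ tN) Ew; apply/mem_set/(cylinder_path _ tN); rewrite -Ew ?E.
pose fI : @Cb R := @exist (OmegaT -> R) (fun f => f \in @Cb R) f (mem_set fC).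
have c1 : continuous (set_val : Central q -> ProbW R) by exact: initial_continuous.
have c2 := @initial_continuous _ _ (fun P : Prob R =>
    (fun f => \int[P]_w (val f w))%R : {ptws @Cb R -> R}).
have c3 : continuous (fun g : {ptws @Cb R -> R} => g fI).
  exact: (@proj_continuous _ (fun _ => R) fI).
have c : continuous (fun Q : Central q => \int[meas Q]_w (f w)).
  by move=> Q; exact: (continuous_comp (continuous_comp (c1 Q) (c2 (set_val Q))) (c3 _)).
have mE (Q : Central q) : mass (meas Q) t = \int[meas Q]_w (f w).
  by rewrite /mass -Rintegral_indic //; apply: measurable_cylinder; exact: is_path_size tN.
have /cvgrPdist_lt/(_ e e0) := c Q0.
by apply: filterS => Q; rewrite !mE.
Qed.

(** Convergence on units gives convergence on [uspan], and the common bound |chi(x)| <= |x| extends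
    it to the closure. *)
Lemma measure_char_continuous : continuous measure_char.
Proof.
apply: continuous_comp_initial => Q0; have FF : Filter (nbhs Q0) := nbhs_filter Q0; apply: cvg_ptws => x.
pose Z y := forall e : R, 0 < e -> \forall Q \near Q0,
  nm (val (measure_char Q0) y - val (measure_char Q) y) < e.
have Zspan y : uspan GT y -> Z y.
  move=> ys; apply: (@uspan_ind _ _ _ GT L Z _ _ _ y ys).
  - move=> e e0; apply: (@filterE _ (nbhs Q0) FF) => Q.
    by rewrite !(scalar0 (Ch_scalar (ChP _))) subrr nm0.
  - move=> c a b Za Zb e e0.
    have c0 : 0 < 2 * (nm c + 1) by rewrite mulr_gt0 // ltr_wpDl ?nm_ge0.
    apply: filterS2 (Za _ (divr_gt0 e0 c0)) (Zb _ (divr_gt0 e0 (ltr0n R 2))) => Q H1 H2.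
    rewrite !(Ch_scalar (ChP _)) opprD addrACA -mulrBr; apply: (le_lt_trans (nmD _ _)); rewrite nmM.
    rewrite ltr_pdivlMr // in H1.
    have := nm_ge0 (val (measure_char Q0) a - val (measure_char Q) a); have := nm_ge0 c; nra.
  - move=> N t u v e e0; have [tN _ _] := and3P v.
    apply: filterS (mass_continuous Q0 tN e0) => Q.
    rewrite !measure_charE // -[_ - toC _](rmorphB (@real_complex R)) -mulrBr -/(toC _) nm_toC normrM.
    by case: (t == u); rewrite ?normr1 ?normr0 ?mul1r ?mul0r.
apply/cvgrPdist_lt => _ /gt0_toC[e e0 ->].
have [y ys xy] := uspan_dense GT x (divr_gt0 e0 (ltr0n R 4)).
apply: filterS (Zspan y ys _ (divr_gt0 e0 (ltr0n R 2))) => Q H.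
have D (chi : Ch tau) : nm (val chi x - val chi y) <= e / 4.
  rewrite -(scalarB _ _ (Ch_scalar (ChP chi))); apply: (le_trans (Ch_bound (ChP chi) _)).
  by rewrite SV_valB ltW.
rewrite nmE toC_lt; change (nm (val (measure_char Q0) x - val (measure_char Q) x) < e).
set A := val (measure_char Q0) x; set B := val (measure_char Q) x.
have -> : A - B = (A - val (measure_char Q0) y) + (val (measure_char Q0) y - val (measure_char Q) y) -
   (B - val (measure_char Q) y) by ring.
apply: (le_lt_trans (nmD _ _)); rewrite nmN; have := nmD (A - val (measure_char Q0) y) (val (measure_char Q0) y - val (measure_char Q) y).
have := D (measure_char Q0); have := D (measure_char Q); rewrite -/A -/B; lra.
Qed.

(** [weak_mass] reduces a test function to finitely many masses, each the real part of a value of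
    chi at a diagonal unit. *)
Lemma char_measure_continuous : continuous char_measure.
Proof.
apply: continuous_comp_initial; apply: continuous_comp_initial => chi0.
have FF : Filter (nbhs chi0) := nbhs_filter chi0; apply: cvg_ptws => f.
apply/cvgrPdist_lt => e e0; have [fc fb] := set_mem (valP f).
have [n [s [d [d0 sn H]]]] := weak_mass (meas (char_measure chi0)) fc fb e0.
have c1 : continuous (set_val : Ch tau -> {ptws SV_alg L -> C}) by exact: initial_continuous.
have c2 y : continuous (fun g : {ptws SV_alg L -> C} => g y).
  exact: (@proj_continuous _ (fun _ => C) y).
have c y : continuous (fun chi : Ch tau => (val chi : SV_alg L -> C) y).
  by move=> chi; exact: (continuous_comp (c1 chi) (c2 y _)).
suff : \forall chi \near chi0, forall t, t \in s ->
   `|mass (meas (char_measure chi0)) t - mass (meas (char_measure chi)) t| < d.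
  by apply: filterS => chi; exact: H.
elim: s sn {H} => [|t s IH] /=; first by move=> _; apply: (@filterE _ (nbhs chi0) FF) => chi t; rewrite in_nil.
move=> /andP[tn /IH{}IH].
have /cvgrPdist_lt/(_ (toC d)) := c (eS (size t) t t) chi0; rewrite -toC0 toC_lt => /(_ d0).
apply: filterS2 IH => chi IH Ht u; rewrite inE => /predU1P[->|]; last exact: IH.
rewrite !(char_measureE _ tn) /diag_value.
move: Ht; rewrite nmE toC_lt; apply: le_lt_trans; apply: le_trans (abs_re_nm _).
by case: (val chi0 _) (val chi _) => ? ? [? ?].
Qed.

End Homeomorphism.

Theorem theorem3p1 (R : realType) (q : R) (hq : 0 < q < 1)
    (UU : quantum_unitary_system q) (GT : GT_bases UU)
    (L : cstar_limit UU) (tau : dual_flow L) :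
  exists Phi : Ch tau -> Central q,
    [/\ homeomorphism Phi,
        affine_map Phi &
        forall (chi : Ch tau) (P : Central q),
          Phi chi = P <->
          forall N, (0 < N)%N ->
          forall (f : UU N -> Cx R) (x : SV_alg L), Cstar f -> is_image f x ->
            partial_sum (fun nu : Sign N =>
                toC (fine ((val P : Prob R) (at_level N nu))) *
                quantum_char GT nu f)
              @ totally --> (val chi x : Cx R)].
Proof.
exists (char_measure GT hq); split.
- split; first exact: char_measure_continuous.
  exists (measure_char GT tau hq); split; [exact: char_measureK|exact: measure_charK|].
  exact: measure_char_continuous.
- move=> a chi1 chi2 a01; pose Phi : Ch tau -> Central q := char_measure GT hq.
  (* The combination is formed on the side of measures, where it is a central probability, and then
     matched with that of the characters on the matrix units. *)
  have [P' P'E] := mixture_exists (val (Phi chi1) : Prob R) (val (Phi chi2) : Prob R) a01.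
  have [z1 c1] := CentralP GT hq (Phi chi1); have [z2 c2] := CentralP GT hq (Phi chi2).
  have P'0 (B : set OmegaM) : ~ measurable B -> P' B = 0%E.
    by move=> mB; rewrite P'E z1 // z2 // !mule0 adde0.
  have mP' N t : is_path N t -> mass P' t = a * mass (val (Phi chi1) : Prob R) t + (1 - a) * mass (val (Phi chi2) : Prob R) t.
    by move=> tN; rewrite {1}/mass P'E !(massE _ tN).
  have P'c : central_mass q P'.
    move=> N t u /[dup] v /and3P[tN uN _]; rewrite !(mP' N) // (c1 N t u v) (c2 N t u v); ring.
  have [Q QP] := Central_intro GT hq P'0 P'c.
  have Kc (chi : Ch tau) N t u : valid N t u -> val chi (eS GT L N t u) = toC ((t == u)%:R * mass (val (Phi chi) : Prob R) t).
    by move=> v; rewrite -{1}(char_measureK GT hq chi) measure_charE.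
  exists (measure_char GT tau hq Q); split; last first.
    by move=> B mB; rewrite (measure_charK GT tau hq Q) QP P'E.
  have S (chi : Ch tau) := Ch_scalar (set_mem (valP chi)).
  have Bd (chi : Ch tau) := Ch_bound (set_mem (valP chi)).
  have [a0 a1] := andP a01.
  apply: (functional_ext (GT := GT) (S _)).
  + by move=> c x y; rewrite !S; ring.
  + exact: Bd.
  + move=> x; apply: (le_trans (nmD _ _)); rewrite !nmM !nm_toC !ger0_norm ?subr_ge0 //.
    have := Bd chi1 x; have := Bd chi2 x; have := rn_ge0 (SV_val x); nra.
  + move=> N t u v; have [tN _ _] := and3P v.
    by rewrite measure_charE // QP (mP' N) // !Kc // -!toCM -toCD; congr toC; ring.
- move=> chi P; have [_ Pc] := CentralP GT hq P; have cC := set_mem (valP chi).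
  split=> [PE N N0 f x fC fx|H].
    apply: (character_formula hq cC Pc _ fC fx) => t tN.
    by rewrite -PE (char_measureE GT hq chi tN).
  apply: (Central_eq GT hq) => N t tN.
  rewrite (char_measureE GT hq chi tN).
  (* The formula starts at N = 1; at the root both masses are 1. *)
  have [N0|N0] := posnP N.
    move: tN; rewrite N0 => /andP[_ /nilP ->]; rewrite mass_root; exact: (diag_value_root GT hq cC).
  have [fC fi] := (unit_fun_Cstar GT N t t, svC_image L (unit_fun_Cstar GT N t t)).
  have E := character_formula_unit hq Pc tN (H N N0 _ _ fC fi).
  have sE : size t = N by case/andP: tN => _ /eqP.
  by rewrite /diag_value sE /eS E.
Qed.
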